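(* Let $p\ge 2$ and $s>0$, and put $$A_{p,s}=2^{\frac1s-\frac12}\,\sup_{y\ge 0}\frac{\cosh^{1/s}\left(\frac{sy}{2}\right)}{\sqrt{\cosh y-\cos\frac{\pi}{p}}}.$$ Then for every complex-valued $f\in L^p(\mathbb{T})$, $$\left\|\left(|P_+f|^s+|P_-f|^s\right)^{1/s}\right\|_{L^p(\mathbb{T})}\le A_{p,s}\,\|f\|_{L^p(\mathbb{T})},$$ and this inequality is sharp, i.e. $A_{p,s}$ cannot be replaced by any smaller constant. In particular, for $p\ge 2$ and $0<s\le \csc^2\frac{\pi}{2p}$, for every $f\in L^p(\mathbb{T})$, $$\left\|\left(|P_+f|^s+|P_-f|^s\right)^{1/s}\right\|_{L^p(\mathbb{T})}\le \frac{2^{1/s}}{2\sin\frac{\pi}{2p}}\,\|f\|_{L^p(\mathbb{T})}.$$ If $1<p\le \frac43$ and $0<s\le\sec^2\frac{\pi}{2p}$, then for every complex-valued $f\in L^p(\mathbb{T})$, $$\left\|\left(|P_+f|^s+|P_-f|^s\right)^{1/s}\right\|_{L^p(\mathbb{T})}\le \frac{2^{1/s}}{2\cos\frac{\pi}{2p}}\,\|f\|_{L^p(\mathbb{T})}.$$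
   Context: $\mathbb{T}=\{\zeta\in\mathbb{C}:|\zeta|=1\}$ is the unit circle with normalized arc-length measure, and $L^p(\mathbb{T})$ is the Lebesgue space of complex-valued functions on it. For $f\in L^p(\mathbb{T})$, $1<p<\infty$, with Fourier coefficients $\hat f(n)=\frac1{2\pi}\int_0^{2\pi}f(e^{it})e^{-int}\,dt$, the analytic (Riesz) and co-analytic projections are $$P_+f(\zeta)=\sum_{n=0}^{\infty}\hat f(n)\zeta^n,\qquad P_-f(\zeta)=\sum_{n=-\infty}^{-1}\hat f(n)\zeta^n,$$ so $P_-=I-P_+$; both are bounded operators on $L^p(\mathbb{T})$ for $1<p<\infty$. *)

(* Defs.v *)
From HB Require Import structures.
From mathcomp Require Import all_boot all_order all_algebra.
From mathcomp Require Import all_classical all_reals all_analysis.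
From mathcomp Require Import complex.
Set Implicit Arguments.
Unset Strict Implicit.
Unset Printing Implicit Defensive.
Import Order.TTheory GRing.Theory Num.Theory.
Import numFieldNormedType.Exports.
Local Open Scope classical_set_scope.
Local Open Scope ring_scope.
Local Open Scope complex_scope.

Definition circle (R : realType) := {z : R[i] | `|z| == 1}.

Lemma normr_cis (R : realType) (t : R) : `|cos t +i* sin t| == 1.
Proof. by rewrite normc_def /= cos2Dsin2 sqrtr1. Qed.

Definition expi (R : realType) (t : R) : circle R :=
  exist _ (cos t +i* sin t) (normr_cis t).

(* The modulus as an element of R; the generic norm of [R[i]] lies in [R[i]]. *)
Definition cabs (R : realType) (z : R[i]) : R := ComplexField.Normc.normc z.

Lemma pi2_gt0 (R : realType) : (0 : R) < 2 * pi.
Proof. by rewrite mulr_gt0 ?pi_gt0. Qed.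

(* Normalized arc length, carried by the parameter t of [expi t]: functions on
   the circle are integrated, measured and normed through t |-> f (expi t). *)
Definition arc_length (R : realType) : probability (measurableTypeR R) R :=
  uniform_prob (pi2_gt0 R).

Definition circle_norm (R : realType) (p : R) (F : circle R -> R) : \bar R :=
  Lnorm (arc_length R) p%:E (fun t : R => (F (expi t))%:E).

Definition Lp_norm (R : realType) (p : R) (f : circle R -> R[i]) : \bar R :=
  circle_norm p (fun z => cabs (f z)).

Definition in_Lp (R : realType) (p : R) (f : circle R -> R[i]) : Prop :=
  [/\ measurable_fun [set: R] (fun t : R => complex.Re (f (expi t))),
      measurable_fun [set: R] (fun t : R => complex.Im (f (expi t))) &
      (Lp_norm p f < +oo)%E].

Definition cintegral (R : realType) (F : R -> R[i]) : R[i] :=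
  (\int[arc_length R]_t complex.Re (F t))
    +i* (\int[arc_length R]_t complex.Im (F t)).

Definition fourier (R : realType) (f : circle R -> R[i]) (n : int) : R[i] :=
  cintegral (fun t : R => f (expi t) * val (expi (- n%:~R * t))).

Definition Lp_limit (R : realType) (p : R) (u : nat -> circle R -> R[i])
    (g : circle R -> R[i]) : Prop :=
  in_Lp p g /\
  (Lp_norm p (fun z => u N z - g z)) @[N --> \oo] --> (0 : \bar R)%E.

(* The two series are summed in the norm of L^p. The chosen limit is unique up
   to equality almost everywhere, and exists for f in L^p when 1 < p < oo. *)
Definition analytic_proj (R : realType) (p : R) (f : circle R -> R[i]) :
    circle R -> R[i] :=
  xget (cst 0) [set g | Lp_limit p
    (fun N z => \sum_(0 <= n < N) fourier f n%:Z * val z ^ n%:Z) g].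

Definition coanalytic_proj (R : realType) (p : R) (f : circle R -> R[i]) :
    circle R -> R[i] :=
  xget (cst 0) [set g | Lp_limit p
    (fun N z => \sum_(1 <= k < N.+1) fourier f (- k%:Z) * val z ^ (- k%:Z)) g].

Definition proj_mean (R : realType) (p s : R) (f : circle R -> R[i])
    (z : circle R) : R :=
  (cabs (analytic_proj p f z) `^ s + cabs (coanalytic_proj p f z) `^ s)
    `^ s^-1.

Definition cosh (R : realType) (x : R) : R := (expR x + expR (- x)) / 2.

Definition best_const (R : realType) (p s : R) : R :=
  2 `^ (s^-1 - 2^-1) *
  sup [set cosh (s * y / 2) `^ s^-1 / Num.sqrt (cosh y - cos (pi / p))
      | y in [set y : R | 0 <= y]].

(* Main.v *)
(** Write [w = P_+ f] and [z = conj (P_- f)], so that [f = w + conj z], both [w] and [z] are analytic and [z] vanishes at the origin.  The upper bounds rest on a pointwise inequality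
      [(|w|^s + |z|^s)^(p/s) + C Phi (w z) <= A^p |w + conj z|^p],   [Phi (r e^(it)) = r^(p/2) phi t],
    whose weight [Phi] is subharmonic and vanishes at [0]: integrating over the circle, the mean of [Phi (w z)] is nonnegative and may be dropped.  It is enough to do this for Fejer means, which are trigonometric polynomials and contract the [L^p] norm, and to pass to the limit.
    With [|w| = r e^(y/2)], [|z| = r e^(-y/2)] and [t = arg (w z)] the pointwise inequality is one about [cosh y + cos t].  For fixed [y] the minimum in [t] of the difference of its two sides is attained on a curve [X t = cosh y], along which the logarithmic derivative of the difference changes sign only once, at the extremal point.
    For sharpness take [f = a h - b conj h] with [a = e^(y/2)], [b = e^(-y/2)] and [h] a partial sum of the binomial series of [(1 + rho zeta)^(-1/p)]: up to a small error the values of [h] lie in the sector [|arg h| <= pi/(2p)], where [|f|^2 <= 2 (cosh y - cos (pi/p)) |h|^2], and the [L^p] norm of [h] tends to infinity as [rho] tends to [1], so that the constant term of [h] does not matter. *)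
From HB Require Import structures.
Require Import Defs.
From mathcomp Require Import all_boot all_order all_algebra.
From mathcomp Require Import all_classical all_reals all_analysis.
From mathcomp Require Import measurable_realfun complex.
From mathcomp Require Import ring lra.
Set Implicit Arguments.
Unset Strict Implicit.
Unset Printing Implicit Defensive.
Import Order.TTheory GRing.Theory Num.Theory.
Import numFieldNormedType.Exports.
Local Open Scope classical_set_scope.
Local Open Scope ring_scope.

(** * Real calculus *)

(** The weight is fixed by one condition: its coefficient [lam] makes the difference of the two
    sides stationary in the angle at the extremal point. Along the curve the logarithmic derivatives
    of both sides have the form [q * dX / (X - c)]. On the larger side [c] is a ratio of sines, on
    the smaller one it is [ch], the same ratio of hyperbolic sines, so everything depends on the
    sign of [ch - c]. That this difference crosses zero only upwards compares a trigonometric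
    quantity with a hyperbolic one; the two are separated by an intermediate bound with the constant
    3. For p <= 4/3 the trigonometric half uses q <= 2 (1 - q) with q = p / 2, which is precisely
    this range. The weight is not smooth, so subharmonicity is used without second derivatives. Away
    from zeros the weight of a polynomial is supported from below by the real part of a quadratic,
    up to a cubic error, and the points z + h, z - h, z + ih, z - ih cancel the quadratic part. At
    zeros a small term of half the degree takes over. A maximum principle for sums over rotations
    then bounds Riemann sums of the weight on the circle. *)

Definition isd (R : realType) (x : R) (f : R -> R) (d : R) : Prop := is_derive x 1 f d.

Section RealDerivatives.
Variable R : realType.
Implicit Types (f g : R -> R) (x a b : R).

Lemma isd_eq x f a b : isd x f a -> a = b -> isd x f b.
Proof. by move=> ? <-. Qed.

Lemma isd_cst x (c : R) : isd x (fun _ : R => c) 0.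
Proof. exact: is_derive_cst. Qed.

Lemma isd_id x : isd x (fun t : R => t) 1.
Proof. exact: is_derive_id. Qed.

Lemma isd_add f g x a b : isd x f a -> isd x g b -> isd x (fun t => f t + g t) (a + b).
Proof. by move=> ? ?; exact: is_deriveD. Qed.

Lemma isd_opp f x a : isd x f a -> isd x (fun t => - f t) (- a).
Proof. by move=> ?; exact: is_deriveN. Qed.

Lemma isd_mul f g x a b : isd x f a -> isd x g b ->
  isd x (fun t => f t * g t) (a * g x + f x * b).
Proof.
move=> fa gb; have h := is_deriveM fa gb.
by apply: is_derive_eq h _; rewrite /GRing.scale /= addrC mulrC.
Qed.

Lemma isd_exp f x a n : isd x f a ->
  isd x (fun t => f t ^+ n) (n%:R * f x ^+ n.-1 * a).
Proof.
move=> fa; elim: n => [|n IH].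
  by rewrite !mul0r; apply: isd_cst.
have h := isd_mul fa IH.
have -> : (fun t => f t ^+ n.+1) = (fun t => f t * f t ^+ n).
  by apply/funext => t; rewrite exprS.
apply: isd_eq h _; case: n {IH} => [|n]; first by rewrite !expr0; ring.
by rewrite /= exprS -natr1; ring.
Qed.

Lemma isd_inv f x a : f x != 0 -> isd x f a ->
  isd x (fun t => (f t)^-1) (- a / f x ^+ 2).
Proof.
move=> f0 fa; have h := is_deriveV f0 fa.
by apply: is_derive_eq h _; rewrite /GRing.scale /= mulNr mulrC mulNr.
Qed.

Lemma isd_comp f g x a b : isd (g x) f a -> isd x g b ->
  isd x (fun t => f (g t)) (a * b).
Proof. by move=> ? ?; exact: is_derive1_comp. Qed.

Lemma isd_expR g x b : isd x g b -> isd x (fun t => expR (g t)) (expR (g x) * b).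
Proof. by move=> gb; apply: (@isd_comp expR g _ (expR (g x))) => //; exact: is_derive_expR. Qed.

Lemma isd_sin g x b : isd x g b -> isd x (fun t => sin (g t)) (cos (g x) * b).
Proof. by move=> gb; apply: (@isd_comp sin g _ (cos (g x))) => //; exact: is_derive_sin. Qed.

Lemma isd_cos g x b : isd x g b -> isd x (fun t => cos (g t)) (- sin (g x) * b).
Proof. by move=> gb; apply: (@isd_comp cos g _ (- sin (g x))) => //; exact: is_derive_cos. Qed.

Lemma isd_ln g x b : 0 < g x -> isd x g b -> isd x (fun t => ln (g t)) ((g x)^-1 * b).
Proof. by move=> g0 gb; apply: (@isd_comp (@ln R)) => //; exact: is_derive1_ln. Qed.

Lemma isd_powR g x b (r : R) : 0 < g x -> isd x g b ->
  isd x (fun t => g t `^ r) (r * g x `^ (r - 1) * b).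
Proof. by move=> g0 gb; apply: (@isd_comp (fun y => y `^ r)) => //; exact: is_derive1_powR. Qed.

Lemma isd_sqrt g x b : 0 < g x -> isd x g b ->
  isd x (fun t => Num.sqrt (g t)) ((2 * Num.sqrt (g x))^-1 * b).
Proof. by move=> g0 gb; apply: (@isd_comp Num.sqrt) => //; exact: is_derive1_sqrt. Qed.

Lemma isd_cont f x a : isd x f a -> {for x, continuous f}.
Proof. by move=> [fa _]; apply: differentiable_continuous; apply/derivable1_diffP. Qed.

End RealDerivatives.

(** Hook of [deriv], rebound once [sinh] and [cosh] have derivative rules. *)
Ltac deriv_hyperbolic := fail.

(** Follows the syntax of the function and instantiates the derivative; positivity and nonvanishing
    conditions remain as goals. It is used after [isd_eq], which leaves the comparison with the
    wanted derivative to [ring] or [field]. *)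
Ltac deriv :=
  lazymatch goal with
  | |- isd _ (fun _ => ?c) _ => apply: isd_cst
  | |- isd _ (fun t => t) _ => apply: isd_id
  | |- isd _ (fun t => @?f t + @?g t) _ => apply: (@isd_add _ f g); deriv
  | |- isd _ (fun t => - @?f t) _ => apply: (@isd_opp _ f); deriv
  | |- isd _ (fun t => @?f t * @?g t) _ => apply: (@isd_mul _ f g); deriv
  | |- isd _ (fun t => @?f t ^+ ?n) _ => apply: (@isd_exp _ f _ _ n); deriv
  | |- isd _ (fun t => (@?f t)^-1) _ => apply: (@isd_inv _ f); [|deriv]
  | |- isd _ (fun t => expR (@?f t)) _ => apply: (@isd_expR _ f); deriv
  | |- isd _ (fun t => sin (@?f t)) _ => apply: (@isd_sin _ f); deriv
  | |- isd _ (fun t => cos (@?f t)) _ => apply: (@isd_cos _ f); deriv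
  | |- isd _ (fun t => ln (@?f t)) _ => apply: (@isd_ln _ f); [|deriv]
  | |- isd _ (fun t => powR (@?f t) ?r) _ => apply: (@isd_powR _ f); [|deriv]
  | |- isd _ (fun t => Num.sqrt (@?f t)) _ => apply: (@isd_sqrt _ f); [|deriv]
  | |- _ => first [eassumption | deriv_hyperbolic | idtac]
  end.

Ltac pos :=
  first [assumption | apply: ltW; assumption | lazymatch goal with
  | |- is_true (0 < _ - _) => lra
  | |- is_true (0 <= _ - _) => lra
  | |- is_true (0 < _ * _) => apply: mulr_gt0; pos
  | |- is_true (0 < _ + _) => apply: addr_gt0; pos
  | |- is_true (0 < _ ^+ _) => apply: exprn_gt0; pos
  | |- is_true (0 < _^-1) => rewrite invr_gt0; pos
  | |- is_true (0 <= _ * _) => apply: mulr_ge0; pos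
  | |- is_true (0 <= _ + _) => apply: addr_ge0; pos
  | |- is_true (0 <= _ ^+ _) => apply: exprn_ge0; pos
  | |- is_true (0 <= _^-1) => rewrite invr_ge0; pos
  | |- is_true (0 < _) => first [exact: expR_gt0 | exact: pi_gt0 | exact: ltr0n | lra]
  | |- is_true (0 <= _) => first [exact: expR_ge0
      | exact: pi_ge0 | exact: ler0n | lra]
  | |- _ => idtac
  end].

(** Transports an inequality through the clearing of denominators: the two differences are
    proportional, and the proportionality is an identity for [field]. *)
Lemma lt_scaled (R : realFieldType) (k x y c d : R) :
  0 < k -> d - c = (y - x) * k -> x < y -> c < d.
Proof. by move=> k0 E xy; rewrite -subr_gt0 E mulr_gt0// subr_gt0. Qed.

Lemma le_scaled (R : realFieldType) (k x y c d : R) :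
  0 <= k -> d - c = (y - x) * k -> x <= y -> c <= d.
Proof. by move=> k0 E xy; rewrite -subr_ge0 E mulr_ge0// subr_ge0. Qed.

Section Monotonicity.
Variable R : realType.
Implicit Types (f df : R -> R) (a b : R).

Lemma mvt f df a b : a < b -> (forall x, a <= x <= b -> isd x f (df x)) ->
  exists2 c, a < c < b & f b - f a = df c * (b - a).
Proof.
move=> ab fd.
have [c cab E] : exists2 c, c \in `]a, b[ & f b - f a = df c * (b - a).
  apply: (MVT ab) => [x|]; first by rewrite in_itv/= => /andP[? ?]; apply: fd; rewrite !ltW.
  apply/continuous_in_subspaceT => x; rewrite inE /= in_itv /= => xab.
  by apply: isd_cont; apply: fd.
by exists c => //; move: cab; rewrite in_itv.
Qed.

Lemma incr_le f df a b : a <= b -> (forall x, a <= x <= b -> isd x f (df x)) ->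
  (forall x, a < x < b -> 0 <= df x) -> f a <= f b.
Proof.
rewrite le_eqVlt => /predU1P[-> //|ab] fd d0.
have [c cab E] := mvt ab fd.
by rewrite -subr_ge0 E mulr_ge0 ?d0// subr_ge0 ltW.
Qed.

Lemma incr_lt f df a b : a < b -> (forall x, a <= x <= b -> isd x f (df x)) ->
  (forall x, a < x < b -> 0 < df x) -> f a < f b.
Proof.
move=> ab fd d0.
have [c cab E] := mvt ab fd.
by rewrite -subr_gt0 E mulr_gt0 ?d0// subr_gt0.
Qed.

Lemma decr_le f df a b : a <= b -> (forall x, a <= x <= b -> isd x f (df x)) ->
  (forall x, a < x < b -> df x <= 0) -> f b <= f a.
Proof.
move=> ab fd d0; rewrite -lerN2; apply: (@incr_le (fun t => - f t) (fun t => - df t)) => //.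
- by move=> x /fd h; apply: isd_opp.
- by move=> x /d0; rewrite oppr_ge0.
Qed.

Lemma decr_lt f df a b : a < b -> (forall x, a <= x <= b -> isd x f (df x)) ->
  (forall x, a < x < b -> df x < 0) -> f b < f a.
Proof.
move=> ab fd d0; rewrite -ltrN2; apply: (@incr_lt (fun t => - f t) (fun t => - df t)) => //.
- by move=> x /fd h; apply: isd_opp.
- by move=> x /d0; rewrite oppr_gt0.
Qed.

End Monotonicity.

(** * Huygens type inequalities for sine and tangent *)

Section TrigInequalities.
Variable R : realType.
Implicit Types x t : R.

Lemma sinDD x : sin (x + x) = 2 * sin x * cos x.
Proof. by rewrite sinD; ring. Qed.

Lemma cosDD x : cos (x + x) = 1 - 2 * sin x ^+ 2.
Proof. by rewrite cosD; have := cos2Dsin2 x; lra. Qed.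

Lemma cosDD' x : 1 + cos (x + x) = 2 * cos x ^+ 2.
Proof. by rewrite cosD; have := cos2Dsin2 x; lra. Qed.

Lemma cos_anti x t : 0 <= x -> x <= t -> t <= pi -> cos t <= cos x.
Proof.
move=> x0; rewrite le_eqVlt => /predU1P[->//|xt] tpi; apply: ltW.
by rewrite ltr_cos// in_itv/= ?x0 ?tpi ?andbT; lra.
Qed.

Lemma sin_mono x t : - (pi / 2) <= x -> x <= t -> t <= pi / 2 -> sin x <= sin t.
Proof.
move=> x0; rewrite le_eqVlt => /predU1P[->//|xt] tpi; apply: ltW.
by rewrite ltr_sin// in_itv/= ?x0 ?tpi ?andbT; lra.
Qed.

Lemma sin_le x : 0 <= x -> sin x <= x.
Proof.
move=> x0; rewrite -subr_ge0.
have := @incr_le R (fun t => t - sin t) (fun t => 1 - cos t) 0 x x0.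
rewrite sin0 subr0; apply => t _.
- by eapply isd_eq; [deriv|cbv beta; ring].
- by rewrite subr_ge0 cos_le1.
Qed.

Lemma xcos_le_sin x : 0 <= x <= pi -> x * cos x <= sin x.
Proof.
case/andP=> x0 xpi; rewrite -subr_ge0.
have := @incr_le R (fun t => sin t - t * cos t) (fun t => t * sin t) 0 x x0.
rewrite sin0 mul0r subr0; apply => t /andP[t0 tx].
- by eapply isd_eq; [deriv|cbv beta; ring].
- by rewrite mulr_ge0 ?(ltW t0)// sin_ge0_pi// (ltW t0) (le_trans (ltW tx)).
Qed.

Lemma xcos_lt_sin x : 0 < x <= pi -> x * cos x < sin x.
Proof.
case/andP=> x0 xpi; rewrite -subr_gt0.
have := @incr_lt R (fun t => sin t - t * cos t) (fun t => t * sin t) 0 x x0.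
rewrite sin0 mul0r subr0; apply => t /andP[t0 tx].
- by eapply isd_eq; [deriv|cbv beta; ring].
- by rewrite mulr_gt0// sin_gt0_pi// t0 (lt_le_trans tx).
Qed.

(** The Cusa-Huygens inequality. Two differentiations of the difference lead to sin t - t cos t,
    which is nonnegative on [0, pi]. *)
Lemma cusa_huygens x : 0 <= x <= pi -> 3 * sin x <= x * (2 + cos x).
Proof.
case/andP=> x0 xpi; rewrite -subr_ge0.
have := @incr_le R (fun t => t * (2 + cos t) - 3 * sin t)
  (fun t => 2 - 2 * cos t - t * sin t) 0 x x0.
rewrite sin0 mul0r mulr0 subr0; apply => t /andP[t0 tx].
- by eapply isd_eq; [deriv|cbv beta; ring].
have := @incr_le R (fun t => 2 - 2 * cos t - t * sin t)
  (fun t => sin t - t * cos t) 0 t (ltW t0).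
rewrite cos0 mul0r mulr1 !subrr; apply => u /andP[u0 ut].
- by eapply isd_eq; [deriv|cbv beta; ring].
- by rewrite subr_ge0 xcos_le_sin// (ltW u0) (le_trans (ltW ut) (le_trans (ltW tx) _)).
Qed.

(** The Snell-Huygens inequality 3 x <= 2 sin x + tan x, cleared of its denominator. With c = cos t,
    the derivative of the difference is (1 - c)^2 (2 c + 1) / c^2. *)
Lemma snell_huygens x : 0 <= x < pi / 2 -> 3 * x * cos x <= (2 * cos x + 1) * sin x.
Proof.
case/andP=> x0 xpi.
have cp t : 0 <= t <= x -> 0 < cos t.
  move=> /andP[t0 tx]; apply: cos_gt0_pihalf; rewrite (le_lt_trans tx xpi) andbT.
  by rewrite (lt_le_trans _ t0)// oppr_lt0 divr_gt0 ?pi_gt0.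
have cx : 0 < cos x by apply: cp; rewrite x0 lexx.
suff : 0 <= 2 * sin x + sin x / cos x - 3 * x.
  rewrite -(pmulr_lge0 _ cx) => h; rewrite -subr_ge0; move: h; congr (0 <= _).
  by field; rewrite gt_eqF.
have := @incr_le R (fun t => 2 * sin t + sin t / cos t - 3 * t)
  (fun t => 2 * cos t + (cos t)^-2 - 3) 0 x x0.
rewrite sin0 !(mul0r, mulr0) addr0 subr0; apply => t /andP[t0 tx].
- have ct : 0 < cos t by apply: cp; rewrite t0 tx.
  eapply isd_eq; [deriv; by rewrite gt_eqF|cbv beta].
  have := cos2Dsin2 t; move: ct; set c := cos t; set s := sin t => c0 E.
  have -> : 2 * c + c ^- 2 - 3 = 2 * c + (c ^+ 2 + s ^+ 2) / c ^+ 2 - 3.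
    by rewrite E mul1r.
  by field; rewrite gt_eqF.
- have ct : 0 < cos t by apply: cp; rewrite !ltW.
  have c1 := cos_le1 t.
  move: ct c1; set c := cos t => c0 c1.
  have -> : 2 * c + c ^- 2 - 3 = (1 - c) ^+ 2 * (2 * c + 1) / c ^+ 2.
    by field; rewrite gt_eqF.
  by rewrite divr_ge0 ?sqr_ge0// mulr_ge0 ?sqr_ge0//; lra.
Qed.

Lemma x_le_tan x : 0 <= x < pi / 2 -> x * cos x <= sin x.
Proof.
case/andP=> x0 xp; apply: xcos_le_sin; rewrite x0 (le_trans (ltW xp))//.
by rewrite ler_pdivrMr// ler_peMr ?pi_ge0//; lra.
Qed.

End TrigInequalities.

(** * Hyperbolic functions *)

Section Hyperbolic.
Variable R : realType.
Implicit Types x t : R.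

Definition sinh x : R := (expR x - expR (- x)) / 2.

Lemma isd_cosh g x b : isd x g b -> isd x (fun t => cosh (g t)) (sinh (g x) * b).
Proof.
by move=> gb; rewrite /cosh /sinh; eapply isd_eq; [deriv; eassumption|cbv beta; field].
Qed.

Lemma isd_sinh g x b : isd x g b -> isd x (fun t => sinh (g t)) (cosh (g x) * b).
Proof.
by move=> gb; rewrite /cosh /sinh; eapply isd_eq; [deriv; eassumption|cbv beta; field].
Qed.

Lemma sinh0 : sinh 0 = 0. Proof. by rewrite /sinh oppr0 subrr mul0r. Qed.
Lemma cosh0 : cosh (0 : R) = 1.
Proof. by rewrite /cosh oppr0 expR0; field. Qed.

Lemma coshE x : cosh x = (expR x + expR (- x)) / 2. Proof. by []. Qed.
Lemma sinhE x : sinh x = (expR x - expR (- x)) / 2. Proof. by []. Qed.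

Lemma cosh_gt0 x : 0 < cosh x.
Proof. by rewrite /cosh divr_gt0// addr_gt0// expR_gt0. Qed.

Lemma coshN x : cosh (- x) = cosh x.
Proof. by rewrite /cosh opprK addrC. Qed.

Lemma sinhN x : sinh (- x) = - sinh x.
Proof. by rewrite /sinh opprK; field. Qed.

Lemma cosh2Bsinh2 x : cosh x ^+ 2 - sinh x ^+ 2 = 1.
Proof. by rewrite /cosh /sinh expRN; field; rewrite gt_eqF ?expR_gt0. Qed.

Lemma coshD x t : cosh (x + t) = cosh x * cosh t + sinh x * sinh t.
Proof.
rewrite /cosh /sinh opprD !expRD !expRN.
by field; rewrite !gt_eqF ?expR_gt0.
Qed.

Lemma sinhD x t : sinh (x + t) = sinh x * cosh t + cosh x * sinh t.
Proof.
rewrite /cosh /sinh opprD !expRD !expRN.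
by field; rewrite !gt_eqF ?expR_gt0.
Qed.

Lemma sinhB x t : sinh (x - t) = sinh x * cosh t - cosh x * sinh t.
Proof. by rewrite sinhD sinhN coshN; ring. Qed.

Lemma sinh2x x : sinh (2 * x) = 2 * sinh x * cosh x.
Proof. by rewrite mulrDl mul1r sinhD; ring. Qed.

Lemma cosh2x x : cosh (2 * x) = 1 + 2 * sinh x ^+ 2.
Proof. by rewrite mulrDl mul1r coshD; have := cosh2Bsinh2 x; lra. Qed.

Lemma sinh_gt0 x : 0 < x -> 0 < sinh x.
Proof. by move=> x0; rewrite /sinh divr_gt0// subr_gt0 ltr_expR; lra. Qed.

Lemma sinh_ge0 x : 0 <= x -> 0 <= sinh x.
Proof. by move=> x0; rewrite /sinh divr_ge0// subr_ge0 ler_expR; lra. Qed.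

Lemma cosh_ge1 x : 1 <= cosh x.
Proof.
have := cosh2Bsinh2 x; have := cosh_gt0 x; have := sqr_ge0 (sinh x); nra.
Qed.

Lemma cosh_gt1 x : 0 < x -> 1 < cosh x.
Proof.
move=> /sinh_gt0 s0; have := cosh2Bsinh2 x; have := cosh_gt0 x.
have : 0 < sinh x ^+ 2 by rewrite exprn_gt0.
nra.
Qed.

Lemma cosh_le x t : 0 <= x <= t -> cosh x <= cosh t.
Proof.
case/andP=> x0 xt; have := @incr_le R (@cosh R) sinh _ _ xt; apply => u /andP[xu ut].
  have h := @isd_cosh _ u 1 (isd_id u); apply: isd_eq h _; ring.
by rewrite sinh_ge0// (le_trans x0 (ltW xu)).
Qed.

Lemma cosh_lt x t : 0 <= x < t -> cosh x < cosh t.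
Proof.
case/andP=> x0 xt; have := @incr_lt R (@cosh R) sinh _ _ xt; apply => u /andP[xu ut].
  have h := @isd_cosh _ u 1 (isd_id u); apply: isd_eq h _; ring.
by rewrite sinh_gt0// (le_lt_trans x0 xu).
Qed.

End Hyperbolic.

Global Opaque sinh cosh.

Ltac deriv_hyperbolic ::=
  lazymatch goal with
  | |- isd _ (fun t => cosh (@?f t)) _ => apply: (@isd_cosh _ f); deriv
  | |- isd _ (fun t => sinh (@?f t)) _ => apply: (@isd_sinh _ f); deriv
  end.

Section HyperbolicInequalities.
Variable R : realType.
Implicit Types x t a h : R.

Lemma sinh_le_xcosh x : 0 <= x -> sinh x <= x * cosh x.
Proof.
move=> x0; rewrite -subr_ge0.
have := @incr_le R (fun t => t * cosh t - sinh t) (fun t => t * sinh t) 0 x x0.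
rewrite sinh0 mul0r subr0; apply => t /andP[t0 tx].
- by eapply isd_eq; [deriv|cbv beta; ring].
- by rewrite mulr_ge0 ?sinh_ge0// ltW.
Qed.

(** Hyperbolic counterpart of [cusa_huygens], by the same two differentiations. *)
Lemma hyp_huygens x : 0 <= x -> 3 * sinh x <= 2 * x + x * cosh x.
Proof.
move=> x0; rewrite -subr_ge0.
have := @incr_le R (fun t => 2 * t + t * cosh t - 3 * sinh t)
  (fun t => 2 + t * sinh t - 2 * cosh t) 0 x x0.
rewrite sinh0 !(mul0r, mulr0) subr0 addr0; apply => t /andP[t0 tx].
- by eapply isd_eq; [deriv|cbv beta; ring].
have := @incr_le R (fun t => 2 + t * sinh t - 2 * cosh t)
  (fun t => t * cosh t - sinh t) 0 t (ltW t0).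
rewrite cosh0 mul0r mulr1 addr0 subrr; apply => u /andP[u0 ut].
- by eapply isd_eq; [deriv|cbv beta; ring].
- by rewrite subr_ge0 sinh_le_xcosh// ltW.
Qed.

Lemma x_lt_sinh x : 0 < x -> x < sinh x.
Proof.
move=> x0; rewrite -subr_gt0.
have := @incr_lt R (fun t => sinh t - t) (fun t => cosh t - 1) 0 x x0.
rewrite sinh0 subr0; apply => t /andP[t0 tx].
- by eapply isd_eq; [deriv|cbv beta; ring].
- by rewrite subr_gt0 cosh_gt1.
Qed.

(** A consequence of the concavity of tanh on the half-line: tanh t / t is decreasing there, since
    the numerator of its derivative is t - sinh t cosh t. *)
Lemma tanh_concave h a : 0 < h < a -> h * (sinh a * cosh h) < a * (sinh h * cosh a).
Proof.
case/andP=> h0 ha; have a0 := lt_trans h0 ha.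
have : sinh a / (a * cosh a) < sinh h / (h * cosh h).
  apply: (@decr_lt R (fun t => sinh t / (t * cosh t))
    (fun t => (t - sinh t * cosh t) / (t * cosh t) ^+ 2) _ _ ha) => t /andP[ht ta].
    have t0 : 0 < t by rewrite (lt_le_trans h0 ht).
    have c0 := cosh_gt0 t.
    eapply isd_eq; [deriv; by rewrite gt_eqF// mulr_gt0|cbv beta].
    have F : t = t * (cosh t ^+ 2 - sinh t ^+ 2) by rewrite cosh2Bsinh2 mulr1.
    rewrite [X in _ = (X - _) / _]F.
    by field; rewrite !gt_eqF.
  have t0 := lt_trans h0 ht.
  rewrite ltr_pdivrMr; last by rewrite exprn_gt0// mulr_gt0// cosh_gt0.
  rewrite mul0r subr_lt0.
  by apply: lt_le_trans (x_lt_sinh t0) _; rewrite ler_peMr ?cosh_ge1// sinh_ge0// ltW.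
have c1 := cosh_gt0 a; have c2 := cosh_gt0 h.
apply: (@lt_scaled _ (h * cosh h * (a * cosh a))); first by pos.
by field; rewrite !gt_eqF.
Qed.

(* The gap of [t coth t] between [a - h] and [a + h] is, after clearing
   denominators, [h sinh 2a - a sinh 2h] over [sinh^2 a - sinh^2 h]. *)
Lemma coth_gap h a : 0 < h < a ->
  4 * h * sinh a * (sinh a ^+ 2 - sinh h ^+ 2) <
  3 * cosh a * (h * sinh (2 * a) - a * sinh (2 * h)).
Proof.
case/andP=> h0 ha; have a0 := lt_trans h0 ha.
set T := sinh a / cosh a; have ca := cosh_gt0 a.
(* Division by 3 h cosh a turns the claim into a comparison of one function of t at [h] and at [a].
   The slope [T] = tanh a is kept fixed, so that only monotonicity in t is at stake. *)
have : (4 / 3) * T * sinh a ^+ 2 - a * (sinh (2 * a) / a) <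
       (4 / 3) * T * sinh h ^+ 2 - a * (sinh (2 * h) / h).
  apply: (@decr_lt R (fun t => (4 / 3) * T * sinh t ^+ 2 - a * (sinh (2 * t) / t))
    (fun t => (4 / 3) * T * (2 * sinh t * cosh t) -
              a * ((2 * t * cosh (2 * t) - sinh (2 * t)) / t ^+ 2)) _ _ ha).
    move=> t /andP[ht ta]; have t0 : 0 < t by rewrite (lt_le_trans h0 ht).
    by eapply isd_eq; [deriv; by rewrite gt_eqF|cbv beta; field; rewrite !gt_eqF].
  move=> t /andP[ht ta]; have t0 := lt_trans h0 ht.
  rewrite subr_lt0 -(@ltr_pM2r _ (t ^+ 2)) ?exprn_gt0// mulrA mulfVK ?gt_eqF ?exprn_gt0//.
  have s0 := sinh_gt0 t0; have c0 := cosh_gt0 t.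
  have H : t * (sinh a * cosh t) < a * (sinh t * cosh a) by rewrite tanh_concave// t0.
  have K : 4 * t * sinh t ^+ 2 * 2 <= 3 * (2 * t * cosh (2 * t) - sinh (2 * t)).
    have := @hyp_huygens (2 * t); rewrite cosh2x; have := ltW t0; lra.
  have H' : t * T * cosh t < a * sinh t.
    have -> : t * T * cosh t = t * (sinh a * cosh t) / cosh a by rewrite /T; ring.
    by rewrite ltr_pdivrMr//; lra.
  apply: (@lt_le_trans _ _ (a * (4 * t * sinh t ^+ 2 * 2 / 3))).
    rewrite (_ : _ * _ = (8 / 3 * t * sinh t) * (t * T * cosh t)); last by field.
    rewrite (_ : a * _ = (8 / 3 * t * sinh t) * (a * sinh t)); last by field.
    by rewrite ltr_pM2l//; pos.
  by rewrite ler_pM2l//; lra.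
apply: (@lt_scaled _ (3 * h * cosh a)); first by pos.
by rewrite /T; field; rewrite !gt_eqF.
Qed.

End HyperbolicInequalities.

(** * The key trigonometric inequalities *)

Section KeyInequality.
Variable R : realType.
Implicit Types u v x y : R.

(* Both polynomials are written in the Bernstein basis of the unit square. *)
Lemma bernstein_lin (A B D : R) : 0 <= A <= 1 -> 0 <= B <= 1 ->
  D = (2 + A) * (1 + 2 * B) ->
  0 <= D ^+ 2 + 54 * B ^+ 2 + B ^+ 2 * D * (18 - 33 * A).
Proof.
move=> /andP[A0 A1] /andP[B0 B1] DE.
have a0 : 0 <= 1 - A by lra.
have b0 : 0 <= 1 - B by lra.
have -> : D ^+ 2 + 54 * B ^+ 2 + B ^+ 2 * D * (18 - 33 * A) =
  A ^+ 2 * (144 * ((1 - B) * B ^+ 2) + 63 * ((1 - B) ^+ 2 * B) + 9 * (1 - B) ^+ 3)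
  + (1 - A) * A * (288 * B ^+ 3 + 312 * ((1 - B) * B ^+ 2) +
      84 * ((1 - B) ^+ 2 * B) + 12 * (1 - B) ^+ 3)
  + (1 - A) ^+ 2 * (198 * B ^+ 3 + 150 * ((1 - B) * B ^+ 2) +
      28 * ((1 - B) ^+ 2 * B) + 4 * (1 - B) ^+ 3) by rewrite DE; ring.
by pos.
Qed.

Lemma bernstein_cst (A B D : R) : 0 < A < 1 -> 0 < B < 1 ->
  D = (2 + A) * (1 + 2 * B) ->
  0 < 3 * D * (2 * A + A ^+ 3 * B ^+ 2 - 3 * A * (1 - A ^+ 2) * B ^+ 2)
      - A ^+ 2 * D ^+ 2 + 54 * (1 - A ^+ 2) * B ^+ 2.
Proof.
move=> /andP[A0 A1] /andP[B0 B1] DE.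
have a0 : 0 < 1 - A by lra.
have b0 : 0 < 1 - B by lra.
have -> : 3 * D * (2 * A + A ^+ 3 * B ^+ 2 - 3 * A * (1 - A ^+ 2) * B ^+ 2)
      - A ^+ 2 * D ^+ 2 + 54 * (1 - A ^+ 2) * B ^+ 2 =
  A ^+ 4 * (27 * ((1 - B) ^+ 2 * B) + 9 * (1 - B) ^+ 3)
  + (1 - A) * A ^+ 3 * (216 * ((1 - B) * B ^+ 2) +
      156 * ((1 - B) ^+ 2 * B) + 36 * (1 - B) ^+ 3)
  + (1 - A) ^+ 2 * A ^+ 2 * (171 * B ^+ 3 + 441 * ((1 - B) * B ^+ 2) +
      182 * ((1 - B) ^+ 2 * B) + 38 * (1 - B) ^+ 3)
  + (1 - A) ^+ 3 * A * (198 * B ^+ 3 + 282 * ((1 - B) * B ^+ 2) +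
      60 * ((1 - B) ^+ 2 * B) + 12 * (1 - B) ^+ 3)
  + (1 - A) ^+ 4 * (54 * B ^+ 3 + 54 * ((1 - B) * B ^+ 2)) by rewrite DE; ring.
by pos.
Qed.

(** [A], [B], [M], [C], [T] are cos w, cos v, sin v sin w, cos (v + w) and sin w sin (v + w) in
    [rho_ineq]. As a polynomial in [M], the expression has its constant term given by
    [bernstein_cst], a linear term whose sign comes from [bernstein_lin], and the square term 4 A
    M^2. *)
Lemma rho_bound_ineq (A B M C T r : R) : 0 < A < 1 -> 0 < B < 1 -> 0 <= M ->
  C = A * B - M -> T = (1 - A ^+ 2) * B + A * M ->
  r = (2 + A) * (1 + 2 * B) / (9 * B) ->
  0 < A * (2 + C ^+ 2 - 3 * r * C) + T * (2 / r - 3 * C).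
Proof.
move=> A01 B01 M0 -> -> ->.
have /andP[A0 A1] := A01; have /andP[B0 B1] := B01.
pose D := (2 + A) * (1 + 2 * B).
have D0 : 0 < D by rewrite /D; pos.
have := bernstein_cst A01 B01 (erefl D); set g := (X in 0 < X) => g0.
have A01' : 0 <= A <= 1 by rewrite !ltW.
have B01' : 0 <= B <= 1 by rewrite !ltW.
have := bernstein_lin A01' B01' (erefl D); set l := (X in 0 <= X) => l0.
have -> : A * (2 + (A * B - M) ^+ 2 - 3 * (D / (9 * B)) * (A * B - M))
  + ((1 - A ^+ 2) * B + A * M) * (2 / (D / (9 * B)) - 3 * (A * B - M)) =
  g / (3 * D) + A * M * ((l + 3 * D * (1 - A) * B ^+ 2 * (3 * (1 + A) / A - 6)) / (3 * B * D)) + 4 * A * M ^+ 2.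
  rewrite /g /l; field.
  by rewrite !gt_eqF.
have h : 0 <= 3 * (1 + A) / A - 6.
  by rewrite subr_ge0 ler_pdivlMr//; lra.
apply: ltr_wpDr; first by pos.
apply: ltr_wpDr; last by rewrite divr_gt0//; pos.
apply: mulr_ge0; first by pos.
apply: divr_ge0; last by pos.
apply: addr_ge0 => //; apply: mulr_ge0 => //.
by pos.
Qed.

(** The expression decreases in [r]. The bounds of Cusa-Huygens for sin w / w and of Snell-Huygens
    for v / sin v give a larger value [r1] that is rational in cos v and cos w, so that a polynomial
    inequality remains. *)
Lemma rho_ineq (w v r S C : R) : 0 < w -> 0 < v -> v + w < pi / 2 ->
  r = v / sin v * (sin w / w) -> S = sin (v + w) -> C = cos (v + w) ->
  0 < 2 * S * (S * cos w + sin w / r) - 3 * C * (r * cos w - C * cos w + S * sin w).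
Proof.
move=> w0 v0 vw rE -> ->.
have pi0 := pi_gt0 R.
have C0 : 0 < cos (v + w) by apply: cos_gt0_pihalf; lra.
have S0 : 0 < sin (v + w) by apply: sin_gt0_pihalf; lra.
have cv : 0 < cos v by apply: cos_gt0_pihalf; lra.
have cw : 0 < cos w by apply: cos_gt0_pihalf; lra.
have sv : 0 < sin v by apply: sin_gt0_pihalf; lra.
have sw : 0 < sin w by apply: sin_gt0_pihalf; lra.
have cv2 := cos2Dsin2 v; have cw2 := cos2Dsin2 w.
have r0 : 0 < r by rewrite rE; pos.
have [r1 r1E] : exists r1, r1 = (2 + cos w) * (1 + 2 * cos v) / (9 * cos v) by eexists.
have rr1 : r <= r1.
  have h1 : sin w / w <= (2 + cos w) / 3.
    by rewrite ler_pdivrMr//; have := @cusa_huygens R w; lra.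
  have h2 : v / sin v <= (2 * cos v + 1) / (3 * cos v).
    rewrite ler_pdivrMr// mulrAC ler_pdivlMr; last by pos.
    by have := @snell_huygens R v; lra.
  rewrite rE r1E (_ : _ / (9 * cos v) = (2 * cos v + 1) / (3 * cos v) * ((2 + cos w) / 3)).
    by apply: ler_pM => //; apply: ltW; pos.
  by field; rewrite gt_eqF.
have r10 : 0 < r1 by apply: lt_le_trans rr1.
apply: (@lt_le_trans _ _ (2 * sin (v + w) * (sin (v + w) * cos w + sin w / r1) -
  3 * cos (v + w) * (r1 * cos w - cos (v + w) * cos w + sin (v + w) * sin w))); last first.
  apply: lerB; apply: ler_wpM2l; try by pos.
    rewrite lerD2l; apply: ler_wpM2l; first exact: ltW.
    by rewrite lef_pV2 ?posrE.
  by have := ler_wpM2r (ltW cw) rr1; lra.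
have := @rho_bound_ineq (cos w) (cos v) (sin v * sin w) (cos (v + w)) (sin w * sin (v + w)) r1.
have w1 : cos w < 1 by rewrite -cos0 ltr_cos ?in_itv/= ?w0//; lra.
have v1 : cos v < 1 by rewrite -cos0 ltr_cos ?in_itv/= ?v0//; lra.
rewrite cw w1 cv v1 => /(_ isT isT) H.
have {H} := H (ltW (mulr_gt0 sv sw)).
rewrite {1 2}cosD {1 2}sinD => H.
have E1 : cos v * cos w - sin v * sin w = cos w * cos v - sin v * sin w by ring.
have E2 : sin w * (sin v * cos w + cos v * sin w) = (1 - cos w ^+ 2) * cos v + cos w * (sin v * sin w).
  by rewrite -cw2; ring.
move: (H E1 E2 r1E); rewrite -cosD -sinD; congr (0 < _).
have -> : 2 + cos (v + w) ^+ 2 = 2 * sin (v + w) ^+ 2 + 3 * cos (v + w) ^+ 2.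
  by have := cos2Dsin2 (v + w); lra.
by field; rewrite gt_eqF.
Qed.

(* With [x = u + v], [b (cot u - ...)] and [k] below are the logarithmic
   derivatives governing the extremal curve. *)
Lemma trig_key u v : 0 < u -> 0 < v -> v + u / 2 < pi / 2 ->
  let x := u + v in
  let b := (u * (cos u / sin u) - x * (cos x / sin x)) / v in
  let k := (v * (cos v / sin v) - x * (cos x / sin x)) / u in
  3 * k * (sin x - sin v) < (sin x + sin v) * (sin u + (1 - cos u) * b)
  /\ sin u < b * (1 + cos u).
Proof.
move=> u0 v0 uv x b k.
have pi0 := pi_gt0 R.
(* With w = u / 2, the sum and the difference of sin x and sin v factor through the angles v + w and
   w; the quotients v / sin v and sin w / w enter only through [r]. *)
pose w := u / 2; have w0 : 0 < w by rewrite /w; pos.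
have uw : u = 2 * w by rewrite /w; field.
have vw : v + w < pi / 2 by [].
set S := sin (v + w); set C := cos (v + w).
have xE : x = (v + w) + w by rewrite /x uw; ring.
have vE : v = (v + w) - w by ring.
have uE : u = w + w by rewrite uw; ring.
have C0 : 0 < C by apply: cos_gt0_pihalf; lra.
have S0 : 0 < S by apply: sin_gt0_pihalf; lra.
have cv : 0 < cos v by apply: cos_gt0_pihalf; lra.
have cw : 0 < cos w by apply: cos_gt0_pihalf; lra.
have sv : 0 < sin v by apply: sin_gt0_pihalf; lra.
have sw : 0 < sin w by apply: sin_gt0_pihalf; lra.
have su : sin u = 2 * sin w * cos w by rewrite uE sinD; ring.
have cu : 1 - cos u = 2 * sin w ^+ 2.
  by rewrite uE cosD; have := cos2Dsin2 w; lra.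
have su0 : 0 < sin u by rewrite su; pos.
have sx : 0 < sin x by apply: sin_gt0_pi; rewrite /x; lra.
have D1 : sin x + sin v = 2 * S * cos w by rewrite xE {2}vE sinD sinB -/S -/C; ring.
have D2 : sin x - sin v = 2 * C * sin w by rewrite xE {2}vE sinD sinB -/S -/C; ring.
have D3 : sin v = sin x * cos u - cos x * sin u.
  by rewrite -sinB /x; congr sin; ring.
have D4 : sin u = sin x * cos v - cos x * sin v.
  by rewrite -sinB /x; congr sin; ring.
have D5 : S = sin x * cos w - cos x * sin w.
  by rewrite -sinB xE /S; congr sin; ring.
have D6 : cos x = C * cos w - S * sin w by rewrite xE cosD.
have xx : x * (cos x / sin x) = u * (cos x / sin x) + v * (cos x / sin x).
  by rewrite -mulrDl.
have bE : b = (u * (sin v / (sin u * sin x)) - v * (cos x / sin x)) / v.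
  by rewrite /b xx D3; field; rewrite !gt_eqF.
have kE : k = (v * (sin u / (sin v * sin x)) - u * (cos x / sin x)) / u.
  by rewrite /k xx D4; field; rewrite !gt_eqF.
have bS : cos w + sin w * b = (S + w * sin v / (v * cos w)) / sin x.
  by rewrite bE D5 su uw; field; rewrite !gt_eqF.
have [r rE] : exists r, r = v / sin v * (sin w / w) by eexists.
have Hr := rho_ineq w0 v0 vw rE (erefl S) (erefl C).
have r0 : 0 < r by rewrite rE; pos.
split.
  rewrite D1 D2 su cu -subr_gt0.
  have -> : 2 * S * cos w * (2 * sin w * cos w + 2 * sin w ^+ 2 * b) - 3 * k * (2 * C * sin w)
    = 2 * sin w * (2 * S * cos w * (cos w + sin w * b) - 3 * k * C) by ring.
  rewrite bS kE su.
  have -> : 2 * S * cos w * ((S + w * sin v / (v * cos w)) / sin x) -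
    3 * ((v * (2 * sin w * cos w / (sin v * sin x)) - u * (cos x / sin x)) / u) * C
    = (2 * S * (S * cos w + sin w / r) - 3 * C * (r * cos w - C * cos w + S * sin w)) / sin x.
    by rewrite D6 uw rE; field; rewrite !gt_eqF.
  by pos.
have -> : 1 + cos u = 2 * cos w ^+ 2 by have := cos2Dsin2 w; move: cu; lra.
rewrite su -subr_gt0.
have -> : b * (2 * cos w ^+ 2) - 2 * sin w * cos w =
   2 * cos w / sin w * (cos w * (cos w + sin w * b) - (cos w ^+ 2 + sin w ^+ 2)).
  by field; rewrite gt_eqF.
apply: mulr_gt0; first by pos.
rewrite bS cos2Dsin2 subr_gt0 mulrA ltr_pdivlMr// mul1r.
have -> : sin x = S * cos w + C * sin w by rewrite xE sinD.
have -> : cos w * (S + w * sin v / (v * cos w)) = S * cos w + w * sin v / v.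
  by field; rewrite !gt_eqF.
rewrite mulrC ltrD2l ltr_pdivlMr//.
have h1 : v * C < sin v.
  apply: le_lt_trans (_ : v * C <= v * cos v) _.
    by rewrite ler_pM2l// ltW// ltr_cos ?in_itv/=; lra.
  by apply: xcos_lt_sin; lra.
have h2 : sin w <= w by apply: sin_le; rewrite ltW.
apply: (@le_lt_trans _ _ (w * (v * C))).
  by rewrite (_ : C * _ * v = sin w * (v * C)); [apply: ler_wpM2r => //; apply: ltW; pos|ring].
by rewrite ltr_pM2l.
Qed.

(** [s], [k], [e] are sin d, cos d and tan (v - 2 d) in [huygens_key]; [N], [M], [L] are sin v, cos
    v and cos (v + 2 d) divided by cos (v - 2 d). Sorted by powers of [e], the polynomial has
    nonnegative coefficients on the given range of [s] and [k]. The last summand of the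
    decomposition is a multiple of k^2 + s^2 - 1 and vanishes. *)
Lemma tan_poly_ge0 (e s k N M L : R) :
  k ^+ 2 + s ^+ 2 = 1 -> 0 <= s -> 23 / 25 <= k <= 1 -> s ^+ 2 <= 3 / 20 -> 0 <= e ->
  N = e * (1 - 2 * s ^+ 2) + 2 * s * k ->
  M = 1 - 2 * s ^+ 2 - e * (2 * s * k) ->
  L = 1 - 2 * (2 * s * k) ^+ 2 - e * (2 * (2 * s * k) * (1 - 2 * s ^+ 2)) ->
  0 <= k * (4 * s ^+ 2 * N ^+ 2)
    + s * (2 * s + e) * (k * (4 * N ^+ 2 + 2 * (2 * N ^+ 2 * s ^+ 2 - N * M * (2 * s * k))) + 6 * s * N * L)
    + (2 * s + e) ^+ 2 * (k * (2 * (2 * N ^+ 2 * s ^+ 2 - N * M * (2 * s * k)) - 6 * s ^+ 2 * (1 + e ^+ 2))).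
Proof.
move=> ks s0 /andP[k0 k1] sle e0 -> -> ->.
set P := (X in 0 <= X).
pose t := s ^+ 2.
have t0 : 0 <= t by rewrite sqr_ge0.
have t1 : t <= 3 / 20 by [].
have kt : 1 - k <= t.
  have : k ^+ 2 = 1 - t by rewrite -ks /t; ring.
  by nra.
have p1 : 0 <= 36 * (1 - k) + t * (- 48 + 88 * k - 64 * (t * k)).
  have tk : t * k <= 3 / 20 by nra.
  by apply: addr_ge0; [lra|apply: mulr_ge0 => //; lra].
have p2 : 0 <= 2 * (1 - k) + t * (104 - 8 * k - 240 * t - 32 * (t * k) + 128 * t ^+ 2).
  have tk : t * k <= 3 / 20 by nra.
  have : 0 <= t ^+ 2 by rewrite sqr_ge0.
  by move=> ?; apply: addr_ge0; [lra|apply: mulr_ge0 => //; lra].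
have p3 : 0 <= t * (52 - 4 * k - 112 * t - 88 * (t * k) + 64 * t ^+ 2 + 64 * (t ^+ 2 * k)) - 4 * (1 - k).
  have tk : t * k <= 3 / 20 by nra.
  have tt : 0 <= t ^+ 2 by rewrite sqr_ge0.
  have ttk : 0 <= t ^+ 2 * k by rewrite mulr_ge0//; lra.
  rewrite subr_ge0; apply: (@le_trans _ _ (t * 4)); first by lra.
  by apply: ler_wpM2l => //; lra.
have p4 : 0 <= 6 - 40 * t + 32 * t ^+ 2.
  by have : 0 <= t ^+ 2 by [rewrite sqr_ge0]; lra.
have -> : P = e * s ^+ 3 * (36 * (1 - k) + t * (- 48 + 88 * k - 64 * (t * k)))
  + e ^+ 2 * s ^+ 2 * (2 * (1 - k) + t * (104 - 8 * k - 240 * t - 32 * (t * k) + 128 * t ^+ 2))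
  + e ^+ 3 * s * (t * (52 - 4 * k - 112 * t - 88 * (t * k) + 64 * t ^+ 2 + 64 * (t ^+ 2 * k)) - 4 * (1 - k))
  + e ^+ 4 * s ^+ 2 * k * (6 - 40 * t + 32 * t ^+ 2)
  + (k ^+ 2 + s ^+ 2 - 1) * (24 * e ^+ 1 * s ^+ 3 - 24 * e ^+ 1 * s ^+ 3 * k ^+ 1 + 64 * e ^+ 1 * s ^+ 5 * k ^+ 1 + 96 * e ^+ 1 * s ^+ 5 * k ^+ 2 - 4 * e ^+ 2 * s ^+ 2 - 8 * e ^+ 2 * s ^+ 2 * k ^+ 1 + 112 * e ^+ 2 * s ^+ 4 + 80 * e ^+ 2 * s ^+ 4 * k ^+ 1 + 80 * e ^+ 2 * s ^+ 4 * k ^+ 2 - 128 * e ^+ 2 * s ^+ 6 - 96 * e ^+ 2 * s ^+ 6 * k ^+ 1 - 4 * e ^+ 3 * s ^+ 1 + 48 * e ^+ 3 * s ^+ 3 + 40 * e ^+ 3 * s ^+ 3 * k ^+ 1 + 16 * e ^+ 3 * s ^+ 3 * k ^+ 2 - 64 * e ^+ 3 * s ^+ 5 - 80 * e ^+ 3 * s ^+ 5 * k ^+ 1 + 8 * e ^+ 4 * s ^+ 2 * k ^+ 1 - 16 * e ^+ 4 * s ^+ 4 * k ^+ 1).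
  by rewrite /P /t; ring.
have k2 : 0 <= k by lra.
rewrite ks subrr mul0r addr0.
by pos.
Qed.

(** From cos 2d >= cos (pi / 4) >= 7/10 one gets sin^2 d <= 3/20, hence cos^2 d >= 17/20, which
    exceeds (23/25)^2. *)
Lemma half_angle_bounds (d : R) : 0 <= d <= pi / 8 ->
  [/\ 0 <= sin d, 23 / 25 <= cos d <= 1 & sin d ^+ 2 <= 3 / 20].
Proof.
move=> /andP[d0 d8]; have pi0 := pi_gt0 R.
have sd : 0 <= sin d by apply: sin_ge0_pi; lra.
have cd : 0 <= cos d by apply: cos_ge0_pihalf; lra.
have c4 : 7 / 10 <= cos (pi / 4 : R).
  have h0 : 0 < cos (pi / 4 : R) by apply: cos_gt0_pihalf; lra.
  have h1 : cos (pi / 4 : R) ^+ 2 = 1 / 2.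
    have := cos_pihalf R; rewrite (_ : pi / 2 = pi / 4 + pi / 4); last by field.
    by rewrite cosD; have := cos2Dsin2 (pi / 4 : R); lra.
  by nra.
have c2 : 7 / 10 <= cos (d + d) by apply: (le_trans c4); apply: cos_anti; lra.
rewrite cosDD in c2.
have s2 : sin d ^+ 2 <= 3 / 20 by lra.
split => //; rewrite cos_le1 andbT.
by have := cos2Dsin2 d; nra.
Qed.

Lemma sinc_decr v x : 0 < v < x -> x <= pi -> v * sin x < x * sin v.
Proof.
case/andP=> v0 vx xpi; have x0 := lt_trans v0 vx.
have H : sin x / x < sin v / v.
  apply: (@decr_lt R (fun y => sin y / y) (fun y => (y * cos y - sin y) / y ^+ 2) _ _ vx).
    move=> y /andP[vy yx]; have y0 : 0 < y by lra.
    by eapply isd_eq; [deriv; by rewrite gt_eqF|cbv beta; field; rewrite gt_eqF].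
  move=> y /andP[vy yx]; have y0 : 0 < y by lra.
  rewrite ltr_pdivrMr ?exprn_gt0// mul0r subr_lt0.
  by apply: xcos_lt_sin; rewrite y0; lra.
by apply: (@lt_scaled _ (x * v) _ _ _ _ _ _ H); [pos|field; rewrite !gt_eqF].
Qed.

(** [D] is nondecreasing: its increment is [r - r0] times a sum of nonnegative terms, one of them
    the gap in the last hypothesis on [cv] and [sv]. In [huygens_key] this lets the transcendental
    ratio d / v be lowered. *)
Lemma huygens_quadratic (sv cv cx sd cd r r0 : R) :
  0 <= r0 <= r -> 0 < cd -> 0 <= sd -> 0 < sv -> 0 <= cx -> cv * (2 * sd * cd) <= sv ->
  let D (r : R) := 2 * (1 + r) * (2 * sv * sd ^+ 2 - cv * (2 * sd * cd) + 2 * r * sv)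
  - 6 * (sd / cd) * (sd * cd / sv - r * cx) in
  0 <= D r0 -> 0 <= D r.
Proof.
move=> /andP[r00 rr] cd0 sd0 sv0 cx0 h D D0; apply: (le_trans D0).
rewrite -subr_ge0.
have -> : D r - D r0 = (r - r0) * (4 * sv * (r + r0) + (2 * (sv + (sv - cv * (2 * sd * cd)) +
   2 * sv * sd ^+ 2) + 6 * (sd / cd) * cx)).
  by rewrite /D; ring.
have rp : 0 <= r by apply: le_trans rr.
have rr' : 0 <= r - r0 by rewrite subr_ge0.
have h' : 0 <= sv - cv * (2 * sd * cd) by rewrite subr_ge0.
by apply: mulr_ge0 => //; apply: addr_ge0; pos.
Qed.

Lemma double_sin_le (d v : R) : 0 < d -> 2 * d <= v -> v <= pi / 2 ->
  cos v * (2 * sin d * cos d) <= sin v.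
Proof.
move=> d0 dv vpi; have pi0 := pi_gt0 R.
have s2v : 2 * sin d * cos d <= sin v by rewrite -sinDD; apply: sin_mono; lra.
have cv1 := cos_le1 v.
have cv0 : 0 <= cos v by apply: cos_ge0_pihalf; lra.
have h0 : 0 <= 2 * sin d * cos d.
  by apply: mulr_ge0; [apply: mulr_ge0; [|apply: sin_ge0_pi]|apply: cos_ge0_pihalf]; lra.
by rewrite -[leRHS]mul1r; apply: ler_pM.
Qed.

(** The form to which [trig_key3] reduces. The left side grows with d / v, and d / v is at least sin
    d / (2 sin d + tan (v - 2 d)), because sin d <= d and v - 2 d <= tan (v - 2 d). With this value
    all terms are polynomial in sin d, cos d and tan (v - 2 d). *)
Lemma huygens_key (v d : R) : 0 < d -> 2 * d <= v -> v + 2 * d <= pi / 2 ->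
  0 <= 2 * (1 + d / v) * (2 * sin v * sin d ^+ 2 - cos v * (2 * sin d * cos d) + 2 * (d / v) * sin v)
  - 6 * (sin d / cos d) * (sin d * cos d / sin v - d / v * cos (v + 2 * d)).
Proof.
move=> d0 dv vpi; have pi0 := pi_gt0 R.
have v0 : 0 < v by lra.
have dd : 0 <= d <= pi / 8 by lra.
have [_ cdd s2d] := half_angle_bounds dd.
have cd : 0 < cos d by case/andP: cdd => ? _; lra.
have sd : 0 < sin d by apply: sin_gt0_pi; lra.
have sv : 0 < sin v by apply: sin_gt0_pi; lra.
have cx : 0 <= cos (v + 2 * d) by apply: cos_ge0_pihalf; lra.
have [ep vd] : exists ep, v = 2 * d + ep by exists (v - 2 * d); ring.
have ep0 : 0 <= ep by lra.
have epp : ep < pi / 2 by lra.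
have cep : 0 < cos ep by apply: cos_gt0_pihalf; lra.
have sep : 0 <= sin ep by apply: sin_ge0_pi; lra.
have [e eE] : exists e, e = sin ep / cos ep by eexists.
have e0 : 0 <= e by rewrite eE; pos.
have ee : e * cos ep = sin ep by rewrite eE mulfVK// gt_eqF.
have h1 : sin d <= d by apply: sin_le; rewrite ltW.
have h2 : ep <= e by rewrite eE ler_pdivlMr//; apply: x_le_tan; rewrite ep0.
have den : 0 < 2 * sin d + e by apply: ltr_pwDl => //; pos.
have dsv : cos v * (2 * sin d * cos d) <= sin v by apply: double_sin_le => //; lra.
have rr0 : 0 <= sin d / (2 * sin d + e) <= d / v.
  apply/andP; split; first by pos.
  rewrite ler_pdivrMr// mulrAC ler_pdivlMr// vd.
  have : sin d * ep <= d * e by apply: ler_pM => //; apply: ltW.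
  by move=> ?; rewrite !mulrDr mulrCA [d * (2 * _)]mulrCA [d * sin d]mulrC lerD2l.
apply: (huygens_quadratic rr0 cd (ltW sd) sv cx dsv).
have := tan_poly_ge0 (cos2Dsin2 d) (ltW sd) cdd s2d e0 erefl erefl erefl.
have [N NE] : exists N, N = e * (1 - 2 * sin d ^+ 2) + 2 * sin d * cos d by eexists.
have [M ME] : exists M, M = 1 - 2 * sin d ^+ 2 - e * (2 * sin d * cos d) by eexists.
have [L LE] : exists L, L = 1 - 2 * (2 * sin d * cos d) ^+ 2 -
   e * (2 * (2 * sin d * cos d) * (1 - 2 * sin d ^+ 2)) by eexists.
rewrite -NE -ME -LE => HP.
have vd' : v = d + d + ep by rewrite vd; ring.
have c2d := esym (cosDD d); have s2d' := esym (sinDD d).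
have svE : sin v = cos ep * N.
  by rewrite NE c2d s2d' vd' sinD -ee; ring.
have cvE : cos v = cos ep * M.
  by rewrite ME c2d s2d' vd' cosD -ee; ring.
have cxE : cos (v + 2 * d) = cos ep * L.
  rewrite LE c2d s2d' (_ : v + 2 * d = ep + (d + d + (d + d))); last by rewrite vd; ring.
  rewrite (cosD ep) (cosD (d + d)) (sinD (d + d)) -ee.
  have := cos2Dsin2 (d + d); set c := cos (d + d); set s := sin (d + d) => cs.
  have -> : c * c = 1 - s ^+ 2 by rewrite -cs; ring.
  by ring.
have N0 : 0 < N by move: sv; rewrite svE pmulr_rgt0.
have ecc : 1 + e ^+ 2 = cos ep ^- 2.
  apply: (mulIf (_ : cos ep ^+ 2 != 0)); first by rewrite expf_neq0// gt_eqF.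
  rewrite mulVf ?expf_neq0 ?gt_eqF// -[RHS](cos2Dsin2 ep) -ee; ring.
rewrite svE cvE cxE.
rewrite ecc in HP.
clear - cep cd den N0 HP.
set P := (X in 0 <= X) in HP.
have -> : 2 * (1 + sin d / (2 * sin d + e)) * (2 * (cos ep * N) * sin d ^+ 2 -
      cos ep * M * (2 * sin d * cos d) + 2 * (sin d / (2 * sin d + e)) * (cos ep * N)) -
  6 * (sin d / cos d) * (sin d * cos d / (cos ep * N) - sin d / (2 * sin d + e) * (cos ep * L))
  = P * (cos ep / (N * cos d * (2 * sin d + e) ^+ 2)).
  by rewrite /P; field; rewrite !gt_eqF.
by apply: mulr_ge0 => //; pos.
Qed.

(** Counterpart of [trig_key] for an exponent below 1, where it is applied with x = q t and v = (1 -
    q) t. Writing x = v + 2 d, the bound x <= 2 v says that v - 2 d is nonnegative, and with x <= pi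
    / 2 it gives d <= pi / 8. *)
Lemma trig_key3 v x : 0 < v < x -> x <= 2 * v -> x <= pi / 2 ->
  let t := x + v in
  let b := (x * (cos x / sin x) - t * (cos t / sin t)) / v in
  let k := (v * (cos v / sin v) - x * (cos x / sin x)) / t in
  3 * k * (sin x - sin v) <= (sin x + sin v) * ((1 + cos t) * b - sin t)
  /\ 0 < (1 + cos t) * b - sin t.
Proof.
case/andP=> v0 vx xv xpi t b k.
have pi0 := pi_gt0 R.
have x0 : 0 < x by lra.
have t0 : 0 < t by rewrite /t; lra.
have [d x2d] : exists d, x = v + 2 * d by exists ((x - v) / 2); field.
have [w wE] : exists w, w = v + d by eexists.
have xE : x = w + d by rewrite x2d wE; ring.
have vE : v = w - d by rewrite wE; ring.
have tE : t = w + w by rewrite /t x2d wE; ring.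
have d0 : 0 < d by lra.
have w0 : 0 < w by lra.
have dv : 2 * d <= v by lra.
have dpi : v + 2 * d <= pi / 2 by lra.
have sx : 0 < sin x by apply: sin_gt0_pi; lra.
have sv : 0 < sin v by apply: sin_gt0_pi; lra.
have st : 0 < sin t by apply: sin_gt0_pi; rewrite tE; lra.
have sw : 0 < sin w by apply: sin_gt0_pi; lra.
have cw : 0 < cos w by apply: cos_gt0_pihalf; lra.
have cd : 0 < cos d by apply: cos_gt0_pihalf; lra.
have ratio : v * sin x < x * sin v by apply: sinc_decr; rewrite ?v0//; lra.
have HD := huygens_key d0 dv dpi.
clear xv vx xpi dv dpi d0.
have ctE : 1 + cos t = 2 * cos w ^+ 2.
  by rewrite tE cosDD'.
have stE : sin t = 2 * sin w * cos w by rewrite tE sinDD.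
have D1 : sin x + sin v = 2 * sin w * cos d by rewrite xE vE sinD sinB; ring.
have D2 : sin x - sin v = 2 * cos w * sin d by rewrite xE vE sinD sinB; ring.
have D3 : sin v = sin t * cos x - cos t * sin x by rewrite -sinB /t; congr sin; ring.
have D4 : 2 * sin d * cos d = sin x * cos v - cos x * sin v.
  by rewrite -sinB (_ : x - v = d + d); [rewrite sinD; ring|rewrite x2d; ring].
have tt : t * (cos t / sin t) = x * (cos t / sin t) + v * (cos t / sin t).
  by rewrite -mulrDl.
have bE : b = (x * (sin v / (sin x * sin t)) - v * (cos t / sin t)) / v.
  by rewrite /b tt D3; field; rewrite !gt_eqF.
have xx : x * (cos x / sin x) = v * (cos x / sin x) + 2 * d * (cos x / sin x).
  by rewrite -mulrDl -x2d.
have kE : k = (v * (2 * sin d * cos d / (sin v * sin x)) - 2 * d * (cos x / sin x)) / t.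
  by rewrite /k xx D4; field; rewrite !gt_eqF.
have E1 : (1 + cos t) * b - sin t = cos w / sin w * (x * sin v / (v * sin x) - 1).
  have -> : (1 + cos t) * b - sin t =
    2 * cos w ^+ 2 * (x * sin v / (v * sin x * sin t)) -
    (2 * cos w ^+ 2 * cos t + sin t * sin t) / sin t.
    by rewrite ctE bE; field; rewrite !gt_eqF.
  have -> : 2 * cos w ^+ 2 * cos t + sin t * sin t = 2 * cos w ^+ 2.
    by rewrite -ctE; have := cos2Dsin2 t; lra.
  by rewrite stE; field; rewrite !gt_eqF.
have cot0 : 0 < x * sin v / (v * sin x) - 1.
  by rewrite subr_gt0 ltr_pdivlMr ?mul1r//; pos.
split; last by rewrite E1; pos.
rewrite E1 D1 D2 kE -subr_ge0.
have sxE : sin x = sin v * (1 - 2 * sin d ^+ 2) + cos v * (2 * sin d * cos d).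
  by rewrite -cosDD -sinDD {1}x2d mulrDl mul1r sinD.
rewrite -x2d in HD.
set lhs := (X in 0 <= X).
have E : 2 * sin v * sin d ^+ 2 - cos v * (2 * sin d * cos d) + 2 * (d / v) * sin v
    = (1 + 2 * (d / v)) * sin v - sin x by rewrite sxE; ring.
rewrite E in HD; set P := (X in 0 <= X) in HD.
have -> : lhs = 2 * cos w * cos d * v / (t * sin x) * P.
  have tvd : t = 2 * (v + d) by rewrite tE wE; ring.
  have vd0 : v + d != 0 by rewrite -wE gt_eqF.
  rewrite /lhs /P tvd [X in X * sin v]x2d.
  move: (cos x) vd0 (sin x) sx (cos w) cw (sin w) sw => cx vd0 {}sx ? cw ? sw ?.
  by field; rewrite vd0 !gt_eqF.
by apply: mulr_ge0; pos.
Qed.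

End KeyInequality.

(** * The extremal curve *)

Section HyperbolicSide.
Variable R : realType.
Implicit Types s x y : R.

(** The function cosh (s y)^(1/s) / (cosh y - k) is stationary at a positive y exactly when [ch s y]
    = k, by [tanh_ch]. [kh] is minus the logarithmic derivative of [ch]. *)
Definition ch s y := sinh ((s - 1) * y) / sinh (s * y).
Definition kh s y := s * (cosh (s * y) / sinh (s * y)) -
  (s - 1) * (cosh ((s - 1) * y) / sinh ((s - 1) * y)).

Lemma ch_gt0 s y : 1 < s -> 0 < y -> 0 < ch s y.
Proof.
by move=> s1 y0; rewrite /ch divr_gt0// sinh_gt0// mulr_gt0//; lra.
Qed.

Lemma ch_coth s y : 1 < s -> 0 < y ->
  ch s y = cosh y - sinh y * (cosh (s * y) / sinh (s * y)).
Proof.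
move=> s1 y0; have h : 0 < sinh (s * y) by rewrite sinh_gt0// mulr_gt0//; lra.
by rewrite /ch mulrBl mul1r sinhB; field; rewrite gt_eqF.
Qed.

Lemma isd_ch s y : 1 < s -> 0 < y -> isd y (ch s) (- (ch s y * kh s y)).
Proof.
move=> s1 y0; rewrite /ch /kh.
have h1 : 0 < sinh (s * y) by rewrite sinh_gt0// mulr_gt0//; lra.
have h2 : 0 < sinh ((s - 1) * y) by rewrite sinh_gt0// mulr_gt0//; lra.
by eapply isd_eq; [deriv; rewrite gt_eqF|cbv beta; field; rewrite !gt_eqF].
Qed.

(** With y = 2 h and a = (s - 1/2) y, the quantities 1 + ch and 1 - ch become products, and 2 h kh
    is the gap of t coth t between a - h and a + h. What remains is [coth_gap]. *)
Lemma hyp_key s y : 1 < s -> 0 < y ->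
  2 * sinh (y / 2) * (1 + ch s y) < 3 * cosh (y / 2) * (kh s y * (1 - ch s y)).
Proof.
move=> s1 y0.
have [h yE] : exists h, y = 2 * h by exists (y / 2); field.
have h0 : 0 < h by lra.
have [a aE] : exists a, (s - 1) * y = a - h by exists ((s - 1) * y + h); ring.
have sE : s * y = a + h by move: aE; rewrite yE; lra.
have sm : 0 < s - 1 by lra.
have ha : 0 < h < a.
  by rewrite h0 /=; have := mulr_gt0 sm y0; rewrite aE subr_gt0.
have a0 : 0 < a by case/andP: ha => ? ?; lra.
have hB : 0 < sinh (a - h) by rewrite sinh_gt0// subr_gt0; case/andP: ha.
have hD : 0 < sinh (a + h) by rewrite sinh_gt0//; lra.
have := coth_gap ha.
have -> : y / 2 = h by rewrite yE; field.
have -> : kh s y = (h * sinh (2 * a) - a * sinh (2 * h)) / (sinh (a + h) * sinh (a - h) * (2 * h)).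
  have -> : kh s y = ((a + h) * (cosh (a + h) / sinh (a + h)) -
      (a - h) * (cosh (a - h) / sinh (a - h))) / (2 * h).
    by rewrite /kh sE aE -sE -aE yE; field; rewrite !gt_eqF// -?yE// ?sE ?aE.
  have -> : 2 * a = a + h + (a - h) by ring.
  have -> : sinh (2 * h) = sinh (a + h - (a - h)) by congr sinh; ring.
  rewrite (sinhD (a + h)) (sinhB (a + h)).
  by field; rewrite !gt_eqF.
rewrite /ch sE aE.
have D : sinh (a + h) * sinh (a - h) = sinh a ^+ 2 - sinh h ^+ 2.
  rewrite sinhD sinhB.
  have -> : sinh a ^+ 2 - sinh h ^+ 2 = sinh a ^+ 2 * (cosh h ^+ 2 - sinh h ^+ 2)
     - sinh h ^+ 2 * (cosh a ^+ 2 - sinh a ^+ 2) by rewrite !cosh2Bsinh2 !mulr1.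
  by ring.
have P1 : 1 + sinh (a - h) / sinh (a + h) = 2 * sinh a * cosh h / sinh (a + h).
  have -> : 2 * sinh a * cosh h = sinh (a + h) + sinh (a - h) by rewrite sinhD sinhB; ring.
  by field; rewrite gt_eqF.
have P2 : 1 - sinh (a - h) / sinh (a + h) = 2 * cosh a * sinh h / sinh (a + h).
  have -> : 2 * cosh a * sinh h = sinh (a + h) - sinh (a - h) by rewrite sinhD sinhB; ring.
  by field; rewrite gt_eqF.
rewrite P1 P2 -D.
have sh := sinh_gt0 h0; have ch0 := cosh_gt0 h.
apply: (@lt_scaled _ (sinh h * cosh h / (sinh (a + h) * (sinh (a + h) * sinh (a - h)) * h))).
  by pos.
by field; rewrite !gt_eqF.
Qed.

Lemma kh_gt0 s y : 1 < s -> 0 < y -> ch s y < 1 -> 0 < kh s y.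
Proof.
move=> s1 y0 c1; have := hyp_key s1 y0; have c0 := ch_gt0 s1 y0.
have y2 : 0 < y / 2 by lra.
have s0 := sinh_gt0 y2; have c2 := cosh_gt0 (y / 2).
move=> H; have : 0 < 3 * cosh (y / 2) * (kh s y * (1 - ch s y)).
  by apply: lt_trans H; pos.
by rewrite pmulr_rgt0 ?pmulr_lgt0//; pos.
Qed.

(** sinh t / t is increasing; the bound is the limit of [ch s y] at y = 0. *)
Lemma ch_lt s y : 1 < s -> 0 < y -> ch s y < (s - 1) / s.
Proof.
move=> s1 y0; rewrite /ch.
have sm : 0 < s - 1 by lra.
have s0 : 0 < s by lra.
have V0 : 0 < (s - 1) * y by pos.
have VY : (s - 1) * y < s * y by rewrite ltr_pM2r//; lra.
have Y0 := lt_trans V0 VY.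
have : sinh ((s - 1) * y) / ((s - 1) * y) < sinh (s * y) / (s * y).
  apply: (@incr_lt R (fun t => sinh t / t) (fun t => (t * cosh t - sinh t) / t ^+ 2) _ _ VY).
    move=> t /andP[Vt _]; have t0 := lt_le_trans V0 Vt.
    by eapply isd_eq; [deriv; by rewrite gt_eqF|cbv beta; field; rewrite gt_eqF].
  move=> t /andP[Vt _]; have t0 := lt_trans V0 Vt.
  rewrite divr_gt0 ?exprn_gt0// subr_gt0.
  have := @incr_lt R (fun t => t * cosh t - sinh t) (fun t => t * sinh t) 0 t t0.
  rewrite sinh0 mul0r subr0 subr_gt0; apply => u /andP[u0 ut].
  - by eapply isd_eq; [deriv|cbv beta; ring].
  - by rewrite mulr_gt0// sinh_gt0.
have sY := sinh_gt0 Y0.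
apply: (@lt_scaled _ ((s - 1) * y / sinh (s * y))); first by pos.
by field; rewrite !gt_eqF.
Qed.

Lemma ch_lt1 s y : 1 < s -> 0 < y -> ch s y < 1.
Proof.
move=> s1 y0; apply: lt_trans (ch_lt s1 y0) _.
by rewrite ltr_pdivrMr; lra.
Qed.

Lemma ch_decr s x y : 1 < s -> 0 < x -> x <= y -> ch s y <= ch s x.
Proof.
move=> s1 x0 xy.
apply: (@decr_le R (ch s) (fun t => - (ch s t * kh s t)) _ _ xy) => t /andP[xt ty].
  by apply: isd_ch => //; apply: lt_le_trans xt.
have t0 := lt_trans x0 xt.
rewrite oppr_le0 mulr_ge0// ltW ?ch_gt0// kh_gt0//.
exact: ch_lt1.
Qed.

(* [tanh (s y) = sinh y / (cosh y - ch s y)]; the logarithmic derivatives of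
   the two sides of the pointwise inequality are compared in this form. *)
Lemma tanh_ch s y : 1 < s -> 0 < y ->
  sinh (s * y) / cosh (s * y) = sinh y / (cosh y - ch s y).
Proof.
move=> s1 y0; rewrite ch_coth// opprB addrC subrK.
have h : 0 < sinh (s * y) by rewrite sinh_gt0// mulr_gt0//; lra.
have hy := sinh_gt0 y0; have hc := cosh_gt0 (s * y).
by field; rewrite !gt_eqF.
Qed.

(** Joins the trigonometric and the hyperbolic estimates: the former bounds [kt] from above,
    [hyp_key] bounds [kh] from below, both through the ratio of 1 + ch to 1 - ch, and the constant 3
    cancels. In the uses [Q] is minus the slope of the curve and [P] the same expression with cosh y
    replaced by 1. *)
Lemma W_pos s y kt P Q : 1 < s -> 0 < y -> 0 < P -> 0 < Q ->
  cosh (y / 2) ^+ 2 * P <= Q ->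
  3 * kt * (1 - ch s y) <= (1 + ch s y) * P ->
  kt * sinh y < kh s y * Q.
Proof.
move=> s1 y0 P0 Q0 QP kP.
have c1 := ch_lt1 s1 y0; have c0 := ch_gt0 s1 y0; have k0 := kh_gt0 s1 y0 c1.
have y2 : 0 < y / 2 by lra.
have s0 := sinh_gt0 y2; have c2 := cosh_gt0 (y / 2).
have -> : sinh y = 2 * sinh (y / 2) * cosh (y / 2) by rewrite -sinh2x; congr sinh; field.
have H := hyp_key s1 y0.
have c1' : 0 < 1 - ch s y by rewrite subr_gt0.
rewrite -(@ltr_pM2r _ (3 * (1 - ch s y))); last by pos.
apply: (@le_lt_trans _ _ ((1 + ch s y) * P * (2 * sinh (y / 2) * cosh (y / 2)))).
  apply: (@le_scaled _ (2 * sinh (y / 2) * cosh (y / 2)) _ _ _ _ _ _ kP); first by pos.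
  by ring.
apply: (@lt_le_trans _ _ (kh s y * (cosh (y / 2) ^+ 2 * P) * (3 * (1 - ch s y)))).
  apply: (@lt_scaled _ (cosh (y / 2) * P) _ _ _ _ _ _ H); first by pos.
  by ring.
apply: (@le_scaled _ (kh s y * (3 * (1 - ch s y))) _ _ _ _ _ _ QP); first by pos.
by ring.
Qed.

Definition acosh x := ln (x + Num.sqrt (x ^+ 2 - 1)).

Lemma sinh_acosh_aux x : 1 <= x ->
  cosh (acosh x) = x /\ sinh (acosh x) = Num.sqrt (x ^+ 2 - 1).
Proof.
move=> x1; set r := Num.sqrt _.
have x0 : 0 < x by lra.
have r0 : 0 <= r by exact: sqrtr_ge0.
have rr : r ^+ 2 = x ^+ 2 - 1 by rewrite sqr_sqrtr//; nra.
have xr : 0 < x + r by rewrite ltr_pwDl.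
have E : expR (acosh x) = x + r by rewrite /acosh lnK.
have xrV : (x + r)^-1 = x - r.
  by apply: (mulfI (_ : x + r != 0)); [rewrite gt_eqF|rewrite mulfV ?gt_eqF//; lra].
have E' : expR (- acosh x) = x - r by rewrite expRN E xrV.
by rewrite coshE sinhE E E'; split; field.
Qed.

Lemma acoshK x : 1 <= x -> cosh (acosh x) = x.
Proof. by case/sinh_acosh_aux. Qed.

Lemma sinh_acosh x : 1 <= x -> sinh (acosh x) = Num.sqrt (x ^+ 2 - 1).
Proof. by case/sinh_acosh_aux. Qed.

Lemma acosh1 : acosh 1 = 0.
Proof. by rewrite /acosh expr1n subrr sqrtr0 addr0 ln1. Qed.

Lemma acosh_gt0 x : 1 < x -> 0 < acosh x.
Proof.
move=> x1; rewrite /acosh ln_gt0//; have := sqrtr_ge0 (x ^+ 2 - 1); lra.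
Qed.

Lemma isd_acosh g x b : 1 < g x -> isd x g b ->
  isd x (fun t => acosh (g t)) (b / sinh (acosh (g x))).
Proof.
move=> gx gb; rewrite sinh_acosh ?ltW//.
have r0 : 0 < g x ^+ 2 - 1 by nra.
have sr : 0 < Num.sqrt (g x ^+ 2 - 1) by rewrite sqrtr_gt0.
have xr : 0 < g x + Num.sqrt (g x ^+ 2 - 1) by lra.
rewrite /acosh; eapply isd_eq.
  apply: (@isd_ln _ (fun t => g t + Num.sqrt (g t ^+ 2 - 1))) => //.
  apply: (@isd_add _ g (fun t => Num.sqrt (g t ^+ 2 - 1))); first exact: gb.
  apply: (@isd_sqrt _ (fun t => g t ^+ 2 - 1)) => //.
  by apply: (@isd_add _ (fun t => g t ^+ 2) (fun=> -1)); [apply: isd_exp; exact: gb|exact: isd_cst].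
rewrite addr0 expr1; field.
by rewrite !gt_eqF.
Qed.

Lemma cosh_inj x y : 0 <= x -> 0 <= y -> cosh x = cosh y -> x = y.
Proof.
move=> x0 y0 E; have [xy|yx|//] := ltgtP x y.
- by have := @cosh_lt R x y; rewrite x0 xy E ltxx => /(_ isT).
- by have := @cosh_lt R y x; rewrite y0 yx E ltxx => /(_ isT).
Qed.

Lemma coshK y : 0 <= y -> acosh (cosh y) = y.
Proof.
move=> y0; have := cosh_ge1 y => c1.
apply: cosh_inj => //; last by rewrite acoshK.
move: c1; rewrite le_eqVlt => /predU1P[<-|/acosh_gt0/ltW//].
by rewrite acosh1.
Qed.

End HyperbolicSide.

(** * Functions that increase at each of their zeros *)

Section Crossing.
Variable R : realType.
Implicit Types (f W dW : R -> R) (x y z u v t : R).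

Lemma isd_eps f x d : isd x f d -> forall e, 0 < e ->
  exists2 r, 0 < r & forall h, `|h| < r -> `|f (x + h) - f x - d * h| <= e * `|h|.
Proof.
move=> [fd fv] e e0.
have : (h^-1 *: (f (h + x) - f x)) @[h --> 0^'] --> d.
  rewrite -fv; move: fd; rewrite /derivable /derive => fd.
  suff -> : (fun h : R => h^-1 *: (f (h + x) - f x)) =
    (fun h : R => h^-1 *: (f (h *: 1 + x) - f x)) by [].
  by apply/funext => h; rewrite [h *: 1]mulr1.
move/cvgrPdist_le => /(_ _ e0) [r /= r0 H].
exists r => // h hr; have [->|h0] := eqVneq h 0.
  by rewrite addr0 subrr mulr0 subrr !normr0 mulr0.
have := H h; rewrite /ball/= sub0r normrN => /(_ hr h0).
rewrite distrC [x + h]addrC /GRing.scale /=.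
have hn : 0 < `|h| by rewrite normr_gt0.
rewrite -(ler_pM2r hn) -normrM mulrBl mulrAC mulVf// mul1r.
by [].
Qed.

Lemma isd_right f x d : isd x f d -> 0 < d ->
  exists2 r, 0 < r & forall h, 0 < h < r -> f x < f (x + h).
Proof.
move=> fd d0; have d2 : 0 < d / 2 by lra.
have [r r0 H] := isd_eps fd d2; exists r => // h /andP[h0 hr].
have := H h; rewrite gtr0_norm// => /(_ hr); rewrite ler_norml => /andP[+ _].
have := mulr_gt0 d0 h0; lra.
Qed.

Lemma isd_left f x d : isd x f d -> 0 < d ->
  exists2 r, 0 < r & forall h, 0 < h < r -> f (x - h) < f x.
Proof.
move=> fd d0; have d2 : 0 < d / 2 by lra.
have [r r0 H] := isd_eps fd d2; exists r => // h /andP[h0 hr].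
have := H (- h); rewrite normrN gtr0_norm// => /(_ hr); rewrite ler_norml => /andP[_].
have := mulr_gt0 d0 h0; lra.
Qed.

Lemma cont_pos f x : {for x, continuous f} -> 0 < f x ->
  exists2 r, 0 < r & forall h, `|h| < r -> 0 < f (x + h).
Proof.
move=> fc f0; have /cvgr_gt/(_ _ f0) [r /= r0 H] := fc.
by exists r => // h hr; apply: H; rewrite /ball/= opprD addNKr normrN.
Qed.

(** A function increasing at each of its zeros cannot return to zero or below. If it did, let m be
    the supremum of the points before a negative value where it is nonnegative: it is nonnegative at
    m by continuity, and remains so slightly beyond m. *)
Lemma crossing W dW x z : x < z -> (forall u, x <= u <= z -> isd u W (dW u)) ->
  (forall u, x <= u <= z -> W u = 0 -> 0 < dW u) -> 0 <= W x -> 0 < W z.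
Proof.
move=> xz dWP W0 Wx; rewrite ltNge; apply/negP => Wz.
(* If the value at [z] is zero, it is negative just before [z], because the function increases
   there. *)
have [z' /andP[xz' z'z] Wz'] : exists2 z', x < z' <= z & W z' < 0.
  move: Wz; rewrite le_eqVlt => /predU1P[Wz|Wz]; last by exists z; rewrite ?xz ?lexx.
  have zz : x <= z <= z by rewrite (ltW xz) lexx.
  have [r r0 H] := isd_left (dWP z zz) (W0 z zz Wz).
  pose h := Num.min (r / 2) ((z - x) / 2).
  have zx0 : 0 < (z - x) / 2 by lra.
  have h0 : 0 < h by rewrite lt_min; apply/andP; split => //; lra.
  have h1 : h <= r / 2 by rewrite ge_min lexx.
  have h2 : h <= (z - x) / 2 by rewrite ge_min lexx orbT.
  exists (z - h); first by apply/andP; split; lra.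
  by rewrite -Wz; apply: H; rewrite h0 /=; lra.
pose B := [set u | x <= u <= z' /\ 0 <= W u].
have Bx : B x by split => //; rewrite lexx ltW.
have Bsup : has_sup B.
  by split; [exists x|exists z' => u [/andP[]]].
pose m := sup B.
have xm : x <= m by apply: sup_upper_bound.
have mz' : m <= z' by apply: ge_sup; [exists x|move=> u [/andP[]]].
have mI : x <= m <= z by rewrite xm (le_trans mz').
have nB u : m < u -> ~ B u.
  by move=> mu /(sup_upper_bound Bsup); rewrite leNgt mu.
have Wm : 0 <= W m.
  rewrite leNgt; apply/negP => Wm.
  have cW : {for m, continuous (fun t => - W t)}.
    by apply: isd_cont; apply: isd_opp; apply: dWP.
  have [|r r0 H] := cont_pos cW; first by rewrite oppr_gt0.
  have [u Bu mu] := sup_adherent r0 Bsup.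
  have um := sup_upper_bound Bsup Bu.
  have := H (u - m); rewrite [m + _]addrC subrK oppr_gt0 ler0_norm ?subr_le0//.
  case: Bu => _ Wu F; move: Wu; rewrite leNgt F//.
  by rewrite -/m in mu *; lra.
have mz : m < z'.
  by rewrite lt_neqAle mz' andbT; apply/eqP => E; move: Wm; rewrite E leNgt Wz'.
have [r r0 H] : exists2 r, 0 < r & forall h, 0 < h < r -> 0 <= W (m + h).
  move: Wm; rewrite le_eqVlt => /predU1P[/esym Wm|Wm].
    have [r r0 H] := isd_right (dWP m mI) (W0 m mI Wm).
    by exists r => // h /H; rewrite Wm => /ltW.
  have [r r0 H] := cont_pos (isd_cont (dWP m mI)) Wm.
  by exists r => // h /andP[h0 hr]; apply: ltW; apply: H; rewrite gtr0_norm.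
pose h := Num.min (r / 2) (z' - m).
have h0 : 0 < h by rewrite lt_min; apply/andP; split; lra.
have h1 : h <= r / 2 by rewrite ge_min lexx.
have h2 : h <= z' - m by rewrite ge_min lexx orbT.
apply: (nB (m + h)); first by lra.
split; first by apply/andP; split; lra.
by apply: H; rewrite h0 /=; lra.
Qed.

(** Only continuity is asked at [b]: [acosh] is not differentiable at 1, the end of the curve when
    the extremal y is 0. *)
Lemma decr_le_cont f df a b : a < b -> (forall x, a <= x < b -> isd x f (df x)) ->
  {for b, continuous f} -> (forall x, a < x < b -> df x <= 0) -> f b <= f a.
Proof.
move=> ab fd fb d0.
have [c cab E] : exists2 c, c \in `]a, b[ & f b - f a = df c * (b - a).
  apply: (MVT ab) => [x|].
    by rewrite in_itv/= => /andP[? ?]; apply: fd; rewrite ltW.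
  apply/continuous_in_subspaceT => x; rewrite inE /= in_itv /= => /andP[ax].
  rewrite le_eqVlt => /predU1P[->//|xb]; apply: isd_cont; apply: fd.
  by rewrite ax.
move: cab; rewrite in_itv/= => cab.
by rewrite -subr_le0 E mulr_le0_ge0 ?d0// subr_ge0 ltW.
Qed.

End Crossing.

(** * Monotonicity of the ratio of the two sides along the extremal curve *)

Section Curve.
Variable R : realType.
Implicit Types (X dX c dc E : R -> R) (s q u a b : R).

(** Up to a constant, the logarithm of the ratio of the two sides along the curve cosh y = X u: [E]
    is the larger side at its angular minimum, and cosh (s y)^(q/s) the smaller one. *)
Definition curve_K s q X E u := ln (E u) - q / s * ln (cosh (s * acosh (X u))).

Lemma isd_curveW s X dX c dc u : 1 < s -> 1 < X u -> isd u X (dX u) -> isd u c (dc u) ->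
  isd u (fun t => ch s (acosh (X t)) - c t)
    (- (ch s (acosh (X u)) * kh s (acosh (X u))) * (dX u / sinh (acosh (X u))) - dc u).
Proof.
move=> s1 Xu dXu dcu; apply: isd_add; last exact: isd_opp.
apply: (@isd_comp _ (ch s) (fun t => acosh (X t))); last exact: isd_acosh.
by apply: isd_ch => //; exact: acosh_gt0.
Qed.

(** By [tanh_ch] the logarithmic derivative of the hyperbolic cosine term also takes the form dX /
    (X - ch), so the sign of the result is decided by comparing [c] with [ch]. *)
Lemma isd_curveK s q X dX c E u : 1 < s -> 1 < X u -> isd u X (dX u) -> 0 < E u ->
  isd u E (q * E u * (dX u / (X u - c u))) ->
  isd u (curve_K s q X E) (q * (dX u / (X u - c u) - dX u / (X u - ch s (acosh (X u))))).
Proof.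
move=> s1 Xu dXu E0 dE; rewrite /curve_K.
have y0 := acosh_gt0 Xu.
have sy := sinh_gt0 y0.
have cs := cosh_gt0 (s * acosh (X u)).
have T := tanh_ch s1 y0; rewrite acoshK ?(ltW Xu)// in T.
eapply isd_eq.
  apply: isd_add; first by apply: isd_ln; [|exact: dE].
  apply: isd_opp; apply: isd_mul; first exact: isd_cst.
  apply: isd_ln; first exact: cs.
  apply: isd_cosh; apply: isd_mul; first exact: isd_cst.
  exact: (isd_acosh Xu dXu).
cbv beta; rewrite !mul0r !add0r.
have -> : dX u / (X u - ch s (acosh (X u))) =
  sinh (acosh (X u)) / (X u - ch s (acosh (X u))) * (dX u / sinh (acosh (X u))).
  move: (X u - _)^-1 => Z; field.
  by rewrite gt_eqF.
have s0 : 0 < s by lra.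
rewrite -T; move: (dX u / (X u - c u)) => P.
by field; rewrite !gt_eqF.
Qed.

Lemma cont_acosh (g : R -> R) (x : R) : {for x, continuous g} -> 1 <= g x ->
  {for x, continuous (fun t => acosh (g t))}.
Proof.
move=> gc gx; rewrite /acosh.
apply: (@continuous_comp _ _ _ (fun t => g t + Num.sqrt (g t ^+ 2 - 1)) (@ln R)).
  apply: continuousD => //.
  apply: (@continuous_comp _ _ _ (fun t => g t ^+ 2 - 1) Num.sqrt); last exact: sqrt_continuous.
  apply: continuousB; last exact: cst_continuous.
  by apply: (@continuous_comp _ _ _ g (fun y => y ^+ 2)) => //; exact: exprn_continuous.
apply: continuous_ln; have := sqrtr_ge0 (g x ^+ 2 - 1); lra.
Qed.

Lemma cont_cosh : continuous (@cosh R).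
Proof.
move=> x; apply: (@isd_cont _ _ _ (sinh x * 1)).
by apply: (isd_cosh (isd_id x)).
Qed.

Lemma cont_curveK s q X E u : {for u, continuous X} -> {for u, continuous E} ->
  1 <= X u -> 0 < E u -> {for u, continuous (curve_K s q X E)}.
Proof.
move=> Xc Ec Xu Eu; rewrite /curve_K.
apply: continuousB; first by apply: (@continuous_comp _ _ _ E (@ln R)) => //; exact: continuous_ln.
apply: continuousM; first exact: cst_continuous.
apply: (@continuous_comp _ _ _ (fun t => cosh (s * acosh (X t))) (@ln R)); last first.
  by apply: continuous_ln; exact: cosh_gt0.
apply: (@continuous_comp _ _ _ (fun t => s * acosh (X t)) (@cosh R)); last exact: cont_cosh.
by apply: continuousM; [exact: cst_continuous|exact: cont_acosh].
Qed.

Section CurveLemmas.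
Variables (s q : R) (X dX c dc E : R -> R).
Hypotheses (s1 : 1 < s) (q0 : 0 < q).

Let W u := ch s (acosh (X u)) - c u.

(* At a zero of [ch s (acosh X) - c] the derivative is positive, so there is
   at most one zero. *)
Definition crossing_up u :=
  c u = ch s (acosh (X u)) ->
  0 < - (ch s (acosh (X u)) * kh s (acosh (X u))) * (dX u / sinh (acosh (X u))) - dc u.

Lemma curve_left a b :
  (forall u, a < u <= b -> isd u X (dX u)) ->
  (forall u, a < u <= b -> isd u c (dc u)) ->
  (forall u, a < u < b -> 1 < X u) ->
  (forall u, a < u < b -> dX u < 0) ->
  (forall u, a < u <= b -> c u < 1) ->
  (forall u, a < u <= b -> 0 < E u /\ isd u E (q * E u * (dX u / (X u - c u)))) ->
  (forall u, a < u <= b -> 1 < X u -> crossing_up u) ->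
  (1 < X b /\ c b = ch s (acosh (X b))) \/ (X b = 1 /\ (s - 1) / s < c b) ->
  forall u, a < u < b -> ch s (acosh (X u)) <= c u /\ curve_K s q X E b <= curve_K s q X E u.
Proof.
move=> dXP dcP X1 dX0 c1 dEP cross endp.
have W0 u : a < u < b -> W u < 0.
  move=> /andP[au ub]; rewrite ltNge; apply/negP => Wu.
  case: endp => -[Xb cb].
    have : 0 < W b.
      apply: (@crossing _ W (fun u => - (ch s (acosh (X u)) * kh s (acosh (X u))) *
        (dX u / sinh (acosh (X u))) - dc u) _ _ ub) => // [v|v] /andP[uv vb].
        have av : a < v <= b by rewrite vb (lt_le_trans au).
        have Xv : 1 < X v.
          by move: vb; rewrite le_eqVlt => /predU1P[->//|vb]; apply: X1; rewrite vb (lt_le_trans au).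
        by apply: isd_curveW => //; [exact: dXP|exact: dcP].
      have av : a < v <= b by rewrite vb (lt_le_trans au).
      have Xv : 1 < X v.
        by move: vb; rewrite le_eqVlt => /predU1P[->//|vb]; apply: X1; rewrite vb (lt_le_trans au).
      by move=> /eqP; rewrite subr_eq0 => /eqP/esym; apply: cross.
    by rewrite /W cb subrr ltxx.
  have abb : a < b <= b by rewrite lexx (lt_trans au).
  (* Close to [b], [c] exceeds (s - 1) / s, which is an upper bound of [ch]; hence [W] is negative
     there although it need not be defined through X > 1 at [b] itself. *)
  have cc : {for b, continuous (fun t => c t - (s - 1) / s)}.
    by apply: continuousB; [apply: (isd_cont (dcP b abb))|exact: cst_continuous].
  have [|r r0 H] := cont_pos cc; first by rewrite subr_gt0.
  pose h := Num.min (r / 2) ((b - u) / 2).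
  have h0 : 0 < h by rewrite lt_min; apply/andP; split; lra.
  have h1 : h <= r / 2 by rewrite ge_min lexx.
  have h2 : h <= (b - u) / 2 by rewrite ge_min lexx orbT.
  have v1 : u < b - h by lra.
  have v2 : a < b - h < b by lra.
  have : 0 < W (b - h).
    apply: (@crossing _ W (fun u => - (ch s (acosh (X u)) * kh s (acosh (X u))) *
        (dX u / sinh (acosh (X u))) - dc u) _ _ v1) => // [v|v] /andP[uv vb].
      have av : a < v <= b by lra.
      by apply: isd_curveW => //; [apply: X1; lra|exact: dXP|exact: dcP].
    have av : a < v <= b by lra.
    have Xv : 1 < X v by apply: X1; lra.
    by move=> /eqP; rewrite subr_eq0 => /eqP/esym; apply: cross.
  rewrite subr_gt0; apply/negP; rewrite -leNgt; apply: ltW.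
  apply: (@lt_trans _ _ ((s - 1) / s)); first by apply: ch_lt => //; apply: acosh_gt0; apply: X1.
  have := H (- h); rewrite normrN gtr0_norm// subr_gt0; apply; lra.
move=> u /andP[au ub]; have aub : a < u < b by rewrite au.
split; first by apply: ltW; rewrite -subr_lt0; exact: W0.
have abb : a < b <= b by rewrite lexx (lt_trans au).
have Xb1 : 1 <= X b by case: endp => -[Xb _]; lra.
apply: (@decr_le_cont _ (curve_K s q X E)
  (fun v => q * (dX v / (X v - c v) - dX v / (X v - ch s (acosh (X v))))) _ _ ub).
- move=> v /andP[uv vb]; have av : a < v <= b by rewrite (lt_le_trans au uv) ltW.
  have [Ev dEv] := dEP v av.
  by apply: isd_curveK => //; [apply: X1; rewrite vb (lt_le_trans au uv)|exact: dXP].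
- have [Eb dEb] := dEP b abb.
  by apply: cont_curveK => //; [apply: isd_cont (dXP b abb)|apply: isd_cont dEb].
move=> v /andP[uv vb]; have av : a < v < b by rewrite vb (lt_trans au).
have av' : a < v <= b by lra.
rewrite pmulr_rle0// subr_le0.
have Xv := X1 v av; have cv := c1 v av'.
have Wv := W0 v av; rewrite subr_lt0 in Wv.
rewrite ler_nM2l ?dX0// lef_pV2 ?posrE ?subr_gt0; [|lra|lra].
by rewrite lerD2l lerN2 ltW.
Qed.

Lemma curve_right a b :
  (forall u, a <= u < b -> isd u X (dX u)) ->
  (forall u, a <= u < b -> isd u c (dc u)) ->
  (forall u, a <= u < b -> 1 < X u) ->
  (forall u, a <= u < b -> dX u < 0) ->
  (forall u, a <= u < b -> c u < 1 -> 0 < E u /\ isd u E (q * E u * (dX u / (X u - c u)))) ->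
  (forall u, a <= u < b -> crossing_up u) ->
  c a = ch s (acosh (X a)) ->
  forall u, a <= u < b -> curve_K s q X E a <= curve_K s q X E u /\ c u < 1.
Proof.
move=> dXP dcP X1 dX0 dEP cross Wa.
have W0 u : a <= u < b -> 0 <= W u.
  move=> /andP[]; rewrite le_eqVlt => /predU1P[<- _|au ub]; first by rewrite /W Wa subrr.
  apply: ltW.
  apply: (@crossing _ W (fun u => - (ch s (acosh (X u)) * kh s (acosh (X u))) *
      (dX u / sinh (acosh (X u))) - dc u) _ _ au) => // [v|v|] .
  - move=> /andP[av vu]; have av' : a <= v < b by rewrite av (le_lt_trans vu).
    by apply: isd_curveW => //; [exact: X1|exact: dXP|exact: dcP].
  - move=> /andP[av vu]; have av' : a <= v < b by rewrite av (le_lt_trans vu).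
    by move=> /eqP; rewrite subr_eq0 => /eqP/esym; apply: cross.
  - by rewrite /W Wa subrr.
have cl u : a <= u < b -> c u < 1.
  move=> au; have := W0 u au; rewrite subr_ge0 => /le_lt_trans; apply.
  by apply: ch_lt1 => //; apply: acosh_gt0; exact: X1.
move=> u /andP[au ub]; split; last by apply: cl; rewrite au.
apply: (@incr_le _ (curve_K s q X E)
  (fun v => q * (dX v / (X v - c v) - dX v / (X v - ch s (acosh (X v))))) _ _ au).
- move=> v /andP[av vu]; have av' : a <= v < b by rewrite av (le_lt_trans vu).
  have [Ev dEv] := dEP v av' (cl v av').
  by apply: isd_curveK => //; [exact: X1|exact: dXP].
move=> v /andP[av vu]; have av' : a <= v < b by rewrite (ltW av) (lt_trans vu).
rewrite pmulr_rge0// subr_ge0.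
have Xv := X1 v av'; have cv := cl v av'.
have Wv := W0 v av'; rewrite subr_ge0 in Wv.
have hv : ch s (acosh (X v)) < 1 by apply: ch_lt1 => //; exact: acosh_gt0.
rewrite ler_nM2l ?dX0// lef_pV2 ?posrE ?subr_gt0; [|lra|lra].
by rewrite lerD2l lerN2.
Qed.

End CurveLemmas.
End Curve.

(** * The pointwise inequality for p >= 2 *)

Section Common.
Variable R : realType.
Implicit Types (x y u v t : R).

Lemma xcot_decr x y : 0 < x -> x < y -> y < pi ->
  y * (cos y / sin y) < x * (cos x / sin x).
Proof.
move=> x0 xy ypi.
apply: (@decr_lt R (fun t => t * (cos t / sin t))
  (fun t => (cos t * sin t - t) / sin t ^+ 2) _ _ xy) => t /andP[xt ty].
  have st : 0 < sin t by apply: sin_gt0_pi; lra.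
  eapply isd_eq; [deriv; by rewrite gt_eqF|cbv beta].
  have F : t = t * (cos t ^+ 2 + sin t ^+ 2) by rewrite cos2Dsin2 mulr1.
  by rewrite [X in _ = (_ - X) / _]F; field; rewrite gt_eqF.
have t0 : 0 < t by lra.
have st : 0 < sin t by apply: sin_gt0_pi; lra.
rewrite ltr_pdivrMr ?exprn_gt0// mul0r subr_lt0.
have c1 : cos t < 1 by rewrite -cos0 ltr_cos ?in_itv/=; lra.
apply: lt_le_trans (sin_le (ltW t0)).
by rewrite -[ltRHS]mul1r ltr_pM2r.
Qed.

Lemma ge0_right (f : R -> R) x : {for x, continuous f} ->
  (exists2 r, 0 < r & forall h, 0 < h < r -> 0 <= f (x + h)) -> 0 <= f x.
Proof.
move=> fc [r r0 H]; rewrite leNgt; apply/negP => fx.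
have [||r' r'0 H'] := @cont_pos R (fun t => - f t) x.
- exact: continuousN.
- by rewrite oppr_gt0.
pose h := Num.min (r / 2) (r' / 2).
have h0 : 0 < h by rewrite lt_min; apply/andP; split; lra.
have h1 : h <= r / 2 by rewrite ge_min lexx.
have h2 : h <= r' / 2 by rewrite ge_min lexx orbT.
have := H h; have := H' h; rewrite gtr0_norm// oppr_gt0 => A B.
have : 0 <= f (x + h) by apply: B; lra.
by rewrite leNgt A//; lra.
Qed.

Lemma ge0_left (f : R -> R) x : {for x, continuous f} ->
  (exists2 r, 0 < r & forall h, 0 < h < r -> 0 <= f (x - h)) -> 0 <= f x.
Proof.
move=> fc [r r0 H].
have := @ge0_right (fun t => f (x *+ 2 - t)) x; rewrite mulr2n addrK; apply.
  apply: (@continuous_comp _ _ _ (fun t => x + x - t) f); last by rewrite addrK.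
  by apply: continuousB; [exact: cst_continuous|exact: id].
by exists r => // h /H; rewrite opprD addrA addrK.
Qed.

Lemma ivt_decr (f df : R -> R) a b v : a <= b ->
  (forall x, a <= x <= b -> isd x f (df x)) -> f b <= v <= f a ->
  exists2 c, a <= c <= b & f c = v.
Proof.
move=> ab fd /andP[fb fa].
have [c cab E] : exists2 c, c \in `[a, b] & f c = v.
  apply: IVT => //; last by rewrite ge_min le_max fb fa orbT.
  apply/continuous_in_subspaceT => x; rewrite inE /= in_itv /= => xab.
  by apply: isd_cont; apply: fd.
by exists c => //; move: cab; rewrite in_itv.
Qed.

Lemma powR_split (x r : R) : 0 < x -> x `^ r = x `^ (r - 1) * x.
Proof.
move=> x0; have x0' : x != 0 by rewrite gt_eqF.
by rewrite -[X in _ = _ * X](powRr1 (ltW x0)) -powRD ?subrK// x0' implybT.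
Qed.

End Common.

(** * The inequality on the curve and off it for q > 1, in the variable u = pi - t *)

Module ObtuseCase.
Section ObtuseCase.
Variable R : realType.
Variables (q s y0 : R).
Hypotheses (q1 : 1 < q) (s1 : 1 < s) (y0_ge0 : 0 <= y0).
Implicit Types (y u t : R).

(* The auxiliary quantities are variables with defining equations, not
   definitions: [lra], [ring] and [field] then treat them as atoms. *)
Variable u0 : R.
Hypothesis u0E : u0 = pi / (2 * q).
Variable k : R.
Hypothesis kE : k = cos u0.
(** Either [y0] is a positive stationary point of cosh (s y)^(1/s) / (cosh y - k), or no such point
    exists, because [ch] stays below (s - 1) / s, and the extremal point is 0. *)
Hypothesis endp : (0 < y0 /\ ch s y0 = k) \/ (y0 = 0 /\ (s - 1) / s < k).
Variable tau : R.
Hypothesis tauE : tau = pi / q.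
Variable X0 : R.
Hypothesis X0E : X0 = cosh y0.
Variable Z0 : R.
Hypothesis Z0E : Z0 = X0 - k.
(** This value makes the derivative of [H y0] in u vanish at [u0], since then [P u0] equals
    Z0^(q-1). *)
Variable lam : R.
Hypothesis lamE : lam = Z0 `^ (q - 1) * sin u0.
(** The smaller side cosh (s y)^(q/s) divided by the q-th power of cosh (s y0)^(1/s) / Z0; its value
    at [y0] is Z0^q. *)
Variable M : R -> R.
Hypothesis ME : M = (fun y => expR (q * ln Z0 + q / s * (ln (cosh (s * y)) - ln (cosh (s * y0))))).

Lemma q_gt0 : 0 < q. Proof. exact: lt_trans ltr01 q1. Qed.
Lemma pi_pos : 0 < pi :> R. Proof. exact: pi_gt0. Qed.
Lemma tau_pi : tau < pi.
Proof. by rewrite tauE ltr_pdivrMr ?q_gt0// ltr_pMr ?pi_pos. Qed.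
Lemma tau_gt0 : 0 < tau. Proof. by rewrite tauE divr_gt0 ?pi_pos ?q_gt0. Qed.
Lemma u0_half : u0 = tau / 2. Proof. by rewrite u0E tauE; field; rewrite gt_eqF ?q_gt0. Qed.
Lemma u0_gt0 : 0 < u0. Proof. by rewrite u0_half divr_gt0 ?tau_gt0. Qed.
Lemma u0_lt_tau : u0 < tau. Proof. by rewrite u0_half; have := tau_gt0; lra. Qed.
Lemma q_u0 : q * u0 = pi / 2. Proof. by rewrite u0E; field; rewrite gt_eqF ?q_gt0. Qed.
Lemma q_tau : q * tau = pi. Proof. by rewrite tauE mulrC divfK// gt_eqF ?q_gt0. Qed.
#[local] Hint Resolve q_gt0 pi_pos tau_gt0 tau_pi u0_gt0 u0_lt_tau : core.
Lemma sin_u0_gt0 : 0 < sin u0.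
Proof. by apply: sin_gt0_pi; rewrite u0_gt0 (lt_trans u0_lt_tau tau_pi). Qed.
Lemma k_lt1 : k < 1.
Proof. by rewrite kE -cos0 ltr_cos ?in_itv/= ?u0_gt0 ?lexx ?pi_ge0 ?ltW ?(lt_trans u0_lt_tau tau_pi). Qed.
Lemma X0_ge1 : 1 <= X0. Proof. by rewrite X0E; exact: cosh_ge1. Qed.
Lemma Z0_gt0 : 0 < Z0. Proof. by rewrite Z0E subr_gt0 (lt_le_trans k_lt1 X0_ge1). Qed.
Lemma lam_gt0 : 0 < lam. Proof. by rewrite lamE mulr_gt0 ?sin_u0_gt0// powR_gt0// Z0_gt0. Qed.
Lemma u0_itv : 0 < u0 < tau. Proof. by rewrite u0_gt0 u0_lt_tau. Qed.
#[local] Hint Resolve sin_u0_gt0 k_lt1 X0_ge1 Z0_gt0 lam_gt0 u0_itv : core.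

Lemma qu_itv u : 0 < u < tau -> 0 < q * u < pi.
Proof. by move=> /andP[u_0 ut]; rewrite mulr_gt0//= -q_tau ltr_pM2l. Qed.
Lemma sin_qu_gt0 u : 0 < u < tau -> 0 < sin (q * u).
Proof. by move=> /qu_itv; exact: sin_gt0_pi. Qed.
Lemma sin_u_gt0 u : 0 < u < tau -> 0 < sin u.
Proof. by move=> /andP[? ut]; apply: sin_gt0_pi; rewrite (lt_trans ut tau_pi) andbT. Qed.

(** [H y] is stationary in u where (cosh y - cos u)^(q-1) = P u. [Zc] solves this equation for cosh
    y - cos u and [X] solves it for cosh y. [b] is minus the logarithmic derivative of [Zc], [c] the
    trigonometric analogue of [ch] with logarithmic derivative [kt], and [E] the value of [H] on the
    curve. *)
Variable P : R -> R.
Hypothesis PE : P = (fun u => lam * (sin (q * u) / sin u)).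
Variable Zc : R -> R.
Hypothesis ZcE : Zc = (fun u => expR ((q - 1)^-1 * ln (P u))).
Variable X : R -> R.
Hypothesis XE : X = (fun u => cos u + Zc u).
Variable b : R -> R.
Hypothesis bE : b = (fun u => (cos u / sin u - q * (cos (q * u) / sin (q * u))) / (q - 1)).
Variable c : R -> R.
Hypothesis cE : c = (fun u => sin ((q - 1) * u) / sin (q * u)).
Variable kt : R -> R.
Hypothesis ktE : kt = (fun u => (q - 1) * (cos ((q - 1) * u) / sin ((q - 1) * u)) - q * (cos (q * u) / sin (q * u))).
Variable dX : R -> R.
Hypothesis dXE : dX = (fun u => - (sin u + Zc u * b u)).
Variable E : R -> R.
Hypothesis EE : E = (fun u => P u * Zc u + lam * cos (q * u)).
Variable H : R -> R -> R.
Hypothesis HE : H = (fun y u => (cosh y - cos u) `^ q + lam * cos (q * u)).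

Lemma P_gt0 u : 0 < u < tau -> 0 < P u.
Proof. by move=> ut; rewrite PE mulr_gt0// divr_gt0 ?sin_qu_gt0 ?sin_u_gt0. Qed.
Lemma Zc_gt0 u : 0 < Zc u. Proof. by rewrite ZcE expR_gt0. Qed.
Lemma v_itv u : 0 < u < tau -> 0 < (q - 1) * u < pi.
Proof.
move=> ut; have /andP[qu qu'] := qu_itv ut; case/andP: ut => u_0 _.
by rewrite mulr_gt0 ?subr_gt0//= (lt_trans _ qu')// ltr_pM2r//; lra.
Qed.

Lemma b_gt0 u : 0 < u < tau -> 0 < b u.
Proof.
move=> ut; have /andP[qu qu'] := qu_itv ut; case/andP: (ut) => u_0 ut'.
rewrite bE divr_gt0 ?subr_gt0//.
have : q * u * (cos (q * u) / sin (q * u)) < u * (cos u / sin u).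
  by apply: xcot_decr => //; rewrite ltr_pMl.
by rewrite -mulrA mulrCA ltr_pM2l.
Qed.

Lemma kt_gt0 u : 0 < u < tau -> 0 < kt u.
Proof.
move=> ut; have /andP[qu qu'] := qu_itv ut; have /andP[v0 _] := v_itv ut.
case/andP: (ut) => u_0 ut'; rewrite ktE subr_gt0.
have : q * u * (cos (q * u) / sin (q * u)) <
   (q - 1) * u * (cos ((q - 1) * u) / sin ((q - 1) * u)).
  by apply: xcot_decr => //; rewrite ltr_pM2r//; lra.
by rewrite ![_ * u]mulrC -!mulrA ltr_pM2l.
Qed.

Lemma isd_P u : 0 < u < tau -> isd u P (- ((q - 1) * P u * b u)).
Proof.
move=> ut; have h1 := sin_qu_gt0 ut; have h2 := sin_u_gt0 ut; rewrite PE bE.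
eapply isd_eq; [deriv; by rewrite gt_eqF|cbv beta; field].
by rewrite !gt_eqF// subr_gt0.
Qed.

Lemma isd_Zc u : 0 < u < tau -> isd u Zc (- (Zc u * b u)).
Proof.
move=> ut; have Pu := P_gt0 ut; rewrite ZcE.
eapply isd_eq.
  apply: isd_expR; apply: isd_mul; first exact: isd_cst.
  by apply: isd_ln; [exact: Pu|exact: isd_P].
cbv beta; field; rewrite gt_eqF//= gt_eqF// subr_gt0.
by [].
Qed.

Lemma isd_X u : 0 < u < tau -> isd u X (dX u).
Proof.
move=> ut; rewrite XE dXE; eapply isd_eq.
  by apply: isd_add; [apply: isd_cos; exact: isd_id|exact: isd_Zc].
by cbv beta; ring.
Qed.

Lemma dX_lt0 u : 0 < u < tau -> dX u < 0.
Proof.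
move=> ut; rewrite dXE oppr_lt0 addr_gt0 ?sin_u_gt0// mulr_gt0 ?Zc_gt0//.
exact: b_gt0.
Qed.

Lemma isd_c u : 0 < u < tau -> isd u c (c u * kt u).
Proof.
move=> ut; have h1 := sin_qu_gt0 ut; have h2 : 0 < sin ((q - 1) * u).
  by apply: sin_gt0_pi; exact: v_itv.
rewrite cE ktE.
eapply isd_eq; [deriv; by rewrite gt_eqF|cbv beta; field].
by rewrite !gt_eqF.
Qed.

Lemma c_cotE u : 0 < u < tau -> c u = cos u - sin u * (cos (q * u) / sin (q * u)).
Proof.
move=> ut; have h1 := sin_qu_gt0 ut.
by rewrite cE mulrBl mul1r sinB; field; rewrite gt_eqF.
Qed.

Lemma E_factor u : 0 < u < tau -> E u = P u * (X u - c u).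
Proof.
move=> ut; have h1 := sin_qu_gt0 ut; have h2 := sin_u_gt0 ut.
rewrite c_cotE// EE XE PE; field.
by rewrite !gt_eqF.
Qed.

(** [H] is stationary in u on the curve, so only the variation of [X] counts and E' = q P dX; the
    factorization E = P (X - c) gives the logarithmic form. *)
Lemma isd_E u : 0 < u < tau -> c u < X u -> 0 < E u /\ isd u E (q * E u * (dX u / (X u - c u))).
Proof.
move=> ut cX; have h1 := sin_qu_gt0 ut; have h2 := sin_u_gt0 ut.
have Xc : 0 < X u - c u by rewrite subr_gt0.
have E0 : 0 < E u by rewrite E_factor// mulr_gt0// P_gt0.
split=> //; rewrite E_factor//.
have -> : q * (P u * (X u - c u)) * (dX u / (X u - c u)) = q * P u * dX u.
  by field; rewrite gt_eqF.
rewrite EE; eapply isd_eq.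
  apply: isd_add; first by apply: isd_mul; [exact: isd_P|exact: isd_Zc].
  apply: isd_mul; first exact: isd_cst.
  by apply: isd_cos; apply: isd_mul; [exact: isd_cst|exact: isd_id].
cbv beta; have -> : lam * (- sin (q * u) * (0 * u + q * 1)) = - (q * P u * sin u).
  by rewrite PE; field; rewrite gt_eqF.
by rewrite dXE; ring.
Qed.

Lemma curve_crossing u : 0 < u < tau -> 1 < X u -> crossing_up s X dX c (fun t => c t * kt t) u.
Proof.
move=> ut Xu; rewrite /crossing_up => cuE.
have y_0 := acosh_gt0 Xu.
have c0 := ch_gt0 s1 y_0; have c_lt1 := ch_lt1 s1 y_0.
have sy := sinh_gt0 y_0.
have cE' := acoshK (ltW Xu).
move: (acosh (X u)) y_0 c0 c_lt1 sy cuE cE' => y y_0 c0 c_lt1 sy cuE cE'.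
rewrite cuE.
have /andP[qu qu'] := qu_itv ut; have /andP[v0 vpi] := v_itv ut; case/andP: (ut) => u_0 ut'.
have h1 := sin_qu_gt0 ut; have h2 := sin_u_gt0 ut.
have h3 : 0 < sin ((q - 1) * u) by apply: sin_gt0_pi; exact: v_itv.
have xE : u + (q - 1) * u = q * u by ring.
(* The range needed by [trig_key] follows from being at a zero: there c u = ch < 1, so sin (q u) >
   sin ((q - 1) u), and this difference is 2 sin (u / 2) cos ((q - 1) u + u / 2). *)
have uv : (q - 1) * u + u / 2 < pi / 2.
  have : 0 < cos ((q - 1) * u + u / 2).
    have : 0 < sin (q * u) - sin ((q - 1) * u).
      by rewrite subr_gt0; move: c_lt1; rewrite -cuE cE ltr_pdivrMr// mul1r.
    have -> : q * u = ((q - 1) * u + u / 2) + u / 2 by field.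
    have -> : sin ((q - 1) * u) = sin ((q - 1) * u + u / 2 - u / 2) by congr sin; ring.
    move: ((q - 1) * u + u / 2) => w; rewrite sinD sinB.
    have -> : sin w * cos (u / 2) + cos w * sin (u / 2) -
      (sin w * cos (u / 2) - cos w * sin (u / 2)) = 2 * sin (u / 2) * cos w by ring.
    rewrite pmulr_rgt0// mulr_gt0//; by apply: sin_gt0_pi; rewrite divr_gt0//= (lt_trans _ (lt_trans ut' tau_pi))// ltr_pdivrMr// ltr_pMr// ltr1n.
  rewrite !ltNge; apply: contra => le.
  have -> : 0 = cos (pi / 2) :> R by rewrite cos_pihalf.
  by apply: cos_anti => //; lra.
have /= [K1 K2] := trig_key u_0 v0 uv.
move: K1 K2; rewrite xE.
have -> : (u * (cos u / sin u) - q * u * (cos (q * u) / sin (q * u))) / ((q - 1) * u) = b u.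
  by rewrite bE; field; rewrite !gt_eqF// subr_gt0.
have -> : ((q - 1) * u * (cos ((q - 1) * u) / sin ((q - 1) * u)) -
    q * u * (cos (q * u) / sin (q * u))) / u = kt u.
  by rewrite ktE; field; rewrite !gt_eqF.
move=> K1 K2; have bu := b_gt0 ut.
have cu1 : 0 <= 1 - cos u by rewrite subr_ge0 cos_le1.
have QE : - dX u = sin u + (cosh y - cos u) * b u by rewrite dXE cE' XE; ring.
have := @W_pos _ s y (kt u) (sin u + (1 - cos u) * b u) (- dX u) s1 y_0.
have Pp : 0 < sin u + (1 - cos u) * b u by rewrite ltr_pwDl// mulr_ge0// ltW.
have Qp : 0 < - dX u by rewrite oppr_gt0 dX_lt0.
move=> /(_ Pp Qp) W.
have W1 : cosh (y / 2) ^+ 2 * (sin u + (1 - cos u) * b u) <= - dX u.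
  rewrite QE; have -> : cosh y = 1 + 2 * sinh (y / 2) ^+ 2.
    by rewrite -cosh2x; congr cosh; field.
  have -> : cosh (y / 2) ^+ 2 = 1 + sinh (y / 2) ^+ 2 by have := cosh2Bsinh2 (y / 2); lra.
  rewrite -subr_ge0.
  have -> : sin u + (1 + 2 * sinh (y / 2) ^+ 2 - cos u) * b u -
    (1 + sinh (y / 2) ^+ 2) * (sin u + (1 - cos u) * b u) =
    sinh (y / 2) ^+ 2 * (b u * (1 + cos u) - sin u) by ring.
  by rewrite mulr_ge0 ?sqr_ge0// subr_ge0 ltW.
have W2 : 3 * kt u * (1 - ch s y) <= (1 + ch s y) * (sin u + (1 - cos u) * b u).
  apply: ltW; apply: (@lt_scaled _ (sin (q * u))^-1 _ _ _ _ _ _ K1); first by rewrite invr_gt0.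
  by rewrite -cuE cE; field; rewrite gt_eqF.
have {W W1 W2} := W W1 W2.
rewrite -subr_gt0 => W; rewrite -subr_gt0.
have -> : - (ch s y * kh s y) * (dX u / sinh y) - ch s y * kt u - 0 =
  ch s y / sinh y * (kh s y * - dX u - kt u * sinh y) by field; rewrite gt_eqF.
by rewrite mulr_gt0// divr_gt0.
Qed.

Lemma X_decr u t : 0 < u -> u < t -> t < tau -> X t < X u.
Proof.
move=> u_0 ut tt; apply: (@decr_lt R X dX _ _ ut) => w /andP[uw wt].
  by apply: isd_X; rewrite (lt_le_trans u_0 uw) (le_lt_trans wt tt).
by apply: dX_lt0; rewrite (lt_trans u_0 uw) (lt_trans wt tt).
Qed.

Lemma P_u0 : P u0 = Z0 `^ (q - 1).
Proof.
by rewrite PE lamE q_u0 sin_pihalf mul1r mulfK// gt_eqF.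
Qed.

Lemma Zc_u0 : Zc u0 = Z0.
Proof.
rewrite ZcE P_u0 ln_powR mulrA mulVf ?mul1r ?lnK ?posrE//.
by rewrite gt_eqF// subr_gt0.
Qed.

Lemma X_u0 : X u0 = X0. Proof. by rewrite XE Zc_u0 Z0E -kE addrC subrK. Qed.

Lemma c_u0 : c u0 = k.
Proof. by rewrite c_cotE// q_u0 cos_pihalf mul0r mulr0 subr0. Qed.

Lemma E_u0 : E u0 = Z0 `^ q.
Proof. by rewrite EE q_u0 cos_pihalf mulr0 addr0 P_u0 Zc_u0 -powR_split. Qed.

Lemma c_lt1 u : 0 < u <= u0 -> c u < 1.
Proof.
move=> /andP[u_0]; rewrite le_eqVlt => /predU1P[->|uu]; first by rewrite c_u0.
apply: lt_trans k_lt1; rewrite -c_u0.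
apply: (@incr_lt R c (fun t => c t * kt t) _ _ uu) => t /andP[ut tu].
  by apply: isd_c; rewrite (lt_le_trans u_0 ut) (le_lt_trans tu u0_lt_tau).
have tt : 0 < t < tau by rewrite (lt_trans u_0 ut) (lt_trans tu u0_lt_tau).
rewrite mulr_gt0 ?kt_gt0// cE divr_gt0 ?sin_qu_gt0//.
by apply: sin_gt0_pi; exact: v_itv.
Qed.

Lemma M_le_E u y : 0 < E u -> curve_K s q X E u0 <= ln (E u) - q / s * ln (cosh (s * y)) ->
  M y <= E u.
Proof.
move=> Eu; rewrite /curve_K E_u0 X_u0 ln_powR X0E coshK// => KK.
rewrite -[leRHS]lnK ?posrE// ME ler_expR.
by move: KK; rewrite mulrBr; lra.
Qed.

Lemma Zc_pow u : 0 < u < tau -> Zc u `^ (q - 1) = P u.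
Proof.
move=> ut; rewrite ZcE -expRM mulrC mulrA mulfV ?mul1r ?gt_eqF ?subr_gt0//.
by rewrite lnK ?posrE ?P_gt0.
Qed.

Lemma HcurveE u y : 0 < u < tau -> X u = cosh y -> H y u = E u.
Proof.
move=> ut XY; rewrite HE -XY EE XE /= [cos u + _]addrC addrK; congr (_ + _).
by rewrite powR_split ?Zc_gt0// Zc_pow.
Qed.

Lemma left_curve u : 0 < u < u0 ->
  ch s (acosh (X u)) <= c u /\ M (acosh (X u)) <= E u.
Proof.
move=> uu; have /andP[u_0 uu0] := uu.
have sub t : 0 < t <= u0 -> 0 < t < tau by move=> /andP[-> h]; rewrite (le_lt_trans h u0_lt_tau).
have X1 t : 0 < t < u0 -> 1 < X t.
  by move=> /andP[t0 tu]; apply: le_lt_trans X0_ge1 _; rewrite -X_u0; exact: X_decr.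
have X1' t : 0 < t <= u0 -> 1 <= X t.
  by move=> /andP[t0]; rewrite le_eqVlt => /predU1P[->|tu];
    [rewrite X_u0|apply: ltW; apply: X1; rewrite t0].
have ep : (1 < X u0 /\ c u0 = ch s (acosh (X u0))) \/ (X u0 = 1 /\ (s - 1) / s < c u0).
  rewrite X_u0 c_u0 X0E; case: endp => -[h1 h2]; [left|right].
    by rewrite coshK// cosh_gt1.
  by rewrite h1 cosh0.
have h1 t : 0 < t <= u0 -> isd t X (dX t) by move=> /sub; exact: isd_X.
have h2 t : 0 < t <= u0 -> isd t c (c t * kt t) by move=> /sub; exact: isd_c.
have h3 t : 0 < t < u0 -> dX t < 0.
  by move=> /andP[t0 tu]; apply: dX_lt0; rewrite t0 (lt_trans tu u0_lt_tau).
have h4 t : 0 < t <= u0 -> 0 < E t /\ isd t E (q * E t * (dX t / (X t - c t))).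
  move=> tt; apply: isd_E; first exact: sub.
  exact: lt_le_trans (c_lt1 tt) (X1' t tt).
have h5 t : 0 < t <= u0 -> 1 < X t -> crossing_up s X dX c (fun t => c t * kt t) t.
  by move=> /sub; exact: curve_crossing.
have [cc KK] := curve_left s1 q_gt0 h1 h2 X1 h3 (fun t => @c_lt1 t) h4 h5 ep uu.
split; first exact: cc.
apply: M_le_E; last exact: KK.
by apply: (h4 u _).1; rewrite u_0 ltW.
Qed.

(** This half of the curve matters only for [0 < y0]; when [y0] is 0 one has X u0 = 1, and the curve
    lies below 1 to the right of [u0]. *)
Lemma right_curve b1 u : 0 < y0 -> b1 < tau -> X b1 = 1 -> u0 <= u < b1 ->
  M (acosh (X u)) <= E u.
Proof.
move=> y0p b1t Xb uu.
have sub t : u0 <= t < b1 -> 0 < t < tau.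
  by move=> /andP[h1 h2]; rewrite (lt_le_trans u0_gt0 h1) (lt_trans h2).
have X1 t : u0 <= t < b1 -> 1 < X t.
  move=> /andP[h1 h2]; rewrite -Xb; apply: X_decr => //.
  exact: lt_le_trans h1.
have ca : c u0 = ch s (acosh (X u0)).
  rewrite X_u0 c_u0 X0E coshK//; case: endp => -[] //.
  by move=> yE; move: y0p; rewrite yE ltxx.
have h1 t : u0 <= t < b1 -> isd t X (dX t) by move=> /sub; exact: isd_X.
have h2 t : u0 <= t < b1 -> isd t c (c t * kt t) by move=> /sub; exact: isd_c.
have h3 t : u0 <= t < b1 -> dX t < 0 by move=> /sub; exact: dX_lt0.
have h4 t : u0 <= t < b1 -> c t < 1 -> 0 < E t /\ isd t E (q * E t * (dX t / (X t - c t))).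
  move=> tt c_1; apply: isd_E; first exact: sub.
  exact: lt_trans c_1 (X1 t tt).
have h5 t : u0 <= t < b1 -> crossing_up s X dX c (fun t => c t * kt t) t.
  by move=> tt; apply: curve_crossing; [exact: sub|exact: X1].
have [KK c_1] := curve_right s1 q_gt0 h1 h2 X1 h3 h4 h5 ca uu.
apply: M_le_E; last exact: KK.
exact: (h4 u uu c_1).1.
Qed.

Lemma cosh_cos y u : 0 < y -> 0 < cosh y - cos u.
Proof. by move=> y_0; rewrite subr_gt0 (le_lt_trans (cos_le1 u))// cosh_gt1. Qed.

Lemma isd_H y u : 0 < y -> 0 < u < tau ->
  isd u (H y) (q * sin u * ((cosh y - cos u) `^ (q - 1) - P u)).
Proof.
move=> y_0 ut; have h := sin_u_gt0 ut; rewrite HE; eapply isd_eq.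
  apply: (@isd_add _ (fun t => (cosh y - cos t) `^ q) (fun t => lam * cos (q * t))).
    by apply: (@isd_powR _ (fun t => cosh y - cos t)); [exact: cosh_cos|deriv].
  by deriv.
by cbv beta; rewrite PE; field; rewrite gt_eqF.
Qed.

Lemma H_incr y u u' : 0 < y -> 0 < u' -> u' <= u -> u < tau ->
  (forall t, u' < t < u -> X t <= cosh y) -> H y u' <= H y u.
Proof.
move=> y_0 u'0 uu ut HX.
have sub t : u' <= t <= u -> 0 < t < tau.
  by move=> /andP[h1 h2]; rewrite (lt_le_trans u'0 h1) (le_lt_trans h2 ut).
apply: (incr_le uu) => t tt.
  by apply: isd_H => //; exact: sub.
have tt' : 0 < t < tau by apply: sub; case/andP: tt => /ltW -> /ltW ->.
rewrite mulr_ge0//; first by rewrite mulr_ge0 ?ltW ?q_gt0 ?sin_u_gt0.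
rewrite subr_ge0 -Zc_pow//; apply: ge0_ler_powR.
- by rewrite subr_ge0 ltW.
- by rewrite nnegrE ZcE expR_ge0.
- by rewrite nnegrE ltW ?cosh_cos.
- by have := HX t tt; rewrite XE lerBrDl.
Qed.

Lemma H_decr y u u' : 0 < y -> 0 < u -> u <= u' -> u' < tau ->
  (forall t, u < t < u' -> cosh y <= X t) -> H y u' <= H y u.
Proof.
move=> y_0 u_0 uu ut HX.
have sub t : u <= t <= u' -> 0 < t < tau.
  by move=> /andP[h1 h2]; rewrite (lt_le_trans u_0 h1) (le_lt_trans h2 ut).
apply: (decr_le uu) => t tt.
  by apply: isd_H => //; exact: sub.
have tt' : 0 < t < tau by apply: sub; case/andP: tt => /ltW -> /ltW ->.
rewrite mulr_ge0_le0//; first by rewrite mulr_ge0 ?ltW ?q_gt0 ?sin_u_gt0.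
rewrite subr_le0 -Zc_pow//; apply: ge0_ler_powR.
- by rewrite subr_ge0 ltW.
- by rewrite nnegrE ltW ?cosh_cos.
- by rewrite nnegrE ZcE expR_ge0.
- by have := HX t tt; rewrite XE lerBlDl.
Qed.

Lemma lam_cos u : 0 < u < tau -> lam * cos (q * u) = P u * (cos u - c u).
Proof.
move=> ut; have h1 := sin_qu_gt0 ut; have h2 := sin_u_gt0 ut; rewrite c_cotE// PE; field.
by rewrite !gt_eqF.
Qed.

(** Raises y at fixed u. Put Z = cosh z - cos u. Since P <= Z^(q-1), cos u >= c and ch <= c, the
    value H = Z^q + P (cos u - c) is at most Z^(q-1) (cosh z - ch). Hence ln H grows in z at least
    as fast as ln M, whose derivative is q sinh z / (cosh z - ch). *)
Lemma fixed_u u yb y : 0 < u <= u0 -> 0 <= yb -> X u <= cosh yb ->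
  (forall z, yb < z -> ch s z <= c u) -> M yb <= H yb u -> yb <= y -> M y <= H y u.
Proof.
move=> /andP[u_0 uu0] yb0 Xy chc MH yby.
have ut : 0 < u < tau by rewrite u_0 (le_lt_trans uu0 u0_lt_tau).
have Pu := P_gt0 ut.
have cq : 0 <= cos (q * u).
  apply: cos_ge0_pihalf; rewrite -q_u0 ler_pM2l// uu0 andbT.
  by rewrite (@le_trans _ _ 0)// ?oppr_le0 ?mulr_ge0 ?ltW.
have Zz z : yb <= z -> Zc u <= cosh z - cos u.
  move=> ybz; rewrite lerBrDl; apply: le_trans (_ : cosh yb <= _); first by move: Xy; rewrite XE.
  by apply: cosh_le; rewrite yb0.
have Zp z : yb <= z -> 0 < cosh z - cos u.
  by move=> /Zz; apply: lt_le_trans; rewrite ZcE expR_gt0.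
have Hp z : yb <= z -> 0 < H z u.
  move=> ybz; rewrite HE ltr_pwDl ?powR_gt0 ?Zp//.
  by rewrite mulr_ge0 ?(ltW lam_gt0).
have F0 : ln (M yb) <= ln (H yb u) by rewrite ler_ln ?posrE ?Hp// ME expR_gt0.
have MF z : ln (M z) = q * ln Z0 + q / s * (ln (cosh (s * z)) - ln (cosh (s * y0))).
  by rewrite ME expRK.
suff : ln (M y) <= ln (H y u) by rewrite ler_ln ?posrE ?Hp// ME expR_gt0.
rewrite -subr_ge0; rewrite -subr_ge0 in F0; apply: (le_trans F0).
pose F z := ln (H z u) - (q * ln Z0 + q / s * (ln (cosh (s * z)) - ln (cosh (s * y0)))).
suff : F yb <= F y by rewrite /F -!MF.
apply: (@incr_le R F (fun z => q * ((cosh z - cos u) `^ (q - 1) * sinh z / H z u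
   - sinh (s * z) / cosh (s * z))) _ _ yby) => z /andP[ybz zy].
  have Hz := Hp z ybz; have cz := cosh_gt0 (s * z); have s0 : 0 < s by exact: lt_trans ltr01 s1.
  rewrite /F; eapply isd_eq.
    apply: isd_add.
      apply: isd_ln; first exact: Hz.
      rewrite HE; apply: (@isd_add _ (fun z => (cosh z - cos u) `^ q) (fun=> lam * cos (q * u))).
        by apply: (@isd_powR _ (fun z => cosh z - cos u)); [exact: Zp|deriv].
      exact: isd_cst.
    by deriv; exact: cosh_gt0.
  cbv beta; move: (H z u) Hz => Hzu Hz; move: (_ `^ _) => W.
  by field; rewrite !gt_eqF.
have z0 : 0 < z by apply: le_lt_trans ybz.
have zz : yb <= z by exact: ltW.
rewrite mulr_ge0 ?(ltW q_gt0)// subr_ge0 tanh_ch// -mulrA mulrCA ler_pM2l ?sinh_gt0//.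
have c_1 := ch_lt1 s1 z0; have C1 := cosh_gt1 z0.
have Xc : 0 < cosh z - ch s z by rewrite subr_gt0 (lt_trans c_1).
rewrite -[leLHS]mul1r ler_pdivrMr// mulrAC ler_pdivlMr ?Hp// mul1r.
have PZ : P u <= (cosh z - cos u) `^ (q - 1).
  rewrite -Zc_pow//; apply: ge0_ler_powR; rewrite ?nnegrE ?(ltW (Zp _ _))//.
  - by rewrite subr_ge0 ltW.
  - by rewrite ZcE expR_ge0.
  - exact: Zz.
rewrite HE powR_split ?Zp//.
have -> : lam * cos (q * u) = P u * (cos u - c u).
  exact: lam_cos.
have cc : 0 <= cos u - c u.
  rewrite c_cotE// opprB addrCA subrr addr0.
  by apply: mulr_ge0; [exact: ltW (sin_u_gt0 ut)|apply: divr_ge0 => //; exact: ltW (sin_qu_gt0 ut)].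
apply: (@le_trans _ _ ((cosh z - cos u) `^ (q - 1) * (cosh z - cos u + (cos u - c u)))).
  by rewrite [leRHS]mulrDr lerD2l ler_wpM2r.
by rewrite addrA subrK ler_wpM2l ?powR_ge0// lerD2l lerN2 chc// (le_lt_trans ybz).
Qed.

(** sin (q u) vanishes at [tau], and so does [P]; shortly before [tau] it is therefore below (1 -
    cos u)^(q-1), which means X u < 1. *)
Lemma X_small : exists2 u2, u0 < u2 < tau & X u2 < 1.
Proof.
pose f t := (1 - cos t) `^ (q - 1) * sin t - lam * sin (q * t).
have st : 0 < sin tau by apply: sin_gt0_pi; rewrite tau_gt0 tau_pi.
have ct t : 0 < t < pi -> 0 < 1 - cos t.
  by move=> /andP[t0 tp]; rewrite subr_gt0 -cos0 ltr_cos ?in_itv/= ?lexx ?(ltW t0) ?(ltW tp) ?pi_ge0.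
have ctau : 0 < 1 - cos tau by apply: ct; rewrite tau_gt0 tau_pi.
have f0 : 0 < f tau by rewrite /f q_tau sinpi mulr0 subr0 mulr_gt0// powR_gt0.
have fc : {for tau, continuous f}.
  apply: isd_cont; rewrite /f.
  apply: (@isd_add _ (fun t => (1 - cos t) `^ (q - 1) * sin t)).
    apply: (@isd_mul _ (fun t => (1 - cos t) `^ (q - 1))); last by deriv.
    by apply: (@isd_powR _ (fun t => 1 - cos t)) => //; deriv.
  by deriv.
have [r r0 Hr] := cont_pos fc f0.
pose h := Num.min (r / 2) ((tau - u0) / 2).
have tu : 0 < tau - u0 by rewrite subr_gt0.
have h0 : 0 < h by rewrite lt_min !divr_gt0.
have h1 : h < r by rewrite (@le_lt_trans _ _ (r / 2)) ?ge_min ?lexx//; lra.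
have h2 : h < tau - u0 by rewrite (@le_lt_trans _ _ ((tau - u0) / 2)) ?ge_min ?lexx ?orbT//; lra.
have t1 : u0 < tau - h by rewrite ltrBrDr addrC -ltrBrDr.
have t2 : tau - h < tau by rewrite ltrBlDr ltrDl.
exists (tau - h); first by rewrite t1 t2.
have tt : 0 < tau - h < tau by rewrite (lt_trans u0_gt0 t1).
have := Hr (- h); rewrite normrN gtr0_norm// => /(_ h1).
rewrite /f subr_gt0 => H1.
have PP : P (tau - h) < (1 - cos (tau - h)) `^ (q - 1).
  by rewrite PE mulrA ltr_pdivrMr ?sin_u_gt0.
rewrite XE -ltrBrDl ltNge; apply/negP => le.
move: PP; apply/negP; rewrite -leNgt -Zc_pow//; apply: ge0_ler_powR; rewrite ?nnegrE//.
- by rewrite subr_ge0 ltW.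
- exact: ltW (Zc_gt0 _).
Qed.

Lemma M_y0 : M y0 = Z0 `^ q.
Proof. by rewrite ME subrr mulr0 addr0 /powR gt_eqF. Qed.

Lemma base_u0 y : y0 <= y -> M y <= H y u0.
Proof.
move=> yy; apply: (@fixed_u u0 y0 y) => //.
- by rewrite u0_gt0 lexx.
- by rewrite X_u0 X0E.
- move=> z y0z; rewrite c_u0; case: endp => -[h1 h2].
    by rewrite -h2; apply: ch_decr => //; exact: ltW.
  by apply: ltW; apply: lt_trans h2; apply: ch_lt => //; apply: le_lt_trans y0z.
by rewrite HcurveE ?E_u0 ?M_y0// X_u0 X0E.
Qed.

Lemma on_curve y u' : 0 < y -> 0 < u' < tau -> X u' = cosh y -> M y <= H y u'.
Proof.
move=> y_0 ut XY; rewrite HcurveE//.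
have yE : y = acosh (X u') by rewrite XY coshK// ltW.
have X1 : 1 < X u' by rewrite XY cosh_gt1.
case/andP: (ut) => u'0 u't.
have [lt|gt|eq] := ltgtP u' u0.
- by rewrite yE; have /left_curve[] : 0 < u' < u0 by rewrite u'0.
- have y0p : 0 < y0.
    case: endp => -[] // y0E _.
    have : X u' < X u0 by apply: X_decr.
    by rewrite X_u0 X0E y0E cosh0 => /(lt_trans X1); rewrite ltxx.
  have [u2 /andP[u02 u2t] X2] := X_small.
  have [b1 /andP[b1l b1r] Xb] : exists2 b1, u0 <= b1 <= u2 & X b1 = 1.
    apply: (@ivt_decr R X dX u0 u2) => //; first exact: ltW.
      move=> w /andP[w1 w2]; apply: isd_X.
      by rewrite (lt_le_trans u0_gt0 w1) (le_lt_trans w2 u2t).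
    by rewrite (ltW X2) X_u0.
  rewrite yE; apply: (@right_curve b1) => //; first exact: le_lt_trans b1r u2t.
  rewrite (ltW gt) /= ltNge; apply/negP; rewrite le_eqVlt => /predU1P[E1|lt].
    by move: X1; rewrite -E1 Xb ltxx.
  have : X u' < X b1 by apply: X_decr => //; apply: lt_le_trans b1l.
  by rewrite Xb => /(lt_trans X1); rewrite ltxx.
- rewrite eq E_u0 -M_y0.
  have -> : y = y0 by apply: cosh_inj => //; [exact: ltW|rewrite -XY eq X_u0 X0E].
  by [].
Qed.

Lemma case_one y u : 0 < y -> 0 < u < tau -> M y <= H y u.
Proof.
move=> y_0 ut; case/andP: (ut) => u_0 utt.
have near_curve u' : 0 < u' < tau -> X u' = cosh y -> M y <= H y u.
  move=> ut' XY; apply: (le_trans (on_curve y_0 ut' XY)).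
  case/andP: ut' => u'0 u't.
  have [le|le] := leP u u'.
    apply: H_decr => // t /andP[t1 t2]; rewrite -XY ltW//.
    by apply: X_decr => //; exact: lt_trans t1.
  apply: H_incr => //; first exact: ltW.
  move=> t /andP[t1 t2]; rewrite -XY ltW//.
  by apply: X_decr => //; exact: lt_trans utt.
have [Xy|yX] := leP X0 (cosh y); last first.
  have [u2 /andP[u02 u2t] X2] := X_small.
  have [u' /andP[l r] XY] : exists2 b1, u0 <= b1 <= u2 & X b1 = cosh y.
    apply: (@ivt_decr R X dX u0 u2) => //; first exact: ltW.
      move=> w /andP[w1 w2]; apply: isd_X.
      by rewrite (lt_le_trans u0_gt0 w1) (le_lt_trans w2 u2t).
    by rewrite X_u0 (ltW yX) (le_trans (ltW X2)) ?cosh_ge1.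
  by apply: (near_curve u') => //; rewrite (lt_le_trans u0_gt0 l) (le_lt_trans r u2t).
have y0y : y0 <= y.
  rewrite leNgt; apply/negP => lt; move: Xy; rewrite leNgt X0E.
  by rewrite cosh_lt// (ltW y_0).
have [le|gt] := leP u u0; last first.
  apply: (le_trans (base_u0 y0y)); apply: H_incr => //; first exact: ltW.
  move=> t /andP[t1 t2]; apply: le_trans Xy; rewrite -X_u0 ltW//.
  by apply: X_decr => //; exact: lt_trans utt.
have [XY|XY] := leP (X u) (cosh y); last first.
  have [u' /andP[l r] XYu] : exists2 b1, u <= b1 <= u0 & X b1 = cosh y.
    apply: (@ivt_decr R X dX u u0) => //.
      move=> w /andP[w1 w2]; apply: isd_X.
      by rewrite (lt_le_trans u_0 w1) (le_lt_trans w2 u0_lt_tau).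
    by rewrite X_u0 Xy ltW.
  by apply: (near_curve u') => //; rewrite (lt_le_trans u_0 l) (le_lt_trans r u0_lt_tau).
move: le; rewrite le_eqVlt => /predU1P[->|lt]; first exact: base_u0.
have X1 : 1 < X u by apply: le_lt_trans X0_ge1 _; rewrite -X_u0; exact: X_decr.
have yb := acosh_gt0 X1.
have [] := @left_curve u; first by rewrite u_0.
move=> cc MM; apply: (@fixed_u u (acosh (X u)) y) => //.
- by rewrite u_0 ltW.
- exact: ltW.
- by rewrite acoshK// ltW.
- move=> z yz; apply: le_trans cc; apply: ch_decr => //; exact: ltW.
- by rewrite HcurveE// acoshK// ltW.
rewrite leNgt; apply/negP => lt2.
have := @cosh_lt R y (acosh (X u)); rewrite lt2 (ltW y_0) => /(_ isT).
by rewrite acoshK ?(ltW X1)// ltNge XY.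
Qed.

End ObtuseCase.
End ObtuseCase.

(** * Monotonicity in the exponent *)

Section PowerMeans.
Variable R : realType.
Implicit Types (x y u v t q s : R).

Lemma ln_cosh_le x : 0 <= x -> ln (cosh x) <= x * (sinh x / cosh x).
Proof.
move=> x0; rewrite -subr_ge0.
have -> : 0 = 0 * (sinh 0 / cosh 0) - ln (cosh 0) :> R by rewrite cosh0 ln1 mul0r subr0.
apply: (@incr_le R (fun t => t * (sinh t / cosh t) - ln (cosh t))
  (fun t => t / cosh t ^+ 2) _ _ x0) => t /andP[t0 _].
  have c0 := cosh_gt0 t.
  eapply isd_eq; [deriv; rewrite ?gt_eqF//|cbv beta].
  have F : t = t * (cosh t ^+ 2 - sinh t ^+ 2) by rewrite cosh2Bsinh2 mulr1.
  by rewrite [X in _ = X / _]F; field; rewrite gt_eqF.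
by rewrite divr_ge0 ?exprn_ge0 ?ltW ?cosh_gt0.
Qed.

(** ln cosh (t y) / t is nondecreasing in t, by [ln_cosh_le]. This reduces small exponents to
    exponents above 1, where [ch] is positive. *)
Lemma power_mean_cosh q s s' y : 0 <= q -> 0 < s -> s <= s' -> 0 <= y ->
  cosh (s * y) `^ (q / s) <= cosh (s' * y) `^ (q / s').
Proof.
move=> q0 s0 ss y0; rewrite /powR !(gt_eqF (cosh_gt0 _)) ler_expR -!mulrA ler_wpM2l//.
apply: (@incr_le R (fun t => t^-1 * ln (cosh (t * y)))
  (fun t => (t ^+ 2)^-1 * (t * y * (sinh (t * y) / cosh (t * y)) - ln (cosh (t * y)))) _ _ ss) => t /andP[st _].
  have c0 := cosh_gt0 (t * y); have t0 : 0 < t := lt_le_trans s0 st.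
  eapply isd_eq; [deriv; rewrite ?gt_eqF//|].
  by cbv beta; field; rewrite !gt_eqF.
have t0 : 0 < t by apply: lt_trans st.
by rewrite mulr_ge0 ?invr_ge0 ?exprn_ge0 ?(ltW t0)// subr_ge0 ln_cosh_le// mulr_ge0// ltW.
Qed.

Lemma powR_le_self q x : 1 <= q -> 0 <= x <= 1 -> x `^ q <= x.
Proof.
move=> q1 /andP[]; rewrite le_eqVlt => /predU1P[<- _|x0 x1].
  by rewrite powR0// gt_eqF// (lt_le_trans ltr01 q1).
rewrite powR_split// -[leRHS]mul1r ler_pM2r//.
rewrite -[leRHS](_ : 1 `^ (q - 1) = 1); last by rewrite powR1.
by apply: ge0_ler_powR; rewrite ?nnegrE ?subr_ge0// ltW.
Qed.

End PowerMeans.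

(** * Extension of the inequality to the closed range of y and u *)

Section Closure.
Variable R : realType.
Implicit Types (x y u v t : R).

(** Beyond pi / q the cosine is frozen while the power still grows with u. At the corner y = u = 0
    the base of the power vanishes; there the limit is taken on the larger quantity 1 - cos u
    supplied by [powR_le_self]. *)
Lemma closure_one (q lam B : R) (N : R -> R) : 1 < q -> 0 <= B -> 0 <= lam ->
  (forall y, {for y, continuous N}) ->
  (forall y u, 0 < y -> 0 < u < pi / q ->
     N y <= B * ((cosh y - cos u) `^ q + lam * cos (q * u))) ->
  forall y u, 0 <= y -> 0 <= u <= pi ->
     N y <= B * ((cosh y - cos u) `^ q + lam * cos (q * Num.min u (pi / q))).
Proof.
move=> q1 B0 lam0 Nc H.
have q0 : 0 < q by apply: lt_trans ltr01 q1.
have [tau tauE] : exists tau, tau = pi / q by exists (pi / q).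
rewrite -tauE in H *.
have tau0 : 0 < tau by rewrite tauE divr_gt0 ?pi_gt0.
have taupi : tau < pi by rewrite tauE ltr_pdivrMr// ltr_pMr ?pi_gt0.
have cc y u : 0 < y -> 0 < cosh y - cos u.
  by move=> y_0; rewrite subr_gt0 (le_lt_trans (cos_le1 u))// cosh_gt1.
have Fc y u : 0 < y -> {for u, continuous (fun u => B * ((cosh y - cos u) `^ q + lam * cos (q * u)) - N y)}.
  move=> y0; apply: isd_cont; apply: isd_add; last exact: isd_cst.
  apply: isd_mul; first exact: isd_cst.
  apply: (@isd_add _ (fun t => (cosh y - cos t) `^ q) (fun t => lam * cos (q * t))).
    by apply: (@isd_powR _ (fun t => cosh y - cos t)); [exact: cc|deriv].
  by deriv.
have S1 y u : 0 < y -> 0 <= u -> u <= tau -> N y <= B * ((cosh y - cos u) `^ q + lam * cos (q * u)).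
  move=> y0; rewrite le_eqVlt => /predU1P[<- _|u0].
    rewrite -subr_ge0; apply: (ge0_right (Fc y 0 y0)).
    by exists tau => // h hh; rewrite add0r subr_ge0 H.
  rewrite le_eqVlt => /predU1P[->|ut]; last by apply: H; rewrite ?u0.
  rewrite -subr_ge0; apply: (ge0_left (Fc y tau y0)).
  exists tau => // h /andP[h0 ht]; rewrite subr_ge0 H// subr_gt0 ht.
  by rewrite ltrBlDr ltrDl h0.
have S3 y u : 0 < y -> 0 <= u -> u <= pi ->
    N y <= B * ((cosh y - cos u) `^ q + lam * cos (q * Num.min u tau)).
  move=> y0 u0 up; have [ut|ut] := leP u tau; first exact: S1.
  apply: le_trans (S1 y tau y0 (ltW tau0) (lexx _)) _.
  rewrite ler_wpM2l// lerD2r; apply: ge0_ler_powR; rewrite ?nnegrE ?(ltW (cc _ _ _))// ?(ltW q0)//.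
  by rewrite lerD2l lerN2 cos_anti// ltW.
move=> y u; rewrite le_eqVlt => /predU1P[<-|y0] /andP[]; last exact: S3.
rewrite le_eqVlt => /predU1P[<- _|u0 up]; last first.
  rewrite -subr_ge0.
  apply: (@ge0_right R (fun y => B * ((cosh y - cos u) `^ q + lam * cos (q * Num.min u tau)) - N y)).
    apply: continuousB; last exact: Nc.
    apply: isd_cont; apply: isd_mul; first exact: isd_cst.
    apply: (@isd_add _ (fun t => (cosh t - cos u) `^ q)); last exact: isd_cst.
    apply: (@isd_powR _ (fun t => cosh t - cos u)); last by apply: isd_add; [apply: isd_cosh; exact: isd_id|deriv].
    by rewrite cosh0 subr_gt0 -cos0 ltr_cos ?in_itv/= ?lexx ?pi_ge0 ?(ltW u0).
  by exists 1 => // h /andP[h0 _]; rewrite add0r subr_ge0 S3// ltW.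
rewrite cos0 cosh0 subrr powR0 ?gt_eqF// add0r.
have -> : Num.min 0 tau = 0 by rewrite min_l// ltW.
rewrite mulr0 cos0 mulr1 -subr_ge0.
have -> : B * lam - N 0 = B * ((1 - cos 0) + lam) - N 0 by rewrite cos0 subrr add0r.
apply: (@ge0_right R (fun u => B * ((1 - cos u) + lam) - N 0)); first by apply: isd_cont; deriv.
have pi2 : 0 < pi / 2 :> R by rewrite divr_gt0 ?pi_gt0.
exists (Num.min tau (pi / 2)); first by rewrite lt_min tau0 pi2.
move=> h /andP[h0]; rewrite lt_min => /andP[ht h2]; rewrite add0r subr_ge0.
have hp : h <= pi := ltW (lt_trans ht taupi).
have c1 := cos_le1 h.
have c0 : 0 <= cos h by apply: cos_ge0_pihalf; rewrite (ltW h2) andbT (le_trans _ (ltW h0))// oppr_le0 ltW.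
have P0 : 0 < 1 - cos h by rewrite subr_gt0 -cos0 ltr_cos ?in_itv/= ?lexx ?pi_ge0 ?(ltW h0).
have : N 0 <= B * ((cosh 0 - cos h) `^ q + lam * cos (q * Num.min h tau)).
  rewrite -subr_ge0.
  apply: (@ge0_right R (fun y => B * ((cosh y - cos h) `^ q + lam * cos (q * Num.min h tau)) - N y)).
    apply: continuousB; last exact: Nc.
    apply: isd_cont; apply: isd_mul; first exact: isd_cst.
    apply: (@isd_add _ (fun t => (cosh t - cos h) `^ q)); last exact: isd_cst.
    apply: (@isd_powR _ (fun t => cosh t - cos h)); last by apply: isd_add; [apply: isd_cosh; exact: isd_id|deriv].
    by rewrite cosh0.
  by exists 1 => // z /andP[z0 _]; rewrite add0r subr_ge0 S3// ltW.
move=> /le_trans; apply; rewrite ler_wpM2l// cosh0 lerD//; last first.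
  by rewrite -[leRHS]mulr1 ler_wpM2l// cos_le1.
by rewrite powR_le_self ?(ltW q1)// (ltW P0)/= gerBl.
Qed.

End Closure.

(** Here [q] and [s] are half of the exponents of the theorem; e^y is the ratio of the moduli of w
    and z, and t the argument of their product, folded to [0, pi]. *)
Definition pointwise_majorant (R : realType) (q s B : R) (phi : R -> R) :=
  exists2 lam, 0 <= lam & forall y t, 0 <= y -> 0 <= t <= pi ->
    cosh (s * y) `^ (q / s) <= B `^ q * ((cosh y + cos t) `^ q - lam * phi t).

(* In terms of [u = pi - t] this is [- cos (q u)], continued by its maximal
   value [1] beyond [u = pi / q]. *)
Definition phi_obtuse (R : realType) (q t : R) : R := - cos (q * Num.min (pi - t) (pi / q)).

Section MajorantOne.
Variable R : realType.
Implicit Types (x y u v t q s B : R).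

Lemma cont_Ncosh q s y : {for y, continuous (fun y => cosh (s * y) `^ (q / s))}.
Proof.
apply: isd_cont; apply: (@isd_powR _ (fun y => cosh (s * y))); first exact: cosh_gt0.
by apply: isd_cosh; deriv.
Qed.

(** The bracket multiplied by the power of [B] is nonnegative, because that product dominates a
    positive power; so the bound only weakens as [B] grows. *)
Lemma majorant_le q s B B' phi : 0 <= q -> 0 <= B -> B <= B' ->
  pointwise_majorant q s B phi -> pointwise_majorant q s B' phi.
Proof.
move=> q0 B0 BB [lam lam0 H]; exists lam => // y t y0 t0.
have h := H y t y0 t0; apply: (le_trans h).
have pB : B `^ q <= B' `^ q by apply: ge0_ler_powR; rewrite ?nnegrE// (le_trans B0).
have [B_0|B_0] := eqVneq (B `^ q) 0.
  by move: h; rewrite B_0 mul0r leNgt powR_gt0// cosh_gt0.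
have Bp : 0 < B `^ q by rewrite lt_neqAle eq_sym B_0 powR_ge0.
rewrite ler_wpM2r// -(pmulr_rge0 _ Bp); apply: le_trans h; exact: powR_ge0.
Qed.

(** [ObtuseCase.case_one] read in t = pi - u. The constant is the value at [y0] of cosh (s y)^(1/s)
    / (cosh y - k), where k = cos (pi / (2 q)). *)
Lemma majorant_lt_one q s y0 : 1 < q -> 1 < s -> 0 <= y0 ->
  (0 < y0 /\ ch s y0 = cos (pi / (2 * q))) \/ (y0 = 0 /\ (s - 1) / s < cos (pi / (2 * q))) ->
  let Z0 := cosh y0 - cos (pi / (2 * q)) in
  forall y t, 0 <= y -> 0 <= t <= pi ->
    cosh (s * y) `^ (q / s) <= (cosh (s * y0) `^ s^-1 / Z0) `^ q *
      ((cosh y + cos t) `^ q -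
       (Z0 `^ (q - 1) * sin (pi / (2 * q))) * phi_obtuse q t).
Proof.
move=> q1 s1 y00 ep Z0 y t yy /andP[t0 tp].
have s0 : 0 < s := lt_trans ltr01 s1.
have Z0p : 0 < Z0 by apply: (@ObtuseCase.Z0_gt0 R q y0 q1) => //.
have lamp : 0 < Z0 `^ (q - 1) * sin (pi / (2 * q)) by apply: (@ObtuseCase.lam_gt0 R q y0 q1) => //.
have u_in : 0 <= pi - t <= pi by rewrite subr_ge0 tp gerBl.
rewrite /phi_obtuse mulrN opprK.
have -> : cos t = - cos (pi - t) by rewrite cosB cospi sinpi mul0r addr0 mulN1r opprK.
apply: (closure_one q1 (powR_ge0 _ _) (ltW lamp) (@cont_Ncosh q s)) => // {}y u {}yy uu.
have := @ObtuseCase.case_one R q s y0 q1 s1 y00 _ erefl _ erefl ep _ erefl _ erefl _ erefl _ erefl _ erefl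
  _ erefl _ erefl _ erefl _ erefl _ erefl _ erefl _ erefl _ erefl _ erefl y u yy uu.
rewrite -/Z0 => h.
have Bp : 0 < (cosh (s * y0) `^ s^-1 / Z0) `^ q by rewrite powR_gt0// divr_gt0// powR_gt0// cosh_gt0.
rewrite -(ler_pM2l Bp) in h; apply: le_trans h.
rewrite [_ / Z0 in leRHS](_ : _ = expR (s^-1 * ln (cosh (s * y0)) - ln Z0)); last first.
  by rewrite expRB /powR gt_eqF ?cosh_gt0// lnK.
rewrite -expRM -expRD /powR gt_eqF ?cosh_gt0// ler_expR.
rewrite le_eqVlt; apply/orP; left; apply/eqP.
by field; rewrite gt_eqF.
Qed.

End MajorantOne.

Section MajorantOneAll.
Variable R : realType.
Implicit Types (x y u v t q s B k : R).

Lemma ch_le_expN s y : 1 < s -> 0 < y -> ch s y <= expR (- y).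
Proof.
move=> s1 y0; have sy : 0 < s * y by rewrite mulr_gt0// (lt_trans ltr01).
rewrite /ch ler_pdivrMr ?sinh_gt0//.
rewrite !sinhE mulrA ler_pM2r// mulrBr -!expRD lerB// ler_expR; last by lra.
by rewrite -subr_ge0; have := ltW y0; lra.
Qed.

Lemma ch_ge s y : 1 < s -> 0 < y -> (s - 1) / (s * cosh (s * y)) <= ch s y.
Proof.
move=> s1 y0; have s0 : 0 < s := lt_trans ltr01 s1; have sy : 0 < s * y by exact: mulr_gt0.
have c0 := cosh_gt0 (s * y).
have h1 : (s - 1) * y <= sinh ((s - 1) * y) by rewrite ltW// x_lt_sinh// mulr_gt0// subr_gt0.
have h2 := sinh_le_xcosh (ltW sy).
rewrite /ch ler_pdivlMr ?sinh_gt0//; apply: le_trans h1.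
apply: (@le_trans _ _ ((s - 1) / (s * cosh (s * y)) * (s * y * cosh (s * y)))).
  by rewrite ler_wpM2l// divr_ge0 ?mulr_ge0 ?(ltW s0) ?(ltW c0)// subr_ge0 ltW.
rewrite le_eqVlt; apply/orP; left; apply/eqP.
by field; rewrite !gt_eqF.
Qed.

(** [ch s] takes a value at least k at [y1], chosen so that the lower bound of [ch_ge] equals k
    there, and falls to k or below at [y2] by the exponential bound. *)
Lemma exists_peak s k : 1 < s -> 0 < k -> k < (s - 1) / s -> exists2 y, 0 < y & ch s y = k.
Proof.
move=> s1 k0 ks; have s0 : 0 < s := lt_trans ltr01 s1.
have m1 : 1 < (s - 1) / (s * k).
  rewrite ltr_pdivlMr ?mulr_gt0// mul1r.
  by move: ks; rewrite ltr_pdivlMr// mulrC.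
pose y1 := acosh ((s - 1) / (s * k)) / s.
have y10 : 0 < y1 by rewrite divr_gt0// acosh_gt0.
have k1 : k <= ch s y1.
  apply: le_trans (ch_ge s1 y10).
  rewrite /y1 [s * (_ / s)]mulrC divfK ?gt_eqF// acoshK ?(ltW m1)//.
  have sm : 0 < s - 1 by rewrite subr_gt0.
  rewrite le_eqVlt; apply/orP; left; apply/eqP.
  by field; rewrite !gt_eqF.
pose y2 := Num.max y1 (- ln k).
have y12 : y1 <= y2 by rewrite le_max lexx.
have k2 : ch s y2 <= k.
  apply: le_trans (ch_le_expN s1 (lt_le_trans y10 y12)) _.
  rewrite -[leRHS](@lnK R k) ?posrE// ler_expR lerNl.
  by rewrite le_max lexx orbT.
have [||y /andP[yy1 _] E] := @ivt_decr R (ch s) (fun t => - (ch s t * kh s t)) y1 y2 k y12.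
  by move=> x /andP[x1 _]; apply: isd_ch => //; exact: lt_le_trans x1.
  by rewrite k1 k2.
by exists y => //; apply: lt_le_trans yy1.
Qed.

(** A strict bound on [s] above 1 means (s - 1) / s < k, so the extremal point is y = 0. Exponents
    up to 1 are dominated by one strictly between 1 and the threshold; the threshold itself is a
    limit from the left in the exponent. *)
Lemma majorant_obtuse_small q s : 1 < q -> 0 < s ->
  s <= (1 - cos (pi / (2 * q)))^-1 ->
  pointwise_majorant q s (1 - cos (pi / (2 * q)))^-1 (phi_obtuse q).
Proof.
move=> q1 s0; have q0 : 0 < q := lt_trans ltr01 q1.
have k1 : cos (pi / (2 * q)) < 1 by apply: (@ObtuseCase.k_lt1 R q q1).
have u0 : 0 < pi / (2 * q) by rewrite divr_gt0 ?pi_gt0 ?mulr_gt0.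
have kp : 0 < cos (pi / (2 * q)).
  apply: cos_gt0_pihalf; rewrite (lt_trans _ u0)/= ?oppr_lt0 ?divr_gt0 ?pi_gt0//.
  rewrite ltr_pM2l ?pi_gt0// ltf_pV2 ?posrE ?mulr_gt0//.
  by rewrite ltr_pMr.
have L := @majorant_lt_one R q ^~ 0.
move: k1 kp L; set k := cos (pi / (2 * q)) => k1 kp L.
set lam := (1 - k) `^ (q - 1) * sin (pi / (2 * q)).
have km : 0 < 1 - k by rewrite subr_gt0.
have S1 : 1 < (1 - k)^-1 by rewrite -invr1 ltf_pV2 ?posrE//; lra.
have H s' y t : s' < (1 - k)^-1 -> 0 < s' -> 0 <= y -> 0 <= t <= pi ->
    cosh (s' * y) `^ (q / s') <= (1 - k)^-1 `^ q * ((cosh y + cos t) `^ q - lam * phi_obtuse q t).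
  move=> s'1 s'0 y0 tt.
  pose s2 := Num.max s' ((1 + (1 - k)^-1) / 2).
  have h1 : 1 < s2 by rewrite lt_max; apply/orP; right; clear -S1; lra.
  have h2 : s2 < (1 - k)^-1 by rewrite gt_max s'1/=; clear -S1; lra.
  apply: le_trans (_ : cosh (s2 * y) `^ (q / s2) <= _).
    by apply: power_mean_cosh => //; [exact: ltW|rewrite le_max lexx].
  have := L s2 q1 h1 (lexx 0).
  have -> : (s2 - 1) / s2 < k.
    have s20 : 0 < s2 by apply: lt_trans h1.
    rewrite ltr_pdivrMr//; move: h2; rewrite -[ltRHS]mul1r ltr_pdivlMr//.
    by rewrite mulrBr mulr1 mulrC; clear; lra.
  move=> /(_ (or_intror (conj erefl isT)) y t y0 tt).
  by rewrite mulr0 cosh0 powR1 mul1r.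
move=> sS; exists lam.
  by rewrite mulr_ge0 ?powR_ge0// ltW// (@ObtuseCase.sin_u0_gt0 R q q1 _ erefl _ erefl).
move=> y t y0 tt; move: sS; rewrite le_eqVlt => /predU1P[->|sS]; last exact: H.
rewrite -subr_ge0.
apply: (@ge0_left R (fun s => (1 - k)^-1 `^ q * ((cosh y + cos t) `^ q - lam * phi_obtuse q t)
   - cosh (s * y) `^ (q / s))).
  apply: continuousB; first exact: cst_continuous.
  have S0 : 0 < (1 - k)^-1 by rewrite invr_gt0.
  rewrite (_ : (fun s => cosh (s * y) `^ (q / s)) = fun s => expR (q / s * ln (cosh (s * y)))); last first.
    by apply/funext => z; rewrite /powR gt_eqF ?cosh_gt0.
  by apply: isd_cont; deriv; rewrite ?cosh_gt0 ?gt_eqF.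
exists (1 - k)^-1; first by rewrite invr_gt0.
move=> h /andP[h0 h1]; rewrite subr_ge0; apply: H => //.
  by rewrite ltrBlDr ltrDl.
by rewrite subr_gt0.
Qed.

Lemma majorant_obtuse q s B : 1 <= q -> 0 < s ->
  (s <= (1 - cos (pi / (2 * q)))^-1 /\ B = (1 - cos (pi / (2 * q)))^-1) \/
  (forall y, 0 <= y -> cosh (s * y) `^ s^-1 / (cosh y - cos (pi / (2 * q))) <= B) ->
  pointwise_majorant q s B (phi_obtuse q).
Proof.
move=> q1' s0 HB; move: q1'; rewrite le_eqVlt => /predU1P[qE|q1].
  (* For q = 1 the weight is cos t itself, and [lam] = 1 cancels it, leaving cosh y alone. *)
  have kE : cos (pi / (2 * q)) = 0 by rewrite -qE mulr1 cos_pihalf.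
  exists 1 => // y t y0 /andP[t0 tp].
  have -> : phi_obtuse q t = cos t.
    rewrite /phi_obtuse -qE divr1 mul1r min_l; last by rewrite gerBl.
    by rewrite cosB cospi sinpi mul0r addr0 mulN1r opprK.
  have ct : 0 <= cosh y + cos t by have := cosh_ge1 y; have := cos_geN1 t; lra.
  have BB : cosh (s * y) `^ s^-1 <= B * cosh y.
    rewrite kE in HB; case: HB => [[]|/(_ y y0)].
      rewrite subr0 invr1 => s1 ->; rewrite mul1r.
      have := @power_mean_cosh R 1 s 1 y ler01 s0 s1 y0.
      by rewrite !mul1r invr1 powRr1// ltW// cosh_gt0.
    by rewrite subr0 ler_pdivrMr ?cosh_gt0.
  have B0 : 0 <= B.
    by rewrite -(pmulr_lge0 _ (cosh_gt0 y)); apply: le_trans BB; exact: powR_ge0.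
  by rewrite -qE !mul1r !powRr1// addrK.
have q0 : 0 < q := lt_trans ltr01 q1.
have k1 : cos (pi / (2 * q)) < 1 by apply: (@ObtuseCase.k_lt1 R q q1).
have u0 : 0 < pi / (2 * q) by rewrite divr_gt0 ?pi_gt0 ?mulr_gt0.
have kp : 0 < cos (pi / (2 * q)).
  apply: cos_gt0_pihalf; rewrite (lt_trans _ u0)/= ?oppr_lt0 ?divr_gt0 ?pi_gt0//.
  rewrite ltr_pM2l ?pi_gt0// ltf_pV2 ?posrE ?mulr_gt0//.
  by rewrite ltr_pMr.
have km : 0 < 1 - cos (pi / (2 * q)) by rewrite subr_gt0.
case: HB => [[sS ->]|HB]; first exact: majorant_obtuse_small.
have [sS|Ss] := leP s (1 - cos (pi / (2 * q)))^-1.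
  apply: majorant_le (majorant_obtuse_small q1 s0 sS).
  - exact: ltW.
  - by rewrite invr_ge0 ltW.
  - by have := HB 0 (lexx 0); rewrite mulr0 cosh0 powR1 mul1r.
have s1 : 1 < s by apply: le_lt_trans Ss; rewrite -[leLHS]invr1 lef_pV2 ?posrE// gerBl ltW.
have [|y0 y00 y0E] := @exists_peak s (cos (pi / (2 * q))) s1 kp.
  rewrite ltr_pdivlMr//; move: Ss; rewrite -[ltLHS]mul1r ltr_pdivrMr//.
  by rewrite mulrBr mulr1 mulrC; clear; lra.
have L := @majorant_lt_one R q s y0 q1 s1 (ltW y00) (or_introl (conj y00 y0E)).
have Zp : 0 < cosh y0 - cos (pi / (2 * q)) by rewrite subr_gt0 (lt_le_trans k1)// cosh_ge1.
apply: (majorant_le (ltW q0) _ (HB y0 (ltW y00))).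
  by rewrite divr_ge0 ?powR_ge0// ltW.
eexists; last exact: L.
by rewrite mulr_ge0 ?powR_ge0// ltW// (@ObtuseCase.sin_u0_gt0 R q q1 _ erefl _ erefl).
Qed.

End MajorantOneAll.

(** * The pointwise inequality for p <= 4/3 *)

Lemma half_lt (R : realType) (q : R) : 1 / 2 < q -> 1 - q < q. Proof. by lra. Qed.
Lemma two_thirds_le (R : realType) (q : R) : q <= 2 / 3 -> q <= 2 * (1 - q). Proof. by lra. Qed.

Lemma cos_gtN1 (R : realType) (t : R) : 0 < t < pi -> 0 < 1 + cos t.
Proof.
move=> /andP[t_0 tp]; rewrite -[1]opprK -cospi addrC subr_gt0.
by rewrite ltr_cos// in_itv/= ?lexx ?pi_ge0// !ltW.
Qed.

Section AcuteTail.
Variable R : realType.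
Implicit Types (q t d e : R).

Lemma sin_pi6 : sin (pi / 6) = 1 / 2 :> R.
Proof.
have pi0 : 0 < pi :> R := pi_gt0 R.
have c0 : 0 < cos (pi / 6) :> R.
  apply: cos_gt0_pihalf; rewrite (lt_trans _ (_ : 0 < pi / 6)) ?oppr_lt0 ?divr_gt0//=.
  by rewrite ltr_pM2l// ltf_pV2 ?posrE// ltr_nat.
have : sin (pi / 6 + pi / 6) = cos (pi / 6) :> R.
  have -> : pi / 6 + pi / 6 = pi / 2 - pi / 6 :> R by field.
  by rewrite sinB sin_pihalf cos_pihalf mul0r subr0 mul1r.
rewrite sinDD -[RHS]mul1r => /(mulIf (lt0r_neq0 c0)); lra.
Qed.

Lemma cos_pi6 : cos (pi / 6) ^+ 2 = 3 / 4 :> R /\ 0 < cos (pi / 6) :> R.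
Proof.
split; first by have := cos2Dsin2 (pi / 6 : R); rewrite sin_pi6; lra.
have pi0 : 0 < pi :> R := pi_gt0 R.
apply: cos_gt0_pihalf; rewrite (lt_trans _ (_ : 0 < pi / 6)) ?oppr_lt0 ?divr_gt0//=.
by rewrite ltr_pM2l// ltf_pV2 ?posrE// ltr_nat.
Qed.

(** Snell-Huygens at pi / 6, used as an upper bound for pi. *)
Lemma pi_cos_pi6 : pi * cos (pi / 6) <= 2 * cos (pi / 6) + 1 :> R.
Proof.
have pi0 : 0 < pi :> R := pi_gt0 R.
have := @snell_huygens R (pi / 6); rewrite sin_pi6 divr_ge0 ?(ltW pi0)//.
have -> /= : pi / 6 < pi / 2 :> R by rewrite ltr_pM2l// ltf_pV2 ?posrE// ltr_nat.
by move=> /(_ isT); lra.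
Qed.

Lemma cos_pi6_itv : 86 / 100 < cos (pi / 6 : R) < 867 / 1000.
Proof.
have [] := cos_pi6; move: (cos _) => C C2 C0; apply/andP; split; rewrite ltNge; apply/negP => le.
  have h : 0 <= (86 / 100 - C) * (86 / 100 + C) by apply: mulr_ge0; lra.
  have : (86 / 100 - C) * (86 / 100 + C) = 86 / 100 * (86 / 100) - C ^+ 2 by ring.
  by rewrite C2; lra.
have h : 0 <= (C - 867 / 1000) * (C + 867 / 1000) by apply: mulr_ge0; lra.
have : (C - 867 / 1000) * (C + 867 / 1000) = C ^+ 2 - 867 / 1000 * (867 / 1000) by ring.
by rewrite C2; lra.
Qed.

Lemma pi_lt_32 : pi < 32 / 10 :> R.
Proof.
have [_ C0] := cos_pi6; have h := pi_cos_pi6; have /andP[C1 _] := cos_pi6_itv.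
by rewrite -(ltr_pM2r C0); apply: le_lt_trans h _; lra.
Qed.

Lemma tan_pi6_le (c : R) : 92 / 100 <= c -> 1 / 2 / cos (pi / 6) <= 2 * c / pi.
Proof.
move=> c92; have [C2 C0] := cos_pi6; have h := pi_cos_pi6; have /andP[_ C1] := cos_pi6_itv.
rewrite ler_pdivrMr// mulrAC ler_pdivlMr ?pi_gt0// -(ler_pM2r C0).
have -> : 2 * c * cos (pi / 6) * cos (pi / 6) = 2 * c * cos (pi / 6) ^+ 2 by ring.
by rewrite C2; lra.
Qed.

Lemma cos_ge92 d : 0 <= d -> d <= pi -> d <= 4 / 10 -> 92 / 100 <= cos d.
Proof.
move=> d0 dpi d4.
have dd : d = d / 2 + d / 2 by field.
rewrite dd cosDD; have h : 0 <= sin (d / 2) by apply: sin_ge0_pi; apply/andP; split; lra.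
have h' : sin (d / 2) <= d / 2 by apply: sin_le; lra.
have : sin (d / 2) * sin (d / 2) <= (2 / 10) * (2 / 10) by apply: ler_pM => //; lra.
by rewrite -expr2; lra.
Qed.

(** Let r = 2 q and a = r d + e, which is at most pi / 6. Then tan d + tan e <= tan (r d) + tan e <=
    tan a <= 2 cos d / pi, the last step being numerical. Since sin d <= d and 2 r d <= pi (r - 1),
    the right side of the claim is at least r times this bound. *)
Lemma acute_tail_half d e q : 1 / 2 < q -> q <= 2 / 3 -> 0 < d -> 0 <= e ->
  2 * q * d + e = pi * (2 * q - 1) / 2 ->
  sin d / cos d + 2 * q * (sin e / cos e) <= (2 * q - 1) * (cos d / sin d).
Proof.
move=> q12 q23 d0 e0.
have [r rE] : exists r, r = 2 * q by exists (2 * q).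
rewrite -rE => aE.
have r1 : 1 < r by rewrite rE; lra.
have r43 : r <= 4 / 3 by rewrite rE; lra.
move: aE; set a := pi * _ / 2 => aE.
have pi0 : 0 < pi :> R := pi_gt0 R.
have a6 : a <= pi / 6.
  have : pi * (r - 1) <= pi * (1 / 3) by rewrite ler_pM2l//; lra.
  by rewrite /a; lra.
have rd : d <= r * d by rewrite ler_peMl// ltW.
have rda : r * d <= a by lra.
have ea : e <= a by have := mulr_gt0 (lt_trans ltr01 r1) d0; lra.
have cpos x : 0 <= x -> x <= a -> 0 < cos x.
  move=> x0 xa; apply: cos_gt0_pihalf; apply/andP; split; lra.
have spos x : 0 <= x -> x <= a -> 0 <= sin x.
  move=> x0 xa; apply: sin_ge0_pi; apply/andP; split; lra.
have a0 : 0 <= a by lra.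
have da : d <= a by lra.
have cd := cpos d (ltW d0) da.
have ce := cpos e e0 ea.
have rd0 : 0 <= r * d by lra.
have crd := cpos (r * d) rd0 rda.
have ca := cpos a a0 (lexx a).
have sd : 0 < sin d by apply: sin_gt0_pi; apply/andP; split; lra.
have srd := spos _ rd0 rda; have se := spos e e0 ea.
have h1 : sin d / cos d <= sin (r * d) / cos (r * d).
  rewrite ler_pdivrMr// mulrAC ler_pdivlMr// -subr_ge0.
  have -> : sin (r * d) * cos d - sin d * cos (r * d) = sin (r * d - d) by rewrite sinB [sin d * _]mulrC.
  by apply: spos; lra.
have h2 : sin (r * d) / cos (r * d) + sin e / cos e <= sin a / cos a.
  have -> : sin (r * d) / cos (r * d) + sin e / cos e = sin a / (cos (r * d) * cos e).
    by rewrite -aE sinD; field; rewrite !gt_eqF.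
  rewrite ler_wpM2l ?spos// lef_pV2 ?posrE ?mulr_gt0//.
  by rewrite -aE cosD gerBl mulr_ge0.
have [C2 C0] := cos_pi6; have Cpi := pi_cos_pi6; have p32 := pi_lt_32.
have S6 := sin_pi6.
have h3 : sin a / cos a <= 1 / 2 / cos (pi / 6).
  rewrite -S6 ler_pM ?invr_ge0 ?spos ?(ltW ca)//.
    by apply: sin_mono; lra.
  by rewrite lef_pV2 ?posrE//; apply: cos_anti; lra.
have d04 : d <= 4 / 10.
  have h : r * d <= r * (pi / 8).
    apply: (le_trans rda); rewrite -subr_ge0.
    have -> : r * (pi / 8) - a = 3 * pi / 8 * (4 / 3 - r) by rewrite /a; field.
    by rewrite mulr_ge0 ?subr_ge0// divr_ge0// mulr_ge0// ltW.
  by move: h; rewrite ler_pM2l ?(lt_trans ltr01)//; move: p32; clear -R d; lra.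
have cd92 : 92 / 100 <= cos d by apply: cos_ge92 => //; lra.
have h4 := tan_pi6_le cd92.
have h5 : r * (2 * cos d / pi) <= (r - 1) * (cos d / sin d).
  have sdd : sin d <= d by apply: sin_le; exact: ltW.
  rewrite mulrA ler_pdivrMr//.
  have -> : (r - 1) * (cos d / sin d) * pi = (r - 1) * cos d * pi / sin d by field; rewrite gt_eqF.
  rewrite ler_pdivlMr//.
  have : 2 * r * sin d <= pi * (r - 1).
    apply: (@le_trans _ _ (2 * (r * d))); last by move: rda; rewrite /a; lra.
    by rewrite mulrA ler_pM2l//; lra.
  by move=> h; apply: (le_scaled (ltW cd) _ h); ring.
apply: le_trans h5.
have h6 : sin d / cos d + sin e / cos e <= 2 * cos d / pi.
  by apply: le_trans h4; apply: le_trans h3; apply: le_trans h2; rewrite lerD2r.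
have h7 : 0 <= sin d / cos d by rewrite divr_ge0// ltW.
have h8 : sin d / cos d <= r * (sin d / cos d) by rewrite ler_peMl// ltW.
apply: (@le_trans _ _ (r * (sin d / cos d + sin e / cos e))).
  by rewrite mulrDr lerD2r.
by rewrite ler_pM2l//; lra.
Qed.

(** The expression is the logarithmic derivative of P t / (1 + cos t)^(q-1), with [P] as in
    [AcuteCase]. The substitution d = (pi - t) / 2, e = q t - pi / 2 brings it to
    [acute_tail_half]. *)
Lemma acute_tail q t : 1 / 2 < q -> q <= 2 / 3 -> pi / (2 * q) <= t -> t < pi ->
  0 <= q * (cos (q * t) / sin (q * t)) - cos t / sin t + (q - 1) * (sin t / (1 + cos t)).
Proof.
move=> q12 q23 tl tp; have q0 : 0 < q by lra.
have pi0 : 0 < pi :> R := pi_gt0 R.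
have [d dE] : exists d, d = (pi - t) / 2 by eexists.
have [e eE] : exists e, e = q * t - pi / 2 by eexists.
have d0 : 0 < d by rewrite dE divr_gt0// subr_gt0.
have e0 : 0 <= e.
  rewrite eE subr_ge0; apply: (@le_trans _ _ (q * (pi / (2 * q)))); last by rewrite ler_pM2l.
  by rewrite le_eqVlt; apply/orP; left; apply/eqP; field; rewrite gt_eqF.
have := @acute_tail_half d e q q12 q23 d0 e0.
have -> : 2 * q * d + e = pi * (2 * q - 1) / 2 by rewrite dE eE; field.
move=> /(_ erefl) h.
have tE : t = pi - (d + d) by rewrite dE; field.
have qtE : q * t = e + pi / 2 by rewrite eE; field.
have t0 : 0 < t by apply: lt_le_trans tl; rewrite divr_gt0// mulr_gt0.
have e2 : e < pi / 2.
  have : q * t < 1 * pi by apply: ltr_pM => //; lra.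
  by rewrite mul1r qtE; lra.
have sd : 0 < sin d by apply: sin_gt0_pi; rewrite d0 dE; lra.
have cd : 0 < cos d by apply: cos_gt0_pihalf; rewrite dE; apply/andP; split; lra.
have ce : 0 < cos e by apply: cos_gt0_pihalf; rewrite e2 andbT; lra.
rewrite qtE cosD sinD cos_pihalf sin_pihalf !mulr0 !mulr1 sub0r add0r.
rewrite tE cosB sinB cospi sinpi sinDD cosDD !mul0r !mulN1r sub0r addr0 opprK.
set S := sin d in h sd *; set C := cos d in h cd *.
have CS : C ^+ 2 = 1 - S ^+ 2 by have := cos2Dsin2 d; rewrite -/S -/C; lra.
have -> : 1 - 2 * S ^+ 2 = C ^+ 2 - S ^+ 2 by rewrite CS; ring.
have -> : 1 - (C ^+ 2 - S ^+ 2) = 2 * S ^+ 2 by rewrite CS; ring.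
move: h sd cd; clearbody S C => h sd cd.
apply: (@le_scaled _ 2^-1 _ _ _ _ _ _ h); first by [].
by field; rewrite !gt_eqF.
Qed.

End AcuteTail.

(** * The inequality for 1/2 < q <= 2/3, in the variable t itself *)

Module AcuteCase.
Section AcuteCase.
Variable R : realType.
Variables (q s : R).
Hypotheses (q12 : 1 / 2 < q) (q23 : q <= 2 / 3) (s1 : 1 < s).
Implicit Types (y u t : R).

(** The extremal point is y = 0, t = t0, where the weight cos (q t) vanishes; [m0] is the value of
    cosh y + cos t there. *)
Variable t0 : R.
Hypothesis t0E : t0 = pi / (2 * q).
Variable m0 : R.
Hypothesis m0E : m0 = 1 + cos t0.
Hypothesis sm : s < m0^-1.
(** Again the value for which the angular derivative of [H] vanishes at the extremal point. *)
Variable lam : R.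
Hypothesis lamE : lam = m0 `^ (q - 1) * sin t0.

Lemma q_gt0 : 0 < q. Proof. by apply: lt_trans q12; rewrite divr_gt0. Qed.
Lemma q_lt1 : q < 1. Proof. by apply: le_lt_trans q23 _; rewrite ltr_pdivrMr// mul1r ltr_nat. Qed.
Lemma pi_pos : 0 < pi :> R. Proof. exact: pi_gt0. Qed.
#[local] Hint Resolve q_gt0 q_lt1 pi_pos : core.
Lemma subq_lt : 1 - q < q. Proof. exact: half_lt. Qed.
Lemma le_subq : q <= 2 * (1 - q). Proof. exact: two_thirds_le. Qed.
Lemma t0_gt0 : 0 < t0. Proof. by rewrite t0E divr_gt0// mulr_gt0. Qed.
Lemma t0_lt_pi : t0 < pi.
Proof.
rewrite t0E ltr_pdivrMr ?mulr_gt0// ltr_pMr//.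
by rewrite mulrC -ltr_pdivrMr.
Qed.
Lemma q_t0 : q * t0 = pi / 2. Proof. by rewrite t0E; field; rewrite gt_eqF. Qed.
#[local] Hint Resolve t0_gt0 t0_lt_pi : core.
Lemma subq_gt0 : 0 < 1 - q. Proof. by rewrite subr_gt0. Qed.
Lemma sin_t_gt0 t : 0 < t < pi -> 0 < sin t. Proof. exact: sin_gt0_pi. Qed.
Lemma qt_itv t : 0 < t < pi -> 0 < q * t < pi.
Proof.
move=> /andP[t_0 tp]; rewrite mulr_gt0//=; apply: lt_trans tp.
by rewrite gtr_pMl.
Qed.
Lemma sin_qt_gt0 t : 0 < t < pi -> 0 < sin (q * t).
Proof. by move=> /qt_itv; exact: sin_gt0_pi. Qed.
Lemma m0_gt0 : 0 < m0.
Proof.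
by rewrite m0E cos_gtN1// t0_gt0.
Qed.
Lemma sin_t0_gt0 : 0 < sin t0. Proof. by apply: sin_t_gt0; rewrite t0_gt0 t0_lt_pi. Qed.
#[local] Hint Resolve sin_t0_gt0 m0_gt0 : core.
Lemma lam_gt0 : 0 < lam. Proof. by rewrite lamE mulr_gt0 ?powR_gt0// ?sin_t0_gt0 ?m0_gt0. Qed.
#[local] Hint Resolve subq_gt0 lam_gt0 : core.
Lemma coshDcos_gt0 y t : 0 < y -> 0 < cosh y + cos t.
Proof. by move=> y_0; have := cosh_gt1 y_0; have := cos_geN1 t; lra. Qed.

(** Stationarity in t now reads (cosh y + cos t)^(q-1) = P t. The exponent q - 1 is negative, so
    comparisons of powers are reversed with respect to [ObtuseCase], and [b] keeps the sign that
    makes [Zc] decrease. *)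
Variable P : R -> R.
Hypothesis PE : P = (fun t => lam * (sin (q * t) / sin t)).
Variable Zc : R -> R.
Hypothesis ZcE : Zc = (fun t => expR (- (1 - q)^-1 * ln (P t))).
Variable X : R -> R.
Hypothesis XE : X = (fun t => Zc t - cos t).
Variable b : R -> R.
Hypothesis bE : b = (fun t => (q * (cos (q * t) / sin (q * t)) - cos t / sin t) / (1 - q)).
Variable c : R -> R.
Hypothesis cE : c = (fun t => sin ((1 - q) * t) / sin (q * t)).
Variable kt : R -> R.
Hypothesis ktE : kt = (fun t => (1 - q) * (cos ((1 - q) * t) / sin ((1 - q) * t)) - q * (cos (q * t) / sin (q * t))).
Variable dX : R -> R.
Hypothesis dXE : dX = (fun t => sin t - Zc t * b t).
Variable E : R -> R.
Hypothesis EE : E = (fun t => P t * Zc t - lam * cos (q * t)).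
Variable H : R -> R -> R.
Hypothesis HE : H = (fun y t => (cosh y + cos t) `^ q - lam * cos (q * t)).

Lemma P_gt0 t : 0 < t < pi -> 0 < P t.
Proof. by move=> ut; rewrite PE mulr_gt0// divr_gt0 ?sin_qt_gt0 ?sin_t_gt0. Qed.
Lemma Zc_gt0 t : 0 < Zc t. Proof. by rewrite ZcE expR_gt0. Qed.
Lemma v_itv t : 0 < t < pi -> 0 < (1 - q) * t < pi.
Proof.
move=> /andP[t_0 tp]; rewrite mulr_gt0//=; apply: lt_trans tp.
by rewrite gtr_pMl// gtrBl.
Qed.
Lemma sin_v_gt0 t : 0 < t < pi -> 0 < sin ((1 - q) * t).
Proof. by move=> /v_itv; exact: sin_gt0_pi. Qed.

Lemma isd_P t : 0 < t < pi -> isd t P ((1 - q) * P t * b t).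
Proof.
move=> ut; have h1 := sin_qt_gt0 ut; have h2 := sin_t_gt0 ut; rewrite PE bE.
eapply isd_eq; [deriv; by rewrite gt_eqF|cbv beta; field].
by rewrite !gt_eqF.
Qed.

Lemma isd_Zc t : 0 < t < pi -> isd t Zc (- (Zc t * b t)).
Proof.
move=> ut; have Pu := P_gt0 ut; rewrite ZcE.
eapply isd_eq.
  apply: isd_expR; apply: isd_mul; first exact: isd_cst.
  by apply: isd_ln; [exact: Pu|exact: isd_P].
by cbv beta; field; rewrite !gt_eqF.
Qed.

Lemma isd_X t : 0 < t < pi -> isd t X (dX t).
Proof.
move=> ut; rewrite XE dXE; eapply isd_eq.
  by apply: isd_add; [exact: isd_Zc|apply: isd_opp; apply: isd_cos; exact: isd_id].
by cbv beta; ring.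
Qed.

Lemma isd_c t : 0 < t < pi -> isd t c (c t * kt t).
Proof.
move=> ut; have h1 := sin_qt_gt0 ut; have h2 := sin_v_gt0 ut.
rewrite cE ktE.
eapply isd_eq; [deriv; by rewrite gt_eqF|cbv beta; field].
by rewrite !gt_eqF.
Qed.

Lemma c_cotE t : 0 < t < pi -> c t = sin t * (cos (q * t) / sin (q * t)) - cos t.
Proof.
move=> ut; have h1 := sin_qt_gt0 ut.
by rewrite cE mulrBl mul1r sinB; field; rewrite gt_eqF.
Qed.

Lemma lam_cos t : 0 < t < pi -> lam * cos (q * t) = P t * (cos t + c t).
Proof.
move=> ut; have h1 := sin_qt_gt0 ut; have h2 := sin_t_gt0 ut; rewrite c_cotE// PE; field.
by rewrite !gt_eqF.
Qed.

Lemma E_factor t : 0 < t < pi -> E t = P t * (X t - c t).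
Proof. by move=> ut; rewrite EE XE lam_cos//; ring. Qed.

Lemma isd_E t : 0 < t < pi -> c t < X t -> 0 < E t /\ isd t E (q * E t * (dX t / (X t - c t))).
Proof.
move=> ut cX; have h1 := sin_qt_gt0 ut; have h2 := sin_t_gt0 ut.
have Xc : 0 < X t - c t by rewrite subr_gt0.
have E0 : 0 < E t by rewrite E_factor// mulr_gt0// P_gt0.
split=> //; rewrite E_factor//.
have -> : q * (P t * (X t - c t)) * (dX t / (X t - c t)) = q * P t * dX t.
  by field; rewrite gt_eqF.
rewrite EE; eapply isd_eq.
  apply: isd_add; first by apply: isd_mul; [exact: isd_P|exact: isd_Zc].
  apply: isd_opp; apply: isd_mul; first exact: isd_cst.
  by apply: isd_cos; apply: isd_mul; [exact: isd_cst|exact: isd_id].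
cbv beta; have -> : lam * (- sin (q * t) * (0 * t + q * 1)) = - (q * P t * sin t).
  by rewrite PE; field; rewrite gt_eqF.
by rewrite dXE; ring.
Qed.

(** [trig_key3] with x = q t and v = (1 - q) t. The hypothesis q <= 2/3 enters as x <= 2 v, and t <=
    t0 as x <= pi / 2. *)
Lemma curve_estimates t : 0 < t <= t0 ->
  [/\ 3 * kt t * (1 - c t) <= (1 + c t) * ((1 + cos t) * b t - sin t),
   0 < (1 + cos t) * b t - sin t, 0 < b t & c t < 1].
Proof.
move=> /andP[t_0 tt].
have tp : 0 < t < pi by rewrite t_0 (le_lt_trans tt).
have h1 := sin_qt_gt0 tp; have h2 := sin_t_gt0 tp; have h3 := sin_v_gt0 tp.
have v0 : 0 < (1 - q) * t by rewrite mulr_gt0.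
have vx : (1 - q) * t < q * t by rewrite ltr_pM2r// subq_lt.
have xv : q * t <= 2 * ((1 - q) * t) by rewrite mulrA ler_pM2r// le_subq.
have x2 : q * t <= pi / 2 by rewrite -q_t0 ler_pM2l.
have vx' : 0 < (1 - q) * t < q * t by rewrite v0.
have /= [] := trig_key3 vx' xv x2.
have xE : q * t + (1 - q) * t = t by ring.
rewrite xE.
have -> : (q * t * (cos (q * t) / sin (q * t)) - t * (cos t / sin t)) / ((1 - q) * t) = b t.
  by rewrite bE; field; rewrite !gt_eqF.
have -> : ((1 - q) * t * (cos ((1 - q) * t) / sin ((1 - q) * t)) -
    q * t * (cos (q * t) / sin (q * t))) / t = kt t.
  by rewrite ktE; field; rewrite !gt_eqF.
move=> K1 K2; split => //.
- apply: (@le_scaled _ (sin (q * t))^-1 _ _ _ _ _ _ K1); first by rewrite invr_ge0 ltW.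
  by rewrite cE; field; rewrite gt_eqF.
- have ct := cos_gtN1 tp.
  by rewrite -(pmulr_rgt0 _ ct); apply: lt_trans K2 _ => //; rewrite ltrBlDr ltrDl.
rewrite cE ltr_pdivrMr// mul1r; rewrite ltNge; apply/negP => le.
have : (sin ((1 - q) * t) = sin (q * t)).
  by apply/eqP; rewrite eq_le le andbT sin_mono ?(ltW vx)// (@le_trans _ _ 0) ?(ltW v0)// oppr_le0 divr_ge0 ?ltW.
have -> : (1 - q) * t = pi / 2 - (pi / 2 - (1 - q) * t) by ring.
have -> : q * t = pi / 2 - (pi / 2 - q * t) by ring.
rewrite !sinB !cos_pihalf !sin_pihalf !mul0r !mul1r !subr0 => EQ.
have : cos (pi / 2 - (1 - q) * t) < cos (pi / 2 - q * t).
  have pp : pi / 2 <= pi :> R by rewrite ler_pdivrMr// ler_peMr ?pi_ge0// ler1n.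
  rewrite ltr_cos ?in_itv/=.
  - by rewrite ltrD2l ltrN2.
  - by rewrite subr_ge0 x2/= lerBlDr (le_trans pp)// lerDl mulr_ge0 ?ltW.
  - by rewrite subr_ge0 (le_trans (ltW vx))//= lerBlDr (le_trans pp)// lerDl ltW.
by rewrite EQ ltxx.
Qed.

(** The two terms of [dX] have opposite signs here. The estimate on (1 + cos t) b - sin t decides
    only when Zc t >= 1 + cos t, that is, when 1 <= X t. *)
Lemma dX_lt0 t : 0 < t <= t0 -> 1 <= X t -> dX t < 0.
Proof.
move=> tt X_gt1; have [_ K2 b0 _] := curve_estimates tt.
rewrite dXE; rewrite -oppr_gt0 opprB; apply: lt_le_trans K2 _.
by rewrite lerD2r ler_wpM2r ?(ltW b0)//; move: X_gt1; rewrite XE; lra.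
Qed.

Lemma curve_crossing t : 0 < t <= t0 -> 1 < X t -> crossing_up s X dX c (fun t => c t * kt t) t.
Proof.
move=> tt Xt; rewrite /crossing_up => cuE.
have y_0 := acosh_gt0 Xt.
have c0 := ch_gt0 s1 y_0; have c1 := ch_lt1 s1 y_0.
have sy := sinh_gt0 y_0.
have cE' := acoshK (ltW Xt).
have dXn := dX_lt0 tt (ltW Xt).
move: (acosh (X t)) y_0 c0 c1 sy cuE cE' => y y_0 c0 c1 sy cuE cE'.
rewrite cuE.
have [K1 K2 b0 _] := curve_estimates tt; rewrite cuE in K1.
have QE : - dX t = (cosh y + cos t) * b t - sin t by rewrite dXE cE' XE; ring.
have Qp : 0 < - dX t by rewrite oppr_gt0.
have tp : 0 < t < pi by case/andP: tt => -> h; rewrite (le_lt_trans h).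
have h2 := sin_t_gt0 tp.
have := @W_pos _ s y (kt t) ((1 + cos t) * b t - sin t) (- dX t) s1 y_0 K2 Qp.
have W1 : cosh (y / 2) ^+ 2 * ((1 + cos t) * b t - sin t) <= - dX t.
  rewrite QE; have -> : cosh y = 1 + 2 * sinh (y / 2) ^+ 2.
    by rewrite -cosh2x; congr cosh; field.
  have -> : cosh (y / 2) ^+ 2 = 1 + sinh (y / 2) ^+ 2 by have := cosh2Bsinh2 (y / 2); lra.
  rewrite -subr_ge0.
  have -> : (1 + 2 * sinh (y / 2) ^+ 2 + cos t) * b t - sin t -
    (1 + sinh (y / 2) ^+ 2) * ((1 + cos t) * b t - sin t) =
    sinh (y / 2) ^+ 2 * ((1 - cos t) * b t + sin t) by ring.
  by rewrite mulr_ge0 ?sqr_ge0// addr_ge0 ?(ltW h2)// mulr_ge0 ?(ltW b0)// subr_ge0 cos_le1.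
move=> /(_ W1 K1) W.
move: W; rewrite -subr_gt0 => W; rewrite -subr_gt0.
have -> : - (ch s y * kh s y) * (dX t / sinh y) - ch s y * kt t - 0 =
  ch s y / sinh y * (kh s y * - dX t - kt t * sinh y) by field; rewrite gt_eqF.
by rewrite mulr_gt0// divr_gt0.
Qed.

Lemma P_t0 : P t0 = m0 `^ (q - 1).
Proof. by rewrite PE lamE q_t0 sin_pihalf mul1r mulfK// gt_eqF. Qed.

Lemma Zc_t0 : Zc t0 = m0.
Proof.
rewrite ZcE P_t0 ln_powR.
have -> : - (1 - q)^-1 * ((q - 1) * ln m0) = ln m0 by field; rewrite gt_eqF.
by rewrite lnK.
Qed.

Lemma X_t0 : X t0 = 1. Proof. by rewrite XE Zc_t0 m0E addrK. Qed.

Lemma c_t0 : c t0 = - cos t0.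
Proof. by rewrite c_cotE ?t0_gt0// q_t0 cos_pihalf mul0r mulr0 sub0r. Qed.

Lemma E_t0 : E t0 = m0 `^ q.
Proof. by rewrite EE q_t0 cos_pihalf mulr0 subr0 P_t0 Zc_t0 -powR_split. Qed.

(** [X] is known to decrease only where it is at least 1, so monotonicity is replaced by [crossing]
    applied to 1 - X. *)
Lemma X_gt1 t : 0 < t < t0 -> 1 < X t.
Proof.
move=> /andP[t_0 tt]; rewrite ltNge; apply/negP => le.
have : 0 < 1 - X t0.
  apply: (@crossing R (fun t => 1 - X t) (fun t => - dX t) t t0 tt) => [u /andP[tu ut]|u /andP[tu ut]|].
  - rewrite -[- dX u]add0r; apply: isd_add; first exact: isd_cst.
    by apply: isd_opp; apply: isd_X; rewrite (lt_le_trans t_0 tu) (le_lt_trans ut).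
  - move=> /eqP; rewrite subr_eq0 => /eqP XU; rewrite oppr_gt0 dX_lt0//.
      by rewrite (lt_le_trans t_0 tu).
    by rewrite -XU.
  - by rewrite subr_ge0.
by rewrite X_t0 subrr ltxx.
Qed.

Lemma endp : (s - 1) / s < - cos t0.
Proof.
have s0 : 0 < s := lt_trans ltr01 s1.
have mE : - cos t0 = 1 - m0 by rewrite m0E; ring.
rewrite mE ltr_pdivrMr//; move: sm; rewrite -[ltRHS]mul1r ltr_pdivlMr//.
by rewrite mulrBl mul1r mulrC; lra.
Qed.

Lemma left_curve t : 0 < t < t0 ->
  ch s (acosh (X t)) <= c t /\ q * ln m0 <= ln (E t) - q / s * ln (cosh (s * acosh (X t))).
Proof.
move=> uu; have /andP[u_0 uu0] := uu.
have sub u : 0 < u <= t0 -> 0 < u < pi by move=> /andP[-> h]; rewrite (le_lt_trans h).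
have X1' u : 0 < u <= t0 -> 1 <= X u.
  by move=> /andP[tp]; rewrite le_eqVlt => /predU1P[->|tu];
    [rewrite X_t0|apply: ltW; apply: X_gt1; rewrite tp].
have h1 u : 0 < u <= t0 -> isd u X (dX u) by move=> /sub; exact: isd_X.
have h2 u : 0 < u <= t0 -> isd u c (c u * kt u) by move=> /sub; exact: isd_c.
have h3 u : 0 < u < t0 -> dX u < 0.
  by move=> /andP[tp tu]; apply: dX_lt0; [rewrite tp ltW|apply: X1'; rewrite tp ltW].
have hc u : 0 < u <= t0 -> c u < 1 by move=> /curve_estimates[].
have h4 u : 0 < u <= t0 -> 0 < E u /\ isd u E (q * E u * (dX u / (X u - c u))).
  move=> tt; apply: isd_E; first exact: sub.
  exact: lt_le_trans (hc u tt) (X1' u tt).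
have ep : (1 < X t0 /\ c t0 = ch s (acosh (X t0))) \/ (X t0 = 1 /\ (s - 1) / s < c t0).
  by right; rewrite X_t0 c_t0; split => //; exact: endp.
have [cc KK] := curve_left s1 q_gt0 h1 h2 X_gt1 h3 hc h4 curve_crossing ep uu.
split; first exact: cc.
move: KK; rewrite /curve_K E_t0 X_t0 acosh1 mulr0 cosh0 ln1 mulr0 subr0.
by rewrite ln_powR.
Qed.

Lemma Zc_pow t : 0 < t < pi -> Zc t `^ (q - 1) = P t.
Proof.
move=> ut; rewrite ZcE -expRM.
have -> : - (1 - q)^-1 * ln (P t) * (q - 1) = ln (P t) by field; rewrite gt_eqF.
by rewrite lnK ?posrE ?P_gt0.
Qed.

Lemma HcurveE t y : 0 < t < pi -> X t = cosh y -> H y t = E t.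
Proof.
move=> ut XY; rewrite HE -XY EE XE /= subrK; congr (_ - _).
by rewrite powR_split ?Zc_gt0// Zc_pow.
Qed.

Lemma isd_H y t : 0 < y -> 0 < t < pi ->
  isd t (H y) (q * sin t * (P t - (cosh y + cos t) `^ (q - 1))).
Proof.
move=> y_0 ut; have h := sin_t_gt0 ut; rewrite HE; eapply isd_eq.
  apply: (@isd_add _ (fun t => (cosh y + cos t) `^ q) (fun t => - (lam * cos (q * t)))).
    by apply: (@isd_powR _ (fun t => cosh y + cos t)); [exact: coshDcos_gt0|deriv].
  by deriv.
by cbv beta; rewrite PE; field; rewrite gt_eqF.
Qed.

Lemma powR_anti x y : 0 < x -> x <= y -> y `^ (q - 1) <= x `^ (q - 1).
Proof.
move=> x0 xy; have y0 := lt_le_trans x0 xy.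
rewrite -(opprB 1 q) !powRN lef_pV2 ?posrE ?powR_gt0//.
by apply: ge0_ler_powR => //; rewrite ?nnegrE; apply: ltW.
Qed.

Lemma H_decr y t t' : 0 < y -> 0 < t -> t <= t' -> t' < pi ->
  (forall u, t < u < t' -> cosh y <= X u) -> H y t' <= H y t.
Proof.
move=> y_0 u_0 uu ut HX.
have sub u : t <= u <= t' -> 0 < u < pi.
  by move=> /andP[h1 h2]; rewrite (lt_le_trans u_0 h1) (le_lt_trans h2 ut).
apply: (decr_le uu) => u tt.
  by apply: isd_H => //; exact: sub.
have tt' : 0 < u < pi by apply: sub; case/andP: tt => /ltW -> /ltW ->.
rewrite mulr_ge0_le0//; first by rewrite mulr_ge0 ?ltW ?sin_t_gt0.
rewrite subr_le0 -Zc_pow//; apply: powR_anti; first exact: coshDcos_gt0.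
by have := HX u tt; rewrite XE; lra.
Qed.

Let N y := q / s * ln (cosh (s * y)).

(** The argument of [fixed_u], with the power q - 1 now decreasing. Positivity of [H] is carried
    along because the weight is subtracted from the power. *)
Lemma fixed_t t yb y : 0 < t <= t0 -> 0 <= yb -> X t <= cosh yb ->
  (forall z, yb < z -> ch s z <= c t) -> 0 < cosh yb + cos t -> 0 < H yb t ->
  q * ln m0 + N yb <= ln (H yb t) ->
  yb <= y -> 0 < H y t /\ q * ln m0 + N y <= ln (H y t).
Proof.
move=> tt yb0 Xy chc Xb Hb MH yby; have /andP[t_0 tt0] := tt.
have tp : 0 < t < pi by rewrite t_0 (le_lt_trans tt0).
have Pt := P_gt0 tp; have [_ _ _ c1] := curve_estimates tt.
have cq : 0 <= cos (q * t).
  apply: cos_ge0_pihalf; rewrite -q_t0 ler_pM2l// tt0 andbT.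
  by rewrite (@le_trans _ _ 0)// ?oppr_le0 ?mulr_ge0 ?ltW.
have cc : 0 <= cos t + c t.
  rewrite c_cotE// addrCA subrr addr0.
  by apply: mulr_ge0; [exact: ltW (sin_t_gt0 tp)|apply: divr_ge0 => //; exact: ltW (sin_qt_gt0 tp)].
have chh z : yb <= z -> cosh yb <= cosh z by move=> bz; apply: cosh_le; rewrite yb0.
have Zp z : yb <= z -> 0 < cosh z + cos t by move=> /chh; lra.
have PZ z : yb <= z -> (cosh z + cos t) `^ (q - 1) <= P t.
  move=> bz; rewrite -Zc_pow//; apply: powR_anti; first exact: Zc_gt0.
  by have := chh z bz; move: Xy; rewrite XE; lra.
have Hp z : yb <= z -> 0 < H z t.
  move=> ybz; apply: lt_le_trans Hb _; rewrite HE lerD2r.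
  apply: ge0_ler_powR; rewrite ?nnegrE ?(ltW (Zp _ _)) ?(ltW q_gt0) ?(ltW Xb)//.
  by rewrite lerD2r chh.
split; first exact: Hp.
suff : ln (H yb t) - N yb <= ln (H y t) - N y by move: MH; lra.
apply: (@incr_le R (fun z => ln (H z t) - N z) (fun z => q * ((cosh z + cos t) `^ (q - 1) * sinh z / H z t
   - sinh (s * z) / cosh (s * z))) _ _ yby) => z /andP[ybz zy].
  have Hz := Hp z ybz; have cz := cosh_gt0 (s * z); have s0 : 0 < s by exact: lt_trans ltr01 s1.
  eapply isd_eq.
    apply: isd_add.
      apply: isd_ln; first exact: Hz.
      rewrite HE; apply: (@isd_add _ (fun z => (cosh z + cos t) `^ q) (fun=> - (lam * cos (q * t)))).
        by apply: (@isd_powR _ (fun z => cosh z + cos t)); [exact: Zp|deriv].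
      exact: isd_cst.
    by rewrite /N; deriv; exact: cosh_gt0.
  cbv beta; move: (H z t) Hz => Hzu Hz; move: (_ `^ _) => W.
  by field; rewrite !gt_eqF.
have z0 : 0 < z by apply: le_lt_trans ybz.
have zz : yb <= z by exact: ltW.
rewrite mulr_ge0 ?(ltW q_gt0)// subr_ge0 tanh_ch// -mulrA mulrCA ler_pM2l ?sinh_gt0//.
have c_1 := ch_lt1 s1 z0; have C1 := cosh_gt1 z0.
have Xc : 0 < cosh z - ch s z by rewrite subr_gt0 (lt_trans c_1).
rewrite -[leLHS]mul1r ler_pdivrMr// mulrAC ler_pdivlMr ?Hp// mul1r.
rewrite HE powR_split ?Zp// lam_cos//.
have PZz := PZ z zz; have W0 := powR_ge0 (cosh z + cos t) (q - 1).
apply: (@le_trans _ _ ((cosh z + cos t) `^ (q - 1) * (cosh z + cos t - (cos t + c t)))).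
  by rewrite [leRHS]mulrBr lerD2l lerN2 ler_wpM2r.
by rewrite ler_wpM2l// opprD addrA addrK lerD2l lerN2 chc// (le_lt_trans ybz).
Qed.

Lemma base_t0 y : 0 <= y -> 0 < H y t0 /\ q * ln m0 + N y <= ln (H y t0).
Proof.
move=> y_0; have tt : 0 < t0 <= t0 by rewrite t0_gt0 lexx.
have H0 : H 0 t0 = m0 `^ q by rewrite HcurveE ?E_t0 ?X_t0 ?cosh0 ?t0_gt0.
apply: (@fixed_t t0 0 y) => //.
- by rewrite X_t0 cosh0.
- by move=> z z0; rewrite c_t0; apply: ltW; apply: lt_trans endp; exact: ch_lt.
- by rewrite cosh0 -m0E.
- by rewrite H0 powR_gt0.
- by rewrite H0 ln_powR /N mulr0 cosh0 ln1 mulr0 addr0.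
Qed.

Lemma on_left y t : 0 < t < t0 -> 0 <= y -> X t <= cosh y ->
  0 < H y t /\ q * ln m0 + N y <= ln (H y t).
Proof.
move=> tt y_0 Xy; have /andP[t_0 tt0] := tt.
have tp : 0 < t < pi by rewrite t_0 (lt_trans tt0).
have tt' : 0 < t <= t0 by rewrite t_0 ltW.
have Xt := X_gt1 tt; have [cc KK] := left_curve tt.
have [_ _ _ c1] := curve_estimates tt'.
have HE' : H (acosh (X t)) t = E t by rewrite HcurveE// acoshK// ltW.
have yb := acosh_gt0 Xt.
apply: (@fixed_t t (acosh (X t)) y) => //.
- exact: ltW.
- by rewrite acoshK// ltW.
- by move=> z yz; apply: le_trans cc; apply: ch_decr => //; exact: ltW.
- exact: coshDcos_gt0.
- by rewrite HE'; apply: (isd_E tp (lt_trans c1 Xt)).1.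
- by rewrite HE' /N; move: KK; lra.
rewrite leNgt; apply/negP => lt2.
have := @cosh_lt R y (acosh (X t)); rewrite lt2 y_0 => /(_ isT).
by rewrite acoshK ?(ltW Xt)// ltNge Xy.
Qed.

Lemma left_part y t : 0 < y -> 0 < t <= t0 -> 0 < H y t /\ q * ln m0 + N y <= ln (H y t).
Proof.
move=> y_0 /andP[t_0]; rewrite le_eqVlt => /predU1P[->|tt].
  by apply: base_t0; exact: ltW.
have tl : 0 < t < t0 by rewrite t_0.
have [Xy|yX] := leP (X t) (cosh y); first by apply: on_left => //; exact: ltW.
have [u /andP[tu ut] XU] : exists2 u, t <= u <= t0 & X u = cosh y.
  apply: (@ivt_decr R X dX t t0) => //; first exact: ltW.
    by move=> w /andP[w1 w2]; apply: isd_X; rewrite (lt_le_trans t_0 w1) (le_lt_trans w2).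
  by rewrite X_t0 cosh_ge1 ltW.
have u_0 := lt_le_trans t_0 tu.
have [Hu Mu] : 0 < H y u /\ q * ln m0 + N y <= ln (H y u).
  move: ut; rewrite le_eqVlt => /predU1P[->|ut]; first by apply: base_t0; exact: ltW.
  by apply: on_left; rewrite ?XU ?(ltW y_0) ?u_0.
have le : H y u <= H y t.
  apply: H_decr => //; first exact: le_lt_trans ut _.
  move=> w /andP[w1 w2]; rewrite -XU.
  apply: ltW; apply: (@decr_lt R X dX _ _ w2) => z /andP[z1 z2].
    apply: isd_X; rewrite (lt_le_trans (lt_trans t_0 w1) z1) (le_lt_trans z2)//.
    exact: le_lt_trans ut _.
  have z0 : 0 < z by apply: lt_trans z1; exact: lt_trans w1.
  have zt : z < t0 by apply: lt_le_trans ut.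
  by apply: dX_lt0; [rewrite z0 ltW|apply: ltW; apply: X_gt1; rewrite z0].
split; first exact: lt_le_trans le.
by apply: (le_trans Mu); rewrite ler_ln ?posrE// (lt_le_trans Hu).
Qed.

(** Beyond [t0] the curve is replaced by this bound: the angular derivative of [H] is nonnegative
    already for cosh y = 1, hence for every y, so [H y] increases from [t0] on. *)
Lemma tail_le_P t : t0 <= t < pi -> (1 + cos t) `^ (q - 1) <= P t.
Proof.
move=> /andP[tt tpi].
have sub u : t0 <= u <= t -> 0 < u < pi.
  by move=> /andP[h1 h2]; rewrite (lt_le_trans t0_gt0 h1) (le_lt_trans h2).
have tp : 0 < t < pi by apply: sub; rewrite tt lexx.
have h1 := sin_qt_gt0 tp; have h2 := sin_t_gt0 tp; have h3 := cos_gtN1 tp.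
rewrite -ler_ln ?posrE ?powR_gt0 ?P_gt0// ln_powR PE lnM ?posrE ?divr_gt0// ln_div ?posrE//.
suff : ln (sin (q * t0)) - ln (sin t0) - (q - 1) * ln (1 + cos t0) <=
    ln (sin (q * t)) - ln (sin t) - (q - 1) * ln (1 + cos t).
  rewrite q_t0 sin_pihalf ln1 sub0r -m0E lamE lnM ?posrE ?powR_gt0// ln_powR.
  by move=> h; apply: (@le_scaled _ 1 _ _ _ _ _ _ h); [|ring].
apply: (@incr_le R (fun t => ln (sin (q * t)) - ln (sin t) - (q - 1) * ln (1 + cos t))
  (fun t => q * (cos (q * t) / sin (q * t)) - cos t / sin t + (q - 1) * (sin t / (1 + cos t))) _ _ tt) => u tu.
  have up := sub u tu; have k1 := sin_qt_gt0 up; have k2 := sin_t_gt0 up; have k3 := cos_gtN1 up.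
  eapply isd_eq; [deriv|cbv beta] => //.
  by field; rewrite !gt_eqF.
have /andP[u1 u2] := tu; apply: acute_tail => //; first by rewrite -t0E ltW.
exact: lt_trans u2 _.
Qed.

Lemma acute_open y t : 0 < y -> 0 < t < pi ->
  cosh (s * y) `^ (q / s) <= m0^-1 `^ q * ((cosh y + cos t) `^ q - lam * cos (q * t)).
Proof.
move=> y_0 tp; have /andP[t_0 tpi] := tp.
have [H0 MH] : 0 < H y t /\ q * ln m0 + N y <= ln (H y t).
  have [tt|tt] := leP t t0; first by apply: left_part => //; rewrite t_0.
  have [H0 MH] : 0 < H y t0 /\ q * ln m0 + N y <= ln (H y t0) by apply: base_t0; exact: ltW.
  have le : H y t0 <= H y t.
    apply: (incr_le (ltW tt) (df := fun t => (q * sin t * (P t - (cosh y + cos t) `^ (q - 1))))) => u /andP[u1 u2].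
      by apply: isd_H => //; rewrite (lt_le_trans t0_gt0 u1) (le_lt_trans u2).
    have up : 0 < u < pi by rewrite (lt_trans t0_gt0 u1) (lt_trans u2).
    rewrite mulr_ge0//; first by rewrite mulr_ge0 ?ltW ?sin_t_gt0.
    rewrite subr_ge0; apply: le_trans (tail_le_P (t := u) _); last by rewrite ltW//= (lt_trans u2).
    by apply: powR_anti; [exact: cos_gtN1|rewrite lerD2r cosh_ge1].
  split; first exact: lt_le_trans le.
  by apply: (le_trans MH); rewrite ler_ln ?posrE// (lt_le_trans H0).
have Bp : 0 < m0^-1 `^ q by rewrite powR_gt0// invr_gt0.
rewrite HE in H0 MH.
rewrite -ler_ln ?posrE; [|by rewrite powR_gt0 ?cosh_gt0|by apply: mulr_gt0].
rewrite lnM ?posrE// !ln_powR lnV ?posrE//.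
by apply: (@le_scaled _ 1 _ _ _ _ _ _ MH); [|rewrite /N; ring].
Qed.

End AcuteCase.
End AcuteCase.

Section MajorantAcute.
Variable R : realType.
Implicit Types (q s y t : R).

Lemma closure_acute (q lam B : R) (N : R -> R) : 1 / 2 < q -> 0 <= B ->
  (forall y, {for y, continuous N}) ->
  (forall y t, 0 < y -> 0 < t < pi -> N y <= B * ((cosh y + cos t) `^ q - lam * cos (q * t))) ->
  forall y t, 0 <= y -> 0 <= t <= pi -> N y <= B * ((cosh y + cos t) `^ q - lam * cos (q * t)).
Proof.
move=> q12 B0 Nc H; have q0 : 0 < q by lra.
have pi0 : 0 < pi :> R := pi_gt0 R.
have Fc y u : 0 < cosh y + cos u -> {for u, continuous (fun u => B * ((cosh y + cos u) `^ q - lam * cos (q * u)) - N y)}.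
  move=> cc; apply: isd_cont; apply: isd_add; last exact: isd_cst.
  apply: isd_mul; first exact: isd_cst.
  apply: (@isd_add _ (fun t => (cosh y + cos t) `^ q) (fun t => - (lam * cos (q * t)))).
    by apply: (@isd_powR _ (fun t => cosh y + cos t)); [exact: cc|deriv].
  by deriv.
have S1 y t : 0 <= y -> 0 < t < pi -> N y <= B * ((cosh y + cos t) `^ q - lam * cos (q * t)).
  rewrite le_eqVlt => /predU1P[<-|y0] tp; last exact: H.
  rewrite -subr_ge0.
  apply: (@ge0_right R (fun y => B * ((cosh y + cos t) `^ q - lam * cos (q * t)) - N y)).
    apply: continuousB; last exact: Nc.
    apply: isd_cont; apply: isd_mul; first exact: isd_cst.
    apply: (@isd_add _ (fun z => (cosh z + cos t) `^ q)); last exact: isd_cst.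
    apply: (@isd_powR _ (fun z => cosh z + cos t)); last by apply: isd_add; [apply: isd_cosh; exact: isd_id|deriv].
    rewrite cosh0; exact: (cos_gtN1 tp).
  by exists 1 => // h /andP[h0 _]; rewrite add0r subr_ge0 H.
have S2 y t : 0 <= y -> 0 <= t < pi -> N y <= B * ((cosh y + cos t) `^ q - lam * cos (q * t)).
  move=> y0 /andP[]; rewrite le_eqVlt => /predU1P[<- _|t0 tp]; last by apply: S1; rewrite ?t0.
  rewrite -subr_ge0; apply: (ge0_right (Fc y 0 _)).
    by rewrite cos0 addr_gt0// cosh_gt0.
  by exists pi => // h hh; rewrite add0r subr_ge0 S1.
move=> y t y0 /andP[t0]; rewrite le_eqVlt => /predU1P[->|tp]; last by apply: S2; rewrite ?t0.
move: y0; rewrite le_eqVlt => /predU1P[<-|y0].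
  (* At y = 0, t = pi the base of the power vanishes. Near it 1 + cos t is the square of sqrt 2 cos
     (t / 2), a number in [0, 1]; since 2 q > 1, the power is at most sqrt 2 cos (t / 2), and this
     bound passes to the limit. *)
  rewrite cosh0 cospi subrr powR0 ?gt_eqF//.
  rewrite -subr_ge0.
  have -> : B * (0 - lam * cos (q * pi)) - N 0 =
    B * (Num.sqrt 2 * cos (pi / 2) - lam * cos (q * pi)) - N 0 by rewrite cos_pihalf mulr0.
  apply: (@ge0_left R (fun t => B * (Num.sqrt 2 * cos (t / 2) - lam * cos (q * t)) - N 0)).
    by apply: isd_cont; deriv.
  have p3 : 0 < pi / 3 :> R by rewrite divr_gt0.
  exists (pi / 3) => // h /andP[h0 h1]; rewrite subr_ge0.
  have hp : 0 < pi - h < pi.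
    rewrite gtrBl h0 andbT subr_gt0 (lt_trans h1)// ltr_pdivrMr// ltr_pMr// ltr1n//.
  apply: le_trans (S1 0 (pi - h) (lexx 0) hp) _.
  rewrite ler_wpM2l// lerD2r cosh0.
  have [z zE] : exists z, z = cos ((pi - h) / 2) by eexists.
  have z0 : 0 <= z by rewrite zE; apply: cos_ge0_pihalf; apply/andP; split; lra.
  have -> : 1 + cos (pi - h) = (Num.sqrt 2 * z) ^+ 2.
    have -> : pi - h = (pi - h) / 2 + (pi - h) / 2 by field.
    by rewrite cosDD' -zE exprMn sqr_sqrtr.
  rewrite -zE -powR_mulrn ?mulr_ge0 ?sqrtr_ge0// -powRrM; apply: powR_le_self; first by lra.
  rewrite mulr_ge0 ?sqrtr_ge0//= -(@ler_pXn2r _ 2)// ?nnegrE ?mulr_ge0 ?sqrtr_ge0//.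
  rewrite expr1n exprMn sqr_sqrtr//.
  have zh : z <= h / 2.
    rewrite zE; have -> : (pi - h) / 2 = pi / 2 - h / 2 by field.
    rewrite cosB cos_pihalf sin_pihalf mul0r add0r mul1r; apply: sin_le.
    by rewrite divr_ge0// ltW.
  have p32 := pi_lt_32 R.
  have : z * z <= (6 / 10) * (6 / 10) by apply: ler_pM => //; lra.
  by rewrite -expr2; lra.
rewrite -subr_ge0; apply: (ge0_left (Fc y pi _)).
  by rewrite cospi subr_gt0 cosh_gt1.
exists pi => // h /andP[h0 hh]; rewrite subr_ge0; apply: S1; first exact: ltW.
by rewrite subr_gt0 hh gtrBl.
Qed.

Lemma majorant_acute q s : 1 / 2 < q -> q <= 2 / 3 -> 0 < s ->
  s <= (1 + cos (pi / (2 * q)))^-1 ->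
  pointwise_majorant q s (1 + cos (pi / (2 * q)))^-1 (fun t => cos (q * t)).
Proof.
move=> q12 q23 s0 sS; have q0 : 0 < q by lra.
have pi0 : 0 < pi :> R := pi_gt0 R.
have t0p : 0 < pi / (2 * q) < pi.
  rewrite divr_gt0 ?mulr_gt0//= ltr_pdivrMr ?mulr_gt0// ltr_pMr//; lra.
have m0 := cos_gtN1 t0p; have st := sin_gt0_pi t0p.
have ct : cos (pi / (2 * q)) < 0.
  have -> : pi / (2 * q) = pi / 2 + (pi / (2 * q) - pi / 2) by ring.
  have h : 0 < pi / (2 * q) - pi / 2 < pi.
    have : pi / 2 < pi / (2 * q) by rewrite ltr_pM2l// ltf_pV2 ?posrE ?mulr_gt0//; lra.
    by case/andP: t0p => _ ?; move=> ?; apply/andP; split; lra.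
  by rewrite cosD cos_pihalf sin_pihalf mul0r sub0r mul1r oppr_lt0 sin_gt0_pi.
have L s' (h : 1 < s') (h' : s' < (1 + cos (pi / (2 * q)))^-1) :=
  @AcuteCase.acute_open R q s' q12 q23 h _ erefl _ erefl h' _ erefl _ erefl _ erefl _ erefl _ erefl _ erefl _ erefl
   _ erefl _ erefl _ erefl.
move: m0 ct st sS L; set k := cos (pi / (2 * q)); set S := sin _ => km ct st sS L.
have S1 : 1 < (1 + k)^-1 by rewrite -[ltLHS]invr1 ltf_pV2 ?posrE//; lra.
set lam := (1 + k) `^ (q - 1) * S.
have H s' y t : s' < (1 + k)^-1 -> 0 < s' -> 0 <= y -> 0 <= t <= pi ->
    cosh (s' * y) `^ (q / s') <= (1 + k)^-1 `^ q * ((cosh y + cos t) `^ q - lam * cos (q * t)).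
  move=> s'1 s'0 y0 tt.
  pose s2 := Num.max s' ((1 + (1 + k)^-1) / 2).
  have h1 : 1 < s2 by rewrite lt_max; apply/orP; right; clear -S1; lra.
  have h2 : s2 < (1 + k)^-1 by rewrite gt_max s'1/=; clear -S1; lra.
  apply: le_trans (_ : cosh (s2 * y) `^ (q / s2) <= _).
    by apply: power_mean_cosh => //; [exact: ltW|rewrite le_max lexx].
  by apply: (closure_acute q12 (powR_ge0 _ _) (@cont_Ncosh R q s2)) => //; exact: L.
exists lam; first by rewrite mulr_ge0 ?powR_ge0// ltW.
move=> y t y0 tt; move: sS; rewrite le_eqVlt => /predU1P[->|sS]; last exact: H.
rewrite -subr_ge0.
apply: (@ge0_left R (fun s => (1 + k)^-1 `^ q * ((cosh y + cos t) `^ q - lam * cos (q * t))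
   - cosh (s * y) `^ (q / s))).
  apply: continuousB; first exact: cst_continuous.
  have S0 : 0 < (1 + k)^-1 by rewrite invr_gt0.
  rewrite (_ : (fun s => cosh (s * y) `^ (q / s)) = fun s => expR (q / s * ln (cosh (s * y)))); last first.
    by apply/funext => z; rewrite /powR gt_eqF ?cosh_gt0.
  by apply: isd_cont; deriv; rewrite ?cosh_gt0 ?gt_eqF.
exists (1 + k)^-1; first by rewrite invr_gt0.
move=> h /andP[h0 h1]; rewrite subr_ge0; apply: H => //.
  by rewrite ltrBlDr ltrDl.
by rewrite subr_gt0.
Qed.

End MajorantAcute.

(** * Homogeneous form in the complex plane *)

Local Open Scope complex_scope.

(** The arc cosine folds the argument to [0, pi], so the weight takes equal values at conjugate
    points. *)
Definition homog (R : realType) (q : R) (phi : R -> R) (z : R[i]) : R :=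
  cabs z `^ q * phi (acos (complex.Re z / cabs z)).

Section Homogenize.
Variable R : realType.
Implicit Types (a b t q s B : R) (w z : R[i]) (phi : R -> R).

Lemma cabs_sqr z : cabs z ^+ 2 = complex.Re z ^+ 2 + complex.Im z ^+ 2.
Proof. by case: z => x y; rewrite /cabs /= sqr_sqrtr// addr_ge0// sqr_ge0. Qed.

Lemma cabs_ge0 z : 0 <= cabs z.
Proof. by case: z => x y; rewrite /cabs /= sqrtr_ge0. Qed.

Lemma cabsM w z : cabs (w * z) = cabs w * cabs z.
Proof. exact: ComplexField.Normc.normcM. Qed.

Lemma cabs_eq0 z : cabs z = 0 -> z = 0.
Proof. exact: ComplexField.Normc.eq0_normc. Qed.

Lemma Re_cabs z : - cabs z <= complex.Re z <= cabs z.
Proof.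
rewrite -ler_norml -(@ler_pXn2r _ 2)// ?nnegrE ?cabs_ge0// cabs_sqr real_normK ?num_real//.
by rewrite lerDl sqr_ge0.
Qed.

(** Let y tend to infinity at an angle where the weight vanishes. With d = e^(-y), cosh (s y)^(1/s)
    is at least 2^(-1/s) e^y, while B (cosh y + 1) = e^y (B / 2) (1 + d)^2. *)
Lemma majorant_ge1 q s B phi t1 : 0 < q -> 0 < s -> 0 <= B -> 0 <= t1 <= pi -> phi t1 = 0 ->
  pointwise_majorant q s B phi -> 1 <= 2 `^ (s^-1 - 1) * B.
Proof.
move=> q0 s0 B0 t1p phi1 [lam lam0 H].
have K y : 0 <= y -> cosh (s * y) `^ s^-1 <= B * (cosh y + cos t1).
  move=> y0; have := H y t1 y0 t1p; rewrite phi1 mulr0 subr0.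
  have cc : 0 <= cosh y + cos t1 by have := cosh_ge1 y; have := cos_geN1 t1; lra.
  rewrite -powRM// [q / s]mulrC powRrM.
  move=> h; rewrite leNgt; apply/negP => lt; move: h; rewrite leNgt => /negP; apply.
  by apply: gt0_ltr_powR; rewrite ?nnegrE ?powR_ge0// mulr_ge0.
have T : 2 `^ (s^-1 - 1) = expR (s^-1 * ln 2) / 2 :> R.
  by rewrite /powR pnatr_eq0/= mulrBl mul1r expRB lnK// posrE.
rewrite T.
have L d : 0 < d <= 1 -> 0 <= expR (s^-1 * ln 2) / 2 * B * (1 + d) ^+ 2 - 1.
  move=> /andP[d0 d1]; rewrite subr_ge0.
  have [y dE] : exists y, d = expR (- y) by exists (- ln d); rewrite opprK lnK.
  have y0 : 0 <= y by rewrite -oppr_le0 -expR_le1 -dE.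
  have h1 : expR (y - s^-1 * ln 2) <= cosh (s * y) `^ s^-1.
    rewrite /powR gt_eqF ?cosh_gt0// ler_expR.
    have -> : y - s^-1 * ln 2 = s^-1 * (s * y - ln 2) by field; rewrite gt_eqF.
    have := @ler_ln R (expR (s * y) / 2) (cosh (s * y)).
    rewrite !posrE cosh_gt0 divr_gt0 ?expR_gt0// => /(_ isT isT).
    rewrite ln_div ?posrE ?expR_gt0// expRK ler_pM2l ?invr_gt0// => ->.
    by rewrite coshE ler_pM2r// lerDl expR_ge0.
  have h2 : B * (cosh y + cos t1) <= expR y * (B / 2 * (1 + d) ^+ 2).
    have -> : expR y * (B / 2 * (1 + d) ^+ 2) = B * (cosh y + 1).
      rewrite dE coshE expRN; have := expR_gt0 y; move: (expR y) => E E0.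
      by field; rewrite gt_eqF.
    by rewrite ler_wpM2l// lerD2l cos_le1.
  have := le_trans (le_trans h1 (K y y0)) h2.
  rewrite expRB ler_pdivrMr ?expR_gt0//.
  have -> : expR y * (B / 2 * (1 + d) ^+ 2) * expR (s^-1 * ln 2) =
    expR y * (expR (s^-1 * ln 2) / 2 * B * (1 + d) ^+ 2) by ring.
  by rewrite -[leLHS]mulr1 ler_pM2l ?expR_gt0.
rewrite -subr_ge0.
have -> : expR (s^-1 * ln 2) / 2 * B - 1 = expR (s^-1 * ln 2) / 2 * B * (1 + 0) ^+ 2 - 1.
  by rewrite addr0 expr1n mulr1.
apply: (@ge0_right R (fun d => expR (s^-1 * ln 2) / 2 * B * (1 + d) ^+ 2 - 1)).
  by apply: isd_cont; deriv.
by exists 1 => // h /andP[h0 h1]; rewrite add0r L// h0 ltW.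
Qed.

(** For positive a = e^al and b = e^be put y = al - be and factor out the q-th power of a b. When
    one of them is 0 no y exists, and the claim is [majorant_ge1]. *)
Lemma majorant_homog q s B phi t1 : 0 < q -> 0 < s -> 0 < B -> 0 <= t1 <= pi -> phi t1 = 0 ->
  pointwise_majorant q s B phi ->
  exists2 C, 0 <= C & forall a b t, 0 <= a -> 0 <= b -> 0 <= t <= pi ->
    (a `^ (2 * s) + b `^ (2 * s)) `^ (q / s) + C * ((a * b) `^ q * phi t) <=
    (2 `^ (s^-1 - 1) * B) `^ q * (a ^+ 2 + b ^+ 2 + 2 * (a * b) * cos t) `^ q.
Proof.
move=> q0 s0 B0 t1p phi1 maj; have A1 := majorant_ge1 q0 s0 (ltW B0) t1p phi1 maj.
case: maj => lam lam0 H.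
have AE : (2 `^ (s^-1 - 1) * B) `^ q = expR (q / s * ln 2 - q * ln 2) * B `^ q.
  rewrite powRM ?powR_ge0// ?(ltW B0)//; congr (_ * _).
  by rewrite -powRrM /powR pnatr_eq0/=; congr expR; field; rewrite gt_eqF.
have A0 : 1 <= (2 `^ (s^-1 - 1) * B) `^ q.
  have := @ge0_ler_powR R q (ltW q0) 1 (2 `^ (s^-1 - 1) * B).
  by rewrite powR1 !nnegrE ler01 (le_trans ler01 A1); apply.
exists (expR (q / s * ln 2) * B `^ q * lam).
  by rewrite !mulr_ge0 ?expR_ge0 ?powR_ge0.
have s2 : 2 * s != 0 by rewrite mulf_neq0 ?pnatr_eq0 ?gt_eqF.
have Z a t : 0 <= a -> (a `^ (2 * s)) `^ (q / s) <= (2 `^ (s^-1 - 1) * B) `^ q * (a ^+ 2) `^ q.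
  move=> a0; rewrite -[leLHS]mul1r -powRrM.
  have -> : 2 * s * (q / s) = 2 * q by field; rewrite gt_eqF.
  rewrite -(powR_mulrn 2 a0) -powRrM.
  by rewrite ler_wpM2r ?powR_ge0.
suff W a b t : 0 <= b -> b <= a -> 0 <= t <= pi ->
   (a `^ (2 * s) + b `^ (2 * s)) `^ (q / s) + expR (q / s * ln 2) * B `^ q * lam * ((a * b) `^ q * phi t) <=
    (2 `^ (s^-1 - 1) * B) `^ q * (a ^+ 2 + b ^+ 2 + 2 * (a * b) * cos t) `^ q.
  move=> a b t a0 b0 tp; have [ba|ab] := leP b a; first exact: W.
  rewrite [a `^ _ + _]addrC [a ^+ 2 + _]addrC [a * b]mulrC; apply: W => //; exact: ltW.
rewrite le_eqVlt => /predU1P[<-|b0] ba tp.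
  rewrite !mulr0 (powR0 s2) [0 `^ q]powR0 ?gt_eqF// !mul0r !mulr0 !addr0 expr0n /= !addr0.
  exact: Z.
have a0 := lt_le_trans b0 ba.
have [al aE] : exists al, a = expR al by exists (ln a); rewrite lnK.
have [be bE] : exists be, b = expR be by exists (ln b); rewrite lnK.
have y0 : 0 <= al - be by rewrite subr_ge0 -ler_expR -aE -bE.
have h := H (al - be) t y0 tp.
have C0 := cosh_gt0 (s * (al - be)).
have e1 : (a `^ (2 * s) + b `^ (2 * s)) `^ (q / s) =
    expR (q * (al + be) + q / s * ln 2) * cosh (s * (al - be)) `^ (q / s).
  have -> : a `^ (2 * s) + b `^ (2 * s) = expR (s * (al + be) + ln 2) * cosh (s * (al - be)).
    have -> : a `^ (2 * s) = expR (s * (al + be)) * expR (s * (al - be)).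
      by rewrite aE -expRM -expRD; congr expR; ring.
    have -> : b `^ (2 * s) = expR (s * (al + be)) * expR (- (s * (al - be))).
      by rewrite bE -expRM -expRD; congr expR; ring.
    rewrite coshE expRD lnK ?posrE//.
    by move: (expR _) (expR _) (expR _) => *; field.
  rewrite powRM ?expR_ge0 ?(ltW C0)// -expRM; congr (expR _ * _).
  by field; rewrite gt_eqF.
have e2 : (a * b) `^ q = expR (q * (al + be)).
  by rewrite aE bE -expRD -expRM; congr expR; ring.
have e3 : (a ^+ 2 + b ^+ 2 + 2 * (a * b) * cos t) `^ q =
    expR (q * (al + be) + q * ln 2) * (cosh (al - be) + cos t) `^ q.
  have -> : a ^+ 2 + b ^+ 2 + 2 * (a * b) * cos t = expR (al + be + ln 2) * (cosh (al - be) + cos t).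
    rewrite coshE opprB !expRD lnK ?posrE// !expRN -aE -bE.
    by field; rewrite !gt_eqF.
  have cc : 0 <= cosh (al - be) + cos t by have := cosh_ge1 (al - be); have := cos_geN1 t; lra.
  by rewrite powRM ?expR_ge0// -expRM; congr (expR _ * _); ring.
rewrite e1 e2 e3 AE -lerBrDr.
have -> : expR (q / s * ln 2 - q * ln 2) * B `^ q *
   (expR (q * (al + be) + q * ln 2) * (cosh (al - be) + cos t) `^ q) -
   expR (q / s * ln 2) * B `^ q * lam * (expR (q * (al + be)) * phi t) =
   expR (q * (al + be) + q / s * ln 2) * (B `^ q * ((cosh (al - be) + cos t) `^ q - lam * phi t)).
  rewrite expRB !expRD; have := expR_gt0 (q * ln 2 : R).
  move: (expR (q * ln 2)) => E E0.
  by field; rewrite gt_eqF.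
by rewrite ler_pM2l ?expR_gt0.
Qed.

Lemma majorant_complex p s B phi t1 : 0 < p -> 0 < s -> 0 < B -> 0 <= t1 <= pi -> phi t1 = 0 ->
  pointwise_majorant (p / 2) (s / 2) B phi ->
  exists2 C, 0 <= C & forall w z,
    (cabs w `^ s + cabs z `^ s) `^ (p / s) + C * homog (p / 2) phi (w * z) <=
    (2 `^ (s^-1 - 2^-1) * Num.sqrt B * cabs (w + z^*)) `^ p.
Proof.
move=> p0 s0 B0 t1p phi1 maj.
have p2 : 0 < p / 2 by rewrite divr_gt0.
have s2 : 0 < s / 2 by rewrite divr_gt0.
have [C C0 H] := majorant_homog p2 s2 B0 t1p phi1 maj.
exists C => // w z; set t := acos (complex.Re (w * z) / cabs (w * z)).
have [tp ctE] : 0 <= t <= pi /\ cabs (w * z) * cos t = complex.Re (w * z).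
  have [wz0|wz0] := eqVneq (cabs (w * z)) 0.
    rewrite wz0 mul0r (cabs_eq0 wz0) /=; split => //.
    by rewrite /t wz0 invr0 mulr0 acos0 divr_ge0 ?pi_ge0//= ler_pdivrMr// ler_peMr ?pi_ge0// ler1n.
  have wzp : 0 < cabs (w * z) by rewrite lt_neqAle eq_sym wz0 cabs_ge0.
  have /andP[h1 h2] := Re_cabs (w * z).
  have b1 : -1 <= complex.Re (w * z) / cabs (w * z) <= 1.
    by rewrite ler_pdivlMr// mulN1r h1 ler_pdivrMr// mul1r.
  have [h3 h4] := acos_def b1; split; first exact: h3.
  by rewrite /t h4 mulrCA mulfV ?mulr1.
have := H (cabs w) (cabs z) t (cabs_ge0 _) (cabs_ge0 _) tp.
have -> : 2 * (s / 2) = s by field.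
have -> : p / 2 / (s / 2) = p / s by field; rewrite gt_eqF.
rewrite -cabsM /homog -/t => /le_trans; apply.
rewrite le_eqVlt; apply/orP; left; apply/eqP.
have pE : p = 2%:R * (p / 2) by field.
have A0 : 0 <= 2 `^ (s^-1 - 2^-1) * Num.sqrt B by rewrite mulr_ge0 ?powR_ge0 ?sqrtr_ge0.
rewrite [RHS]powRM ?cabs_ge0//; congr (_ * _).
  rewrite (_ : (s / 2)^-1 - 1 = (s^-1 - 2^-1) * 2%:R); last by field; rewrite gt_eqF.
  rewrite [in RHS]pE [RHS]powRrM powR_mulrn// exprMn sqr_sqrtr ?(ltW B0)//.
  by rewrite [2 `^ (_ * 2%:R)]powRrM powR_mulrn ?powR_ge0.
rewrite [in RHS]pE [RHS]powRrM powR_mulrn ?cabs_ge0//.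
congr (_ `^ _); rewrite -mulrA ctE !cabs_sqr; case: w z {H tp ctE A0 t} => [a b] [c d] /=.
by ring.
Qed.

End Homogenize.

(** * Subharmonicity of the weight *)

Section BranchTaylor.
Variable R : realType.
Implicit Types (r b g s x a : R).

Lemma isd_atan (f : R -> R) x d : isd x f d -> isd x (fun t => atan (f t)) ((1 + f x ^+ 2)^-1 * d).
Proof. by move=> fd; apply: (@isd_comp R atan f _ (1 + f x ^+ 2)^-1) => //; exact: is_derive1_atan. Qed.

Lemma sin_atan x : sin (atan x) = x * cos (atan x).
Proof.
have c0 : 0 < cos (atan x) by rewrite cos_atan invr_gt0 sqrtr_gt0 ltr_pwDl// sqr_ge0.
by have h := atanK x; rewrite -[X in _ = X * _]h /tan divfK// gt_eqF.
Qed.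

(** With zeta = e^(ig) and 0 <= s < 1, [sqn] is the squared modulus of 1 + s zeta, [arg_at] its
    principal argument, and [branch] the real part of e^(ib) (1 + s zeta)^r. *)
Definition sqn g s : R := (1 + s * cos g) ^+ 2 + (s * sin g) ^+ 2.
Definition arg_at g s : R := atan (s * sin g / (1 + s * cos g)).
Definition branch r b g s : R := sqn g s `^ (r / 2) * cos (b + r * arg_at g s).

Lemma re_half g s : 0 <= s <= 1 / 2 -> 1 / 2 <= 1 + s * cos g.
Proof.
move=> /andP[s0 s1]; have : - 1 <= cos g := cos_geN1 g => c1.
have : s * -1 <= s * cos g by rewrite ler_wpM2l.
by lra.
Qed.

Lemma sqn_itv g s : 0 <= s <= 1 / 2 -> 1 / 4 <= sqn g s <= 9 / 4.
Proof.
move=> ss; have h := re_half g ss; case/andP: ss => s0 s1.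
have E : sqn g s = 1 + 2 * s * cos g + s ^+ 2.
  rewrite /sqn !exprMn; have := cos2Dsin2 g; move: (cos g) (sin g) => C S CS.
  have -> : (1 + s * C) ^+ 2 + s ^+ 2 * S ^+ 2 = 1 + 2 * s * C + s ^+ 2 * (C ^+ 2 + S ^+ 2) by ring.
  by rewrite CS mulr1.
have c1 := cos_geN1 g; have c2 := cos_le1 g.
apply/andP; split.
  have : (1 / 2) ^+ 2 <= (1 + s * cos g) ^+ 2 by rewrite ler_pXn2r// nnegrE; lra.
  by rewrite /sqn; have := sqr_ge0 (s * sin g); lra.
rewrite E; have h1 : s * cos g <= s * 1 by rewrite ler_wpM2l.
have h2 : s * s <= 1 / 2 * (1 / 2) by apply: ler_pM.
by rewrite expr2; lra.
Qed.

Lemma half_lt1 s : 0 <= s <= 1 / 2 -> 0 <= s < 1.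
Proof. by move=> /andP[-> h] /=; lra. Qed.

Lemma re_pos g s : 0 <= s < 1 -> 0 < 1 + s * cos g.
Proof.
move=> /andP[s0 s1]; have : s * -1 <= s * cos g by rewrite ler_wpM2l// cos_geN1.
by lra.
Qed.

Lemma sqn_gt0 g s : 0 <= s < 1 -> 0 < sqn g s.
Proof. by move=> ss; rewrite /sqn ltr_pwDl ?sqr_ge0// exprn_gt0// re_pos. Qed.

Lemma polar_at g s : 0 <= s < 1 ->
  Num.sqrt (sqn g s) * cos (arg_at g s) = 1 + s * cos g /\
  Num.sqrt (sqn g s) * sin (arg_at g s) = s * sin g.
Proof.
move=> ss; have x0 := re_pos g ss.
have E : Num.sqrt (sqn g s) * cos (arg_at g s) = 1 + s * cos g.
  rewrite /arg_at cos_atan /sqn; set x := 1 + _ in x0 *; set y := s * sin g.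
  have -> : 1 + (y / x) ^+ 2 = (x ^+ 2 + y ^+ 2) / x ^+ 2 by field; rewrite gt_eqF.
  have n0' : 0 < x ^+ 2 + y ^+ 2 by rewrite ltr_pwDl ?exprn_gt0 ?sqr_ge0.
  rewrite sqrtrM ?(ltW n0')// sqrtrV ?sqr_ge0// sqrtr_sqr gtr0_norm// invfM invrK mulrA mulfV ?mul1r//.
  by rewrite gt_eqF ?sqrtr_gt0.
split => //; rewrite /arg_at sin_atan mulrCA -/(arg_at g s) E divfK//.
by rewrite gt_eqF.
Qed.

(** Real form of the derivative r zeta e^(ib) (1 + s zeta)^(r-1): multiplication by zeta adds [g] to
    the phase [b]. *)
Lemma isd_branch r b g s : 0 <= s < 1 ->
  isd s (branch r b g) (r * branch (r - 1) (b + g) g s).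
Proof.
move=> ss; have x0 := re_pos g ss; have n0' := sqn_gt0 g ss.
have [pc ps] := polar_at g ss.
have nE : sqn g s = (1 + s * cos g) ^+ 2 + (s * sin g) ^+ 2 by [].
rewrite /branch /arg_at /sqn.
eapply isd_eq.
  apply: isd_mul; first by deriv; exact: n0'.
  apply: isd_cos; apply: isd_add; first exact: isd_cst.
  apply: isd_mul; first exact: isd_cst.
  by apply: isd_atan; deriv; rewrite gt_eqF.
cbv beta; rewrite -/(sqn g s) -/(arg_at g s).
have -> : b + g + (r - 1) * arg_at g s = (b + r * arg_at g s) + (g - arg_at g s) by ring.
rewrite [cos (_ + (g - _))]cosD cosB sinB.
have rn0 : 0 < Num.sqrt (sqn g s) by rewrite sqrtr_gt0.
have pE : sqn g s `^ ((r - 1) / 2) = sqn g s `^ (r / 2 - 1) * Num.sqrt (sqn g s).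
  rewrite -powR12_sqrt ?(ltW n0')// -powRD; last by rewrite (gt_eqF n0') implybT.
  by congr (_ `^ _); field.
have pE2 : sqn g s `^ (r / 2) = sqn g s `^ (r / 2 - 1) * sqn g s by rewrite powR_split.
rewrite pE pE2.
set A := b + _; set W := sqn g s `^ _.
have -> : r * (W * Num.sqrt (sqn g s) * (cos A * (cos g * cos (arg_at g s) + sin g * sin (arg_at g s)) -
   sin A * (sin g * cos (arg_at g s) - cos g * sin (arg_at g s)))) =
   r * W * (cos A * (cos g * (Num.sqrt (sqn g s) * cos (arg_at g s)) + sin g * (Num.sqrt (sqn g s) * sin (arg_at g s))) -
   sin A * (sin g * (Num.sqrt (sqn g s) * cos (arg_at g s)) - cos g * (Num.sqrt (sqn g s) * sin (arg_at g s)))).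
  by move: (Num.sqrt _) (cos _) (sin _) (cos g) (sin g) => *; rewrite /W; move: (sqn g s `^ _) => *; ring.
rewrite pc ps nE; clearbody A W.
have n1 : (1 + s * cos g) ^+ 2 + (s * sin g) ^+ 2 != 0 by rewrite -nE gt_eqF.
move: (cos A) (sin A) (cos g) (sin g) x0 n1 => CA SA C S x0 n1.
by field; rewrite gt_eqF//= n1.
Qed.

Lemma taylor3_ge (h h1 h2 h3 : R -> R) (K a : R) : 0 <= a ->
  (forall s, 0 <= s <= a -> isd s h (h1 s)) ->
  (forall s, 0 <= s <= a -> isd s h1 (h2 s)) ->
  (forall s, 0 <= s <= a -> isd s h2 (h3 s)) ->
  (forall s, 0 <= s <= a -> - K <= h3 s) ->
  h 0 + a * h1 0 + a ^+ 2 / 2 * h2 0 - K * a ^+ 3 / 6 <= h a.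
Proof.
move=> a0 d0 d1 d2 d3.
have S1 s : 0 <= s <= a -> 0 <= h2 s - h2 0 + s * K.
  move=> /andP[s0 sa].
  rewrite [leLHS](_ : 0 = h2 0 - h2 0 + 0 * K); last by ring.
  apply: (@incr_le R (fun s => h2 s - h2 0 + s * K) (fun s => h3 s + K) _ _ s0) => t /andP[t0 ts].
    have ta : 0 <= t <= a by rewrite t0 (le_trans ts).
    eapply isd_eq; first by apply: isd_add; [apply: isd_add; [exact: d2|exact: isd_cst]|deriv].
    by cbv beta; ring.
  by have := d3 t; rewrite (ltW t0) (le_trans (ltW ts) sa) => /(_ isT); lra.
have S2 s : 0 <= s <= a -> 0 <= h1 s - h1 0 - h2 0 * s + K * s ^+ 2 / 2.
  move=> /andP[s0 sa].
  rewrite [leLHS](_ : 0 = h1 0 - h1 0 - h2 0 * 0 + K * 0 ^+ 2 / 2); last by field.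
  apply: (@incr_le R (fun s => h1 s - h1 0 - h2 0 * s + K * s ^+ 2 / 2) (fun s => h2 s - h2 0 + s * K) _ _ s0) => t /andP[t0 ts].
    have ta : 0 <= t <= a by rewrite t0 (le_trans ts).
    eapply isd_eq.
      apply: isd_add; last by deriv.
      by apply: isd_add; [apply: isd_add; [exact: d1|exact: isd_cst]|deriv].
    by cbv beta; rewrite /=; field.
  by apply: S1; rewrite (ltW t0) (le_trans (ltW ts) sa).
rewrite -subr_ge0.
rewrite [leLHS](_ : 0 = h 0 - h 0 - h1 0 * 0 - h2 0 * 0 ^+ 2 / 2 + K * 0 ^+ 3 / 6); last by field.
have -> : h a - (h 0 + a * h1 0 + a ^+ 2 / 2 * h2 0 - K * a ^+ 3 / 6) =
  h a - h 0 - h1 0 * a - h2 0 * a ^+ 2 / 2 + K * a ^+ 3 / 6 by field.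
apply: (@incr_le R (fun a => h a - h 0 - h1 0 * a - h2 0 * a ^+ 2 / 2 + K * a ^+ 3 / 6)
  (fun s => h1 s - h1 0 - h2 0 * s + K * s ^+ 2 / 2) _ _ a0) => t /andP[t0 ts].
  eapply isd_eq.
    apply: isd_add; last by deriv.
    apply: isd_add; last by deriv.
    by apply: isd_add; [apply: isd_add; [apply: d0; rewrite t0|exact: isd_cst]|deriv].
  by cbv beta; rewrite /=; field.
by apply: S2; rewrite (ltW t0) (ltW ts).
Qed.

(** Taylor expansion of order two in s. The remainder is uniform in [b] and [g], because the modulus
    of 1 + s zeta stays between 1/2 and 3/2. *)
Lemma branch_ge r : exists2 K, 0 <= K & forall b g s, 0 <= s <= 1 / 2 ->
  cos b + r * (s * cos (b + g)) + r * (r - 1) / 2 * (s ^+ 2 * cos (b + 2 * g)) - K * s ^+ 3 <= branch r b g s.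
Proof.
have [M M0 MP] : exists2 M, 0 <= M & forall b g s, 0 <= s <= 1 / 2 -> `|branch (r - 3) b g s| <= M.
  exists ((1 / 4) `^ ((r - 3) / 2) + (9 / 4) `^ ((r - 3) / 2)).
    by rewrite addr_ge0// powR_ge0.
  move=> b g s ss; rewrite normrM ger0_norm ?powR_ge0//.
  have /andP[n1 n2] := sqn_itv g ss.
  have q4 : (0 : R) < 1 / 4 by lra.
  have n0 : 0 < sqn g s by apply: lt_le_trans n1.
  apply: (@le_trans _ _ (sqn g s `^ ((r - 3) / 2))).
    by rewrite -[leRHS]mulr1 ler_wpM2l ?powR_ge0// cos_max.
  have [le|le] := leP 0 ((r - 3) / 2).
    apply: (@le_trans _ _ ((9 / 4) `^ ((r - 3) / 2))); last by rewrite lerDr powR_ge0.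
    by apply: ge0_ler_powR => //; rewrite nnegrE; lra.
  apply: (@le_trans _ _ ((1 / 4) `^ ((r - 3) / 2))); last by rewrite lerDl powR_ge0.
  have [e eE] : exists e, (r - 3) / 2 = - e by exists (- ((r - 3) / 2)); rewrite opprK.
  rewrite eE !powRN lef_pV2 ?posrE ?powR_gt0//.
  by apply: ge0_ler_powR; rewrite ?nnegrE; lra.
exists (`|r * ((r - 1) * (r - 2))| * M / 6); first by rewrite !mulr_ge0.
move=> b g s /andP[s0 s1].
have at0 : arg_at g 0 = 0 by rewrite /arg_at mul0r mul0r atan0.
have b0 r' b' : branch r' b' g 0 = cos b'.
  by rewrite /branch at0 mulr0 addr0 /sqn !mul0r addr0 expr1n expr0n addr0 powR1 mul1r.
have := @taylor3_ge (branch r b g) (fun s => r * branch (r - 1) (b + g) g s)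
  (fun s => r * ((r - 1) * branch (r - 2) (b + 2 * g) g s))
  (fun s => r * ((r - 1) * ((r - 2) * branch (r - 3) (b + 3 * g) g s)))
  (`|r * ((r - 1) * (r - 2))| * M) s s0.
have sub t : 0 <= t <= s -> 0 <= t <= 1 / 2 by move=> /andP[-> /le_trans]; apply.
have D (c : R) (f : R -> R) d t : isd t f d -> isd t (fun s => c * f s) (c * d).
  by move=> fd; eapply isd_eq; [apply: (@isd_mul R (fun=> c) f); [exact: isd_cst|exact: fd]|cbv beta; ring].
have H1 t : 0 <= t <= s -> isd t (branch r b g) (r * branch (r - 1) (b + g) g t).
  by move=> /sub/half_lt1; exact: isd_branch.
have H2 t : 0 <= t <= s -> isd t (fun s => r * branch (r - 1) (b + g) g s)
    (r * ((r - 1) * branch (r - 2) (b + 2 * g) g t)).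
  move=> /sub tt; apply: D; have := isd_branch (r - 1) (b + g) g (half_lt1 tt).
  have -> : b + g + g = b + 2 * g by ring.
  by have -> : r - 1 - 1 = r - 2 by ring.
have H3 t : 0 <= t <= s -> isd t (fun s => r * ((r - 1) * branch (r - 2) (b + 2 * g) g s))
    (r * ((r - 1) * ((r - 2) * branch (r - 3) (b + 3 * g) g t))).
  move=> /sub tt; apply: (D); apply: (D); have := isd_branch (r - 2) (b + 2 * g) g (half_lt1 tt).
  have -> : b + 2 * g + g = b + 3 * g by ring.
  by have -> : r - 2 - 1 = r - 3 by ring.
have H4 t : 0 <= t <= s -> - (`|r * ((r - 1) * (r - 2))| * M) <=
    r * ((r - 1) * ((r - 2) * branch (r - 3) (b + 3 * g) g t)).
  move=> /sub tt.
  have -> : r * ((r - 1) * ((r - 2) * branch (r - 3) (b + 3 * g) g t)) =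
    r * ((r - 1) * (r - 2)) * branch (r - 3) (b + 3 * g) g t by ring.
  rewrite lerNl; apply: (le_trans (ler_norm _)); rewrite normrN normrM.
  by apply: ler_wpM2l => //; exact: MP.
move=> /(_ H1 H2 H3 H4); rewrite !b0; apply: le_trans.
by rewrite le_eqVlt; apply/orP; left; apply/eqP; field.
Qed.

End BranchTaylor.

(* The sub-mean value property of [homog q phi], transcribed to the angular
   profile: [phi] lies above a sinusoid of frequency [q] touching it at [f]. *)
Definition trig_convex (R : realType) (q : R) (phi : R -> R) := forall f, 0 <= f <= pi ->
  exists al d : R, [/\ 0 < d, phi f = cos al &
    forall tau, `|tau| < d -> cos (al + q * tau) <= phi (acos (cos (f + tau)))].

(** * Quadratic support of the weight at a nonzero point *)

Section Support.
Variable R : realType.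
Implicit Types (q s x : R) (u z : R[i]) (phi : R -> R).

Lemma atan_le x : 0 <= x -> 0 <= atan x <= x.
Proof.
move=> x0; apply/andP; split; first by rewrite -[leLHS](atan0 R) le_atan.
rewrite -subr_ge0 [leLHS](_ : 0 = 0 - atan 0); last by rewrite atan0 subr0.
apply: (@incr_le R (fun t => t - atan t) (fun t => 1 - (1 + t ^+ 2)^-1) _ _ x0) => t _.
  eapply isd_eq; first by apply: isd_add; [exact: isd_id|apply: isd_opp; apply: isd_atan; exact: isd_id].
  by cbv beta; rewrite mulr1.
rewrite subr_ge0 -[leRHS]invr1 lef_pV2 ?posrE// ?lerDl ?sqr_ge0//.
by rewrite ltr_pwDl// sqr_ge0.
Qed.

Lemma norm_atan x : `|atan x| <= `|x|.
Proof.
have [x0|x0] := leP 0 x.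
  by have /andP[h1 h2] := atan_le x0; rewrite !ger0_norm.
have := @atan_le (- x); rewrite oppr_ge0 (ltW x0) atanN => /(_ isT) /andP[h1 h2].
by rewrite -normrN [leRHS]ltr0_norm// ger0_norm.
Qed.

(** The angle is kept in [0, pi], as in [homog]; the sign of the imaginary part is stored in [e]. *)
Lemma polar_form z : exists f e : R, [/\ 0 <= f <= pi, e = 1 \/ e = -1,
  z = (cabs z * cos f) +i* (cabs z * (e * sin f)) & cabs z != 0 -> acos (complex.Re z / cabs z) = f].
Proof.
have [z0|z0] := eqVneq (cabs z) 0.
  exists 0, 1; split; rewrite ?lexx ?pi_ge0//; first by left.
  by rewrite z0 !mul0r; exact: cabs_eq0.
have zp : 0 < cabs z by rewrite lt_neqAle eq_sym z0 cabs_ge0.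
have /andP[h1 h2] := Re_cabs z.
have b1 : -1 <= complex.Re z / cabs z <= 1.
  by rewrite ler_pdivlMr// mulN1r h1 ler_pdivrMr// mul1r.
have [fp cf] := acos_def b1.
have [e [e1 eE]] : exists e, (e = 1 \/ e = -1) /\ complex.Im z = cabs z * (e * sin (acos (complex.Re z / cabs z))).
  have S : (complex.Im z) ^+ 2 = (cabs z * sin (acos (complex.Re z / cabs z))) ^+ 2.
    rewrite exprMn sin2cos2 cf mulrBr mulr1 expr_div_n mulrCA mulfV ?mulr1 ?sqrf_eq0//.
    by rewrite cabs_sqr; ring.
  move/eqP: S; rewrite eqf_sqr => /orP[] /eqP ->.
    by exists 1; split; [left|rewrite mul1r].
  by exists (-1); split; [right|rewrite mulN1r mulrN].
exists (acos (complex.Re z / cabs z)), e; split => //.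
rewrite -eE cf mulrCA mulfV// mulr1.
by case: (z).
Qed.

(** The sinusoid supporting [phi] at the angle of z makes |z|^q Re (e^(i e al) (1 + u)^q) a lower
    bound that is exact at u = 0; [c1] and [c2] are its Taylor coefficients. *)
Lemma homog_support q phi z : z != 0 -> trig_convex q phi ->
  exists c1 c2 : R[i], exists M d : R, [/\ 0 <= M, 0 < d & forall u, cabs u < d ->
    homog q phi z + complex.Re (c1 * u + c2 * u ^+ 2) - M * cabs u ^+ 3 <=
    homog q phi (z * (1 + u))].
Proof.
move=> z0 tc.
have zn : cabs z != 0 by apply: contra z0 => /eqP/cabs_eq0 ->.
have zp : 0 < cabs z by rewrite lt_neqAle eq_sym zn cabs_ge0.
have [f [e [fp e1 zE fE]]] := polar_form z; have {fE}fE := fE zn.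
have [al [d0 [d00 phif tcf]]] := tc f fp.
have [K K0 KP] := branch_ge q.
have rq0 := powR_ge0 (cabs z) q.
exists ((cabs z `^ q * q * cos (e * al)) +i* (cabs z `^ q * q * sin (e * al))).
exists ((cabs z `^ q * (q * (q - 1) / 2) * cos (e * al)) +i* (cabs z `^ q * (q * (q - 1) / 2) * sin (e * al))).
exists (cabs z `^ q * K), (Num.min (1 / 2) (d0 / 2)); split.
- by rewrite mulr_ge0.
- by rewrite lt_min !divr_gt0.
move=> u; rewrite lt_min => /andP[u1 u2].
have [fu [eu [_ eu1 uE _]]] := polar_form u.
have [g [gE1 gE2]] : exists g, cos fu = cos g /\ eu * sin fu = sin g.
  case: eu1 => ->.
    by exists fu; rewrite mul1r.
  by exists (- fu); rewrite cosN sinN mulN1r.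
rewrite {}gE1 {}gE2 in uE.
move: (cabs u) (cabs_ge0 u) u1 u2 uE => s s0 s1 s2 uE.
have ss : 0 <= s <= 1 / 2 by rewrite s0 ltW.
have /andP[n0 _] := sqn_itv g ss; have [pc ps] := polar_at g (half_lt1 ss).
have n0' : 0 < sqn g s by lra.
have KP' := KP (e * al) g s ss.
have hz : homog q phi z = cabs z `^ q * cos (e * al).
  by rewrite /homog fE phif; case: e1 => ->; rewrite ?mul1r// mulN1r cosN.
have tau : `|arg_at g s| < d0.
  apply: le_lt_trans (norm_atan _) _; have x2 := re_half g ss.
  rewrite normrM normfV [`|1 + _|]ger0_norm ?(le_trans _ x2)//.
  rewrite ltr_pdivrMr ?(lt_le_trans _ x2)// normrM (ger0_norm s0).
  have h1 : s * `|sin g| <= s by rewrite -[leRHS]mulr1 ler_wpM2l// sin_max.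
  apply: le_lt_trans h1 _; apply: lt_le_trans (_ : d0 * (1 / 2) <= _); first by lra.
  by rewrite ler_pM2l.
have hz1 : homog q phi (z * (1 + u)) = cabs z `^ q * (sqn g s `^ (q / 2) * phi (acos (cos (f + e * arg_at g s)))).
  have cu : cabs (1 + u) = Num.sqrt (sqn g s) by rewrite uE /cabs /= add0r.
  have sn0 : 0 < Num.sqrt (sqn g s) by rewrite sqrtr_gt0.
  rewrite /homog cabsM cu.
  have -> : complex.Re (z * (1 + u)) / (cabs z * Num.sqrt (sqn g s)) = cos (f + e * arg_at g s).
    have -> : complex.Re (z * (1 + u)) = cabs z * Num.sqrt (sqn g s) * cos (f + e * arg_at g s).
      rewrite uE {1}zE /= add0r -pc -ps.
      case: e1 => ->; rewrite ?mul1r ?mulN1r ?sinN cosD ?cosN ?sinN; ring.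
    by rewrite mulrAC mulfV ?mul1r// mulf_neq0// gt_eqF.
  rewrite powRM ?(ltW zp) ?(ltW sn0)// -mulrA; congr (_ * (_ * _)).
  by rewrite -powR12_sqrt ?(ltW n0')// -powRrM; congr (_ `^ _); field.
rewrite hz1 hz.
have -> : complex.Re (((cabs z `^ q * q * cos (e * al)) +i* (cabs z `^ q * q * sin (e * al))) * u +
   ((cabs z `^ q * (q * (q - 1) / 2) * cos (e * al)) +i* (cabs z `^ q * (q * (q - 1) / 2) * sin (e * al))) * u ^+ 2) =
   cabs z `^ q * (q * (s * cos (e * al + g)) + q * (q - 1) / 2 * (s ^+ 2 * cos (e * al + 2 * g))).
  rewrite uE expr2 /=.
  have -> : e * al + 2 * g = e * al + g + g by ring.
  rewrite [cos (e * al + g + g)]cosD !cosD !sinD.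
  move: (cabs z `^ q) (cos _) (sin _) (cos g) (sin g) => Z A B C D; ring.
rewrite [leLHS](_ : _ = cabs z `^ q * (cos (e * al) + q * (s * cos (e * al + g)) +
  q * (q - 1) / 2 * (s ^+ 2 * cos (e * al + 2 * g)) - K * s ^+ 3)); last by ring.
rewrite ler_pM2l ?powR_gt0//.
have tcf' := tcf (e * arg_at g s).
apply: le_trans (_ : branch q (e * al) g s <= _).
  exact: KP'.
rewrite /branch ler_wpM2l ?powR_ge0//.
have -> : cos (e * al + q * arg_at g s) = cos (al + q * (e * arg_at g s)).
  case: e1 => ->; first by rewrite !mul1r.
  by rewrite -cosN; congr cos; ring.
apply: tcf'; rewrite normrM.
by case: e1 => ->; rewrite ?normrN normr1 mul1r.
Qed.

End Support.

Section TrigConvex.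
Variable R : realType.
Implicit Types (q t x : R).

Lemma trig_convex_one q : trig_convex q (fun _ : R => 1).
Proof.
by move=> f _; exists 0, 1; split; rewrite ?cos0// => tau _; exact: cos_le1.
Qed.

(** The function supports itself except where the angle is folded at pi. There the folded value is
    the larger one, because the two differ by 2 sin (q pi) sin (q (x - pi)) and q <= 1. *)
Lemma trig_convex_acute q : 0 < q -> q <= 1 -> trig_convex q (fun t => cos (q * t)).
Proof.
move=> q0 q1 f /andP[f0 fp]; have pi0 : 0 < pi :> R := pi_gt0 R.
exists (q * f), pi; split => // tau; rewrite ltr_norml => /andP[t1 t2].
rewrite -mulrDr; have [x xE] : exists x, x = f + tau by eexists.
rewrite -xE; have x1 : - pi < x by rewrite xE; lra.
have x2 : x < 2 * pi by rewrite xE; lra.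
have [xn|xp] := ltP x 0.
  by rewrite cosKN ?(ltW xn) ?(ltW x1)// mulrN cosN.
have [xpi|xpi] := leP x pi.
  by rewrite cosK// in_itv/= xp xpi.
have -> : cos x = cos (2 * pi - x).
  by have := cosD2pi (- x); rewrite cosN => <-; congr cos; rewrite mulr2n; ring.
rewrite cosK; last by rewrite in_itv/=; apply/andP; split; lra.
have -> : q * (2 * pi - x) = q * pi - q * (x - pi) by ring.
have -> : q * x = q * pi + q * (x - pi) by ring.
rewrite cosD cosB -subr_ge0.
set A := q * pi; set B := q * (x - pi).
have -> : cos A * cos B + sin A * sin B - (cos A * cos B - sin A * sin B) = 2 * (sin A * sin B) by ring.
rewrite !mulr_ge0//; apply: sin_ge0_pi.
  by rewrite mulr_ge0 ?(ltW q0) ?(ltW pi0)//= ler_piMl// ltW.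
rewrite mulr_ge0 ?(ltW q0) ?subr_ge0 ?(ltW xpi)//=.
by apply: (@le_trans _ _ (1 * (x - pi))); [rewrite ler_pM2r// subr_gt0|lra].
Qed.

Lemma trig_convex_ext q (phi psi : R -> R) : (forall t, 0 <= t <= pi -> phi t = psi t) ->
  trig_convex q phi -> trig_convex q psi.
Proof.
move=> E tc f fp; have [al [d [d0 pf h]]] := tc f fp.
exists al, d; split; rewrite -?E// => tau /h; rewrite E//.
have b : -1 <= cos (f + tau) <= 1 by rewrite cos_geN1 cos_le1.
by have [-> _] := acos_def b.
Qed.

(** Outside the plateau the sinusoid is the function itself, prolonged below the value 1 of the
    plateau; inside the plateau it is the cosine with maximum 1 at the point considered. *)
Lemma trig_convex_obtuse q : 1 <= q -> trig_convex q (phi_obtuse q).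
Proof.
have pi0 : 0 < pi :> R := pi_gt0 R.
rewrite le_eqVlt => /predU1P[<-|q1].
  apply: trig_convex_ext (trig_convex_acute ltr01 (lexx 1)) => t /andP[t0 tp].
  rewrite /phi_obtuse divr1 !mul1r min_l; last by rewrite gerBl.
  by rewrite cosB cospi sinpi mul0r addr0 mulN1r opprK.
have q0 : 0 < q := lt_trans ltr01 q1.
have [tau tE] : exists tau, tau = pi / q by eexists.
have tau0 : 0 < tau by rewrite tE divr_gt0.
have taupi : tau < pi by rewrite tE ltr_pdivrMr// ltr_pMr.
have qtau : q * tau = pi by rewrite tE mulrC divfK// gt_eqF.
move=> f /andP[f0 fp].
have [w wE] : exists w, w = pi - f by eexists.
have w0 : 0 <= w by rewrite wE subr_ge0.
have wp : w <= pi by rewrite wE gerBl.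
have [le|lt] := leP w tau.
  exists (pi - q * w), (pi - tau); split; first by rewrite subr_gt0.
    by rewrite /phi_obtuse -wE -tE min_l// cosB cospi sinpi mul0r addr0 mulN1r.
  move=> t; rewrite ltr_norml => /andP[t1 t2].
  have [x xE] : exists x, x = w - t by eexists.
  have -> : pi - q * w + q * t = pi - q * x by rewrite xE; ring.
  have -> : f + t = pi - x by rewrite xE wE; ring.
  have xp : `|x| <= pi by rewrite ler_norml xE; apply/andP; split; lra.
  have -> : cos (pi - x) = cos (pi - `|x|).
    rewrite !cosB cospi sinpi !mul0r !addr0; congr (_ * _).
    by have [x0|x0] := leP 0 x; [rewrite ger0_norm|rewrite ltr0_norm// cosN].
  rewrite cosK; last by rewrite in_itv/= subr_ge0 xp gerBl normr_ge0.
  rewrite /phi_obtuse -tE (_ : pi - (pi - `|x|) = `|x|); last by ring.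
  rewrite cosB cospi sinpi mul0r addr0 mulN1r.
  have [xt|xt] := leP `|x| tau; last by rewrite qtau cospi lerN2 cos_geN1.
  rewrite lerN2; have [x0|x0] := leP 0 x; first by rewrite ger0_norm.
  by rewrite ltr0_norm// mulrN cosN.
exists 0, (Num.min (w - tau) (pi - tau)); split.
- by rewrite lt_min !subr_gt0 lt.
- by rewrite /phi_obtuse -wE -tE min_r ?(ltW lt)// qtau cospi opprK cos0.
move=> t; rewrite lt_min => /andP[]; rewrite !ltr_norml => /andP[t1 t2] /andP[t3 t4].
suff -> : phi_obtuse q (acos (cos (f + t))) = 1 by exact: cos_le1.
have [x xE] : exists x, x = w - t by eexists.
have fE : f + t = pi - x by rewrite xE wE; ring.
suff h : tau <= pi - acos (cos (f + t)) by rewrite /phi_obtuse -tE min_r// qtau cospi opprK.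
rewrite fE; have [xp|xp] := leP x pi.
  rewrite cosK; last by rewrite in_itv/=; apply/andP; split; lra.
  by lra.
by rewrite cosKN; [lra|apply/andP; split; lra].
Qed.

Lemma trig_convex_le1 q phi t : trig_convex q phi -> 0 <= t <= pi -> `|phi t| <= 1.
Proof. by move=> tc /tc[al [d [_ -> _]]]; exact: cos_max. Qed.

Lemma phi_obtuse_cont q : continuous (phi_obtuse q).
Proof.
move=> t; rewrite /phi_obtuse; apply: continuousN.
apply: (@continuous_comp _ _ _ (fun t => q * Num.min (pi - t) (pi / q)) cos); last exact: continuous_cos.
apply: continuousM; first exact: cst_continuous.
apply: (@continuous_min _ _ (fun t => pi - t) (fun=> pi / q)).
  by apply: continuousB; [exact: cst_continuous|exact: id].
exact: cst_continuous.
Qed.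

End TrigConvex.

(** * Continuity of the weight along polynomials *)

Section Continuity.
Variable R : realType.
Implicit Types (q t x : R).

Definition toC (x : R * R) : R[i] := x.1 +i* x.2.
Definition modulus2 (x : R * R) : R := cabs (toC x).

Lemma contD (T : topologicalType) (f g : T -> R) :
  continuous f -> continuous g -> continuous (fun x : T => f x + g x).
Proof. by move=> cf cg x; apply: cvgD; [exact: cf|exact: cg]. Qed.

Lemma contB (T : topologicalType) (f g : T -> R) :
  continuous f -> continuous g -> continuous (fun x : T => f x - g x).
Proof. by move=> cf cg x; apply: cvgB; [exact: cf|exact: cg]. Qed.

Lemma contM (T : topologicalType) (f g : T -> R) :
  continuous f -> continuous g -> continuous (fun x : T => f x * g x).
Proof. by move=> cf cg x; apply: cvgM; [exact: cf|exact: cg]. Qed.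

Lemma fst_cont : continuous (fun x : R * R => x.1). Proof. by move=> x; exact: cvg_fst. Qed.
Lemma snd_cont : continuous (fun x : R * R => x.2). Proof. by move=> x; exact: cvg_snd. Qed.
Lemma cst_cont (T : topologicalType) (c : R) : continuous (fun _ : T => c).
Proof. by move=> x; exact: cvg_cst. Qed.

Lemma modulus2_cont : continuous modulus2.
Proof.
move=> x; rewrite /modulus2 /cabs /toC /=.
apply: (@continuous_comp _ _ _ (fun x : R * R => x.1 * x.1 + x.2 * x.2) Num.sqrt); last exact: sqrt_continuous.
by apply: contD; apply: contM; (exact: fst_cont || exact: snd_cont).
Qed.

Lemma cont_near (T : topologicalType) (f g : T -> R) (x : T) :
  {near x, f =1 g} -> {for x, continuous f} -> {for x, continuous g}.
Proof.
move=> E fc; rewrite /prop_for /continuous_at -(nbhs_singleton E).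
by apply: cvg_trans fc; exact: (near_eq_cvg E).
Qed.

Lemma acos_half (f : R) : 0 <= f <= pi -> 0 < 1 + cos f -> f = 2 * atan (sin f / (1 + cos f)).
Proof.
move=> /andP[f0 fp] c1.
have fE : f = f / 2 + f / 2 by field.
have fp' : f < pi.
  rewrite lt_neqAle fp andbT; apply/eqP => E; move: c1.
  by rewrite E cospi subrr ltxx.
have C0 : 0 < cos (f / 2).
  by apply: cos_gt0_pihalf; have pi0 := pi_gt0 R; apply/andP; split; lra.
have -> : sin f / (1 + cos f) = tan (f / 2).
  rewrite fE sinDD cosDD' -fE /tan; move: (cos _) (sin _) C0 => C S C0.
  by field; rewrite gt_eqF.
rewrite tanK; last by rewrite in_itv/=; have pi0 := pi_gt0 R; apply/andP; split; lra.
by field.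
Qed.

(** At 0 the bound |z|^q suffices. Elsewhere the folded angle is 2 atan (|Im z| / (|z| + Re z)) off
    the negative half-axis, and pi - 2 atan (|Im z| / (|z| - Re z)) off the positive one; each form
    is visibly continuous. *)
Lemma homog2_cont q (phi : R -> R) : 0 < q -> continuous phi ->
  (forall t, 0 <= t <= pi -> `|phi t| <= 1) -> continuous (fun x : R * R => homog q phi (toC x)).
Proof.
move=> q0 phic phi1 x0.
have mcx : modulus2 x @[x --> x0] --> modulus2 x0 by exact: modulus2_cont.
have [n0|n0] := eqVneq (modulus2 x0) 0.
  have H0 : homog q phi (toC x0) = 0 by rewrite /homog -/(modulus2 x0) n0 powR0 ?mul0r// gt_eqF.
  apply/cvgrPdist_lt => e e0; rewrite H0.
  have : \forall x \near x0, `|modulus2 x0 - modulus2 x| < e `^ q^-1.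
    by move/cvgrPdist_lt: mcx; apply; rewrite powR_gt0.
  apply: filterS => x; rewrite n0 sub0r normrN ger0_norm ?cabs_ge0// => h.
  rewrite sub0r normrN /homog normrM ger0_norm ?powR_ge0//.
  have b : -1 <= complex.Re (toC x) / cabs (toC x) <= 1 \/ cabs (toC x) = 0.
    have [->|z0] := eqVneq (cabs (toC x)) 0; first by right.
    left; have zp : 0 < cabs (toC x) by rewrite lt_neqAle eq_sym z0 cabs_ge0.
    have /andP[h1 h2] := Re_cabs (toC x).
    by rewrite ler_pdivlMr// mulN1r h1 ler_pdivrMr// mul1r.
  case: b => [b|->]; last by rewrite powR0 ?gt_eqF// mul0r.
  have [ap _] := acos_def b.
  apply: le_lt_trans (_ : cabs (toC x) `^ q < e).
    by rewrite -[leRHS]mulr1 ler_wpM2l ?powR_ge0// phi1.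
  have -> : e = (e `^ q^-1) `^ q by rewrite -powRrM mulVf ?gt_eqF// powRr1// ltW.
  by apply: gt0_ltr_powR; rewrite ?nnegrE ?powR_ge0 ?cabs_ge0.
have np : 0 < modulus2 x0 by rewrite lt_neqAle eq_sym n0 cabs_ge0.
have mc : {for x0, continuous (fun x : R * R => modulus2 x `^ q)}.
  apply: (@continuous_comp _ _ _ modulus2 (fun y => y `^ q)); first exact: modulus2_cont.
  by apply: isd_cont; apply: (@isd_powR R id) => //; exact: isd_id.
have c1 : {for x0, continuous (fun x : R * R => x.1)} by exact: cvg_fst.
have c2 : {for x0, continuous (fun x : R * R => `|x.2|)}.
  apply: (@continuous_comp _ _ _ (fun x : R * R => x.2) Num.norm); first exact: cvg_snd.
  exact: norm_continuous.
have key (x : R * R) : modulus2 x != 0 -> exists f, [/\ 0 <= f <= pi, acos (complex.Re (toC x) / cabs (toC x)) = f,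
    x.1 = modulus2 x * cos f & `|x.2| = modulus2 x * sin f].
  move=> nx; have [f [e [fp e1 zE fE]]] := polar_form (toC x).
  exists f; split => //; first exact: fE.
    by have := congr1 (fun z => complex.Re z) zE.
  have -> : x.2 = cabs (toC x) * (e * sin f) by have := congr1 (fun z => complex.Im z) zE.
  rewrite !normrM ger0_norm ?cabs_ge0// (ger0_norm (sin_ge0_pi fp)).
  by case: e1 => ->; rewrite ?normrN normr1 mul1r.
have K1 (x : R * R) : 0 < modulus2 x + x.1 -> modulus2 x != 0 ->
    homog q phi (toC x) = modulus2 x `^ q * phi (2 * atan (`|x.2| / (modulus2 x + x.1))).
  move=> hx nx; have [f [fp fE E1 E2]] := key x nx.
  have mx : 0 < modulus2 x by rewrite lt_neqAle eq_sym nx cabs_ge0.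
  have sE : modulus2 x + x.1 = modulus2 x * (1 + cos f) by rewrite E1; ring.
  rewrite /homog fE E2 sE -mulf_div divff// mul1r -acos_half//.
  by move: hx; rewrite sE pmulr_rgt0.
have K2 (x : R * R) : 0 < modulus2 x - x.1 -> modulus2 x != 0 ->
    homog q phi (toC x) = modulus2 x `^ q * phi (pi - 2 * atan (`|x.2| / (modulus2 x - x.1))).
  move=> hx nx; have [f [fp fE E1 E2]] := key x nx.
  have mx : 0 < modulus2 x by rewrite lt_neqAle eq_sym nx cabs_ge0.
  have sE' : modulus2 x - x.1 = modulus2 x * (1 + cos (pi - f)).
    by rewrite E1 cosB cospi sinpi mul0r addr0; ring.
  have sE : sin (pi - f) = sin f by rewrite sinB cospi sinpi mul0r sub0r mulN1r opprK.
  have fp2 : 0 <= pi - f <= pi by case/andP: fp => ? ?; rewrite subr_ge0 gerBl; apply/andP.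
  rewrite /homog fE E2 sE' -mulf_div divff// mul1r -sE -acos_half//.
    by rewrite opprB addrCA subrr addr0.
  by move: hx; rewrite sE' pmulr_rgt0.
have nearn : \forall x \near x0, modulus2 x != 0.
  have := mcx => /cvgr_gt /(_ 0 np).
  by apply: filterS => x /gt_eqF ->.
have phic' : {for x0, continuous (fun x : R * R => modulus2 x + x.1)}.
  by apply: continuousD; [exact: modulus2_cont|].
have phic'' : {for x0, continuous (fun x : R * R => modulus2 x - x.1)}.
  by apply: continuousB; [exact: modulus2_cont|].
have [h|h] := ltP 0 (modulus2 x0 + x0.1).
  have E : {near x0, (fun x : R * R => modulus2 x `^ q * phi (2 * atan (`|x.2| / (modulus2 x + x.1)))) =1
      (fun x : R * R => homog q phi (toC x))}.
    near=> x; rewrite K1//; last by near: x.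
    near: x; move: phic' => /cvgr_gt /(_ 0 h); exact.
  apply: (cont_near E).
  apply: continuousM; first exact: mc.
  apply: (@continuous_comp _ _ _ (fun x : R * R => 2 * atan (`|x.2| / (modulus2 x + x.1))) phi); last exact: phic.
  apply: continuousM; first exact: cst_continuous.
  apply: (@continuous_comp _ _ _ (fun x : R * R => `|x.2| / (modulus2 x + x.1)) atan); last exact: continuous_atan.
  apply: continuousM => //; apply: continuousV => //.
  by rewrite gt_eqF.
have h' : 0 < modulus2 x0 - x0.1 by lra.
have E : {near x0, (fun x : R * R => modulus2 x `^ q * phi (pi - 2 * atan (`|x.2| / (modulus2 x - x.1)))) =1
    (fun x : R * R => homog q phi (toC x))}.
  near=> x; rewrite K2//; last by near: x.
  near: x; move: phic'' => /cvgr_gt /(_ 0 h'); exact.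
apply: (cont_near E).
apply: continuousM; first exact: mc.
apply: (@continuous_comp _ _ _ (fun x : R * R => pi - 2 * atan (`|x.2| / (modulus2 x - x.1))) phi); last exact: phic.
apply: continuousB; first exact: cst_continuous.
apply: continuousM; first exact: cst_continuous.
apply: (@continuous_comp _ _ _ (fun x : R * R => `|x.2| / (modulus2 x - x.1)) atan); last exact: continuous_atan.
apply: continuousM => //; apply: continuousV => //.
by rewrite gt_eqF.
Unshelve. all: by end_near.
Qed.

Lemma poly_cont (F : {poly R[i]}) :
  continuous (fun x : R * R => complex.Re F.[toC x]) /\ continuous (fun x : R * R => complex.Im F.[toC x]).
Proof.
elim/poly_ind: F => [|F c [IH1 IH2]].
  split; rewrite (_ : (fun _ => _) = (fun _ : R * R => 0)); try exact: cst_cont;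
    by apply/funext => y; rewrite horner0.
split.
  rewrite (_ : (fun _ => _) = (fun y : R * R => complex.Re F.[toC y] * y.1 - complex.Im F.[toC y] * y.2 + complex.Re c)).
    by apply: contD (@cst_cont _ _); apply: contB; apply: contM => //; (exact: fst_cont || exact: snd_cont).
  by apply/funext => y; rewrite hornerMXaddC; case: (F.[toC y]) c => [a b] [d e].
rewrite (_ : (fun _ => _) = (fun y : R * R => complex.Re F.[toC y] * y.2 + complex.Im F.[toC y] * y.1 + complex.Im c)).
  by apply: contD (@cst_cont _ _); apply: contD; apply: contM => //; (exact: fst_cont || exact: snd_cont).
by apply/funext => y; rewrite hornerMXaddC; case: (F.[toC y]) c => [a b] [d e].
Qed.

Lemma homog_poly_cont q (phi : R -> R) (F : {poly R[i]}) : 0 < q -> continuous phi ->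
  (forall t, 0 <= t <= pi -> `|phi t| <= 1) -> continuous (fun x : R * R => homog q phi F.[toC x]).
Proof.
move=> q0 pc p1 x; have [c1 c2] := poly_cont F.
have := @continuous_comp _ _ _ (fun x : R * R => (complex.Re F.[toC x], complex.Im F.[toC x]))
  (fun y => homog q phi (toC y)) x.
rewrite (_ : _ \o _ = (fun x : R * R => homog q phi F.[toC x])); last first.
  by apply/funext => y /=; rewrite /toC; case: (F.[_]).
apply; last exact: homog2_cont.
exact: (cvg_pair (c1 x) (c2 x)).
Qed.

End Continuity.

(** * A four-point sub-mean value property and a maximum principle *)

Section FourPoint.
Variable R : realType.
Implicit Types (q h : R) (z e : R[i]) (F Q : {poly R[i]}).

Lemma cabs_le_add z e : cabs (z + e) <= cabs z + cabs e.
Proof. exact: le_normcD. Qed.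

Lemma poly_split F : exists Q c, F = Q * 'X + c%:P.
Proof. by elim/poly_ind: F => [|F c _]; [exists 0, 0; rewrite mul0r addr0|exists F, c]. Qed.

Lemma poly_bound F : exists2 B, 0 <= B & forall z, cabs z <= 1 -> cabs F.[z] <= B.
Proof.
elim/poly_ind: F => [|F c [B B0 IH]].
  by exists 0 => // z _; rewrite horner0 /cabs /= expr0n addr0 sqrtr0.
exists (B + cabs c); first by rewrite addr_ge0 ?cabs_ge0.
move=> z z1; rewrite hornerMXaddC; apply: (le_trans (cabs_le_add _ _)).
rewrite lerD2r cabsM -[leRHS]mulr1; apply: ler_pM => //; exact: cabs_ge0 || exact: IH.
Qed.

Definition sum4 (g : R[i] -> R) z h : R :=
  g (z + (h +i* 0)) + g (z + (0 +i* h)) + g (z + (- h +i* 0)) + g (z + (0 +i* - h)).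

Lemma cabs_pts h : 0 <= h -> [/\ cabs (h +i* 0) = h, cabs (0 +i* h) = h,
  cabs (- h +i* 0) = h & cabs (0 +i* - h) = h].
Proof.
move=> h0; split; rewrite /cabs /= ?sqrrN expr0n ?addr0 ?add0r sqrtr_sqr ger0_norm//.
Qed.

(** The fourth roots of unity cancel the terms of degree 1 and 2; the rest is divisible by the cube
    of the increment. *)
Lemma sum4_poly Q : exists2 M, 0 <= M & forall h, 0 <= h <= 1 ->
  4 * complex.Re Q.[0] - M * h ^+ 3 <= sum4 (fun z => complex.Re Q.[z]) 0 h.
Proof.
have [Q1 [c0 ->]] := poly_split Q; have [Q2 [c1 ->]] := poly_split Q1.
have [Q3 [c2 ->]] := poly_split Q2; have [B B0 BP] := poly_bound Q3.
exists (4 * B); first by rewrite mulr_ge0.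
move=> h /andP[h0 h1].
have K e : cabs e = h -> - (B * h ^+ 3) <= complex.Re (e ^+ 3 * Q3.[e]).
  move=> eh; have /andP[le _] := Re_cabs (e ^+ 3 * Q3.[e]); apply: le_trans le.
  rewrite lerN2 cabsM mulrC; apply: ler_pM; rewrite ?cabs_ge0//.
    by apply: BP; rewrite eh.
  by rewrite exprSr expr2 !cabsM eh -expr2 -exprSr.
have [p0 p1 p2 p3] := cabs_pts h0.
have := K _ p0; have := K _ p1; have := K _ p2; have := K _ p3.
rewrite /sum4 !add0r !hornerMXaddC.
move: (Q3.[h +i* 0]) (Q3.[0 +i* h]) (Q3.[- h +i* 0]) (Q3.[0 +i* - h]) Q3.[0].
case: c0 c1 c2 => [a0 b0] [a1 b1] [a2 b2] [u1 v1] [u2 v2] [u3 v3] [u4 v4] [u5 v5].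
rewrite !exprSr !expr0 !mul1r /=.
move=> k3 k2 k1 k0.
rewrite -subr_ge0; rewrite -subr_ge0 in k0; rewrite -subr_ge0 in k1; rewrite -subr_ge0 in k2; rewrite -subr_ge0 in k3.
apply: le_trans (addr_ge0 (addr_ge0 k0 k1) (addr_ge0 k2 k3)) _.
by rewrite le_eqVlt; apply/orP; left; apply/eqP; ring.
Qed.

(** [U] is the relative increment F (z + e) / F z - 1. Inserted in the quadratic of [homog_support]
    it gives a polynomial, to which [sum4_poly] applies. *)
Lemma sum4_homog q (phi : R -> R) F z : trig_convex q phi -> F.[z] != 0 ->
  exists M d : R, [/\ 0 <= M, 0 < d & forall h, 0 < h < d ->
    4 * homog q phi F.[z] - M * h ^+ 3 <= sum4 (fun z => homog q phi F.[z]) z h].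
Proof.
move=> tc Fz; have [c1 [c2 [M [d [M0 d0 H]]]]] := homog_support Fz tc.
pose U := (F.[z])^-1 *: (F \Po ('X + z%:P) - F.[z]%:P).
have UE e : F.[z] * (1 + U.[e]) = F.[z + e].
  rewrite /U hornerZ hornerD hornerN hornerC horner_comp !hornerE mulrDr mulr1 mulrA mulfV// mul1r.
  by rewrite addrCA subrr addr0 addrC.
have U0 : U.[0] = 0.
  by rewrite /U hornerZ hornerD hornerN hornerC horner_comp !hornerE ?add0r subrr mulr0.
clearbody U; have [V [c VE]] := poly_split U.
have c0 : c = 0 by move: U0; rewrite VE hornerMXaddC mulr0 add0r.
have [B B0 BP] := poly_bound V.
have Ub e : cabs e <= 1 -> cabs U.[e] <= B * cabs e.
  move=> e1; rewrite VE c0 hornerMXaddC addr0 cabsM ler_wpM2r ?cabs_ge0//; exact: BP.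
have [M' M'0 M'P] := sum4_poly (c1 *: U + c2 *: U ^+ 2).
exists (M' + 4 * (M * B ^+ 3)), (Num.min 1 (d / (B + 1))); split.
- by rewrite addr_ge0// !mulr_ge0// exprn_ge0.
- by rewrite lt_min ltr01 divr_gt0// ltr_wpDl.
move=> h /andP[h0]; rewrite lt_min => /andP[h1 h2].
have hB : B * h < d.
  move: h2; rewrite ltr_pdivlMr ?ltr_wpDl// mulrDr mulr1 mulrC; apply: le_lt_trans.
  by rewrite lerDl ltW.
have K e : cabs e = h -> homog q phi F.[z] + complex.Re (c1 *: U + c2 *: U ^+ 2).[e] - M * B ^+ 3 * h ^+ 3 <= homog q phi F.[z + e].
  move=> eh; have Ue : cabs U.[e] <= B * h by rewrite -eh Ub// eh ltW.
  have := H U.[e] (le_lt_trans Ue hB); rewrite UE; apply: le_trans.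
  rewrite hornerD !hornerZ horner_exp; apply: lerB => //.
  rewrite -mulrA -exprMn; apply: ler_wpM2l => //.
  by apply: lerXn2r => //; rewrite nnegrE ?cabs_ge0// mulr_ge0// ltW.
have [p0 p1 p2 p3] := cabs_pts (ltW h0).
have := K _ p0; have := K _ p1; have := K _ p2; have := K _ p3.
have := M'P h; rewrite (ltW h0) (ltW h1) => /(_ isT).
rewrite /sum4 !add0r.
have -> : (c1 *: U + c2 *: U ^+ 2).[0] = 0.
  by rewrite hornerD !hornerZ horner_exp U0 expr0n/= !mulr0 addr0.
have -> : complex.Re (0 : R[i]) = 0 by [].
rewrite mulr0 sub0r.
move: (homog q phi F.[z + (h +i* 0)]) (homog q phi F.[z + (0 +i* h)]) (homog q phi F.[z + (- h +i* 0)]) (homog q phi F.[z + (0 +i* - h)]).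
move: (complex.Re _) (complex.Re (_.[0 +i* h])) (complex.Re (_.[- h +i* 0])) (complex.Re (_.[0 +i* - h])).
move: (homog q phi F.[z]) (h ^+ 3) (B ^+ 3) => H0 h3 B3 r0 r1 r2 r3 a0 a1 a2 a3.
move=> k k3 k2 k1 k0.
rewrite -subr_ge0; rewrite -subr_ge0 in k; rewrite -subr_ge0 in k0; rewrite -subr_ge0 in k1; rewrite -subr_ge0 in k2; rewrite -subr_ge0 in k3.
apply: le_trans (addr_ge0 k (addr_ge0 (addr_ge0 k0 k1) (addr_ge0 k2 k3))) _.
by rewrite le_eqVlt; apply/orP; left; apply/eqP; ring.
Qed.

(* The small term of degree [q / 2] makes the second-order support strict. *)
Definition homog_eps q phi (eps : R) z := homog q phi z + eps * homog (q / 2) (fun=> 1) z.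

Lemma homog_ge q (phi : R -> R) z : trig_convex q phi -> - cabs z `^ q <= homog q phi z.
Proof.
move=> tc; rewrite /homog.
have [->|z0] := eqVneq (cabs z) 0.
  have p2 : 0 <= @pi R / 2 <= pi.
    by rewrite divr_ge0 ?pi_ge0//= ler_pdivrMr// ler_peMr ?pi_ge0// ler1n.
  have [t [d [_ E _]]] := tc _ p2.
  by rewrite invr0 mulr0 acos0 E -mulrN1 ler_wpM2l ?powR_ge0// cos_geN1.
have zp : 0 < cabs z by rewrite lt_neqAle eq_sym z0 cabs_ge0.
have /andP[h1 h2] := Re_cabs z.
have b1 : -1 <= complex.Re z / cabs z <= 1.
  by rewrite ler_pdivlMr// mulN1r h1 ler_pdivrMr// mul1r.
have [ap _] := acos_def b1; have [t [d [_ -> _]]] := tc _ ap.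
by rewrite -mulrN1 ler_wpM2l ?powR_ge0// cos_geN1.
Qed.

(** At a zero of [F] there is no quadratic support, but the central value is 0. Near it |F| <=
    eps^(2/q), so eps |F|^(q/2) dominates |F|^q, and all four values are nonnegative. *)
Lemma sum4_homog_eps q (phi : R -> R) eps F z : 0 < q -> trig_convex q phi -> 0 < eps ->
  exists M d : R, [/\ 0 <= M, 0 < d & forall h, 0 < h < d ->
    4 * homog_eps q phi eps F.[z] - M * h ^+ 3 <= sum4 (fun z => homog_eps q phi eps F.[z]) z h].
Proof.
move=> q0 tc e0; have [Fz|Fz] := eqVneq F.[z] 0; last first.
  have [M1 [d1 [M10 d10 H1]]] := sum4_homog tc Fz.
  have [M2 [d2 [M20 d20 H2]]] := sum4_homog (@trig_convex_one R (q / 2)) Fz.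
  exists (M1 + eps * M2), (Num.min d1 d2); split.
  - by rewrite addr_ge0// mulr_ge0// ltW.
  - by rewrite lt_min d10.
  move=> h /andP[h0]; rewrite lt_min => /andP[h1 h2].
  have := H1 h; rewrite h0 h1 => /(_ isT) k1.
  have := H2 h; rewrite h0 h2 => /(_ isT) k2.
  rewrite -subr_ge0 in k1; rewrite -subr_ge0 in k2; rewrite -subr_ge0.
  apply: le_trans (addr_ge0 k1 (mulr_ge0 (ltW e0) k2)) _.
  by rewrite le_eqVlt /sum4 /homog_eps; apply/orP; left; apply/eqP; ring.
pose U := F \Po ('X + z%:P).
have UE e : U.[e] = F.[z + e] by rewrite /U horner_comp !hornerE addrC.
have [V [c VE]] := poly_split U.
have c0 : c = 0 by have := UE 0; rewrite VE hornerMXaddC mulr0 add0r addr0 Fz.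
have [B B0 BP] := poly_bound V.
have Ub e : cabs e <= 1 -> cabs F.[z + e] <= B * cabs e.
  move=> e1; rewrite -UE VE c0 hornerMXaddC addr0 cabsM ler_wpM2r ?cabs_ge0//; exact: BP.
have r0 : 0 < eps `^ (2 / q) by rewrite powR_gt0.
exists 0, (Num.min 1 (eps `^ (2 / q) / (B + 1))); split=> //.
  by rewrite lt_min ltr01 divr_gt0// ltr_wpDl.
move=> h /andP[h0]; rewrite lt_min => /andP[h1 h2].
have hB : B * h < eps `^ (2 / q).
  move: h2; rewrite ltr_pdivlMr ?ltr_wpDl// mulrDr mulr1 mulrC; apply: le_lt_trans.
  by rewrite lerDl ltW.
have -> : homog_eps q phi eps F.[z] = 0.
  rewrite /homog_eps /homog Fz.
  have -> : cabs (0 : R[i]) = 0 by rewrite /cabs /= expr0n addr0 sqrtr0.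
  by rewrite !powR0 ?mul0r ?mulr0 ?addr0// gt_eqF// divr_gt0.
rewrite mulr0 mul0r subr0.
have K e : cabs e = h -> 0 <= homog_eps q phi eps F.[z + e].
  move=> eh; have Ue : cabs F.[z + e] <= eps `^ (2 / q).
    by apply: le_trans (ltW hB); rewrite -eh Ub// eh ltW.
  have := homog_ge F.[z + e] tc; rewrite /homog_eps.
  have -> : homog (q / 2) (fun=> 1) F.[z + e] = cabs F.[z + e] `^ (q / 2) by rewrite /homog mulr1.
  have := cabs_ge0 F.[z + e]; move: (cabs _) (homog _ _ _) Ue => r H re r00 HH.
  have : r `^ q <= eps * r `^ (q / 2).
    have [->|rn] := eqVneq r 0; first by rewrite !powR0 ?mulr0// gt_eqF// divr_gt0.
    have rq : r `^ q = r `^ (q / 2) * r `^ (q / 2).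
      rewrite -powRD; first by congr (_ `^ _); field.
      by rewrite rn implybT.
    rewrite rq ler_wpM2r ?powR_ge0//.
    have -> : eps = (eps `^ (2 / q)) `^ (q / 2).
      rewrite -powRrM; have -> : 2 / q * (q / 2) = 1 by field; rewrite gt_eqF.
      by rewrite powRr1// ltW.
    by apply: ge0_ler_powR; rewrite ?nnegrE ?powR_ge0// divr_ge0// ltW.
  by lra.
have [p0 p1 p2 p3] := cabs_pts (ltW h0).
by rewrite /sum4; apply: addr_ge0; [apply: addr_ge0; [apply: addr_ge0|]|]; apply: K.
Qed.

Lemma sum4_family q (phi : R -> R) eps (Fs : seq {poly R[i]}) z : 0 < q -> trig_convex q phi -> 0 < eps ->
  exists M d : R, [/\ 0 <= M, 0 < d & forall h, 0 < h < d ->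
    4 * (\sum_(F <- Fs) homog_eps q phi eps F.[z]) - M * h ^+ 3 <=
    sum4 (fun z => \sum_(F <- Fs) homog_eps q phi eps F.[z]) z h].
Proof.
move=> q0 tc e0; elim: Fs => [|F Fs [M1 [d1 [M10 d10 H1]]]].
  by exists 0, 1; split => // h _; rewrite /sum4 !big_nil mulr0 mul0r subr0 !addr0.
have [M2 [d2 [M20 d20 H2]]] := @sum4_homog_eps q phi eps F z q0 tc e0.
exists (M1 + M2), (Num.min d1 d2); split.
- by rewrite addr_ge0.
- by rewrite lt_min d10.
move=> h /andP[h0]; rewrite lt_min => /andP[h1 h2].
have := H1 h; rewrite h0 h1 => /(_ isT) k1.
have := H2 h; rewrite h0 h2 => /(_ isT) k2.
rewrite -subr_ge0 in k1; rewrite -subr_ge0 in k2; rewrite -subr_ge0.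
apply: le_trans (addr_ge0 k1 k2) _.
by rewrite le_eqVlt /sum4 !big_cons; apply/orP; left; apply/eqP; ring.
Qed.

Lemma disc_compact : compact ([set x : R * R | x.1 * x.1 + x.2 * x.2 <= 1] : set (R * R)).
Proof.
apply: (@subclosed_compact (R * R)%type _ ([set` `[(-1 : R), 1]] `*` [set` `[(-1 : R), 1]])).
- have c : continuous (fun x : R * R => x.1 * x.1 + x.2 * x.2).
    by apply: contD; apply: contM; (exact: fst_cont || exact: snd_cont).
  rewrite (_ : [set x : R * R | _] = (fun x : R * R => x.1 * x.1 + x.2 * x.2) @^-1` [set y | y <= 1])//.
  by apply: closed_comp; [move=> x _; exact: c|exact: closed_le].
- by apply: compact_setX; exact: segment_compact.
- move=> [a b] /= h; rewrite !in_itv /= -!ler_norml; split.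
    rewrite -(@ler_pXn2r _ 2)// ?nnegrE// real_normK ?num_real// expr1n expr2.
    by apply: le_trans h; rewrite lerDl -expr2 sqr_ge0.
  rewrite -(@ler_pXn2r _ 2)// ?nnegrE// real_normK ?num_real// expr1n expr2.
  by apply: le_trans h; rewrite lerDr -expr2 sqr_ge0.
Qed.

Lemma sum_cont (T : topologicalType) (I : Type) (r : seq I) (f : I -> T -> R) :
  (forall i, continuous (f i)) -> continuous (fun x : T => \sum_(i <- r) f i x).
Proof.
move=> fc; elim: r => [|i r IH].
  by rewrite (_ : (fun _ => _) = (fun _ : T => 0)); [exact: cst_cont|apply/funext => x; rewrite big_nil].
rewrite (_ : (fun _ => _) = (fun x : T => f i x + \sum_(i <- r) f i x)); last first.
  by apply/funext => x; rewrite big_cons.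
by apply: contD; [exact: fc|exact: IH].
Qed.

Lemma homog_eps_cont q (phi : R -> R) eps F : 0 < q -> trig_convex q phi -> continuous phi ->
  continuous (fun x : R * R => homog_eps q phi eps F.[toC x]).
Proof.
move=> q0 tc pc; rewrite /homog_eps; apply: contD.
  by apply: homog_poly_cont => // t tp; exact: trig_convex_le1 tc tp.
apply: contM; first exact: cst_cont.
apply: homog_poly_cont; first by rewrite divr_gt0.
  exact: cst_cont.
by move=> t _; rewrite normr1.
Qed.

(* The family [Fs] consists of rotations of one polynomial, so that its sums
   are Riemann sums over the circle. *)
Lemma max_principle q (phi : R -> R) eps (Fs : seq {poly R[i]}) (eta : R) :
  0 < q -> trig_convex q phi -> continuous phi -> 0 < eps -> 0 < eta ->
  exists2 z, cabs z = 1 & \sum_(F <- Fs) homog_eps q phi eps F.[0] - eta <=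
    \sum_(F <- Fs) homog_eps q phi eps F.[z].
Proof.
move=> q0 tc pc e0 eta0.
(* The added paraboloid raises the four-point sum by 4 eta h^2, which beats the error M h^3 for
   small h; no maximum can then be interior. *)
pose g (x : R * R) := \sum_(F <- Fs) homog_eps q phi eps F.[toC x] + eta * (x.1 * x.1 + x.2 * x.2).
have gc : continuous g.
  apply: contD.
    by apply: (@sum_cont _ _ Fs (fun F (x : R * R) => homog_eps q phi eps F.[toC x])) => F; exact: homog_eps_cont.
  apply: contM; first exact: cst_cont.
  by apply: contD; apply: contM; (exact: fst_cont || exact: snd_cont).
have [|c cK cmax] := compact_EVT_max _ disc_compact (continuous_subspaceT gc).
  by exists (0, 0) => /=; rewrite mul0r addr0.
have cabsE (x : R * R) : cabs (toC x) ^+ 2 = x.1 * x.1 + x.2 * x.2.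
  by rewrite cabs_sqr /= !expr2.
rewrite inE /= in cK.
have g0 : g (0, 0) <= g c.
  by apply: cmax; rewrite inE /= mul0r addr0.
move: cK; rewrite le_eqVlt => /predU1P[c1|clt].
  exists (toC c).
    by apply/eqP; rewrite -(@eqrXn2 _ 2)// ?cabs_ge0// cabsE c1 expr1n.
  by move: g0; rewrite /g /= c1 !mul0r addr0 mulr0 mulr1 addr0 lerBlDr.
exfalso.
have [M [d [M0 d0 H]]] := @sum4_family q phi eps Fs (toC c) q0 tc e0.
pose r := c.1 * c.1 + c.2 * c.2.
have r0 : 0 <= r by rewrite addr_ge0// -expr2 sqr_ge0.
have r1 : r < 1 by exact: clt.
have near1 (x y : R) (h : R) : 0 <= h -> h <= (1 - r) / 4 -> x * x + y * y = h ^+ 2 ->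
    (c.1 + x) * (c.1 + x) + (c.2 + y) * (c.2 + y) <= 1.
  move=> h0 hr xy.
  have cr : c.1 * x + c.2 * y <= h.
    have h2 : (c.1 * x + c.2 * y) ^+ 2 <= h ^+ 2.
      rewrite -xy; apply: (@le_trans _ _ (r * (x * x + y * y))).
        rewrite -subr_ge0.
        have -> : r * (x * x + y * y) - (c.1 * x + c.2 * y) ^+ 2 = (c.1 * y - c.2 * x) ^+ 2 by rewrite /r; ring.
        exact: sqr_ge0.
      by rewrite -[leRHS]mul1r ler_wpM2r ?(ltW r1)// xy exprn_ge0.
    rewrite (le_trans (ler_norm _))// -(@ler_pXn2r _ 2)// ?nnegrE// real_normK// num_real//.
  have hh : h ^+ 2 <= h.
    rewrite expr2 -[leRHS]mulr1 ler_wpM2l//; lra.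
  have -> : (c.1 + x) * (c.1 + x) + (c.2 + y) * (c.2 + y) = r + 2 * (c.1 * x + c.2 * y) + (x * x + y * y) by rewrite /r; ring.
  by rewrite xy; lra.
(* Small enough for the local estimate, for the four points to remain in the disc, and for M h < 4
   eta. *)
pose h := Num.min (d / 2) (Num.min ((1 - r) / 4) (eta / (M + 1))).
have h0 : 0 < h by rewrite !lt_min !divr_gt0// ?subr_gt0// ltr_wpDl.
have hd : h < d by rewrite (@le_lt_trans _ _ (d / 2)) ?ge_min ?lexx//; lra.
have hr : h <= (1 - r) / 4 by rewrite !ge_min lexx orbT.
have hM : h <= eta / (M + 1) by rewrite !ge_min lexx !orbT.
have := H h; rewrite h0 hd => /(_ isT) K.
have P x y : x * x + y * y = h ^+ 2 -> g (c.1 + x, c.2 + y) <= g c.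
  by move=> xy; apply: cmax; rewrite inE /=; apply: (near1 x y h) => //; exact: ltW.
have P0 := P h 0; have P1 := P 0 h; have P2 := P (- h) 0; have P3 := P 0 (- h).
move: P0 P1 P2 P3; rewrite !mulrNN !mul0r !addr0 !add0r -expr2.
move=> /(_ erefl) P0 /(_ erefl) P1 /(_ erefl) P2 /(_ erefl) P3.
move: P0 P1 P2 P3 K; rewrite /g /sum4 /toC /=.
have E (x y : R) : c.1 +i* c.2 + (x +i* y) = (c.1 + x) +i* (c.2 + y) by [].
rewrite !E !addr0.
move: (\sum_(F <- Fs) _) (\sum_(F <- Fs) homog_eps q phi eps F.[(c.1 + h) +i* c.2])
  (\sum_(F <- Fs) homog_eps q phi eps F.[c.1 +i* (c.2 + h)])
  (\sum_(F <- Fs) homog_eps q phi eps F.[(c.1 - h) +i* c.2])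
  (\sum_(F <- Fs) homog_eps q phi eps F.[c.1 +i* (c.2 - h)]) => S S0 S1 S2 S3 P0 P1 P2 P3 K.
have L : 4 * eta * h ^+ 2 <= M * h ^+ 3.
  rewrite -subr_ge0; rewrite -subr_ge0 in P0; rewrite -subr_ge0 in P1; rewrite -subr_ge0 in P2; rewrite -subr_ge0 in P3; rewrite -subr_ge0 in K.
  apply: le_trans (addr_ge0 K (addr_ge0 (addr_ge0 P0 P1) (addr_ge0 P2 P3))) _.
  by rewrite le_eqVlt; apply/orP; left; apply/eqP; ring.
have : M * h < 4 * eta.
  have : h * (M + 1) <= eta by rewrite -ler_pdivlMr// ltr_wpDl.
  by rewrite mulrDr mulr1 mulrC; lra.
rewrite ltNge; apply/negP; rewrite negbK.
rewrite -(@ler_pM2r _ (h ^+ 2)) ?exprn_gt0//; apply: le_trans L _.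
by rewrite le_eqVlt; apply/orP; left; apply/eqP; ring.
Qed.

End FourPoint.

(** * Means over the circle and nonnegativity of the mean of the weight *)

Section ArcMean.
Variable R : realType.
Implicit Types (g G : R -> R) (t : R).
Local Notation mu := (@lebesgue_measure R).

Lemma bounded_integrable g c : measurable_fun setT g -> (forall t, `|g t| <= c) ->
  (arc_length R).-integrable setT (EFin \o g).
Proof.
move=> mg gb; apply: measurable_bounded_integrable => //.
  by have /= -> := @probability_setT _ _ _ (arc_length R); rewrite ltry.
by exists c; split; rewrite ?num_real// => x cx y _; apply: le_trans (gb y) (ltW cx).
Qed.

Lemma arc_ftc g G c : continuous g -> (forall t, `|g t| <= c) ->
  (forall t, 0 <= t <= 2 * pi -> isd t G (g t)) ->
  (\int[arc_length R]_t g t = (2 * pi)^-1 * (G (2 * pi) - G 0))%R.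
Proof.
move=> gc gb dG; have pi0 : 0 < 2 * pi :> R := pi2_gt0 R.
have mg := continuous_measurable_fun gc.
have c0 : 0 <= c by apply: le_trans (gb 0).
have ig := bounded_integrable mg gb.
(* The integrand is shifted by its bound [c], since the density formula is applied to a nonnegative
   function. *)
have E : (\int[arc_length R]_t (g t + c)%:E = ((2 * pi)^-1 * (G (2 * pi) - G 0) + c)%:E)%E.
  rewrite integral_uniform; last 2 first.
  - by apply/measurable_EFinP; apply: measurable_funD => //; exact: measurable_cst.
  - move=> t; rewrite lee_fin -lerBlDr sub0r.
    by have := gb t; rewrite ler_norml => /andP[].
  have dGc t : 0 <= t <= 2 * pi -> isd t (fun t => G t + t * c) (g t + c).
    move=> tt; eapply isd_eq; first by apply: isd_add; [exact: dG|deriv].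
    by cbv beta; ring.
  rewrite (@continuous_FTC2 R (fun t => g t + c) (fun t => G t + t * c) 0 (2 * pi)) //.
  - rewrite -EFinB -EFinM subr0; congr (_%:E).
    by move: (2 * pi) pi0 => P P0; field; rewrite gt_eqF.
  - apply: (@continuous_subspaceT _ _ _ (fun t => g t + c)) => t.
    by apply: continuousD; [exact: gc|exact: cst_continuous].
  - have dc t : 0 <= t <= 2 * pi -> {for t, continuous (fun t => G t + t * c)}.
      by move=> /dGc; exact: isd_cont.
    split.
    + by move=> t; rewrite in_itv/= => /andP[/ltW t0 /ltW t1]; have [] := dGc t; rewrite ?t0.
    + by apply: cvg_at_right_filter; apply: dc; rewrite lexx ltW.
    + by apply: cvg_at_left_filter; apply: dc; rewrite lexx ltW.
  - move=> t; rewrite in_itv/= => /andP[/ltW t0 /ltW t1].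
    have tt : 0 <= t <= 2 * pi by rewrite t0.
    by have [_ E] := dGc t tt; rewrite derive1E.
rewrite /Rintegral.
have F : (\int[arc_length R]_t (g t + c)%:E = \int[arc_length R]_t (g t)%:E + c%:E)%E.
  under eq_integral do rewrite EFinD.
  rewrite integralD//=.
    by rewrite integral_cst//; have /= -> := @probability_setT _ _ _ (arc_length R); rewrite mule1.
  apply: (@bounded_integrable (fun=> c) `|c|); first exact: measurable_cst.
  by move=> t; rewrite ger0_norm.
have fg := integrable_fin_num measurableT ig.
move: E; rewrite F -(fineK fg) -EFinD => -[] /addIr -> //=.
Qed.

Lemma antiderivative g a b : continuous g -> exists G, forall t, a < t < b -> isd t G (g t).
Proof.
move=> gc; exists (fun x => \int[mu]_(t in `[a, x]) g t)%R => t /andP[at_ tb].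
have ig : mu.-integrable `[a, b] (EFin \o g).
  apply: continuous_compact_integrable; first exact: segment_compact.
  exact: continuous_subspaceT.
have [dg Eg] := continuous_FTC1_closed tb ig at_ (gc t).
by split; [exact: dg|rewrite -Eg derive1E].
Qed.

Lemma unif_continuous_itv g a b (e : R) : continuous g -> 0 < e ->
  exists2 d, 0 < d & forall x y, a <= x <= b -> `|y - x| < d -> `|g y - g x| < e.
Proof.
move=> gc e0.
have /compact_near_coveringP/(_ R (nbhs (0 : R)) (fun i x => `|g (x + i) - g x| < e)) := @segment_compact R a b.
have [] := _ : Filter (nbhs (0 : R)).
move=> ? ? ?; case.
  move=> x _.
  have e2 : 0 < e / 2 by rewrite divr_gt0.
  have : \forall y \near x, `|g x - g y| < e / 2 by move/cvgrPdist_lt: (gc x); apply.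
  move=> /nbhs_ballP[r /= r0 H].
  have r2 : 0 < r / 2 by rewrite divr_gt0.
  exists (ball x (r / 2), ball (0 : R) (r / 2)) => /=.
    by split; exact: nbhsx_ballx.
  move=> [x' i] [/= h1 h2].
  have k1 : `|g x - g x'| < e / 2.
    by apply: H; apply: le_ball h1; rewrite ler_pdivrMr// ler_peMr ?ler1n// ltW.
  have k2 : `|g x - g (x' + i)| < e / 2.
    apply: H; rewrite /ball /= in h1 h2 *.
    rewrite sub0r normrN in h2.
    have -> : x - (x' + i) = (x - x') - i by ring.
    by apply: le_lt_trans (ler_normB _ _) _; lra.
  have -> : g (x' + i) - g x' = (g x - g x') - (g x - g (x' + i)) by ring.
  by apply: le_lt_trans (ler_normB _ _) _; lra.
move=> r /= r0 H; exists r => // x y xab xy.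
have := H (y - x); rewrite /ball /= sub0r normrN => /(_ xy x).
rewrite /= in_itv/= => /(_ xab).
by rewrite addrCA subrr addr0.
Qed.

Lemma circle_cont (H : R * R -> R) : continuous H -> continuous (fun t => H (cos t, sin t)).
Proof.
move=> Hc t.
apply: (@continuous_comp _ _ _ (fun t : R => (cos t, sin t)) H); last exact: Hc.
exact: (cvg_pair (@continuous_cos R t) (@continuous_sin R t)).
Qed.

Lemma cabs_circle t : cabs (cos t +i* sin t) = 1.
Proof. by rewrite /cabs /= cos2Dsin2 sqrtr1. Qed.

Lemma circle_angle (z : R[i]) : cabs z = 1 -> exists2 t, - pi <= t <= pi & z = cos t +i* sin t.
Proof.
move=> z1; have [f [e [/andP[f0 fp] e1 zE _]]] := polar_form z.
rewrite z1 !mul1r in zE; case: e1 zE => -> ->.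
  by exists f; rewrite ?mul1r// fp andbT (le_trans _ f0)// oppr_le0 pi_ge0.
exists (- f); last by rewrite cosN sinN mulN1r.
by rewrite lerN2 fp (le_trans _ (pi_ge0 R))// oppr_le0.
Qed.

Lemma homog_bound q phi (z : R[i]) : 0 < q -> trig_convex q phi -> `|homog q phi z| <= cabs z `^ q.
Proof.
move=> q0 tc; rewrite /homog normrM ger0_norm ?powR_ge0//.
have [z0|z0] := eqVneq (cabs z) 0; first by rewrite z0 powR0 ?mul0r// gt_eqF.
have zp : 0 < cabs z by rewrite lt_neqAle eq_sym z0 cabs_ge0.
have /andP[h1 h2] := Re_cabs z.
have b1 : -1 <= complex.Re z / cabs z <= 1.
  by rewrite ler_pdivlMr// mulN1r h1 ler_pdivrMr// mul1r.
have [ap _] := acos_def b1.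
by rewrite -[leRHS]mulr1 ler_wpM2l ?powR_ge0// (trig_convex_le1 tc).
Qed.

Lemma homog_circle_bound q phi (F : {poly R[i]}) : 0 < q -> trig_convex q phi ->
  exists c, forall t, `|homog q phi F.[cos t +i* sin t]| <= c.
Proof.
move=> q0 tc; have [B B0 BP] := poly_bound F; exists (B `^ q) => t.
apply: le_trans (homog_bound _ q0 tc) _; apply: ge0_ler_powR; rewrite ?nnegrE ?cabs_ge0 ?(ltW q0)//.
by apply: BP; rewrite cabs_circle.
Qed.

(** The integral over a period does not depend on its starting point, so it is approximated by
    Riemann sums starting at whatever [th] the hypothesis provides. *)
Lemma periodic_mean_ge0 g c : continuous g -> (forall t, `|g t| <= c) ->
  (forall t, g (t + 2 * pi) = g t) ->
  (forall (eta : R) (N : nat), 0 < eta -> exists2 th, - pi <= th <= pi &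
     - eta <= \sum_(k < N) g (th + k%:R * (2 * pi / N%:R))) ->
  0 <= (\int[arc_length R]_t g t)%R.
Proof.
move=> gc gb gp H; have pi0 : 0 < pi :> R := pi_gt0 R; have pi2 := pi2_gt0 R.
have [G dG] := @antiderivative g (- (2 * pi)) (4 * pi) gc.
have dG' t : 0 <= t <= 2 * pi -> isd t G (g t).
  by move=> /andP[t0 t1]; apply: dG; apply/andP; split; lra.
rewrite (arc_ftc gc gb dG') mulr_ge0// ?invr_ge0 ?(ltW pi2)//.
(* By periodicity the increment of the primitive over a period has derivative zero in the starting
   point. *)
have dD t : - pi <= t <= pi -> isd t (fun t => G (t + 2 * pi) - G t) 0.
  move=> /andP[t0 t1]; eapply isd_eq.
    apply: isd_add; last by apply: isd_opp; apply: dG; apply/andP; split; lra.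
    apply: (@isd_comp R G (fun t => t + 2 * pi)); last by deriv.
    by apply: dG; apply/andP; split; lra.
  by cbv beta; rewrite gp; ring.
have const th : - pi <= th <= pi -> G (th + 2 * pi) - G th = G (2 * pi) - G 0.
  have [E|ne] := eqVneq th 0; first by rewrite E add0r.
  move=> /andP[t0 t1]; have E0 : G (2 * pi) - G 0 = G (0 + 2 * pi) - G 0 by rewrite add0r.
  rewrite E0; have [lt|ge] := ltP th 0.
    have [|z _ E] := @mvt R (fun t => G (t + 2 * pi) - G t) (fun=> 0) th 0 lt.
      by move=> x /andP[x0 x1]; apply: dD; apply/andP; split; lra.
    by move: E; rewrite mul0r => /eqP; rewrite subr_eq0 => /eqP ->.
  have gt : 0 < th by rewrite lt_neqAle eq_sym ne.
  have [|z _ E] := @mvt R (fun t => G (t + 2 * pi) - G t) (fun=> 0) 0 th gt.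
    by move=> x /andP[x0 x1]; apply: dD; apply/andP; split; lra.
  by move: E; rewrite mul0r => /eqP; rewrite subr_eq0 => /eqP ->.
apply/ler_addgt0Pr => e e0.
have [eta etaE] : exists eta, eta = e / (4 * pi) by eexists.
have eta0 : 0 < eta by rewrite etaE divr_gt0// mulr_gt0.
have [d d0 unif] := @unif_continuous_itv g (- pi) (3 * pi) eta gc eta0.
have [N Nd] : exists N : nat, 2 * pi / N.+1%:R < d.
  exists (Num.trunc (2 * pi / d)).
  rewrite ltr_pdivrMr// [ltRHS]mulrC -ltr_pdivrMr//.
  exact: truncnS_gt.
have N0 : 0 < N.+1%:R :> R by rewrite ltr0n.
have [h hE] : exists h : R, h = 2 * pi / N.+1%:R by exists (2 * pi / N.+1%:R).
have h0 : 0 < h by rewrite hE divr_gt0.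
have Nh : N.+1%:R * h = 2 * pi by rewrite hE mulrC divfK// gt_eqF.
have h2 : h <= 2 * pi by rewrite -Nh ler_peMl ?ler1n// ltW.
have [th /andP[th0 th1] Hth] := H eta N.+1 eta0.
rewrite -hE in Hth; rewrite -hE in Nd.
have step (k : 'I_N.+1) : h * (g (th + k%:R * h) - eta) <= G (th + k.+1%:R * h) - G (th + k%:R * h).
  have kN : k.+1%:R * h <= 2 * pi by rewrite -Nh ler_pM2r// ler_nat.
  have k0 : 0 <= k%:R * h by rewrite mulr_ge0 ?ler0n// ltW.
  have kk : k.+1%:R * h = k%:R * h + h by rewrite -natr1 mulrDl mul1r.
  rewrite kk in kN *.
  have lt : th + k%:R * h < th + (k%:R * h + h) by rewrite ltrD2l ltrDl.
  have [|x /andP[x0 x1] ->] := @mvt R G g _ _ lt.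
    by move=> x /andP[x0 x1]; apply: dG; apply/andP; split; lra.
  have -> : th + (k%:R * h + h) - (th + k%:R * h) = h by ring.
  rewrite mulrC ler_pM2r//.
  have := unif (th + k%:R * h) x.
  have -> : - pi <= th + k%:R * h <= 3 * pi by apply/andP; split; lra.
  have -> : `|x - (th + k%:R * h)| < d by rewrite gtr0_norm; lra.
  by move=> /(_ isT isT); rewrite ltr_norml => /andP[? _]; lra.
have := @ler_sum R 'I_N.+1 (index_enum 'I_N.+1) xpredT _ _ (fun k _ => step k).
rewrite -mulr_sumr big_split /= sumr_const card_ord.
have -> : \sum_(i < N.+1) (G (th + i.+1%:R * h) - G (th + i%:R * h)) = G (2 * pi) - G 0.
  rewrite -(const th) ?th0//.
  rewrite -(big_mkord xpredT (fun i => G (th + i.+1%:R * h) - G (th + i%:R * h))).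
  by rewrite (telescope_sumr (fun i => G (th + i%:R * h))) ?leq0n// Nh mul0r addr0.
move=> le.
have : - (e) <= h * (\sum_(i < N.+1) g (th + i%:R * h) + - eta *+ N.+1); last by lra.
rewrite mulrDr.
have E1 : h * (- eta *+ N.+1) = - (2 * pi) * eta.
  by rewrite -Nh -[_ *+ N.+1]mulr_natr; ring.
have E2 : h * - eta <= h * \sum_(i < N.+1) g (th + i%:R * h) by rewrite ler_pM2l.
have E3 : - (2 * pi) * eta <= h * - eta by rewrite mulrN mulNr lerN2 ler_pM2r.
have E4 : e = 4 * pi * eta by rewrite etaE mulrC divfK// gt_eqF// mulr_gt0.
rewrite E1 E4; lra.
Qed.

(** All N rotations of [F] vanish at 0, so [max_principle] yields a point of the circle where the
    sum of their weights is at least - eta. That sum is a Riemann sum of the weight of [F]. *)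
Lemma homog_eps_mean_ge0 q (phi : R -> R) eps (F : {poly R[i]}) :
  0 < q -> trig_convex q phi -> continuous phi -> 0 < eps -> F.[0] = 0 ->
  0 <= (\int[arc_length R]_t homog_eps q phi eps F.[cos t +i* sin t])%R.
Proof.
move=> q0 tc pc e0 F0.
have [c1 b1] := homog_circle_bound F q0 tc.
have q2 : 0 < q / 2 by rewrite divr_gt0.
have [c2 b2] := homog_circle_bound F q2 (@trig_convex_one R (q / 2)).
apply: (@periodic_mean_ge0 _ (c1 + eps * c2)).
- exact: (circle_cont (@homog_eps_cont R q phi eps F q0 tc pc)).
- move=> t; rewrite /homog_eps; apply: le_trans (ler_normD _ _) _.
  by rewrite lerD// normrM gtr0_norm// ler_pM2l.
- by move=> t; rewrite mulr_natl cosD2pi sinD2pi.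
move=> eta N eta0.
pose rotF k : {poly R[i]} := F \Po ((cos (k%:R * (2 * pi / N%:R)) +i* sin (k%:R * (2 * pi / N%:R)))%:P * 'X).
have [z z1] := @max_principle R q phi eps [seq rotF k | k <- index_iota 0 N] eta q0 tc pc e0 eta0.
have [th thp zE] := circle_angle z1.
rewrite !big_map !big_mkord => Hs.
exists th => //; apply: le_trans (_ : \sum_(k < N) homog_eps q phi eps (rotF k).[z] <= _); last first.
  rewrite le_eqVlt; apply/orP; left; apply/eqP; apply: eq_bigr => k _.
  congr (homog_eps _ _ _ _); rewrite horner_comp hornerM hornerC hornerX zE; congr (_.[_]).
  rewrite cosD sinD; set a := cos th; set b := sin th.
  by congr (_ +i* _); rewrite /=; ring.
apply: le_trans Hs; rewrite big1 ?sub0r// => k _.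
rewrite horner_comp hornerM hornerX mulr0 F0 /homog_eps /homog.
have -> : cabs (0 : R[i]) = 0 by rewrite /cabs /= expr0n addr0 sqrtr0.
by rewrite !powR0 ?mul0r ?mulr0 ?addr0// gt_eqF.
Qed.

(** Lets the auxiliary coefficient tend to 0: the mean of the extra term is bounded by [c2]. *)
Lemma homog_mean_ge0 q (phi : R -> R) (F : {poly R[i]}) :
  0 < q -> trig_convex q phi -> continuous phi -> F.[0] = 0 ->
  0 <= (\int[arc_length R]_t homog q phi F.[cos t +i* sin t])%R.
Proof.
move=> q0 tc pc F0.
have [c1 b1] := homog_circle_bound F q0 tc.
have q2 : 0 < q / 2 by rewrite divr_gt0.
have [c2 b2] := homog_circle_bound F q2 (@trig_convex_one R (q / 2)).
have ct1 : continuous (fun t => homog q phi F.[cos t +i* sin t]).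
  apply: (circle_cont (H := fun x => homog q phi F.[toC x])); apply: homog_poly_cont => // t tp.
  exact: trig_convex_le1 tc tp.
have ct2 : continuous (fun t => homog (q / 2) (fun=> 1) F.[cos t +i* sin t]).
  apply: (circle_cont (H := fun x => homog (q / 2) (fun=> 1) F.[toC x])); apply: homog_poly_cont => //.
    exact: cst_cont.
  by move=> t _; rewrite normr1.
have i1 := bounded_integrable (continuous_measurable_fun ct1) b1.
have i2 := bounded_integrable (continuous_measurable_fun ct2) b2.
have c20 : 0 <= c2 by apply: le_trans (b2 0).
apply/ler_addgt0Pr => e e0.
have ec : 0 < e / (c2 + 1) by rewrite divr_gt0// ltr_wpDl.
have := @homog_eps_mean_ge0 q phi (e / (c2 + 1)) F q0 tc pc ec F0.
rewrite /homog_eps RintegralD//; last first.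
  rewrite (_ : EFin \o _ = (fun t => (e / (c2 + 1))%:E * (homog (q / 2) (fun=> 1) F.[cos t +i* sin t])%:E)%E)//.
  exact: integrableZl.
rewrite RintegralZl// => /le_trans; apply; rewrite lerD2l.
have : (\int[arc_length R]_x homog (q / 2) (fun=> 1) F.[cos x +i* sin x])%R <= c2.
  apply: le_trans (_ : (\int[arc_length R]_(x in setT) c2)%R <= _).
    apply: le_Rintegral => //.
      apply: (@bounded_integrable (fun=> c2) `|c2|); first exact: measurable_cst.
      by move=> t; rewrite ger0_norm.
    by move=> t _; apply: le_trans (ler_norm _) (b2 t).
  by rewrite Rintegral_cst//; have /= -> := @probability_setT _ _ _ (arc_length R); rewrite mulr1.
move=> h; rewrite mulrAC ler_pdivrMr ?ltr_wpDl// ler_pM2l//.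
by apply: le_trans h _; rewrite lerDl.
Qed.

End ArcMean.

(** * Fejer means *)

Section PowerInequalities.
Variable R : realType.
Implicit Types (x m r e p : R).

(** Holds for every positive exponent, below 1 as well. With (1 + h)^r = 1 + e, either d <= h a, and
    the first term suffices, or a < d / h, and the second one does. *)
Lemma power_split r e : 0 < r -> 0 < e -> exists2 C, 0 <= C &
  forall a d : R, 0 <= a -> 0 <= d -> (a + d) `^ r <= (1 + e) * a `^ r + C * d `^ r.
Proof.
move=> r0 e0; have e1 : 1 < 1 + e by rewrite ltrDl.
have e10 : 0 < 1 + e by apply: lt_trans e1.
pose h := (1 + e) `^ r^-1 - 1.
have hr : (1 + h) `^ r = 1 + e.
  by rewrite /h addrCA subrr addr0 -powRrM mulVf ?gt_eqF// powRr1// ltW.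
have h0 : 0 < h.
  rewrite /h subr_gt0 -[ltLHS](_ : 1 `^ r^-1 = 1); last by rewrite powR1.
  by apply: gt0_ltr_powR; rewrite ?invr_gt0 ?nnegrE ?ltW.
clearbody h; exists ((1 + h^-1) `^ r); first exact: powR_ge0.
move=> a d a0 d0.
have [le|lt] := leP d (h * a).
  apply: (@le_trans _ _ ((1 + h) `^ r * a `^ r)); last by rewrite hr lerDl mulr_ge0 ?powR_ge0.
  rewrite -powRM//; last by rewrite addr_ge0 ?ltW.
  apply: ge0_ler_powR; rewrite ?nnegrE ?(ltW r0) ?addr_ge0 ?mulr_ge0 ?addr_ge0 ?(ltW h0)//.
  by rewrite mulrDl mul1r lerD2l.
apply: (@le_trans _ _ ((1 + h^-1) `^ r * d `^ r)); last by rewrite lerDr mulr_ge0 ?powR_ge0// ltW.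
have hi : 0 <= h^-1 by rewrite invr_ge0 ltW.
rewrite -powRM//; last by rewrite addr_ge0.
apply: ge0_ler_powR; rewrite ?nnegrE ?(ltW r0) ?addr_ge0 ?mulr_ge0 ?addr_ge0//.
by rewrite mulrDl mul1r addrC lerD2l mulrC ler_pdivlMr// mulrC ltW.
Qed.

Lemma powR_tangent p x m : 1 < p -> 0 <= x -> 0 <= m -> m `^ p + p * m `^ (p - 1) * (x - m) <= x `^ p.
Proof.
move=> p1 x0; have p0 : 0 < p := lt_trans ltr01 p1.
have pm : 0 < p - 1 by rewrite subr_gt0.
rewrite le_eqVlt => /predU1P[<-|m0].
  by rewrite !powR0 ?gt_eqF// mulr0 mul0r addr0 powR_ge0.
move: x0; rewrite le_eqVlt => /predU1P[<-|x0].
  rewrite powR0 ?gt_eqF// sub0r mulrN -mulrA -powR_split// -[X in X - _]mul1r -mulrBl.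
  by rewrite mulr_le0_ge0 ?powR_ge0// subr_le0 ltW.
have D t : 0 < t -> isd t (fun t => t `^ p - p * m `^ (p - 1) * t) (p * (t `^ (p - 1) - m `^ (p - 1))).
  move=> t0; eapply isd_eq; [deriv => //|].
  by cbv beta; move: (_ `^ _) (_ `^ _) => A B; ring.
suff : m `^ p - p * m `^ (p - 1) * m <= x `^ p - p * m `^ (p - 1) * x.
  by rewrite mulrBr => h; rewrite -subr_ge0; rewrite -subr_ge0 in h; apply: le_trans h _; rewrite le_eqVlt; apply/orP; left; apply/eqP; ring.
have [mx|xm] := leP m x.
  apply: (@incr_le R (fun t => t `^ p - p * m `^ (p - 1) * t) (fun t => p * (t `^ (p - 1) - m `^ (p - 1))) _ _ mx).
    by move=> t /andP[mt _]; apply: D; apply: lt_le_trans mt.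
  move=> t /andP[mt tx]; rewrite mulr_ge0 ?(ltW p0)// subr_ge0.
  by apply: ge0_ler_powR; rewrite ?nnegrE ?(ltW pm) ?(ltW m0) ?(ltW (lt_trans m0 mt))// ltW.
apply: (@decr_le R (fun t => t `^ p - p * m `^ (p - 1) * t) (fun t => p * (t `^ (p - 1) - m `^ (p - 1))) _ _ (ltW xm)).
  by move=> t /andP[mt _]; apply: D; apply: lt_le_trans mt.
move=> t /andP[xt tm]; rewrite mulr_ge0_le0 ?(ltW p0)// subr_le0.
by apply: ge0_ler_powR; rewrite ?nnegrE ?(ltW pm) ?(ltW m0) ?(ltW (lt_trans x0 xt))// ltW.
Qed.

Lemma powR_mean_le p (N : nat) (x : nat -> R) : 1 < p -> (forall i, 0 <= x i) ->
  (N.+1%:R^-1 * \sum_(0 <= i < N.+1) x i) `^ p <= N.+1%:R^-1 * \sum_(0 <= i < N.+1) x i `^ p.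
Proof.
move=> p1 x0; have [m mE] : exists m, m = N.+1%:R^-1 * \sum_(0 <= i < N.+1) x i by eexists.
rewrite -mE.
have N0 : 0 < N.+1%:R :> R by rewrite ltr0n.
have m0 : 0 <= m by rewrite mE mulr_ge0 ?invr_ge0 ?ler0n// sumr_ge0.
have : \sum_(0 <= i < N.+1) (m `^ p + p * m `^ (p - 1) * (x i - m)) <= \sum_(0 <= i < N.+1) x i `^ p.
  by apply: ler_sum => i _; exact: powR_tangent.
rewrite big_split /= -mulr_sumr big_split /= !sumr_const_nat subn0.
have -> : \sum_(0 <= i < N.+1) x i + - m *+ N.+1 = 0.
  by rewrite mE mulNrn -[_ *+ N.+1]mulr_natl mulrA mulfV ?gt_eqF// mul1r subrr.
by rewrite mulr0 addr0 -[_ *+ N.+1]mulr_natl -(ler_pM2l (x := N.+1%:R^-1)) ?invr_gt0// mulrA mulVf ?gt_eqF// mul1r.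
Qed.

End PowerInequalities.

Section Integrals.
Variable R : realType.
Implicit Types (f g : R -> R).
Local Notation arc := (arc_length R).
Definition integ g := arc.-integrable setT (EFin \o g).
Definition mean g : R := (\int[arc]_t g t)%R.

Lemma integ_meas g : integ g -> measurable_fun setT g.
Proof. by move=> /measurable_int/measurable_EFinP. Qed.

Lemma integ_bdd g c : measurable_fun setT g -> (forall t, `|g t| <= c) -> integ g.
Proof. exact: bounded_integrable. Qed.

Lemma integ_cst (c : R) : integ (fun=> c).
Proof. by apply: (@integ_bdd _ `|c|); first exact: measurable_cst. Qed.

Lemma mean_cst (c : R) : mean (fun=> c) = c.
Proof.
rewrite /mean Rintegral_cst//; have /= -> := @probability_setT _ _ _ arc.
by rewrite mulr1.
Qed.

Lemma integ_add f g : integ f -> integ g -> integ (fun t => f t + g t).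
Proof. by move=> h1 h2; exact: (integrableD measurableT h1 h2). Qed.

Lemma mean_add f g : integ f -> integ g -> mean (fun t => f t + g t) = mean f + mean g.
Proof. by move=> h1 h2; rewrite /mean RintegralD. Qed.

Lemma integ_scale (c : R) g : integ g -> integ (fun t => c * g t).
Proof. by move=> h; exact: (integrableZl measurableT c h). Qed.

Lemma mean_scale (c : R) g : integ g -> mean (fun t => c * g t) = c * mean g.
Proof. by move=> h; rewrite /mean RintegralZl. Qed.

Lemma mean_sub f g : integ f -> integ g -> mean (fun t => f t - g t) = mean f - mean g.
Proof. by move=> h1 h2; rewrite /mean RintegralB. Qed.

Lemma integ_mul_bdd g (h : R -> R) (c : R) : integ g -> measurable_fun setT h -> (forall t, `|h t| <= c) ->
  integ (fun t => g t * h t).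
Proof.
move=> ig mh hb; apply: (@le_integrable _ _ _ arc setT measurableT _ (EFin \o (fun t => c * g t))).
- by apply/measurable_EFinP; apply: measurable_funM => //; exact: integ_meas.
- move=> t _; rewrite /= lee_fin !normrM mulrC ler_wpM2r//.
  by apply: le_trans (hb t) (ler_norm _).
- exact: integ_scale.
Qed.

Lemma integ_sum (I : Type) (r : seq I) (h : I -> R -> R) : (forall i, integ (h i)) ->
  integ (fun t => \sum_(i <- r) h i t).
Proof.
move=> ih; elim: r => [|i r IH].
  by have := integ_cst 0; congr integ; apply/funext => t; rewrite big_nil.
by have := integ_add (ih i) IH; congr integ; apply/funext => t; rewrite big_cons.
Qed.

Lemma mean_sum (I : Type) (r : seq I) (h : I -> R -> R) : (forall i, integ (h i)) ->
  mean (fun t => \sum_(i <- r) h i t) = \sum_(i <- r) mean (h i).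
Proof.
move=> ih; elim: r => [|i r IH].
  by rewrite big_nil -[RHS]mean_cst; congr mean; apply/funext => t; rewrite big_nil.
rewrite big_cons -IH -mean_add//; last exact: integ_sum.
by congr mean; apply/funext => t; rewrite big_cons.
Qed.

Lemma mean_le f g : integ f -> integ g -> (forall t, f t <= g t) -> mean f <= mean g.
Proof. by move=> h1 h2 fg; apply: le_Rintegral. Qed.

Lemma mean_E g : integ g -> (\int[arc]_t (g t)%:E = (mean g)%:E)%E.
Proof. by move=> ig; rewrite /mean /Rintegral fineK//; exact: integrable_fin_num. Qed.

Lemma cos_lin_meas (m b : R) : measurable_fun setT (fun t => cos (m * t + b)).
Proof.
apply: continuous_measurable_fun => t; apply: isd_cont; by deriv.
Qed.

Lemma mean_cos (m : nat) (b : R) : mean (fun t => cos (m.+1%:R * t + b)) = 0.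
Proof.
have m0 : m.+1%:R != 0 :> R by rewrite pnatr_eq0.
rewrite /mean (@arc_ftc R _ (fun t => m.+1%:R^-1 * sin (m.+1%:R * t + b)) 1).
- have -> : m.+1%:R * (2 * pi) + b = b + pi *+ 2 *+ m.+1.
    by rewrite addrC mulr2n -[(pi + pi) *+ _]mulr_natl; ring.
  by rewrite mulr0 add0r (periodicn (@sinD2pi R)) subrr mulr0.
- by move=> t; apply: isd_cont; deriv.
- by move=> t; exact: cos_max.
- by move=> t _; eapply isd_eq; [deriv|cbv beta; field].
Qed.

End Integrals.

(** * The Fejer kernel *)

Section FejerKernel.
Variable R : realType.
Implicit Types (x t : R) (N j m : nat).

Definition dirichlet j x : R := 1 + 2 * \sum_(1 <= m < j.+1) cos (m%:R * x).
Definition fejer N x : R := N%:R^-1 * \sum_(0 <= j < N) dirichlet j x.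

(** The right side is the squared modulus of the sum of e^(ijx). One more term adds 1 plus twice the
    real part of its product with the conjugate of the earlier ones, which is a Dirichlet kernel. *)
Lemma fejer_sqr N x : \sum_(0 <= j < N) dirichlet j x =
  (\sum_(0 <= j < N) cos (j%:R * x)) ^+ 2 + (\sum_(0 <= j < N) sin (j%:R * x)) ^+ 2.
Proof.
elim: N => [|N IH]; first by rewrite !big_geq// !expr0n addr0.
rewrite !big_nat_recr//= IH.
have E : cos (N%:R * x) * (\sum_(0 <= j < N) cos (j%:R * x)) +
    sin (N%:R * x) * (\sum_(0 <= j < N) sin (j%:R * x)) = \sum_(1 <= m < N.+1) cos (m%:R * x).
  rewrite !mulr_sumr -big_split /= big_add1 /= [RHS]big_nat_rev /= add0n.
  rewrite [LHS]big_nat_cond [RHS]big_nat_cond; apply: eq_bigr => i; rewrite andbT leq0n /= => iN.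
  rewrite -cosB; congr cos; rewrite -mulrBl; congr (_ * _).
  by rewrite -natrB ?(ltnW iN)//; congr (_%:R); rewrite subnSK.
rewrite /dirichlet -E.
have := cos2Dsin2 (N%:R * x); move: (cos _) (sin _) (\sum_(_ <= _ < _) _) (\sum_(_ <= _ < _) _) => C S A B CS.
have -> : (B + C) ^+ 2 + (A + S) ^+ 2 = B ^+ 2 + A ^+ 2 + (C ^+ 2 + S ^+ 2 + 2 * (C * B + S * A)) by ring.
by rewrite CS.
Qed.

Lemma fejer_ge0 N x : 0 <= fejer N x.
Proof. by rewrite /fejer fejer_sqr mulr_ge0 ?invr_ge0 ?ler0n// addr_ge0// sqr_ge0. Qed.

Lemma fejer_bound N x : `|fejer N x| <= N%:R^-1 * \sum_(0 <= j < N) (1 + 2 * \sum_(1 <= m < j.+1) 1).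
Proof.
rewrite /fejer normrM ger0_norm ?invr_ge0 ?ler0n// ler_wpM2l ?invr_ge0 ?ler0n//.
apply: (le_trans (ler_norm_sum _ _ _)); apply: ler_sum => j _.
apply: (le_trans (ler_normD _ _)); rewrite normr1 lerD2l normrM ger0_norm// ler_wpM2l//.
by apply: (le_trans (ler_norm_sum _ _ _)); apply: ler_sum => m _; exact: cos_max.
Qed.

Lemma fejer_meas N (c b : R) : measurable_fun setT (fun t => fejer N (c * t + b)).
Proof.
apply: continuous_measurable_fun.
rewrite (_ : (fun t => fejer N (c * t + b)) = (fun t => N%:R^-1 * \sum_(0 <= j < N)
   (1 + 2 * \sum_(1 <= m < j.+1) cos (m%:R * (c * t + b)))))//.
apply: contM; first exact: cst_cont.
apply: sum_cont => j; apply: contD; first exact: cst_cont.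
apply: contM; first exact: cst_cont.
by apply: sum_cont => m t; apply: isd_cont; deriv.
Qed.

Lemma mean_fejer N (g : R -> R) (y : R -> R) :
  (forall m : nat, measurable_fun setT (fun t => cos (m%:R * y t))) -> integ g ->
  mean (fun t => g t * fejer N (y t)) =
  N%:R^-1 * \sum_(0 <= j < N) (mean g + \sum_(1 <= m < j.+1) 2 * mean (fun t => g t * cos (m%:R * y t))).
Proof.
move=> my ig.
have ic m : integ (fun t => g t * cos (m%:R * y t)).
  by apply: (@integ_mul_bdd _ _ _ 1) => // t; exact: cos_max.
rewrite (_ : (fun t => g t * fejer N (y t)) = (fun t => N%:R^-1 * \sum_(0 <= j < N)
    (g t + \sum_(1 <= m < j.+1) 2 * (g t * cos (m%:R * y t))))); last first.
  apply/funext => t; rewrite /fejer mulrCA; congr (_ * _); rewrite mulr_sumr.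
  apply: eq_bigr => j _; rewrite /dirichlet mulrDr mulr1; congr (_ + _).
  by rewrite mulrCA !mulr_sumr; apply: eq_bigr => m _; rewrite mulrCA.
have i2 j : integ (fun t => \sum_(1 <= m < j.+1) 2 * (g t * cos (m%:R * y t))).
  by apply: integ_sum => m; apply: integ_scale.
rewrite mean_scale; last by apply: integ_sum => j; apply: integ_add.
congr (_ * _); rewrite mean_sum; last by move=> j; apply: integ_add.
apply: eq_bigr => j _; rewrite mean_add// mean_sum; last by move=> m; apply: integ_scale.
by congr (_ + _); apply: eq_bigr => m _; rewrite mean_scale.
Qed.

Lemma fejer_mass N (c b : R) : c = 1 \/ c = -1 -> mean (fun t => fejer N.+1 (c * t + b)) = 1.
Proof.
move=> c1; have my m : measurable_fun setT (fun t => cos (m%:R * (c * t + b))).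
  by apply: continuous_measurable_fun => t; apply: isd_cont; deriv.
have := @mean_fejer N.+1 (fun=> 1) (fun t => c * t + b) my (integ_cst 1).
rewrite (_ : (fun t => 1 * fejer N.+1 (c * t + b)) = (fun t => fejer N.+1 (c * t + b))); last first.
  by apply/funext => t; rewrite mul1r.
move=> ->; rewrite mean_cst.
have E (j : nat) : \sum_(1 <= m < j.+1) 2 * mean (fun t : R => 1 * cos (m%:R * (c * t + b))) = 0.
  rewrite big_add1 /= big1// => m _; rewrite (_ : mean _ = 0) ?mulr0//.
  have [cE|cE] := c1.
    rewrite -(@mean_cos R m (m.+1%:R * b)); congr mean; apply/funext => t.
    by rewrite mul1r cE mul1r mulrDr.
  rewrite -(@mean_cos R m (- (m.+1%:R * b))); congr mean; apply/funext => t.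
  by rewrite mul1r cE -cosN; congr cos; ring.
under eq_bigr do rewrite E addr0.
by rewrite sumr_const_nat subn0 mulVf// pnatr_eq0.
Qed.

End FejerKernel.

(** * Fejer means as convolutions and their contractivity *)

Section FejerMeans.
Variable R : realType.
Implicit Types (t : R) (N j m : nat).

Lemma cis_add (x y : R) : (cos (x + y) +i* sin (x + y)) = (cos x +i* sin x) * (cos y +i* sin y) :> R[i].
Proof. by rewrite cosD sinD; congr (_ +i* _); rewrite /=; ring. Qed.

Lemma expi_exp t (n : nat) : val (expi t) ^ n%:Z = cos (n%:R * t) +i* sin (n%:R * t).
Proof.
rewrite -exprnP; elim: n => [|n IH]; first by rewrite expr0 mul0r cos0 sin0.
by rewrite exprSr IH -[in RHS]natr1 mulrDl mul1r cis_add.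
Qed.

Lemma expi_expN t (n : nat) : val (expi t) ^ (- n%:Z) = cos (n%:R * t) -i* sin (n%:R * t).
Proof.
rewrite -exprnN.
have E : val (expi t) ^+ n = cos (n%:R * t) +i* sin (n%:R * t) by rewrite -expi_exp.
have U : (cos (n%:R * t) +i* sin (n%:R * t)) * (cos (n%:R * t) -i* sin (n%:R * t)) = 1 :> R[i].
  have := cos2Dsin2 (n%:R * t); move: (cos _) (sin _) => C S CS.
  by apply/eqP; rewrite eq_complex /=; apply/andP; split; apply/eqP; [rewrite -CS|]; ring.
rewrite E; apply: (mulfI (x := cos (n%:R * t) +i* sin (n%:R * t))).
  by apply/eqP => Z; move: U; rewrite Z mul0r => /eqP; rewrite eq_sym oner_eq0.
rewrite U mulfV//.
by apply/eqP => Z; move: U; rewrite Z mul0r => /eqP; rewrite eq_sym oner_eq0.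
Qed.

Lemma sum_complex (I : Type) (r : seq I) (a b : I -> R) :
  \sum_(i <- r) (a i +i* b i) = (\sum_(i <- r) a i) +i* (\sum_(i <- r) b i).
Proof.
elim: r => [|i r IH]; first by rewrite !big_nil.
by rewrite !big_cons IH.
Qed.

Variables (p : R) (f : circle R -> R[i]).
Hypotheses (p1 : 1 < p) (fLp : in_Lp p f).

Let fr t := complex.Re (f (expi t)).
Let fi t := complex.Im (f (expi t)).
Definition circle_abs t := cabs (f (expi t)).

Lemma powR_meas (g : R -> R) (r : R) : measurable_fun setT g -> measurable_fun setT (fun t => g t `^ r).
Proof. by move=> mg; apply: (measurableT_comp (measurable_powR r) mg). Qed.

Lemma sqrt_meas : measurable_fun setT (@Num.sqrt R).
Proof. by apply: continuous_measurable_fun => x; exact: sqrt_continuous. Qed.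

Lemma cabs_meas (g : R -> R[i]) : measurable_fun setT (fun t => complex.Re (g t)) ->
  measurable_fun setT (fun t => complex.Im (g t)) -> measurable_fun setT (fun t => cabs (g t)).
Proof.
move=> m1 m2.
rewrite (_ : (fun t => cabs (g t)) = (fun t => Num.sqrt (complex.Re (g t) ^+ 2 + complex.Im (g t) ^+ 2))); last first.
  by apply/funext => t; rewrite -cabs_sqr sqrtr_sqr ger0_norm// cabs_ge0.
apply: (measurableT_comp sqrt_meas).
by apply: measurable_funD; apply: measurable_funX.
Qed.

Lemma circle_abs_meas : measurable_fun setT circle_abs.
Proof. by have [m1 m2 _] := fLp; exact: cabs_meas. Qed.

Lemma circle_abs_powE : (\int[arc_length R]_t (circle_abs t `^ p)%:E = (Lp_norm p f) `^ p)%E.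
Proof.
have p0 : p != 0 by rewrite gt_eqF// (lt_trans ltr01).
rewrite /Lp_norm /circle_norm (poweR_Lnorm _ _ p0).
by apply: eq_integral => t _; rewrite poweR_EFin (ger0_norm (cabs_ge0 _)).
Qed.

Lemma circle_abs_integ : integ (fun t => circle_abs t `^ p).
Proof.
apply/integrableP; split; first by apply/measurable_EFinP; apply: powR_meas; exact: circle_abs_meas.
under eq_integral do rewrite /= ger0_norm ?powR_ge0//.
by rewrite circle_abs_powE poweR_lty//; case: fLp.
Qed.

Lemma le_one_powR (x : R) : 0 <= x -> x <= 1 + x `^ p.
Proof.
move=> x0; have [x1|x1] := leP x 1; first by rewrite (le_trans x1)// lerDl powR_ge0.
apply: (@le_trans _ _ (x `^ p)); last by rewrite lerDr.
rewrite -[leLHS]powRr1//; apply: ler_powR; [exact: ltW|exact: ltW].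
Qed.

Lemma part_integ (g : R -> R) : measurable_fun setT g -> (forall t, `|g t| <= circle_abs t) -> integ g.
Proof.
move=> mg gb; apply: (@le_integrable _ _ _ (arc_length R) setT measurableT _ (EFin \o (fun t => 1 + circle_abs t `^ p))).
- exact/measurable_EFinP.
- move=> t _; rewrite /= lee_fin [leRHS]ger0_norm ?addr_ge0 ?powR_ge0//.
  by apply: le_trans (gb t) _; apply: le_one_powR; exact: cabs_ge0.
- by apply: integ_add; [exact: integ_cst|exact: circle_abs_integ].
Qed.

Lemma fr_integ : integ fr.
Proof.
apply: part_integ; first by case: fLp.
move=> t; rewrite ler_norml; exact: Re_cabs.
Qed.

Lemma fi_integ : integ fi.
Proof.
apply: part_integ; first by case: fLp.
move=> t; rewrite -(@ler_pXn2r _ 2)// ?nnegrE ?cabs_ge0// cabs_sqr real_normK ?num_real//.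
by rewrite lerDr sqr_ge0.
Qed.

Let cosm g m := mean (fun t => g t * cos (m%:R * t)).
Let sinm g m := mean (fun t => g t * sin (m%:R * t)).

Lemma integ_cosm g m : integ g -> integ (fun t => g t * cos (m%:R * t)).
Proof.
move=> ig; apply: (@integ_mul_bdd _ _ _ 1) => //; last by move=> t; exact: cos_max.
by apply: continuous_measurable_fun => t; apply: isd_cont; deriv.
Qed.

Lemma integ_sinm g m : integ g -> integ (fun t => g t * sin (m%:R * t)).
Proof.
move=> ig; apply: (@integ_mul_bdd _ _ _ 1) => //; last by move=> t; exact: sin_max.
by apply: continuous_measurable_fun => t; apply: isd_cont; deriv.
Qed.

Lemma fourier_pos m : fourier f m%:Z = (cosm fr m + sinm fi m) +i* (cosm fi m - sinm fr m).
Proof.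
rewrite /cosm /sinm -mean_add ?integ_cosm ?integ_sinm ?fr_integ ?fi_integ//.
rewrite -mean_sub ?integ_cosm ?integ_sinm ?fr_integ ?fi_integ//.
rewrite /fourier /cintegral /mean; congr (_ +i* _); congr Rintegral; apply/funext => t.
  rewrite /fr /fi; case: (f (expi t)) => a b /=.
  by rewrite mulNr cosN sinN -pmulrn; ring.
rewrite /fr /fi; case: (f (expi t)) => a b /=.
by rewrite mulNr cosN sinN -pmulrn; ring.
Qed.

Lemma fourier_neg m : fourier f (- m%:Z) = (cosm fr m - sinm fi m) +i* (cosm fi m + sinm fr m).
Proof.
rewrite /cosm /sinm -mean_add ?integ_cosm ?integ_sinm ?fr_integ ?fi_integ//.
rewrite -mean_sub ?integ_cosm ?integ_sinm ?fr_integ ?fi_integ//.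
rewrite /fourier /cintegral /mean; congr (_ +i* _); congr Rintegral; apply/funext => t.
  rewrite /fr /fi; case: (f (expi t)) => a b /=.
  by rewrite mulrNz opprK -pmulrn; ring.
rewrite /fr /fi; case: (f (expi t)) => a b /=.
by rewrite mulrNz opprK -pmulrn; ring.
Qed.

Lemma mean_cos_shift g m t : integ g ->
  mean (fun u => g u * cos (m%:R * (t - u))) = cos (m%:R * t) * cosm g m + sin (m%:R * t) * sinm g m.
Proof.
move=> ig; rewrite -!mean_scale ?integ_cosm ?integ_sinm//.
rewrite -mean_add; first by congr mean; apply/funext => u; rewrite mulrBr cosB; ring.
  by apply: integ_scale; exact: integ_cosm.
by apply: integ_scale; exact: integ_sinm.
Qed.

Lemma fourier_pair m t : fourier f m%:Z * val (expi t) ^ m%:Z + fourier f (- m%:Z) * val (expi t) ^ (- m%:Z) =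
  (2 * mean (fun u => fr u * cos (m%:R * (t - u)))) +i* (2 * mean (fun u => fi u * cos (m%:R * (t - u)))).
Proof.
rewrite expi_exp expi_expN fourier_pos fourier_neg !mean_cos_shift ?fr_integ ?fi_integ//.
move: (cosm fr m) (cosm fi m) (sinm fr m) (sinm fi m) (cos _) (sin _) => a b c d C S.
by apply/eqP; rewrite eq_complex /=; apply/andP; split; apply/eqP; ring.
Qed.

Definition analytic_sum M (z : circle R) : R[i] := \sum_(0 <= n < M) fourier f n%:Z * val z ^ n%:Z.
Definition coanalytic_sum M (z : circle R) : R[i] := \sum_(1 <= k < M.+1) fourier f (- k%:Z) * val z ^ (- k%:Z).

(** Frequency 0 belongs to the analytic part, whence the shift: [analytic_sum j.+1] has the
    frequencies 0 to j and [coanalytic_sum j] the frequencies -1 to -j. *)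
Definition fejer_mean N (z : circle R) : R[i] :=
  ((N%:R : R)^-1)%:C * \sum_(0 <= j < N) (analytic_sum j.+1 z + coanalytic_sum j z).

Lemma fejer_meanE N t : fejer_mean N (expi t) =
  mean (fun u => fr u * fejer N (t - u)) +i* mean (fun u => fi u * fejer N (t - u)).
Proof.
have mc (m : nat) : measurable_fun setT (fun u : R => cos (m%:R * (t - u))).
  by apply: continuous_measurable_fun => u; apply: isd_cont; deriv.
rewrite !(@mean_fejer R N _ (fun u => t - u) mc) ?fr_integ ?fi_integ//.
rewrite /fejer_mean.
have -> : \sum_(0 <= j < N) (analytic_sum j.+1 (expi t) + coanalytic_sum j (expi t)) =
   (\sum_(0 <= j < N) (mean fr + \sum_(1 <= m < j.+1) 2 * mean (fun u => fr u * cos (m%:R * (t - u))))) +i*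
   (\sum_(0 <= j < N) (mean fi + \sum_(1 <= m < j.+1) 2 * mean (fun u => fi u * cos (m%:R * (t - u))))).
  rewrite -sum_complex; apply: eq_bigr => j _.
  rewrite /analytic_sum big_ltn// /coanalytic_sum -addrA -big_split /=.
  under eq_bigr do rewrite fourier_pair.
  rewrite sum_complex.
  have -> : fourier f 0%:Z * val (expi t) ^ 0%:Z = mean fr +i* mean fi.
    rewrite fourier_pos expr0z mulr1 /cosm /sinm.
    have E1 g : (fun u : R => g u * cos (0%:R * u)) = g.
      by apply/funext => u; rewrite mul0r cos0 mulr1.
    have E2 g : (fun u : R => g u * sin (0%:R * u)) = (fun=> 0).
      by apply/funext => u; rewrite mul0r sin0 mulr0.
    by rewrite !E1 !E2 mean_cst addr0 subr0.
  by [].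
by apply/eqP; rewrite eq_complex /= !mul0r subr0 addr0 !eqxx.
Qed.

(* Jensen through the tangent of [x |-> x ^ p] at [m], in the direction of
   the argument of the mean. *)
Lemma fejer_jensen N t : ((cabs (fejer_mean N.+1 (expi t)) `^ p)%:E <=
  \int[arc_length R]_u (circle_abs u `^ p * fejer N.+1 (t - u))%:E)%E.
Proof.
have p0 : 0 < p := lt_trans ltr01 p1.
have Km : measurable_fun setT (fun u : R => fejer N.+1 (t - u)).
  have := @fejer_meas R N.+1 (-1) t; congr (measurable_fun _ _); apply/funext => u.
  by rewrite mulN1r addrC.
set c := N.+1%:R^-1 * \sum_(0 <= j < N.+1) (1 + 2 * \sum_(1 <= m < j.+1) (1 : R)).
have Kb u : `|fejer N.+1 (t - u)| <= c by exact: fejer_bound.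
have K0 u := @fejer_ge0 R N.+1 (t - u).
have iK : integ (fun u => fejer N.+1 (t - u)) by apply: integ_bdd Kb.
have mK : mean (fun u => fejer N.+1 (t - u)) = 1.
  rewrite -(@fejer_mass R N (-1) t); last by right.
  by congr mean; apply/funext => u; rewrite mulN1r addrC.
have ipK : integ (fun u => circle_abs u `^ p * fejer N.+1 (t - u)) by apply: integ_mul_bdd Kb => //; exact: circle_abs_integ.
rewrite mean_E// lee_fin.
set S := fejer_mean _ _; set m := cabs S.
have [g [e [_ e1 SE _]]] := polar_form S.
have m0 : 0 <= m := cabs_ge0 S.
have [d [dE1 dE2]] : exists d, cos g = cos d /\ e * sin g = sin d.
  case: e1 => ->; first by exists g; rewrite mul1r.
  by exists (- g); rewrite cosN sinN mulN1r.
rewrite dE1 dE2 in SE.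
have irK : integ (fun u => fr u * fejer N.+1 (t - u)) by apply: integ_mul_bdd Kb => //; exact: fr_integ.
have iiK : integ (fun u => fi u * fejer N.+1 (t - u)) by apply: integ_mul_bdd Kb => //; exact: fi_integ.
have E1 : mean (fun u => fr u * fejer N.+1 (t - u)) = m * cos d.
  by have := congr1 (fun z => complex.Re z) SE; rewrite {1}/S fejer_meanE.
have E2 : mean (fun u => fi u * fejer N.+1 (t - u)) = m * sin d.
  by have := congr1 (fun z => complex.Im z) SE; rewrite {1}/S fejer_meanE.
have mE : m `^ p = mean (fun u => (m `^ p - p * m `^ (p - 1) * m) * fejer N.+1 (t - u) +
   (p * m `^ (p - 1) * cos d * (fr u * fejer N.+1 (t - u)) + p * m `^ (p - 1) * sin d * (fi u * fejer N.+1 (t - u)))).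
  rewrite mean_add; [|exact: integ_scale|by apply: integ_add; exact: integ_scale].
  rewrite mean_add; [|exact: integ_scale|exact: integ_scale].
  rewrite (mean_scale _ iK) (mean_scale _ irK) (mean_scale _ iiK) mK E1 E2.
  have -> : p * m `^ (p - 1) * cos d * (m * cos d) + p * m `^ (p - 1) * sin d * (m * sin d) =
    p * m `^ (p - 1) * m * (cos d ^+ 2 + sin d ^+ 2) by ring.
  by rewrite cos2Dsin2; ring.
rewrite mE; apply: mean_le => //.
  apply: integ_add; first exact: integ_scale.
  by apply: integ_add; exact: integ_scale.
move=> u.
have -> : (m `^ p - p * m `^ (p - 1) * m) * fejer N.+1 (t - u) +
   (p * m `^ (p - 1) * cos d * (fr u * fejer N.+1 (t - u)) + p * m `^ (p - 1) * sin d * (fi u * fejer N.+1 (t - u))) =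
   (m `^ p + p * m `^ (p - 1) * (fr u * cos d + fi u * sin d - m)) * fejer N.+1 (t - u) by ring.
rewrite ler_wpM2r//.
have CS : fr u * cos d + fi u * sin d <= circle_abs u.
  apply: (le_trans (ler_norm _)); rewrite -(@ler_pXn2r _ 2)// ?nnegrE ?cabs_ge0// real_normK ?num_real// /circle_abs cabs_sqr.
  rewrite -/(fr u) -/(fi u) -subr_ge0.
  have -> : fr u ^+ 2 + fi u ^+ 2 - (fr u * cos d + fi u * sin d) ^+ 2 =
    (fr u ^+ 2 + fi u ^+ 2) * (1 - (cos d ^+ 2 + sin d ^+ 2)) + (fr u * sin d - fi u * cos d) ^+ 2 by ring.
  by rewrite cos2Dsin2 subrr mulr0 add0r sqr_ge0.
apply: le_trans (powR_tangent p1 (cabs_ge0 (f (expi u))) m0).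
by rewrite lerD2l ler_wpM2l ?mulr_ge0 ?powR_ge0 ?(ltW p0)// lerB.
Qed.

Lemma conv_meas N (g : R -> R) : integ g -> measurable_fun setT (fun t => mean (fun u => g u * fejer N (t - u))).
Proof.
move=> ig; apply: continuous_measurable_fun.
rewrite (_ : (fun t => mean (fun u => g u * fejer N (t - u))) = (fun t => N%:R^-1 * \sum_(0 <= j < N)
   (mean g + \sum_(1 <= m < j.+1) 2 * (cos (m%:R * t) * cosm g m + sin (m%:R * t) * sinm g m)))); last first.
  apply/funext => t; rewrite (@mean_fejer R N g (fun u => t - u))//; last first.
    by move=> m; apply: continuous_measurable_fun => u; apply: isd_cont; deriv.
  congr (_ * _); apply: eq_bigr => j _; congr (_ + _); apply: eq_bigr => m _.
  by rewrite mean_cos_shift.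
apply: contM; first exact: cst_cont.
apply: sum_cont => j; apply: contD; first exact: cst_cont.
by apply: sum_cont => m t; apply: isd_cont; deriv.
Qed.

Lemma fejer_cabs_meas N : measurable_fun setT (fun t => cabs (fejer_mean N (expi t))).
Proof.
apply: cabs_meas.
  have := @conv_meas N _ fr_integ; congr measurable_fun; apply/funext => t.
  by rewrite fejer_meanE.
have := @conv_meas N _ fi_integ; congr measurable_fun; apply/funext => t.
by rewrite fejer_meanE.
Qed.

(** [fejer_jensen] is integrated in t and the order of integration is exchanged; in the other
    variable too the kernel has mass 1. *)
Lemma fejer_contract N :
  (\int[arc_length R]_t (cabs (fejer_mean N.+1 (expi t)) `^ p)%:E <= \int[arc_length R]_t (circle_abs t `^ p)%:E)%E.
Proof.
pose G (x : measurableTypeR R * measurableTypeR R) : \bar R := (circle_abs x.2 `^ p * fejer N.+1 (x.1 - x.2))%:E.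
have mm : measurable_fun setT G.
  apply/measurable_EFinP; apply: measurable_funM.
    by apply: (measurableT_comp (f := fun u => circle_abs u `^ p)) => //; apply: powR_meas; exact: circle_abs_meas.
  apply: (measurableT_comp (f := fejer N.+1)).
    have := @fejer_meas R N.+1 1 0; congr measurable_fun; apply/funext => u.
    by rewrite mul1r addr0.
  by apply: measurable_funB.
have nn x : (0 <= G x)%E by rewrite lee_fin mulr_ge0 ?powR_ge0 ?fejer_ge0.
have mF := measurable_fun_fubini_tonelli_F (m2 := arc_length R) G mm nn.
have mG := measurable_fun_fubini_tonelli_G (m1 := arc_length R) G mm nn.
apply: (@le_trans _ _ (\int[arc_length R]_t \int[arc_length R]_u G (t, u))%E).
  apply: ge0_le_integral => //.
  - by move=> t _; rewrite lee_fin powR_ge0.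
  - by apply/measurable_EFinP; apply: powR_meas; exact: fejer_cabs_meas.
  - by move=> t _; exact: fejer_jensen.
rewrite (fubini_tonelli (m1 := arc_length R) (m2 := arc_length R) G mm nn).
apply: ge0_le_integral => //.
- by move=> u _; apply: integral_ge0.
- by apply/measurable_EFinP; apply: powR_meas; exact: circle_abs_meas.
move=> u _; rewrite /G /=.
have E : (fun t : R => fejer N.+1 (t - u)) = (fun t => fejer N.+1 (1 * t + - u)).
  by apply/funext => t; rewrite mul1r.
have iK : integ (fun t : R => fejer N.+1 (t - u)).
  rewrite E; apply: (integ_bdd (fejer_meas _ _ _)) => t; exact: fejer_bound.
rewrite (mean_E (integ_scale (circle_abs u `^ p) iK)) mean_scale// E fejer_mass ?mulr1//.
by left.
Qed.

End FejerMeans.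

(** * The upper bound *)

Section CircleNorms.
Variable R : realType.
Implicit Types (p s : R).

Lemma circle_normE p (F : circle R -> R) : 0 < p -> (forall t, 0 <= F (expi t)) ->
  integ (fun t => F (expi t) `^ p) ->
  circle_norm p F = (mean (fun t => F (expi t) `^ p) `^ p^-1)%:E.
Proof.
move=> p0 F0 iF; rewrite /circle_norm unlock -poweR_EFin -(mean_E iF).
congr (_ `^ _)%E; apply: eq_integral => t _.
by rewrite poweR_EFin (ger0_norm (F0 t)).
Qed.

Lemma dominated_integ (g h : R -> R) : measurable_fun setT g -> integ h -> (forall t, 0 <= g t <= h t) -> integ g.
Proof.
move=> mg ih gh; apply: (@le_integrable _ _ _ (arc_length R) setT measurableT _ (EFin \o h)) => //.
  exact/measurable_EFinP.
move=> t _; have /andP[g0 ght] := gh t.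
by rewrite /= lee_fin !ger0_norm// (le_trans g0).
Qed.

Lemma powR_le_inv p (x y : R) : 0 < p -> 0 <= y -> 0 <= x -> x `^ p <= y `^ p -> x <= y.
Proof.
move=> p0 y0 x0; apply: contraTT; rewrite -!ltNge => yx.
by apply: gt0_ltr_powR; rewrite ?nnegrE.
Qed.

Lemma powR_invK p (x : R) : 0 < p -> 0 <= x -> (x `^ p^-1) `^ p = x.
Proof. by move=> p0 x0; rewrite -powRrM mulVf ?gt_eqF// powRr1. Qed.

Lemma mean_ge0 (g : R -> R) : (forall t, 0 <= g t) -> 0 <= mean g.
Proof. by move=> g0; apply: Rintegral_ge0. Qed.

Lemma powR_mul1 (x r : R) : 0 < x -> x * x `^ r = x `^ (1 + r).
Proof. by move=> x0; rewrite powRD ?powRr1 ?(ltW x0)// (gt_eqF x0) implybT. Qed.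

(** [power_split] is used with exponent [s] inside and p / s outside; [e] is chosen so that the
    total loss (1 + e) (1 + e)^(p/s) equals 1 + eta. *)
Lemma pair_split p s eta : 0 < p -> 0 < s -> 0 < eta -> exists2 C, 0 <= C &
  forall a b d1 d2 : R, 0 <= a -> 0 <= b -> 0 <= d1 -> 0 <= d2 ->
  ((a + d1) `^ s + (b + d2) `^ s) `^ (p / s) <=
  (1 + eta) * (a `^ s + b `^ s) `^ (p / s) + C * (d1 `^ p + d2 `^ p).
Proof.
move=> p0 s0 eta0; have r0 : 0 < p / s by rewrite divr_gt0.
have [e [e0 ee]] : exists e : R, 0 < e /\ (1 + e) * (1 + e) `^ (p / s) = 1 + eta.
  have k0 : 0 < 1 + p / s by rewrite addr_gt0.
  exists ((1 + eta) `^ (1 + p / s)^-1 - 1).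
  have e1 : 0 <= 1 + eta by rewrite addr_ge0// ltW.
  have X1 : 1 < (1 + eta) `^ (1 + p / s)^-1.
    rewrite -[ltLHS](_ : 1 `^ (1 + p / s)^-1 = 1); last by rewrite powR1.
    by apply: gt0_ltr_powR; rewrite ?invr_gt0 ?nnegrE// ltrDl.
  rewrite addrCA subrr addr0 powR_mul1 ?(lt_trans ltr01 X1)//.
    split; last exact: powR_invK.
    by rewrite subr_gt0.
have [C1 C10 H1] := power_split s0 e0.
have [C2 C20 H2] := power_split r0 e0.
exists (C2 * (C1 `^ (p / s) * 2 `^ (p / s))); first by rewrite !mulr_ge0 ?powR_ge0.
move=> a b d1 d2 a0 b0 d10 d20.
have e1 : 0 <= 1 + e by rewrite addr_ge0// ltW.
apply: (@le_trans _ _ (((1 + e) * (a `^ s + b `^ s) + C1 * (d1 `^ s + d2 `^ s)) `^ (p / s))).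
  apply: ge0_ler_powR; rewrite ?nnegrE ?(ltW r0) ?addr_ge0 ?mulr_ge0 ?addr_ge0 ?powR_ge0 ?(ltW e0)//.
  by apply: le_trans (lerD (H1 _ _ a0 d10) (H1 _ _ b0 d20)) _; rewrite le_eqVlt; apply/orP; left; apply/eqP; ring.
apply: (le_trans (H2 _ _ _ _)); rewrite ?mulr_ge0 ?addr_ge0 ?powR_ge0 ?(ltW e0)//.
rewrite powRM// ?addr_ge0 ?powR_ge0// mulrA ee lerD2l -mulrA ler_wpM2l//.
rewrite powRM// ?addr_ge0 ?powR_ge0// -mulrA ler_wpM2l ?powR_ge0//.
wlog d12 : d1 d2 d10 d20 / d1 <= d2.
  move=> W; have [|/ltW] := leP d1 d2; first exact: W.
  by move=> h; rewrite (addrC (d1 `^ s)) (addrC (d1 `^ p)); exact: W.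
apply: (@le_trans _ _ ((2 * d2 `^ s) `^ (p / s))).
  apply: ge0_ler_powR; rewrite ?nnegrE ?(ltW r0) ?addr_ge0 ?mulr_ge0 ?powR_ge0//.
  by rewrite mulr_natl mulr2n lerD2r; apply: ge0_ler_powR; rewrite ?nnegrE ?(ltW s0).
rewrite powRM ?powR_ge0// -powRrM mulrCA mulfV ?gt_eqF// mulr1 ler_wpM2l ?powR_ge0//.
by rewrite lerDr powR_ge0.
Qed.

End CircleNorms.

Section FourierPolynomials.
Variable R : realType.
Variable f : circle R -> R[i].
Implicit Types (t : R) (N M j k : nat).

Definition analytic_poly M : {poly R[i]} := \sum_(0 <= n < M) fourier f n%:Z *: 'X^n.
(** The coefficients are conjugated and the powers made positive: on the circle this polynomial is
    the conjugate of the co-analytic partial sum. *)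
Definition coanalytic_poly M : {poly R[i]} := \sum_(1 <= k < M.+1) (fourier f (- k%:Z))^*%R *: 'X^k.
Definition analytic_mean N : {poly R[i]} := ((N.+1%:R : R)^-1)%:C *: \sum_(0 <= j < N.+1) analytic_poly j.+1.
Definition coanalytic_mean N : {poly R[i]} := ((N.+1%:R : R)^-1)%:C *: \sum_(0 <= j < N.+1) coanalytic_poly j.

Lemma analytic_sumE M t : analytic_sum f M (expi t) = (analytic_poly M).[cos t +i* sin t].
Proof.
rewrite /analytic_sum /analytic_poly horner_sum; apply: eq_bigr => n _.
by rewrite hornerZ hornerXn -exprnP.
Qed.

Lemma conj_expi t k : val (expi t) ^ (- k%:Z) = ((cos t +i* sin t) ^+ k)^*%R.
Proof.
have -> : (cos t +i* sin t) ^+ k = val (expi t) ^ k%:Z by [].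
by rewrite expi_exp expi_expN.
Qed.

Lemma conjc_sum (I : Type) (r : seq I) (F : I -> R[i]) : (\sum_(i <- r) F i)^*%R = \sum_(i <- r) (F i)^*%R.
Proof. exact: rmorph_sum. Qed.

Lemma conjc_mul (z w : R[i]) : (z * w)^*%R = z^*%R * w^*%R.
Proof. exact: rmorphM. Qed.

Lemma coanalytic_sumE M t : coanalytic_sum f M (expi t) = ((coanalytic_poly M).[cos t +i* sin t])^*%R.
Proof.
rewrite /coanalytic_sum /coanalytic_poly horner_sum conjc_sum; apply: eq_bigr => k _.
by rewrite hornerZ hornerXn conjc_mul conjCK conj_expi.
Qed.

Lemma fejer_mean_split N t : fejer_mean f N.+1 (expi t) =
  (analytic_mean N).[cos t +i* sin t] + ((coanalytic_mean N).[cos t +i* sin t])^*%R.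
Proof.
rewrite /fejer_mean big_split /= mulrDr /analytic_mean /coanalytic_mean !hornerZ !horner_sum.
rewrite conjc_mul conjc_sum; congr (_ * _ + _ * _).
- by apply: eq_bigr => j _; rewrite analytic_sumE.
- by apply/eqP; rewrite eq_complex /= oppr0 !eqxx.
- by apply: eq_bigr => j _; rewrite coanalytic_sumE.
Qed.

Lemma coanalytic_mean0 N : (coanalytic_mean N).[0] = 0.
Proof.
rewrite /coanalytic_mean hornerZ horner_sum big1 ?mulr0// => j _.
rewrite /coanalytic_poly horner_sum big_nat_cond big1// => -[|k]; rewrite andbT//.
by rewrite hornerZ hornerXn expr0n mulr0.
Qed.

Lemma poly_circle_meas (F : {poly R[i]}) :
  measurable_fun setT (fun t : R => complex.Re F.[cos t +i* sin t]) /\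
  measurable_fun setT (fun t : R => complex.Im F.[cos t +i* sin t]).
Proof.
have [c1 c2] := poly_cont F.
by split; apply: continuous_measurable_fun; [apply: (circle_cont c1)|apply: (circle_cont c2)].
Qed.

Lemma poly_circle_cabs_meas (F : {poly R[i]}) : measurable_fun setT (fun t : R => cabs F.[cos t +i* sin t]).
Proof. by have [m1 m2] := poly_circle_meas F; exact: cabs_meas. Qed.

End FourierPolynomials.

(** * Cesaro means of series that converge in the p-norm *)

Section CesaroApproximation.
Variable R : realType.
Variables (p : R) (u : nat -> circle R -> R[i]).
Hypothesis p1 : 1 < p.
Hypothesis u_meas : forall N, measurable_fun setT (fun t : R => complex.Re (u N (expi t))) /\
  measurable_fun setT (fun t : R => complex.Im (u N (expi t))).
Hypothesis u_bdd : forall N, exists c, forall t : R, cabs (u N (expi t)) <= c.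
Implicit Types (g : circle R -> R[i]).

Lemma Re_sub (z w : R[i]) : complex.Re (z - w) = complex.Re z - complex.Re w.
Proof. by case: z w => a b [c d]. Qed.
Lemma Im_sub (z w : R[i]) : complex.Im (z - w) = complex.Im z - complex.Im w.
Proof. by case: z w => a b [c d]. Qed.

Lemma cabsN (z : R[i]) : cabs (- z) = cabs z.
Proof. by case: z => a b; rewrite /cabs /= !sqrrN. Qed.

Lemma sub_meas g N : in_Lp p g -> measurable_fun setT (fun t : R => cabs (u N (expi t) - g (expi t))).
Proof.
move=> [m1 m2 _]; have [m3 m4] := u_meas N.
by apply: cabs_meas; [under eq_fun do rewrite Re_sub|under eq_fun do rewrite Im_sub];
  apply: measurable_funB.
Qed.

Lemma sub_integ g N : in_Lp p g -> integ (fun t : R => cabs (u N (expi t) - g (expi t)) `^ p).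
Proof.
move=> gLp; have p0 : 0 < p := lt_trans ltr01 p1.
have [c cb] := u_bdd N.
have c0 : 0 <= c by apply: le_trans (cb 0); exact: cabs_ge0.
have [C C0 H] := power_split p0 (ltr01 : 0 < 1 :> R).
apply: (@dominated_integ _ _ (fun t => (1 + 1) * circle_abs g t `^ p + C * c `^ p)).
- by apply: powR_meas; exact: sub_meas.
- by apply: integ_add; [apply: integ_scale; exact: circle_abs_integ|exact: integ_cst].
move=> t; rewrite powR_ge0 /=; apply: le_trans (H _ _ (cabs_ge0 _) c0).
apply: ge0_ler_powR; rewrite ?nnegrE ?cabs_ge0 ?(ltW p0) ?addr_ge0 ?cabs_ge0//.
by apply: le_trans (cabs_le_add _ _) _; rewrite cabsN [leLHS]addrC lerD2l.
Qed.

Let err g N := mean (fun t : R => cabs (u N (expi t) - g (expi t)) `^ p).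

Lemma err_cvg g : Lp_limit p u g -> err g N @[N --> \oo] --> (0 : R).
Proof.
move=> [gLp lim]; have p0 : 0 < p := lt_trans ltr01 p1.
have E N : Lp_norm p (fun z => u N z - g z) = (err g N `^ p^-1)%:E.
  rewrite /Lp_norm circle_normE//; first by move=> t; exact: cabs_ge0.
  exact: sub_integ.
have e0 N : 0 <= err g N by apply: mean_ge0 => t; exact: powR_ge0.
have lim' : (err g N `^ p^-1) @[N --> \oo] --> (0 : R).
  rewrite (_ : (fun N => err g N `^ p^-1) = (fun N => fine (Lp_norm p (fun z => u N z - g z)))).
    exact: (fine_cvg lim).
  by apply/funext => N; rewrite E.
apply/cvgrPdist_lt => d d0; have dp : 0 < d `^ p^-1 by rewrite powR_gt0.
move/cvgrPdist_lt : lim' => /(_ _ dp); apply: filterS => N.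
rewrite !sub0r !normrN !ger0_norm ?powR_ge0// => h.
rewrite ltNge; apply/negP => /(ge0_ler_powR (r := p^-1)); rewrite !nnegrE invr_ge0 (ltW p0) e0 (ltW d0).
by move=> /(_ isT isT isT) /(lt_le_trans h); rewrite ltxx.
Qed.

Let Phi := xget (cst 0) [set g | Lp_limit p u g].

Lemma limit_meas : measurable_fun setT (fun t : R => cabs (Phi (expi t))).
Proof.
rewrite /Phi; case: xgetP => [g _ [[m1 m2 _] _]|_]; first exact: cabs_meas.
exact: measurable_cst.
Qed.

Lemma cabs_sum (I : Type) (r : seq I) (F : I -> R[i]) : cabs (\sum_(i <- r) F i) <= \sum_(i <- r) cabs (F i).
Proof.
elim: r => [|i r IH]; first by rewrite !big_nil /cabs /= expr0n addr0 sqrtr0.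
rewrite !big_cons; apply: le_trans (cabs_le_add _ _) _; exact: lerD.
Qed.

Lemma cabs_real (x : R) : 0 <= x -> cabs x%:C = x.
Proof. by move=> x0; rewrite /cabs /= expr0n addr0 sqrtr_sqr ger0_norm. Qed.

(* If the series has no limit in [L^p], [xget] returns [0] and [d = 0] works:
   boundedness of the projections is not needed. *)
Lemma limit_approx k (delta : R) : 0 < delta -> exists N0 : nat, forall N, (N0 <= N)%N -> exists d : R -> R,
  [/\ forall t, 0 <= d t, integ (fun t => d t `^ p), mean (fun t => d t `^ p) <= delta &
      forall t, cabs (Phi (expi t)) <=
        cabs ((N.+1%:R^-1)%:C * \sum_(0 <= j < N.+1) u (j + k) (expi t)) + d t].
Proof.
move=> delta0; have p0 : 0 < p := lt_trans ltr01 p1.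
rewrite /Phi; case: xgetP => [g _ /= Lg|_]; last first.
  exists 0%N => N _; exists (fun=> 0).
  have E : (fun t : R => 0 `^ p) = (fun=> 0 :> R) by apply/funext => t; rewrite powR0 ?gt_eqF.
  split => //; rewrite ?E; [exact: integ_cst|by rewrite mean_cst ltW|].
  by move=> t; rewrite addr0 /= {1}/cabs /= expr0n addr0 sqrtr0 cabs_ge0.
(* Cesaro means of the errors tend to 0, and [powR_mean_le] bounds by them the error of the averaged
   sums. The offset [k] is 1 for the analytic sums and 0 for the co-analytic ones, as in
   [fejer_mean]. *)
have ek : err g (j + k) @[j --> \oo] --> (0 : R) by rewrite (cvg_shiftn k (err g)); exact: err_cvg.
have /cvgrPdist_lt/(_ _ delta0) := cesaro ek.
move=> [N0 _ H]; exists N0 => N N0N.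
have {H} := H N N0N; rewrite /arithmetic_mean /series /= sub0r normrN => H.
have [gLp _] := Lg.
have nn t (i : nat) : 0 <= cabs (u (i + k) (expi t) - g (expi t)) by exact: cabs_ge0.
exists (fun t => N.+1%:R^-1 * \sum_(0 <= j < N.+1) cabs (u (j + k) (expi t) - g (expi t))).
have iS : integ (fun t : R => N.+1%:R^-1 * \sum_(0 <= j < N.+1) cabs (u (j + k) (expi t) - g (expi t)) `^ p).
  by apply: integ_scale; apply: integ_sum => j; exact: sub_integ.
have dle t : 0 <= (N.+1%:R^-1 * \sum_(0 <= j < N.+1) cabs (u (j + k) (expi t) - g (expi t))) `^ p <=
   N.+1%:R^-1 * \sum_(0 <= j < N.+1) cabs (u (j + k) (expi t) - g (expi t)) `^ p.
  by rewrite powR_ge0 powR_mean_le.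
have iD : integ (fun t : R => (N.+1%:R^-1 * \sum_(0 <= j < N.+1) cabs (u (j + k) (expi t) - g (expi t))) `^ p).
  apply: dominated_integ iS dle.
  apply: powR_meas; apply: measurable_funM; first exact: measurable_cst.
  by apply: measurable_sum => j; exact: sub_meas.
split => //.
- by move=> t; rewrite mulr_ge0 ?invr_ge0 ?ler0n// sumr_ge0.
- apply: (le_trans (mean_le iD iS _)); first by move=> t; have /andP[] := dle t.
  rewrite mean_scale; last by apply: integ_sum => j; exact: sub_integ.
  rewrite mean_sum; last by move=> j; exact: sub_integ.
  by apply: (le_trans (ler_norm _)); exact: ltW.
move=> t; set S := _ * _.
have {1}-> : g (expi t) = S + (N.+1%:R^-1)%:C * \sum_(0 <= j < N.+1) (g (expi t) - u (j + k) (expi t)).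
  rewrite sumrB sumr_const_nat subn0 mulrBr /S addrCA subrr addr0 -[g (expi t) *+ _]mulr_natl mulrA.
  by rewrite fmorphV rmorph_nat mulVf ?pnatr_eq0// mul1r.
apply: (le_trans (cabs_le_add _ _)); rewrite lerD2l cabsM cabs_real ?invr_ge0 ?ler0n//.
rewrite ler_wpM2l ?invr_ge0 ?ler0n//; apply: (le_trans (cabs_sum _ _)); apply: ler_sum => j _.
by rewrite -cabsN opprB.
Qed.

End CesaroApproximation.

Section UpperBound.
Variable R : realType.
Variables (p s A C : R) (phi : R -> R).
Hypotheses (p1 : 1 < p) (s0 : 0 < s) (A0 : 0 <= A) (C0 : 0 <= C).
Hypotheses (tc : trig_convex (p / 2) phi) (phic : continuous phi).
Hypothesis majorant : forall w z : R[i],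
  (cabs w `^ s + cabs z `^ s) `^ (p / s) + C * homog (p / 2) phi (w * z) <= (A * cabs (w + z^*%R)) `^ p.
Variable f : circle R -> R[i].
Hypothesis fLp : in_Lp p f.

Let I := mean (fun t => circle_abs f t `^ p).
Let pmean (w z : R) := (w `^ s + z `^ s) `^ (p / s).
Let W N t := cabs (analytic_mean f N).[cos t +i* sin t].
Let Z N t := cabs (coanalytic_mean f N).[cos t +i* sin t].

Lemma p_gt0 : 0 < p. Proof. exact: lt_trans p1. Qed.

Lemma pmean_meas (g h : R -> R) : measurable_fun setT g -> measurable_fun setT h ->
  measurable_fun setT (fun t => pmean (g t) (h t)).
Proof. by move=> mg mh; apply: powR_meas; apply: measurable_funD; exact: powR_meas. Qed.

Lemma pmean_le (a b : R) : 0 <= a -> 0 <= b ->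
  exists2 K, 0 <= K & forall w z, 0 <= w <= a -> 0 <= z <= b -> pmean w z <= K.
Proof.
move=> a0 b0; exists (pmean a b); first exact: powR_ge0.
move=> w z /andP[w0 wa] /andP[z0 zb].
apply: ge0_ler_powR; rewrite ?nnegrE ?addr_ge0 ?powR_ge0 ?(ltW (divr_gt0 p_gt0 s0))//.
by apply: lerD; apply: ge0_ler_powR; rewrite ?nnegrE ?(ltW s0).
Qed.

Lemma poly_pmean_integ (F G : {poly R[i]}) :
  integ (fun t => pmean (cabs F.[cos t +i* sin t]) (cabs G.[cos t +i* sin t])).
Proof.
have [B B0 BP] := poly_bound F; have [D D0 DP] := poly_bound G.
have [K K0 KP] := pmean_le B0 D0.
apply: (@integ_bdd _ _ K); first by apply: pmean_meas; exact: poly_circle_cabs_meas.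
move=> t; rewrite ger0_norm ?powR_ge0//; apply: KP; rewrite cabs_ge0 /=.
  by apply: BP; rewrite cabs_circle.
by apply: DP; rewrite cabs_circle.
Qed.

Lemma fejer_integ N : integ (fun t => cabs (fejer_mean f N.+1 (expi t)) `^ p).
Proof.
apply/integrableP; split.
  by apply/measurable_EFinP; apply: powR_meas; exact: (fejer_cabs_meas p1 fLp).
under eq_integral do rewrite /= ger0_norm ?powR_ge0//.
apply: (le_lt_trans (fejer_contract p1 fLp N)).
by rewrite mean_E ?ltry//; exact: circle_abs_integ.
Qed.

(** The product [F] of the two polynomials vanishes at 0 through its co-analytic factor, so
    [homog_mean_ge0] allows its weight to be dropped after integration. *)
Lemma fejer_bound_mean N : mean (fun t => pmean (W N t) (Z N t)) <= A `^ p * I.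
Proof.
have q0 : 0 < p / 2 by rewrite divr_gt0 ?p_gt0.
pose F := analytic_mean f N * coanalytic_mean f N.
have F0 : F.[0] = 0 by rewrite hornerM coanalytic_mean0 mulr0.
have hge := homog_mean_ge0 q0 tc phic F0.
have ih : integ (fun t => homog (p / 2) phi F.[cos t +i* sin t]).
  have [c cb] := homog_circle_bound F q0 tc.
  apply: (integ_bdd _ cb); apply: continuous_measurable_fun.
  by apply: (circle_cont (homog_poly_cont q0 phic (fun t tp => trig_convex_le1 tc tp))).
have iM := poly_pmean_integ (analytic_mean f N) (coanalytic_mean f N).
have iF := fejer_integ N.
apply: (@le_trans _ _ (mean (fun t => A `^ p * cabs (fejer_mean f N.+1 (expi t)) `^ p))).
  apply: (@le_trans _ _ (mean (fun t => pmean (W N t) (Z N t) + C * homog (p / 2) phi F.[cos t +i* sin t]))).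
    by rewrite (mean_add iM (integ_scale C ih)) (mean_scale C ih) lerDl mulr_ge0.
  apply: mean_le.
  - by apply: integ_add => //; exact: integ_scale.
  - exact: integ_scale.
  move=> t; rewrite fejer_mean_split -powRM ?cabs_ge0// /F hornerM; exact: majorant.
rewrite (mean_scale (A `^ p) iF) ler_wpM2l ?powR_ge0//.
by have := fejer_contract p1 fLp N; rewrite (mean_E iF) (mean_E (circle_abs_integ p1 fLp)) lee_fin.
Qed.

Let G1 t := cabs (analytic_proj p f (expi t)).
Let G2 t := cabs (coanalytic_proj p f (expi t)).

Lemma analytic_sum_meas M : measurable_fun setT (fun t : R => complex.Re (analytic_sum f M (expi t))) /\
  measurable_fun setT (fun t : R => complex.Im (analytic_sum f M (expi t))).
Proof.
have [m1 m2] := poly_circle_meas (analytic_poly f M).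
by split; [move: m1|move: m2]; congr measurable_fun; apply/funext => t; rewrite analytic_sumE.
Qed.

Lemma analytic_sum_bdd M : exists c, forall t : R, cabs (analytic_sum f M (expi t)) <= c.
Proof.
have [B _ BP] := poly_bound (analytic_poly f M); exists B => t.
by rewrite analytic_sumE; apply: BP; rewrite cabs_circle.
Qed.

Lemma Re_conj (z : R[i]) : complex.Re (z^*%R) = complex.Re z. Proof. by case: z. Qed.
Lemma Im_conj (z : R[i]) : complex.Im (z^*%R) = - complex.Im z. Proof. by case: z. Qed.
Lemma cabs_conj (z : R[i]) : cabs (z^*%R) = cabs z.
Proof. by case: z => a b; rewrite /cabs /= sqrrN. Qed.

Lemma coanalytic_sum_meas M : measurable_fun setT (fun t : R => complex.Re (coanalytic_sum f M (expi t))) /\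
  measurable_fun setT (fun t : R => complex.Im (coanalytic_sum f M (expi t))).
Proof.
have [m1 m2] := poly_circle_meas (coanalytic_poly f M).
split.
  by move: m1; congr measurable_fun; apply/funext => t; rewrite coanalytic_sumE Re_conj.
have := measurable_funB (@measurable_cst _ _ _ _ setT (0 : R)) m2; congr measurable_fun; apply/funext => t.
by rewrite /= coanalytic_sumE Im_conj sub0r.
Qed.

Lemma coanalytic_sum_bdd M : exists c, forall t : R, cabs (coanalytic_sum f M (expi t)) <= c.
Proof.
have [B _ BP] := poly_bound (coanalytic_poly f M); exists B => t.
by rewrite coanalytic_sumE cabs_conj; apply: BP; rewrite cabs_circle.
Qed.

Lemma G1_meas : measurable_fun setT G1.
Proof. by apply: limit_meas. Qed.

Lemma G2_meas : measurable_fun setT G2.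
Proof. by apply: limit_meas. Qed.

Lemma proj_approx (delta : R) : 0 < delta -> exists N (d1 d2 : R -> R),
  [/\ forall t, 0 <= d1 t /\ 0 <= d2 t, integ (fun t => d1 t `^ p) /\ integ (fun t => d2 t `^ p),
      mean (fun t => d1 t `^ p) <= delta, mean (fun t => d2 t `^ p) <= delta &
      forall t, G1 t <= W N t + d1 t /\ G2 t <= Z N t + d2 t].
Proof.
move=> delta0.
have [N1 H1] := limit_approx p1 analytic_sum_meas analytic_sum_bdd 1 delta0.
have [N2 H2] := limit_approx p1 coanalytic_sum_meas coanalytic_sum_bdd 0 delta0.
have [d1 [d10 id1 md1 Hd1]] := H1 (maxn N1 N2) (leq_maxl _ _).
have [d2 [d20 id2 md2 Hd2]] := H2 (maxn N1 N2) (leq_maxr _ _).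
exists (maxn N1 N2), d1, d2; split => // t; split.
  apply: (le_trans (Hd1 t)); rewrite lerD2r /W /analytic_mean hornerZ horner_sum.
  by rewrite le_eqVlt; apply/orP; left; apply/eqP; congr (cabs (_ * _)); apply: eq_bigr => j _; rewrite addn1 analytic_sumE.
apply: (le_trans (Hd2 t)); rewrite lerD2r /Z /coanalytic_mean hornerZ horner_sum !cabsM.
rewrite -[cabs (\sum_(0 <= j < _) (coanalytic_poly _ _).[_])]cabs_conj rmorph_sum.
by rewrite le_eqVlt; apply/orP; left; apply/eqP; congr (_ * cabs _); apply: eq_bigr => j _; rewrite addn0 coanalytic_sumE.
Qed.

Lemma frac_le (a b : R) : 0 <= a -> 0 <= b -> a / (b + 1) * b <= a.
Proof. by move=> a0 b0; rewrite mulrAC ler_pdivrMr ?ltr_wpDl// ler_wpM2l// lerDl. Qed.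

Lemma proj_mean_bound : integ (fun t => pmean (G1 t) (G2 t)) /\ mean (fun t => pmean (G1 t) (G2 t)) <= A `^ p * I.
Proof.
have mG := pmean_meas G1_meas G2_meas.
have key (eta delta K : R) : 0 < delta -> 0 <= K -> 0 < eta ->
  (forall a b d1 d2 : R, 0 <= a -> 0 <= b -> 0 <= d1 -> 0 <= d2 ->
    pmean (a + d1) (b + d2) <= (1 + eta) * pmean a b + K * (d1 `^ p + d2 `^ p)) ->
  integ (fun t => pmean (G1 t) (G2 t)) /\
  mean (fun t => pmean (G1 t) (G2 t)) <= (1 + eta) * (A `^ p * I) + K * (delta + delta).
  move=> delta0 K0 eta0 H.
  have [N [d1 [d2 [d0 [i1 i2] m1 m2 b]]]] := proj_approx delta0.
  have iM := poly_pmean_integ (analytic_mean f N) (coanalytic_mean f N).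
  have iR : integ (fun t => (1 + eta) * pmean (W N t) (Z N t) + K * (d1 t `^ p + d2 t `^ p)).
    by apply: integ_add; apply: integ_scale => //; exact: integ_add.
  have le t : 0 <= pmean (G1 t) (G2 t) <= (1 + eta) * pmean (W N t) (Z N t) + K * (d1 t `^ p + d2 t `^ p).
    have [d1t d2t] := d0 t; have [b1 b2] := b t.
    rewrite powR_ge0 /=; apply: le_trans (H _ _ _ _ (cabs_ge0 _) (cabs_ge0 _) d1t d2t).
    apply: ge0_ler_powR; rewrite ?nnegrE ?addr_ge0 ?powR_ge0 ?(ltW (divr_gt0 p_gt0 s0))//.
    by apply: lerD; apply: ge0_ler_powR; rewrite ?nnegrE ?(ltW s0) ?addr_ge0 ?cabs_ge0.
  have iG := dominated_integ mG iR le; split => //.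
  apply: (le_trans (mean_le iG iR _)); first by move=> t; have /andP[] := le t.
  rewrite (mean_add (integ_scale (1 + eta) iM) (integ_scale K (integ_add i1 i2))).
  rewrite (mean_scale (1 + eta) iM) (mean_scale K (integ_add i1 i2)) (mean_add i1 i2); apply: lerD; last by rewrite ler_wpM2l// lerD.
  by rewrite ler_wpM2l ?fejer_bound_mean// addr_ge0// ltW.
split.
  have [K K0 H] := pair_split p_gt0 s0 (ltr01 : 0 < 1 :> R).
  by have [] := key 1 1 K ltr01 K0 ltr01 H.
have I0 : 0 <= I by apply: mean_ge0 => t; exact: powR_ge0.
have B0 : 0 <= A `^ p * I by rewrite mulr_ge0// powR_ge0.
have [B BE] : exists B, B = A `^ p * I by eexists.
rewrite -BE in B0 key *.
apply/ler_addgt0Pr => e e0.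
have e2 : 0 < e / 2 by rewrite divr_gt0.
have eta0 : 0 < e / 2 / (B + 1) by rewrite divr_gt0// ltr_wpDl.
have [K K0 H] := pair_split p_gt0 s0 eta0.
(* [K] depends on the splitting loss and is possibly large, so the approximation error is chosen
   after it; each of the two errors then costs at most e / 2. *)
have delta0 : 0 < e / 2 / (2 * (K + 1)) by rewrite divr_gt0// mulr_gt0// ltr_wpDl.
have [_ h] := key _ _ K delta0 K0 eta0 H.
apply: (le_trans h).
have -> : B + e = B + (e / 2 + e / 2) by field.
rewrite mulrDl mul1r -addrA lerD2l; apply: lerD; first by apply: frac_le => //; exact: ltW.
rewrite (_ : K * _ = e / 2 / (K + 1) * K); first by apply: frac_le => //; exact: ltW.
by field; rewrite gt_eqF// ltr_wpDl.
Qed.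

Lemma projection_upper_bound : (circle_norm p (proj_mean p s f) <= A%:E * Lp_norm p f)%E.
Proof.
have [iG mG] := proj_mean_bound; have p0 := p_gt0.
have I0 : 0 <= I by apply: mean_ge0 => t; exact: powR_ge0.
have E t : proj_mean p s f (expi t) `^ p = pmean (G1 t) (G2 t).
  by rewrite /proj_mean -powRrM mulrC.
have iP : integ (fun t => proj_mean p s f (expi t) `^ p) by under eq_fun do rewrite E.
rewrite circle_normE//; last by move=> t; exact: powR_ge0.
rewrite /Lp_norm circle_normE//; [|by move=> t; exact: cabs_ge0|exact: circle_abs_integ].
rewrite -EFinM lee_fin; apply: (powR_le_inv p0); rewrite ?mulr_ge0 ?powR_ge0//.
have J0 : 0 <= mean (fun t => proj_mean p s f (expi t) `^ p) by apply: mean_ge0 => t; exact: powR_ge0.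
rewrite (powR_invK p0 J0) (powRM _ A0 (powR_ge0 _ _)) (powR_invK p0 I0).
have -> : (fun t => proj_mean p s f (expi t) `^ p) = (fun t => pmean (G1 t) (G2 t)) by apply/funext.
exact: mG.
Qed.

End UpperBound.

(** * Sharpness *)

Section BinomialPartialSums.
Variable R : realType.
Variable al : R.
Hypothesis al1 : 0 < al <= 1.
Implicit Types (r s t b rho : R) (n k : nat).

(** Coefficients of the power series of (1 - x)^(-al). *)
Fixpoint binom_coef n : R := if n is k.+1 then binom_coef k * (k%:R + al) / k.+1%:R else 1.

Lemma binom_coef_itv n : 0 <= binom_coef n <= 1.
Proof.
have /andP[a0 a1] := al1.
elim: n => [|n /andP[c0 c1]] /=; first by rewrite ler01 lexx.
have n0 : 0 < n.+1%:R :> R by rewrite ltr0n.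
have na : 0 <= n%:R + al by rewrite addr_ge0 ?ler0n// ltW.
rewrite divr_ge0 ?mulr_ge0 ?ler0n//= ler_pdivrMr// mul1r.
apply: (@le_trans _ _ (1 * (n%:R + al))); first by rewrite ler_wpM2r.
by rewrite mul1r -natr1 lerD2l.
Qed.

(* Real part of [e^(ib)] times [(1 + s e^(it))^al] times the [n]th partial sum
   of the binomial series of [(1 + s e^(it))^(-al)]; its derivative in [s]
   telescopes to a single term. *)
Definition binom_sum n b t s : R := \sum_(0 <= k < n.+1) binom_coef k * (- s) ^+ k * branch al (k%:R * t + b) t s.

Lemma branch_split r b g s : 0 <= s < 1 -> branch r b g s = branch (r - 1) b g s + s * branch (r - 1) (b + g) g s.
Proof.
move=> ss; have [pc ps] := polar_at g ss; have n0 := sqn_gt0 g ss.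
rewrite /branch.
have -> : sqn g s `^ (r / 2) = sqn g s `^ ((r - 1) / 2) * Num.sqrt (sqn g s).
  rewrite -powR12_sqrt ?(ltW n0)// -powRD; last by rewrite (gt_eqF n0) implybT.
  by congr (_ `^ _); field.
have -> : b + r * arg_at g s = (b + (r - 1) * arg_at g s) + arg_at g s by ring.
have -> : b + g + (r - 1) * arg_at g s = (b + (r - 1) * arg_at g s) + g by ring.
have [A AE] : exists A, A = b + (r - 1) * arg_at g s by eexists.
rewrite -AE !cosD; move: (cos A) (sin A) (_ `^ _) => C S W.
have -> : W * Num.sqrt (sqn g s) * (C * cos (arg_at g s) - S * sin (arg_at g s)) =
  W * (C * (Num.sqrt (sqn g s) * cos (arg_at g s)) - S * (Num.sqrt (sqn g s) * sin (arg_at g s))) by ring.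
by rewrite pc ps; ring.
Qed.

(** Each new term is differentiated with one factor 1 + s zeta split off by [branch_split]. The
    recurrence of the coefficients makes part of it cancel the derivative accumulated so far and
    leaves the next single term. *)
Lemma isd_binom_sum n b t s : 0 <= s < 1 ->
  isd s (binom_sum n b t) ((n%:R + al) * binom_coef n * (- s) ^+ n * branch (al - 1) (n.+1%:R * t + b) t s).
Proof.
move=> ss; elim: n => [|n IH].
  rewrite (_ : binom_sum 0 b t = (fun s => branch al (0%:R * t + b) t s)); last first.
    by apply/funext => x; rewrite /binom_sum big_nat1 /= expr0 !mul1r.
  apply: isd_eq (isd_branch al (0%:R * t + b) t ss) _.
  by rewrite /= add0r mulr1 expr0 mulr1; congr (_ * branch _ _ _ _); ring.
rewrite (_ : binom_sum n.+1 b t = (fun s => binom_sum n b t s + binom_coef n.+1 * (- s) ^+ n.+1 * branch al (n.+1%:R * t + b) t s)); last first.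
  by apply/funext => x; rewrite /binom_sum big_nat_recr.
have D := isd_branch al (n.+1%:R * t + b) t ss.
eapply isd_eq.
  apply: isd_add; first exact: IH.
  by apply: isd_mul; [deriv|exact: D].
have n0 : n.+1%:R != 0 :> R by rewrite pnatr_eq0.
have cE : binom_coef n.+1 * n.+1%:R = binom_coef n * (n%:R + al) by rewrite /= divfK.
have -> : n.+2%:R * t + b = n.+1%:R * t + b + t by rewrite -[n.+2%:R]natr1; ring.
rewrite (branch_split al _ _ ss) /=.
rewrite -[binom_coef n * (n%:R + al) / n.+1%:R]/(binom_coef n.+1).
move: (branch (al - 1) (n.+1%:R * t + b) t s) (branch (al - 1) (n.+1%:R * t + b + t) t s) => B1 B2.
rewrite [(n%:R + al) * _]mulrC -cE exprS; move: (binom_coef n.+1) ((- s) ^+ n) => c P.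
by rewrite -natr1; ring.
Qed.

Lemma branch_le b t s : 0 <= s < 1 -> `|branch (al - 1) b t s| <= ((1 - s) ^+ 2) `^ ((al - 1) / 2).
Proof.
move=> ss; have n0 := sqn_gt0 t ss; have /andP[a0 a1] := al1; case/andP: ss => s0 s1.
have s10 : 0 < 1 - s by rewrite subr_gt0.
rewrite /branch normrM ger0_norm ?powR_ge0//.
apply: (@le_trans _ _ (sqn t s `^ ((al - 1) / 2))).
  by rewrite -[leRHS]mulr1 ler_wpM2l ?powR_ge0// cos_max.
have [e [e0 ->]] : exists e, 0 <= e /\ (al - 1) / 2 = - e by exists ((1 - al) / 2); split; [lra|field].
rewrite !powRN lef_pV2 ?posrE ?powR_gt0 ?exprn_gt0//.
apply: ge0_ler_powR; rewrite ?nnegrE ?sqr_ge0 ?(ltW n0)// -subr_ge0.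
have -> : sqn t s - (1 - s) ^+ 2 = 2 * s * (1 + cos t) + s ^+ 2 * (cos t ^+ 2 + sin t ^+ 2 - 1) by rewrite /sqn; ring.
rewrite cos2Dsin2 subrr mulr0 addr0 !mulr_ge0//.
Qed.

(** From e^x >= 1 + x with x = - n (ln rho) / 2 one gets (1 + n v)^2 rho^n <= 1 for some v in (0,
    1]; this gives decay of order 1 / n after multiplication of rho^n by n + 1. *)
Lemma geometric_small rho (K delta : R) : 0 < rho < 1 -> 0 < delta -> exists n, K * (n.+1%:R * rho ^+ n) <= delta.
Proof.
move=> /andP[r0 r1] d0.
have [v [v0 v1 vr]] : exists v, [/\ 0 < v, v <= 1 & forall n : nat, (1 + n%:R * v) ^+ 2 * rho ^+ n <= 1].
  pose u := - ln rho / 2.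
  have u0 : 0 < u by rewrite divr_gt0// oppr_gt0 ln_lt0// r0 r1.
  exists (Num.min u 1); split; first by rewrite lt_min u0 ltr01.
    by rewrite ge_min lexx orbT.
  move=> n.
  have : 1 + n%:R * Num.min u 1 <= expR (n%:R * u).
    apply: le_trans (expR_ge1Dx _); rewrite lerD2l ler_wpM2l ?ler0n// ge_min lexx//.
  have m0 : 0 <= Num.min u 1 by rewrite le_min (ltW u0) ler01.
  move=> h; have : (1 + n%:R * Num.min u 1) ^+ 2 <= expR (n%:R * u) ^+ 2.
    by rewrite ler_pXn2r// nnegrE ?addr_ge0 ?mulr_ge0 ?ler0n ?expR_ge0.
  rewrite -expRM_natl => h2.
  have rE : rho ^+ n = expR (- (n%:R * u *+ 2)).
    rewrite -[rho in LHS]lnK ?posrE// -expRM_natl; congr expR.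
    by rewrite /u -mulr_natl; field.
  rewrite rE expRN ler_pdivrMr ?expR_gt0// mul1r.
  by rewrite -[_ *+ 2]mulr_natl.
have [n nK] : exists n : nat, `|K| / (v ^+ 2 * delta) < n%:R.
  exists (Num.trunc (`|K| / (v ^+ 2 * delta))).+1.
  exact: truncnS_gt.
exists n; apply: (@le_trans _ _ (`|K| * (n.+1%:R * rho ^+ n))).
  by rewrite ler_wpM2r ?ler_norm// mulr_ge0 ?ler0n ?exprn_ge0// ltW.
have n1 : v * n.+1%:R <= 1 + n%:R * v.
  by rewrite -natr1 mulrDr mulr1 addrC [v * _]mulrC lerD2r.
have np : 0 < n.+1%:R :> R by rewrite ltr0n.
have h : n.+1%:R * rho ^+ n <= (v ^+ 2 * n.+1%:R)^-1.
  rewrite -[leRHS]mul1r ler_pdivlMr ?mulr_gt0 ?exprn_gt0//; apply: le_trans (vr n).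
  have -> : n.+1%:R * rho ^+ n * (v ^+ 2 * n.+1%:R) = (v * n.+1%:R) ^+ 2 * rho ^+ n by ring.
  rewrite ler_wpM2r ?exprn_ge0 ?(ltW r0)// ler_pXn2r ?nnegrE ?addr_ge0 ?mulr_ge0 ?ler0n ?(ltW v0)//.
apply: (le_trans (ler_wpM2l (normr_ge0 K) h)).
rewrite ler_pdivrMr ?mulr_gt0 ?exprn_gt0//.
have := nK; rewrite ltr_pdivrMr ?mulr_gt0 ?exprn_gt0// => h3.
apply: (le_trans (ltW h3)).
have -> : delta * (v ^+ 2 * n.+1%:R) = n.+1%:R * (v ^+ 2 * delta) by ring.
apply: ler_wpM2r; last by rewrite ler_nat.
by rewrite mulr_ge0 ?sqr_ge0 ?(ltW d0).
Qed.

(** At s = 0 the sum equals cos b, and on [0, rho] its derivative is at most delta in modulus,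
    uniformly in [b] and [t]. *)
Lemma binom_sum_close rho delta : 0 < rho < 1 -> 0 < delta ->
  exists n, forall b t, `|binom_sum n b t rho - cos b| <= delta.
Proof.
move=> /andP[r0 r1] d0; have /andP[a0 a1] := al1.
pose K := ((1 - rho) ^+ 2) `^ ((al - 1) / 2).
have [n nK] : exists n, K * (n.+1%:R * rho ^+ n) <= delta by apply: geometric_small => //; rewrite r0.
exists n => b t.
pose D s := (n%:R + al) * binom_coef n * (- s) ^+ n * branch (al - 1) (n.+1%:R * t + b) t s.
have dF s : 0 <= s <= rho -> isd s (binom_sum n b t) (D s).
  by move=> /andP[s0 sr]; apply: isd_binom_sum; rewrite s0 (le_lt_trans sr).
have Db s : 0 <= s <= rho -> `|D s| <= delta.
  move=> /andP[s0 sr]; apply: le_trans nK; have s1 := le_lt_trans sr r1.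
  have /andP[c0 c1] := binom_coef_itv n.
  rewrite /D normrM mulrC; apply: ler_pM => //.
    apply: le_trans (branch_le _ _ _) _; first by rewrite s0.
    rewrite /K; have [e [e0 ->]] : exists e, 0 <= e /\ (al - 1) / 2 = - e by exists ((1 - al) / 2); split; [lra|field].
    have p1 : 0 < 1 - s by rewrite subr_gt0.
    have p2 : 0 < 1 - rho by rewrite subr_gt0.
    rewrite !powRN lef_pV2 ?posrE ?powR_gt0 ?exprn_gt0//.
    apply: ge0_ler_powR; rewrite ?nnegrE ?sqr_ge0//.
    by rewrite ler_pXn2r ?nnegrE ?(ltW p1) ?(ltW p2)// lerB.
  rewrite !normrM normrX normrN (ger0_norm s0) (ger0_norm c0) ger0_norm ?addr_ge0 ?ler0n ?(ltW a0)//.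
  apply: ler_pM; rewrite ?mulr_ge0 ?addr_ge0 ?ler0n ?exprn_ge0 ?(ltW a0)//.
    rewrite -[leRHS]mulr1; apply: ler_pM; rewrite ?addr_ge0 ?ler0n ?(ltW a0)//.
    by rewrite -natr1 lerD2l.
  by apply: lerXn2r; rewrite ?nnegrE ?(ltW r0).
have F0 : binom_sum n b t 0 = cos b.
  rewrite /binom_sum big_nat_recl//= expr0 !mul1r mul0r add0r big1 ?addr0; last first.
    by move=> i _; rewrite oppr0 expr0n mulr0 mul0r.
  by rewrite /branch /arg_at /sqn !mul0r addr0 expr1n expr0n addr0 powR1 mul1r atan0 mulr0 addr0.
have Db' s : 0 < s < rho -> `|D s| <= delta by move=> /andP[s0 sr]; apply: Db; rewrite !ltW.
have dl s : isd s (fun x : R => delta * x) delta by eapply isd_eq; [deriv|cbv beta; ring].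
rewrite ler_norml; apply/andP; split.
  have : binom_sum n b t 0 + delta * 0 <= binom_sum n b t rho + delta * rho.
    apply: (@incr_le R (fun s => binom_sum n b t s + delta * s) (fun s => D s + delta) _ _ (ltW r0)) => s ss.
      exact: (isd_add (dF s ss) (dl s)).
    by have := Db' s ss; rewrite ler_norml => /andP[h _]; rewrite -lerBlDr sub0r.
  rewrite F0 mulr0 addr0 => h; have : delta * rho <= delta by rewrite ler_piMr ?(ltW d0) ?(ltW r1).
  by lra.
have : delta * 0 - binom_sum n b t 0 <= delta * rho - binom_sum n b t rho.
  apply: (@incr_le R (fun s => delta * s - binom_sum n b t s) (fun s => delta - D s) _ _ (ltW r0)) => s ss.
    exact: (isd_add (dl s) (isd_opp (dF s ss))).
  by have := Db' s ss; rewrite ler_norml => /andP[_ h]; rewrite subr_ge0.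
rewrite F0 mulr0 sub0r => h; have : delta * rho <= delta by rewrite ler_piMr ?(ltW d0) ?(ltW r1).
by lra.
Qed.

Definition extremal_coef rho k : R := binom_coef k * (- rho) ^+ k.
Definition cos_sum (d : nat -> R) n t : R := \sum_(0 <= k < n.+1) d k * cos (k%:R * t).
Definition sin_sum (d : nat -> R) n t : R := \sum_(0 <= k < n.+1) d k * sin (k%:R * t).

(** Let h have real part [cos_sum] and imaginary part [sin_sum]. Then h (1 + rho e^(it))^al is close
    to 1, and [psi] is al times the argument of 1 + rho e^(it). The phases - psi and - pi / 2 - psi
    in [binom_sum] isolate the real and imaginary parts of h. *)
Lemma extremal_poly rho delta : 0 < rho < 1 -> 0 < delta -> exists n, forall t, exists psi e1 e2 : R,
  [/\ `|psi| <= al * (pi / 2), `|e1| <= delta, `|e2| <= delta,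
      cos_sum (extremal_coef rho) n t = sqn t rho `^ (- (al / 2)) * (cos psi + e1) &
      sin_sum (extremal_coef rho) n t = sqn t rho `^ (- (al / 2)) * (e2 - sin psi)].
Proof.
move=> rr d0; have [n H] := binom_sum_close rr d0; have /andP[a0 a1] := al1.
exists n => t; have [psi psiE] : exists psi, psi = al * arg_at t rho by eexists.
have r01 : 0 <= rho < 1 by case/andP: rr => /ltW -> ->.
have n0 := sqn_gt0 t r01.
have [m mE] : exists m, m = sqn t rho `^ (al / 2) by eexists.
have m0 : 0 < m by rewrite mE powR_gt0.
have E b : binom_sum n b t rho = m * (cos_sum (extremal_coef rho) n t * cos (b + psi) - sin_sum (extremal_coef rho) n t * sin (b + psi)).
  rewrite /cos_sum /sin_sum !mulr_suml -sumrB mulr_sumr; apply: eq_bigr => k _.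
  rewrite /branch -mE -psiE -addrA (cosD (k%:R * t)) /extremal_coef.
  move: ((- rho) ^+ k) (cos (k%:R * t)) (sin (k%:R * t)) (cos _) (sin _) => P c1 s1 c2 s2; ring.
exists psi, (binom_sum n (- psi) t rho - cos (- psi)), (binom_sum n (- (pi / 2) - psi) t rho - cos (- (pi / 2) - psi)).
split => //.
- rewrite psiE normrM (ger0_norm (ltW a0)) ler_wpM2l ?(ltW a0)//.
  by rewrite ler_norml (ltW (atan_gtNpi2 _)) (ltW (atan_ltpi2 _)).
- rewrite powRN -mE E addNr cos0 sin0 cosN mulr0 subr0 mulr1; by field; rewrite gt_eqF.
rewrite powRN -mE E subrK cosN sinN cos_pihalf sin_pihalf mulr0 sub0r.
have -> : cos (- (pi / 2) - psi) = - sin psi by rewrite -opprD cosN addrC cosDpihalf.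
by field; rewrite gt_eqF.
Qed.

End BinomialPartialSums.

(** * Fourier coefficients of cosine and sine sums *)

Section Orthogonality.
Variable R : realType.
Implicit Types (k m n : nat) (b c t : R) (d : nat -> R).

Lemma cos_lin_integ (x b : R) : integ (fun t => cos (x * t + b)).
Proof. by apply: (integ_bdd (@cos_lin_meas R x b)) => t; exact: cos_max. Qed.

Lemma mean_cos_sub k m c : mean (fun t => cos (k%:R * t - m%:R * t + c)) = (k == m)%:R * cos c.
Proof.
case: (ltngtP k m) => [km|km|->].
- rewrite mul0r -(@mean_cos R (m - k).-1 (- c)); congr mean; apply/funext => t.
  rewrite prednK ?subn_gt0// natrB ?(ltnW km)// -cosN; congr cos; ring.
- rewrite mul0r -(@mean_cos R (k - m).-1 c); congr mean; apply/funext => t.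
  by rewrite prednK ?subn_gt0// natrB ?(ltnW km)//; congr cos; ring.
- rewrite mul1r -[RHS]mean_cst; congr mean; apply/funext => t.
  by rewrite subrr add0r.
Qed.

Lemma mean_cos_add k m c : mean (fun t => cos (k%:R * t + m%:R * t + c)) = ((k == 0%N) && (m == 0%N))%:R * cos c.
Proof.
rewrite -addn_eq0 -(mean_cos_sub (k + m)%N 0); congr mean; apply/funext => t.
by rewrite natrD mul0r subr0 mulrDl.
Qed.

Lemma mean_cos_mul k m b c : mean (fun t => cos (k%:R * t + b) * cos (m%:R * t + c)) =
  2^-1 * ((k == m)%:R * cos (b - c) + ((k == 0%N) && (m == 0%N))%:R * cos (b + c)).
Proof.
rewrite -mean_cos_sub -mean_cos_add.
have i1 : integ (fun t => cos (k%:R * t - m%:R * t + (b - c))).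
  by have := cos_lin_integ (k%:R - m%:R) (b - c); congr integ; apply/funext => t; rewrite mulrBl.
have i2 : integ (fun t => cos (k%:R * t + m%:R * t + (b + c))).
  by have := cos_lin_integ (k%:R + m%:R) (b + c); congr integ; apply/funext => t; rewrite mulrDl.
rewrite -(mean_add i1 i2) -(mean_scale _ (integ_add i1 i2)); congr mean; apply/funext => t.
have -> : k%:R * t - m%:R * t + (b - c) = (k%:R * t + b) - (m%:R * t + c) by ring.
have -> : k%:R * t + m%:R * t + (b + c) = (k%:R * t + b) + (m%:R * t + c) by ring.
by rewrite (cosB (_ + b)) (cosD (_ + b)); field.
Qed.

Lemma sum_delta (F : nat -> R) n m : \sum_(0 <= k < n) F k * (k == m)%:R = if (m < n)%N then F m else 0.
Proof.
elim: n => [|n IH]; first by rewrite big_geq.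
rewrite big_nat_recr//= IH ltnS; case: (ltngtP m n) => [mn|nm|->]; by rewrite ?mulr0 ?addr0 ?mulr1 ?add0r.
Qed.

(** One computation serves both kinds of sums: the phase 0 gives cosines and - pi / 2 gives
    sines. *)
Definition phase_sum d n b t := \sum_(0 <= k < n.+1) d k * cos (k%:R * t + b).

Lemma phase_sum_integ d n b : integ (phase_sum d n b).
Proof. by apply: integ_sum => k; apply: integ_scale; exact: cos_lin_integ. Qed.

Lemma mean_phase_sum d n m b c : (forall k, (n < k)%N -> d k = 0) ->
  mean (fun t => phase_sum d n b t * cos (m%:R * t + c)) =
  2^-1 * (d m * cos (b - c) + (m == 0%N)%:R * d 0%N * cos (b + c)).
Proof.
move=> ds.
have ik k : integ (fun t => cos (k%:R * t + b) * cos (m%:R * t + c)).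
  by apply: (integ_mul_bdd (cos_lin_integ _ _) (cos_lin_meas _ _)) => t; exact: cos_max.
rewrite (_ : (fun t => _) = (fun t => \sum_(0 <= k < n.+1) d k * (cos (k%:R * t + b) * cos (m%:R * t + c)))); last first.
  by apply/funext => t; rewrite /phase_sum mulr_suml; apply: eq_bigr => k _; rewrite mulrA.
rewrite mean_sum; last by move=> k; exact: (integ_scale (d k) (ik k)).
rewrite (eq_bigr (fun k => (2^-1 * cos (b - c) * d k) * (k == m)%:R + (2^-1 * (m == 0%N)%:R * cos (b + c) * d k) * (k == 0%N)%:R)); last first.
  move=> k _; rewrite (mean_scale (d k) (ik k)) mean_cos_mul -mulnb natrM; ring.
rewrite big_split /= !sum_delta ltn0Sn.
case: ifP => [_|/negbT]; first by ring.
by rewrite -leqNgt => /ds ->; ring.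
Qed.

Lemma cos_sum_phase d n : cos_sum d n = phase_sum d n 0.
Proof. by apply/funext => t; apply: eq_bigr => k _; rewrite addr0. Qed.

Lemma sin_phase (x : R) : sin x = cos (x + - (pi / 2)).
Proof. by rewrite cosB cos_pihalf sin_pihalf mulr0 mulr1 add0r. Qed.

Lemma sin_sum_phase d n : sin_sum d n = phase_sum d n (- (pi / 2)).
Proof. by apply/funext => t; apply: eq_bigr => k _; rewrite -sin_phase. Qed.

Lemma mean_cos_sum_cos d n m : (forall k, (n < k)%N -> d k = 0) ->
  mean (fun t => cos_sum d n t * cos (m%:R * t)) = 2^-1 * (d m + (m == 0%N)%:R * d 0%N).
Proof.
move=> ds; have := @mean_phase_sum d n m 0 0 ds; rewrite subr0 addr0 cos0 !mulr1 -cos_sum_phase => <-.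
by congr mean; apply/funext => t; rewrite addr0.
Qed.

Lemma mean_cos_sum_sin d n m : (forall k, (n < k)%N -> d k = 0) ->
  mean (fun t => cos_sum d n t * sin (m%:R * t)) = 0.
Proof.
move=> ds; have := @mean_phase_sum d n m 0 (- (pi / 2)) ds; rewrite sub0r opprK add0r cosN cos_pihalf !mulr0 addr0 mulr0.
by rewrite -cos_sum_phase => <-; congr mean; apply/funext => t; rewrite -sin_phase.
Qed.

Lemma mean_sin_sum_cos d n m : (forall k, (n < k)%N -> d k = 0) ->
  mean (fun t => sin_sum d n t * cos (m%:R * t)) = 0.
Proof.
move=> ds; have := @mean_phase_sum d n m (- (pi / 2)) 0 ds; rewrite subr0 addr0 cosN cos_pihalf !mulr0 addr0 mulr0.
by rewrite -sin_sum_phase => <-; congr mean; apply/funext => t; rewrite addr0.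
Qed.

Lemma mean_sin_sum_sin d n m : (forall k, (n < k)%N -> d k = 0) ->
  mean (fun t => sin_sum d n t * sin (m%:R * t)) = 2^-1 * (d m - (m == 0%N)%:R * d 0%N).
Proof.
move=> ds; have := @mean_phase_sum d n m (- (pi / 2)) (- (pi / 2)) ds; rewrite subrr cos0 mulr1.
have -> : cos (- (pi / 2) + - (pi / 2)) = -1 :> R.
  by rewrite -opprD -splitr cosN cospi.
rewrite -sin_sum_phase mulrN1 => <-.
by congr mean; apply/funext => t; rewrite -sin_phase.
Qed.

End Orthogonality.

Section StationaryLimit.
Variable R : realType.
Variables (p : R) (u : nat -> circle R -> R[i]).
Hypothesis p1 : 1 < p.
Hypothesis u_meas : forall N, measurable_fun setT (fun t : R => complex.Re (u N (expi t))) /\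
  measurable_fun setT (fun t : R => complex.Im (u N (expi t))).
Hypothesis u_bdd : forall N, exists c, forall t : R, cabs (u N (expi t)) <= c.

Lemma bounded_in_Lp (g : circle R -> R[i]) (c : R) :
  measurable_fun setT (fun t : R => complex.Re (g (expi t))) ->
  measurable_fun setT (fun t : R => complex.Im (g (expi t))) ->
  (forall t, cabs (g (expi t)) <= c) -> in_Lp p g.
Proof.
move=> m1 m2 gc; split => //; rewrite /Lp_norm circle_normE ?ltry//.
- exact: lt_trans p1.
- by move=> t; exact: cabs_ge0.
apply: (@integ_bdd _ _ (c `^ p)); first by apply: powR_meas; exact: cabs_meas.
move=> t; rewrite ger0_norm ?powR_ge0//; apply: ge0_ler_powR; rewrite ?nnegrE ?cabs_ge0//.
- by rewrite ltW// (lt_trans _ p1).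
- by apply: le_trans (gc t); exact: cabs_ge0.
Qed.

(** Partial sums that are eventually constant converge to that constant, so a limit exists; the
    representative selected by [xget] differs from it by 0 in the p-mean. *)
Lemma limit_stationary M :
  (forall N, (M <= N)%N -> forall t : R, u N (expi t) = u M (expi t)) ->
  let g := xget (cst 0) [set g | Lp_limit p u g] in
  in_Lp p g /\ mean (fun t : R => cabs (u M (expi t) - g (expi t)) `^ p) = 0.
Proof.
move=> st; have p0 : 0 < p := lt_trans ltr01 p1.
have uLp : in_Lp p (u M).
  by have [m1 m2] := u_meas M; have [c cb] := u_bdd M; exact: bounded_in_Lp m1 m2 cb.
have LM : Lp_limit p u (u M).
  split => //; apply/cvg_ballP => e e0; near=> N.
  have -> : Lp_norm p (fun z => u N z - u M z) = 0%E; last exact: ballxx.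
  rewrite /Lp_norm circle_normE//; last 2 first.
  - by move=> t; exact: cabs_ge0.
  - exact: sub_integ.
  have -> : (fun t : R => cabs (u N (expi t) - u M (expi t)) `^ p) = (fun=> 0).
    apply/funext => t; rewrite st; last by near: N; exists M.
    by rewrite subrr /cabs /= expr0n addr0 sqrtr0 powR0// gt_eqF.
  by rewrite mean_cst powR0// invr_eq0 gt_eqF.
rewrite /=; case: xgetP => [g _ /= Lg|no]; last by case: (no (u M)).
split; first by case: Lg.
have := err_cvg p1 u_meas u_bdd Lg => /cvg_lim <-//.
apply/esym/cvg_lim => //; apply: cvg_near_cst; near=> N.
congr mean; apply/funext => t; rewrite st//; near: N; exists M => //.
Unshelve. all: by end_near.
Qed.

End StationaryLimit.

(** * The test functions and their projections *)

Section TestFunction.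
Variable R : realType.
Variables (p s a b : R) (d : nat -> R) (n : nat).
Hypotheses (p1 : 1 < p) (s0 : 0 < s) (a0 : 0 < a) (b0 : 0 < b).
Hypotheses (d_supp : forall k, (n < k)%N -> d k = 0) (d0 : d 0%N = 1).
Implicit Types (t : R) (k m M N : nat).

(** This is a h - b conj h, where h is the polynomial with real coefficients [d], written through
    its real and imaginary parts. *)
Definition test_function (z : circle R) : R[i] :=
  ((a - b) * \sum_(0 <= k < n.+1) d k * complex.Re (val z ^ k%:Z)) +i*
  ((a + b) * \sum_(0 <= k < n.+1) d k * complex.Im (val z ^ k%:Z)).

Let X := cos_sum d n.
Let Y := sin_sum d n.
Let f := test_function.

Lemma test_functionE t : f (expi t) = ((a - b) * X t) +i* ((a + b) * Y t).
Proof.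
rewrite /f /test_function /X /Y /cos_sum /sin_sum; congr ((_ * _) +i* (_ * _)); apply: eq_bigr => k _.
  by rewrite expi_exp.
by rewrite expi_exp.
Qed.

Lemma X_bound t : `|X t| <= \sum_(0 <= k < n.+1) `|d k|.
Proof.
apply: (le_trans (ler_norm_sum _ _ _)); apply: ler_sum => k _.
by rewrite normrM -[leRHS]mulr1 ler_wpM2l// cos_max.
Qed.

Lemma Y_bound t : `|Y t| <= \sum_(0 <= k < n.+1) `|d k|.
Proof.
apply: (le_trans (ler_norm_sum _ _ _)); apply: ler_sum => k _.
by rewrite normrM -[leRHS]mulr1 ler_wpM2l// sin_max.
Qed.

Lemma X_meas : measurable_fun setT X.
Proof. by apply: integ_meas; rewrite /X cos_sum_phase; exact: phase_sum_integ. Qed.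

Lemma Y_meas : measurable_fun setT Y.
Proof. by apply: integ_meas; rewrite /Y sin_sum_phase; exact: phase_sum_integ. Qed.

Lemma cabs_le (x y : R) : cabs (x +i* y) <= `|x| + `|y|.
Proof.
rewrite -(@ler_pXn2r _ 2)// ?nnegrE ?cabs_ge0 ?addr_ge0// cabs_sqr /=.
rewrite -(real_normK (num_real x)) -(real_normK (num_real y)) -subr_ge0.
have -> : (`|x| + `|y|) ^+ 2 - (`|x| ^+ 2 + `|y| ^+ 2) = 2 * (`|x| * `|y|) by ring.
by rewrite !mulr_ge0.
Qed.

Lemma test_function_Lp : in_Lp p f.
Proof.
have [B BE] : exists B, B = \sum_(0 <= k < n.+1) `|d k| by eexists.
apply: (@bounded_in_Lp _ _ p1 _ (`|a - b| * B + `|a + b| * B)).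
- under eq_fun do rewrite test_functionE /=.
  by apply: measurable_funM; [exact: measurable_cst|exact: X_meas].
- under eq_fun do rewrite test_functionE /=.
  by apply: measurable_funM; [exact: measurable_cst|exact: Y_meas].
move=> t; rewrite test_functionE; apply: (le_trans (cabs_le _ _)); rewrite !normrM BE.
by apply: lerD; rewrite ler_wpM2l// (X_bound, Y_bound).
Qed.

Lemma test_means m :
  [/\ mean (fun t => complex.Re (f (expi t)) * cos (m%:R * t)) = (a - b) * (2^-1 * (d m + (m == 0%N)%:R * d 0%N)),
      mean (fun t => complex.Re (f (expi t)) * sin (m%:R * t)) = 0,
      mean (fun t => complex.Im (f (expi t)) * cos (m%:R * t)) = 0 &
      mean (fun t => complex.Im (f (expi t)) * sin (m%:R * t)) = (a + b) * (2^-1 * (d m - (m == 0%N)%:R * d 0%N))].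
Proof.
have iX : integ (fun t => X t * cos (m%:R * t)).
  by rewrite /X cos_sum_phase; apply: integ_cosm; exact: phase_sum_integ.
have iX' : integ (fun t => X t * sin (m%:R * t)).
  by rewrite /X cos_sum_phase; apply: integ_sinm; exact: phase_sum_integ.
have iY : integ (fun t => Y t * cos (m%:R * t)).
  by rewrite /Y sin_sum_phase; apply: integ_cosm; exact: phase_sum_integ.
have iY' : integ (fun t => Y t * sin (m%:R * t)).
  by rewrite /Y sin_sum_phase; apply: integ_sinm; exact: phase_sum_integ.
split.
- rewrite -(mean_cos_sum_cos m d_supp) -(mean_scale _ iX); congr mean; apply/funext => t.
  by rewrite test_functionE /= mulrA.
- rewrite -[RHS](mulr0 (a - b)) -(mean_cos_sum_sin m d_supp) -(mean_scale _ iX'); congr mean; apply/funext => t.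
  by rewrite test_functionE /= mulrA.
- rewrite -[RHS](mulr0 (a + b)) -(mean_sin_sum_cos m d_supp) -(mean_scale _ iY); congr mean; apply/funext => t.
  by rewrite test_functionE /= mulrA.
- rewrite -(mean_sin_sum_sin m d_supp) -(mean_scale _ iY'); congr mean; apply/funext => t.
  by rewrite test_functionE /= mulrA.
Qed.

Lemma fourier_test m : fourier f m%:Z = (a * d m - b * (m == 0%N)%:R) +i* 0.
Proof.
have [E1 E2 E3 E4] := test_means m.
rewrite (fourier_pos p1 test_function_Lp) E1 E2 E3 E4 subr0 d0 mulr1; congr (_ +i* _).
by field.
Qed.

Lemma fourier_testN m : fourier f (- m%:Z) = (- b * d m + a * (m == 0%N)%:R) +i* 0.
Proof.
have [E1 E2 E3 E4] := test_means m.
rewrite (fourier_neg p1 test_function_Lp) E1 E2 E3 E4 addr0 d0 mulr1; congr (_ +i* _).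
by field.
Qed.

Lemma sum_supp (g : nat -> R) M : (n < M)%N -> \sum_(0 <= k < M) d k * g k = \sum_(0 <= k < n.+1) d k * g k.
Proof.
move=> nM; rewrite (@big_cat_nat _ _ _ n.+1)//= [X in _ + X]big_nat_cond [X in _ + X]big1 ?addr0//.
by move=> k /andP[/andP[nk _] _]; rewrite d_supp// mul0r.
Qed.

Lemma sum_first (g : nat -> R) M : \sum_(0 <= k < M.+1) (k == 0%N)%:R * g k = g 0%N.
Proof. by rewrite big_nat_recl//= mul1r big1 ?addr0// => i _; rewrite mul0r. Qed.

(** The constant term - b of - b conj h is analytic, so the projections are a h - b and - b conj (h
    - 1) instead of the two summands of the test function. *)
Lemma analytic_test M t : (n < M)%N ->
  analytic_sum f M (expi t) = (a * X t - b) +i* (a * Y t).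
Proof.
case: M => // M nM; rewrite /analytic_sum.
rewrite (eq_bigr (fun m => (a * (d m * cos (m%:R * t)) - b * ((m == 0%N)%:R * cos (m%:R * t))) +i*
    (a * (d m * sin (m%:R * t)) - b * ((m == 0%N)%:R * sin (m%:R * t))))).
  by rewrite sum_complex !sumrB -!mulr_sumr !(@sum_supp _ M.+1)// !sum_first mul0r cos0 sin0 mulr1 mulr0 subr0.
move=> m _; rewrite fourier_test expi_exp.
by apply/eqP; rewrite eq_complex /=; apply/andP; split; apply/eqP; ring.
Qed.

Lemma coanalytic_test M t : (n <= M)%N ->
  coanalytic_sum f M (expi t) = (- b * (X t - 1)) +i* (b * Y t).
Proof.
move=> nM; rewrite /coanalytic_sum.
have E : \sum_(0 <= k < M.+1) fourier f (- k%:Z) * val (expi t) ^ (- k%:Z) =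
   (- b * X t + a) +i* (b * Y t).
  rewrite (eq_bigr (fun m => (- b * (d m * cos (m%:R * t)) + a * ((m == 0%N)%:R * cos (m%:R * t))) +i*
    (b * (d m * sin (m%:R * t)) - a * ((m == 0%N)%:R * sin (m%:R * t))))).
    by rewrite sum_complex sumrB big_split /= -!mulr_sumr !(@sum_supp _ M.+1)// !sum_first mul0r cos0 sin0 mulr1 mulr0 subr0.
  move=> m _; rewrite fourier_testN expi_expN.
  by apply/eqP; rewrite eq_complex /=; apply/andP; split; apply/eqP; ring.
rewrite big_ltn// in E.
have E0 : fourier f (- 0%:Z) * val (expi t) ^ (- 0%:Z) = (- b + a) +i* 0.
  rewrite fourier_testN expi_expN d0 !mulr1 mul0r cos0 sin0.
  by apply/eqP; rewrite eq_complex /=; apply/andP; split; apply/eqP; ring.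
rewrite E0 in E; apply: (addrI ((- b + a) +i* 0)); rewrite E.
by apply/eqP; rewrite eq_complex /=; apply/andP; split; apply/eqP; ring.
Qed.

End TestFunction.

(** * Lower bound for the constant *)

Section LowerBound.
Variable R : realType.
Implicit Types (p s a b eta C y t rho : R).

Definition bounded_by p s C := forall f : circle R -> R[i], in_Lp p f ->
  (circle_norm p (proj_mean p s f) <= C%:E * Lp_norm p f)%E.

(** [K] is chosen before [C], [d] and [n]: it absorbs the constant that passes from one projection
    to the other, and becomes negligible when the p-mean of h is large. *)
Lemma test_lower p s a b eta : 1 < p -> 0 < s -> 0 < a -> 0 < b -> 0 < eta ->
  exists K, forall C (d : nat -> R) n, 0 <= C -> (forall k, (n < k)%N -> d k = 0) -> d 0%N = 1 ->
  bounded_by p s C ->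
  (a `^ s + b `^ s) `^ (p / s) * mean (fun t => cabs (cos_sum d n t +i* sin_sum d n t) `^ p) <=
  (1 + eta) * (C `^ p * mean (fun t => cabs (test_function a b d n (expi t)) `^ p)) + K.
Proof.
move=> p1 s0 a0 b0 eta0; have p0 : 0 < p := lt_trans ltr01 p1.
have ps0 : 0 < p / s by rewrite divr_gt0.
have [K1 K10 S1] := pair_split p0 s0 eta0.
have [K2 K20 S2] := power_split p0 (ltr01 : 0 < 1 :> R).
exists (K1 * (K2 * b `^ p + K2 * b `^ p)) => C d n C0 ds d0 hC.
have [f fE] : exists f, f = test_function a b d n by eexists.
have fLp : in_Lp p f by rewrite fE; exact: test_function_Lp.
have st1 N : (n < N)%N -> forall t, analytic_sum f N (expi t) = analytic_sum f n.+1 (expi t).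
  by move=> nN t; rewrite fE !(analytic_test a b p1 ds d0).
have st2 N : (n <= N)%N -> forall t, coanalytic_sum f N (expi t) = coanalytic_sum f n (expi t).
  by move=> nN t; rewrite fE !(coanalytic_test a b p1 ds d0).
have [L1 m1] := @limit_stationary R p (analytic_sum f) p1 (analytic_sum_meas f) (analytic_sum_bdd f) n.+1 st1.
have [L2 m2] := @limit_stationary R p (coanalytic_sum f) p1 (coanalytic_sum_meas f) (coanalytic_sum_bdd f) n st2.
have i1 := sub_integ p1 (analytic_sum_meas f) (analytic_sum_bdd f) n.+1 L1.
have i2 := sub_integ p1 (coanalytic_sum_meas f) (coanalytic_sum_bdd f) n L2.
have [g1 g1E] : exists g, g = analytic_proj p f by eexists.
have [g2 g2E] : exists g, g = coanalytic_proj p f by eexists.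
rewrite -[xget _ _]/(analytic_proj p f) -g1E in L1 m1 i1.
rewrite -[xget _ _]/(coanalytic_proj p f) -g2E in L2 m2 i2.
pose G1 t := cabs (g1 (expi t)); pose G2 t := cabs (g2 (expi t)).
pose e1 t := cabs (analytic_sum f n.+1 (expi t) - g1 (expi t)).
pose e2 t := cabs (coanalytic_sum f n (expi t) - g2 (expi t)).
pose H t := cabs (cos_sum d n t +i* sin_sum d n t).
have me1 : mean (fun t => e1 t `^ p) = 0 by exact: m1.
have me2 : mean (fun t => e2 t `^ p) = 0 by exact: m2.
have ie1 : integ (fun t => e1 t `^ p) by exact: i1.
have ie2 : integ (fun t => e2 t `^ p) by exact: i2.
have H0 t : 0 <= H t by exact: cabs_ge0.
(* The error [e1] between the partial sum and the chosen projection has p-mean 0, but need not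
   vanish at every point. *)
have b1 t : a * H t <= G1 t + (b + e1 t).
  have -> : a * H t = cabs (g1 (expi t) + (b%:C + (analytic_sum f n.+1 (expi t) - g1 (expi t)))).
    rewrite addrCA subrKC fE (analytic_test a b p1 ds d0)// -[X in X * _](cabs_real (ltW a0)) -cabsM; congr cabs.
    by apply/eqP; rewrite eq_complex /=; apply/andP; split; apply/eqP; ring.
  apply: (le_trans (cabs_le_add _ _)); rewrite lerD2l; apply: (le_trans (cabs_le_add _ _)).
  by rewrite (cabs_real (ltW b0)).
have b2 t : b * H t <= G2 t + (b + e2 t).
  have -> : b * H t = cabs (g2 (expi t) + ((- b)%:C + (coanalytic_sum f n (expi t) - g2 (expi t)))).
    rewrite addrCA subrKC fE (coanalytic_test a b p1 ds d0)// -[X in X * _](cabs_real (ltW b0)) -cabsM.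
    rewrite -[LHS]cabs_conj -[LHS]cabsN; congr cabs.
    by apply/eqP; rewrite eq_complex /=; apply/andP; split; apply/eqP; ring.
  apply: (le_trans (cabs_le_add _ _)); rewrite lerD2l; apply: (le_trans (cabs_le_add _ _)).
  by rewrite rmorphN cabsN (cabs_real (ltW b0)).
pose pm (x z : R) := (x `^ s + z `^ s) `^ (p / s).
have mG1 : measurable_fun setT G1 by case: L1 => ? ? _; exact: cabs_meas.
have mG2 : measurable_fun setT G2 by case: L2 => ? ? _; exact: cabs_meas.
have mpm : measurable_fun setT (fun t => pm (G1 t) (G2 t)).
  by apply: powR_meas; apply: measurable_funD; exact: powR_meas.
have ipm : integ (fun t => pm (G1 t) (G2 t)).
  apply: (@dominated_integ _ _ (fun t => (1 + eta) * 0 + K1 * (G1 t `^ p + G2 t `^ p))) => //.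
    apply: integ_add; first exact: integ_cst.
    by apply: integ_scale; apply: integ_add; [exact: (circle_abs_integ p1 L1)|exact: (circle_abs_integ p1 L2)].
  move=> t; rewrite powR_ge0 /=.
  have := S1 0 0 (G1 t) (G2 t) (lexx _) (lexx _) (cabs_ge0 _) (cabs_ge0 _).
  by rewrite !add0r powR0 ?gt_eqF// addr0 [0 `^ (p / s)]powR0 ?gt_eqF.
have iF := circle_abs_integ p1 fLp.
have up : mean (fun t => pm (G1 t) (G2 t)) <= C `^ p * mean (fun t => circle_abs f t `^ p).
  have E t : proj_mean p s f (expi t) `^ p = pm (G1 t) (G2 t).
    by rewrite /proj_mean -g1E -g2E -powRrM mulrC.
  have iP : integ (fun t => proj_mean p s f (expi t) `^ p) by under eq_fun do rewrite E.
  have := hC f fLp; rewrite circle_normE//; last by move=> t; exact: powR_ge0.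
  rewrite /Lp_norm circle_normE//; last by move=> t; exact: cabs_ge0.
  rewrite -EFinM lee_fin => h.
  have J0 : 0 <= mean (fun t => proj_mean p s f (expi t) `^ p) by apply: mean_ge0 => t; exact: powR_ge0.
  have I0 : 0 <= mean (fun t => circle_abs f t `^ p) by apply: mean_ge0 => t; exact: powR_ge0.
  have EE : (fun t => proj_mean p s f (expi t) `^ p) = (fun t => pm (G1 t) (G2 t)) by apply/funext.
  have := ge0_ler_powR (ltW p0) _ _ h; rewrite !nnegrE powR_ge0 mulr_ge0 ?powR_ge0// => /(_ isT isT).
  by rewrite (powR_invK p0 J0) (powRM _ C0 (powR_ge0 _ _)) (powR_invK p0 I0) EE.
have pE t : pm (a * H t) (b * H t) = (a `^ s + b `^ s) `^ (p / s) * H t `^ p.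
  rewrite /pm (powRM _ (ltW a0) (H0 t)) (powRM _ (ltW b0) (H0 t)) -mulrDl.
  by rewrite powRM ?addr_ge0 ?powR_ge0// -powRrM mulrCA mulfV ?gt_eqF// mulr1.
have mH : measurable_fun setT H.
  by apply: cabs_meas; apply: integ_meas; rewrite ?(cos_sum_phase, sin_sum_phase); exact: phase_sum_integ.
have iR : integ (fun t => (1 + eta) * pm (G1 t) (G2 t) +
    K1 * (((1 + 1) * e1 t `^ p + K2 * b `^ p) + ((1 + 1) * e2 t `^ p + K2 * b `^ p))).
  apply: integ_add; first exact: integ_scale.
  apply: integ_scale; apply: integ_add; (apply: integ_add; [exact: integ_scale|exact: integ_cst]).
have le t : 0 <= (a `^ s + b `^ s) `^ (p / s) * H t `^ p <= (1 + eta) * pm (G1 t) (G2 t) +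
    K1 * (((1 + 1) * e1 t `^ p + K2 * b `^ p) + ((1 + 1) * e2 t `^ p + K2 * b `^ p)).
  rewrite mulr_ge0 ?powR_ge0//= -pE.
  have be1 : 0 <= b + e1 t by rewrite addr_ge0 ?cabs_ge0// ltW.
  have be2 : 0 <= b + e2 t by rewrite addr_ge0 ?cabs_ge0// ltW.
  have S := S1 _ _ _ _ (cabs_ge0 (g1 (expi t))) (cabs_ge0 (g2 (expi t))) be1 be2.
  apply: (@le_trans _ _ (pm (G1 t + (b + e1 t)) (G2 t + (b + e2 t)))).
    apply: ge0_ler_powR; rewrite ?nnegrE ?addr_ge0 ?powR_ge0 ?(ltW ps0)//.
    apply: lerD; apply: ge0_ler_powR; rewrite ?nnegrE ?(ltW s0) ?addr_ge0 ?mulr_ge0 ?cabs_ge0 ?(ltW a0) ?(ltW b0)//.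
  apply: (le_trans S); rewrite lerD2l ler_wpM2l//.
  by apply: lerD; rewrite addrC; apply: S2; rewrite ?cabs_ge0 ?(ltW b0).
have iH : integ (fun t => (a `^ s + b `^ s) `^ (p / s) * H t `^ p).
  apply: (dominated_integ _ iR le); apply: measurable_funM; first exact: measurable_cst.
  exact: powR_meas.
have D0 : 0 < (a `^ s + b `^ s) `^ (p / s) by rewrite powR_gt0// addr_gt0 ?powR_gt0.
have iH' : integ (fun t => H t `^ p).
  have := integ_scale ((a `^ s + b `^ s) `^ (p / s))^-1 iH; congr integ; apply/funext => t.
  by rewrite mulrA mulVf ?gt_eqF// mul1r.
rewrite -[mean (fun t => cabs (_ +i* _) `^ p)]/(mean (fun t => H t `^ p)) -(mean_scale ((a `^ s + b `^ s) `^ (p / s)) iH').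
have i3 := integ_add (integ_scale (1 + 1) ie1) (integ_cst (K2 * b `^ p)).
have i4 := integ_add (integ_scale (1 + 1) ie2) (integ_cst (K2 * b `^ p)).
apply: (le_trans (mean_le iH iR _)); first by move=> t; have /andP[] := le t.
rewrite (mean_add (integ_scale (1 + eta) ipm) (integ_scale K1 (integ_add i3 i4))).
rewrite (mean_scale K1 (integ_add i3 i4)) (mean_add i3 i4).
rewrite (mean_add (integ_scale (1 + 1) ie1) (integ_cst (K2 * b `^ p))).
rewrite (mean_add (integ_scale (1 + 1) ie2) (integ_cst (K2 * b `^ p))).
rewrite (mean_scale (1 + 1) ie1) (mean_scale (1 + 1) ie2) me1 me2 mulr0 add0r mean_cst (mean_scale (1 + eta) ipm).
rewrite lerD2r; apply: ler_wpM2l; first by rewrite addr_ge0 ?(ltW eta0).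
by rewrite -fE; exact: up.
Qed.

Lemma sqn_ge t s : 0 <= s -> (1 - s) ^+ 2 <= sqn t s.
Proof.
move=> s0; rewrite -subr_ge0.
have -> : sqn t s - (1 - s) ^+ 2 = 2 * s * (1 + cos t) + s ^+ 2 * (cos t ^+ 2 + sin t ^+ 2 - 1) by rewrite /sqn; ring.
rewrite cos2Dsin2 subrr mulr0 addr0; have := cos_geN1 t => c1.
by rewrite !mulr_ge0//; lra.
Qed.

Lemma inv_sqrt_le (x z : R) : 0 < x -> x <= z -> z `^ (- 2^-1) <= x `^ (- 2^-1).
Proof.
move=> x0 xz; have z0 : 0 < z := lt_le_trans x0 xz.
rewrite !powRN lef_pV2 ?posrE ?powR_gt0//.
by apply: ge0_ler_powR; rewrite ?nnegrE ?invr_ge0 ?(ltW x0) ?(ltW z0).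
Qed.

Lemma sqn_integ rho : 0 < rho < 1 -> integ (fun t => sqn t rho `^ (- 2^-1)).
Proof.
move=> /andP[r0 r1]; have d2 : 0 < (1 - rho) ^+ 2 by rewrite exprn_gt0// subr_gt0.
apply: (@integ_bdd _ _ (((1 - rho) ^+ 2) `^ (- 2^-1))).
  apply: powR_meas; apply: continuous_measurable_fun => t; apply: isd_cont; rewrite /sqn; deriv.
move=> t; rewrite ger0_norm ?powR_ge0//; apply: inv_sqrt_le => //.
by apply: sqn_ge; exact: ltW.
Qed.

Lemma sqr_powR_half (x : R) : 0 <= x -> (x ^+ 2) `^ 2^-1 = x.
Proof. by move=> x0; rewrite -powR_mulrn// -powRrM mulfV// powRr1. Qed.

Lemma powR_half_sqr (x : R) : 0 <= x -> (x `^ 2^-1) ^+ 2 = x.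
Proof. by move=> x0; rewrite -powR_mulrn ?powR_ge0// -powRrM mulVf// powRr1. Qed.

(** The squared modulus of 1 + rho e^(it) is at most (1 - rho)^2 + (t - pi)^2. The inverse square
    root of the latter has an elementary primitive, whose increment over [0, 2 pi] is unbounded as
    rho tends to 1. *)
Lemma mean_unbounded (L : R) : exists2 rho, 0 < rho < 1 & L <= mean (fun t => sqn t rho `^ (- 2^-1)).
Proof.
have pp : 0 < pi :> R := pi_gt0 R.
(* With h = 1 - rho the mean will be at least ln ((pi + q) / h) / pi, where q is the square root of
   h^2 + pi^2, and this choice of h makes the logarithm at least pi |L|. *)
pose rho : R := 1 - (1 / 2) * expR (- (pi * `|L|)).
have e1 : expR (- (pi * `|L|)) <= 1 by rewrite -[leRHS]expR0 ler_expR oppr_le0 mulr_ge0// ltW.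
have e0 : 0 < expR (- (pi * `|L|)) := expR_gt0 _.
have rr : 0 < rho < 1 by rewrite /rho; apply/andP; split; lra.
exists rho => //.
have [h hE] : exists h, h = 1 - rho by eexists.
have h0 : 0 < h by rewrite hE /rho; lra.
have h2 : 0 < h ^+ 2 by rewrite exprn_gt0.
pose N t := h ^+ 2 + (t - pi) ^+ 2.
have N0 t : 0 < N t by rewrite ltr_pwDl// sqr_ge0.
have Nabs t : `|t - pi| < N t `^ 2^-1.
  rewrite -(@ltr_pXn2r _ 2)// ?nnegrE ?powR_ge0// powR_half_sqr ?(ltW (N0 t))// real_normK ?num_real//.
  by rewrite /N ltrDr.
pose G t := ln (t - pi + N t `^ 2^-1).
have Gp t : 0 < t - pi + N t `^ 2^-1.
  have := Nabs t; have := ler_norm (- (t - pi)); rewrite normrN => q1 q2; lra.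
have cN : continuous (fun t => N t `^ (- 2^-1)).
  by move=> t; apply: isd_cont; rewrite /N; deriv; exact: N0.
have bN t : `|N t `^ (- 2^-1)| <= h^-1.
  rewrite ger0_norm ?powR_ge0//; apply: (le_trans (inv_sqrt_le h2 _)).
    by rewrite /N lerDl sqr_ge0.
  by rewrite powRN sqr_powR_half ?(ltW h0).
have iN : integ (fun t => N t `^ (- 2^-1)) by apply: (integ_bdd _ bN); exact: continuous_measurable_fun.
have dG t : 0 <= t <= 2 * pi -> isd t G (N t `^ (- 2^-1)).
  move=> _; eapply isd_eq; first by rewrite /G /N; deriv; [exact: Gp|exact: N0].
  cbv beta; rewrite -/(N t).
  have -> : N t `^ (2^-1 - 1) = N t `^ (- 2^-1) by congr (_ `^ _); field.
  rewrite powRN; have := Gp t; have := powR_gt0 2^-1 (N0 t); move: (N t `^ 2^-1) (t - pi) => q w q0 gp.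
  by rewrite /= expr1; field; rewrite !gt_eqF.
apply: (@le_trans _ _ (mean (fun t => N t `^ (- 2^-1)))); last first.
  apply: mean_le => //; first exact: sqn_integ.
  move=> t; apply: inv_sqrt_le.
    apply: lt_le_trans (sqn_ge t (ltW _)); last by case/andP: rr.
    by rewrite -hE.
  rewrite /N; have -> : sqn t rho = h ^+ 2 + 2 * rho * (1 + cos t) + rho ^+ 2 * (cos t ^+ 2 + sin t ^+ 2 - 1).
    by rewrite /sqn hE; ring.
  rewrite cos2Dsin2 subrr mulr0 addr0 lerD2l.
  have cE : 1 + cos t = 2 * sin ((t - pi) / 2) ^+ 2.
    have := cosDD ((t - pi) / 2); rewrite -splitr cosB cospi sinpi mulr0 addr0 mulrN1 => cE; lra.
  have sle : sin ((t - pi) / 2) ^+ 2 <= ((t - pi) / 2) ^+ 2.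
    rewrite -real_normK ?num_real// -[leRHS]real_normK ?num_real// lerXn2r ?nnegrE//.
    have [tp|tp] := leP 0 ((t - pi) / 2).
      rewrite ler_norml [`|_|]ger0_norm// sin_le// andbT.
      have [u1|u1] := leP ((t - pi) / 2) pi.
        by apply: (@le_trans _ _ 0); rewrite ?oppr_le0// sin_ge0_pi// tp.
      by apply: le_trans (sin_geN1 _); rewrite lerN2; have := @pi_ge2 R; lra.
    have tn : 0 <= - ((t - pi) / 2) by rewrite oppr_ge0 ltW.
    rewrite -normrN -sinN -[leRHS]normrN; move: (- _) tn => x tn.
    rewrite ler_norml [`|_|]ger0_norm// sin_le// andbT.
    have [u1|u1] := leP x pi.
      by apply: (@le_trans _ _ 0); rewrite ?oppr_le0// sin_ge0_pi// tn.
    by apply: le_trans (sin_geN1 _); rewrite lerN2; have := @pi_ge2 R; lra.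
  have r1 : rho <= 1 by case/andP: rr => _ /ltW.
  have r0 : 0 <= rho by case/andP: rr => /ltW.
  rewrite cE; apply: (@le_trans _ _ (4 * sin ((t - pi) / 2) ^+ 2)).
    have := sqr_ge0 (sin ((t - pi) / 2)); move: (_ ^+ 2) => z z0.
    by rewrite (_ : 2 * rho * (2 * z) = rho * (4 * z)); [rewrite ler_piMl// mulr_ge0|ring].
  by apply: (le_trans (ler_wpM2l _ sle)) => //; rewrite le_eqVlt; apply/orP; left; apply/eqP; field.
rewrite /mean (arc_ftc cN bN dG) /G.
have -> : 2 * pi - pi = pi :> R by ring.
rewrite sub0r.
have NE : N 0 = N (2 * pi) by rewrite /N; ring.
rewrite NE; have [q qE] : exists q, q = N (2 * pi) `^ 2^-1 by eexists.
have qs : q ^+ 2 = h ^+ 2 + pi ^+ 2 by rewrite qE powR_half_sqr ?(ltW (N0 _))// /N; ring.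
have q1 : 0 < - pi + q by have := Gp 0; rewrite NE -qE sub0r.
rewrite -qE.
have q2 : 0 < pi + q by lra.
rewrite -ln_div ?posrE//.
have -> : (pi + q) / (- pi + q) = ((pi + q) / h) ^+ 2.
  have E : (- pi + q) * (pi + q) = h ^+ 2.
    by rewrite (_ : _ * _ = q ^+ 2 - pi ^+ 2); [rewrite qs; ring|ring].
  rewrite exprMn exprVn -E; move: q1 q2; move: (- pi + q) (pi + q) => A B A0 B0.
  by field; rewrite !gt_eqF.
have big : expR (pi * `|L|) <= (pi + q) / h.
  rewrite ler_pdivlMr// hE /rho -[X in _ <= X]mul1r.
  have -> : expR (pi * `|L|) * (1 - (1 - 1 / 2 * expR (- (pi * `|L|)))) = 1 / 2 * (expR (pi * `|L|) * expR (- (pi * `|L|))) by ring.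
  rewrite expRxMexpNx_1 mul1r mulr1; have := @pi_ge2 R; lra.
have big0 : 0 < (pi + q) / h by rewrite divr_gt0.
rewrite lnXn//.
have : pi * `|L| <= ln ((pi + q) / h).
  by rewrite -[leLHS]expRK ler_ln ?posrE ?expR_gt0.
move: (ln _) => z zL; rewrite mulrC ler_pdivlMr ?mulr_gt0// mulr2n.
have : pi * L <= pi * `|L| by rewrite ler_wpM2l ?ler_norm// ltW.
move: zL; rewrite (_ : L * (2 * pi) = pi * L + pi * L); last by ring.
by move=> h1 h3; apply: lerD; exact: le_trans h1.
Qed.

Lemma perturbed_modulus_ge (m psi e1 e2 dl : R) : 0 < m -> 4 * dl <= 1 -> `|e1| <= dl -> `|e2| <= dl ->
  (1 - 4 * dl) * m <= cabs ((m * (cos psi + e1)) +i* (m * (e2 - sin psi))).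
Proof.
move=> m0 dl4 b1 b2.
have dl0 : 0 <= dl by apply: le_trans b1.
have r0 : 0 <= 1 - 4 * dl by rewrite subr_ge0.
have r1 : 1 - 4 * dl <= 1 by rewrite gerBl mulr_ge0.
rewrite -(@ler_pXn2r _ 2)// ?nnegrE ?cabs_ge0 ?(mulr_ge0 r0 (ltW m0))// cabs_sqr /=.
rewrite !exprMn -mulrDr [leLHS]mulrC; apply: ler_wpM2l; first exact: sqr_ge0.
apply: (@le_trans _ _ (1 - 4 * dl)); first by rewrite expr2; exact: ler_piMr.
have -> : (cos psi + e1) ^+ 2 + (e2 - sin psi) ^+ 2 =
  (cos psi ^+ 2 + sin psi ^+ 2) + 2 * (cos psi * e1) - 2 * (sin psi * e2) + (e1 ^+ 2 + e2 ^+ 2) by ring.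
rewrite cos2Dsin2.
have t1 : `|cos psi * e1| <= dl by rewrite normrM -[leRHS]mul1r; apply: ler_pM => //; exact: cos_max.
have t2 : `|sin psi * e2| <= dl by rewrite normrM -[leRHS]mul1r; apply: ler_pM => //; exact: sin_max.
have t3 : 0 <= e1 ^+ 2 + e2 ^+ 2 by rewrite addr_ge0// sqr_ge0.
move: t1 t2; rewrite !ler_norml => /andP[t1 _] /andP[_ t2].
by move: (cos psi * e1) (sin psi * e2) (e1 ^+ 2 + _) t1 t2 t3; clear; move=> u v w; lra.
Qed.

Lemma perturbed_modulus_le (m psi e1 e2 dl a b k X : R) : 0 < m -> 4 * dl <= 1 -> `|e1| <= dl -> `|e2| <= dl ->
  a * b = 1 -> k <= cos (2 * psi) -> a ^+ 2 + b ^+ 2 - 2 * k + 6 * dl * (a ^+ 2 + b ^+ 2) <= X ->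
  cabs (((a - b) * (m * (cos psi + e1))) +i* ((a + b) * (m * (e2 - sin psi)))) <= Num.sqrt X * m.
Proof.
move=> m0 dl4 b1 b2 ab kl XE.
have dl0 : 0 <= dl by apply: le_trans b1.
have sq (c e : R) : `|c| <= 1 -> `|e| <= dl -> (c + e) ^+ 2 <= c ^+ 2 + 3 * dl.
  move=> hc he; have t1 : `|c * e| <= dl by rewrite normrM -[leRHS]mul1r; apply: ler_pM.
  have t2 : `|e| ^+ 2 <= dl.
    rewrite expr2; apply: (@le_trans _ _ (1 * dl)); last by rewrite mul1r.
    by apply: ler_pM => //; apply: le_trans he _; move: dl4 dl0; clear; lra.
  rewrite real_normK ?num_real// in t2; move: t1; rewrite ler_norml => /andP[_ t1].
  have -> : (c + e) ^+ 2 = c ^+ 2 + 2 * (c * e) + e ^+ 2 by ring.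
  by move: (c * e) (e ^+ 2) (c ^+ 2) t1 t2; clear; move=> u v w; lra.
have h1 : (cos psi + e1) ^+ 2 <= cos psi ^+ 2 + 3 * dl by apply: sq => //; exact: cos_max.
have h2 : (e2 - sin psi) ^+ 2 <= sin psi ^+ 2 + 3 * dl.
  by rewrite -[sin psi ^+ 2]sqrrN addrC; apply: sq => //; rewrite normrN; exact: sin_max.
have main : (a - b) ^+ 2 * (cos psi + e1) ^+ 2 + (a + b) ^+ 2 * (e2 - sin psi) ^+ 2 <= X.
  apply: (le_trans (lerD (ler_wpM2l (sqr_ge0 (a - b)) h1) (ler_wpM2l (sqr_ge0 (a + b)) h2))).
  have -> : (a - b) ^+ 2 * (cos psi ^+ 2 + 3 * dl) + (a + b) ^+ 2 * (sin psi ^+ 2 + 3 * dl) =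
    (a ^+ 2 + b ^+ 2) * (cos psi ^+ 2 + sin psi ^+ 2) - 2 * (a * b) * (cos psi ^+ 2 - sin psi ^+ 2) + 6 * dl * (a ^+ 2 + b ^+ 2) by ring.
  rewrite cos2Dsin2 ab !mulr1; apply: le_trans XE; rewrite lerD2r lerD2l lerN2 ler_wpM2l//.
  by move: kl; rewrite mulr_natl mulr2n cosD -!expr2.
have X0 : 0 <= X by apply: le_trans main; rewrite addr_ge0// mulr_ge0// sqr_ge0.
rewrite -(@ler_pXn2r _ 2)// ?nnegrE ?cabs_ge0 ?(mulr_ge0 (sqrtr_ge0 _) (ltW m0))// cabs_sqr /=.
rewrite [leRHS]exprMn (sqr_sqrtr X0).
have -> : ((a - b) * (m * (cos psi + e1))) ^+ 2 + ((a + b) * (m * (e2 - sin psi))) ^+ 2 =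
   ((a - b) ^+ 2 * (cos psi + e1) ^+ 2 + (a + b) ^+ 2 * (e2 - sin psi) ^+ 2) * m ^+ 2 by ring.
by apply: ler_wpM2r; first exact: sqr_ge0.
Qed.

Lemma cos_double_ge p psi : 2 <= p -> `|psi| <= p^-1 * (pi / 2) -> cos (pi / p) <= cos (2 * psi).
Proof.
move=> p2 bpsi; have p0 : 0 < p by apply: lt_le_trans p2.
have -> : cos (2 * psi) = cos (2 * `|psi|) :> R.
  by have [//|_] := ger0P psi; rewrite mulrN cosN.
apply: cos_anti; first by rewrite mulr_ge0.
  apply: (le_trans (ler_wpM2l _ bpsi)) => //.
  by rewrite le_eqVlt; apply/orP; left; apply/eqP; move: (pi : R) => P; field; exact: lt0r_neq0.
by rewrite ler_piMr ?pi_ge0// invf_le1// (le_trans _ p2)// ler1n.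
Qed.

(** All terms of [test_lower] except [K] are compared with multiples of the mean J of the inverse
    modulus of 1 + rho e^(it). As J >= K / eta, division by J leaves an error of at most eta. *)
Lemma mean_pow_ratio p s C k y eta : 2 <= p -> 0 < s -> 0 <= C -> bounded_by p s C ->
  k = cos (pi / p) -> k < cosh y -> 0 < eta ->
  (expR (y / 2) `^ s + expR (- (y / 2)) `^ s) `^ (p / s) * ((1 + eta)^-1) `^ p <=
  (1 + eta) * (C `^ p * ((1 + eta) * (2 * (cosh y - k))) `^ (p / 2)) + eta.
Proof.
move=> p2 s0 C0 hC kE ky eta0.
have p1 : 1 < p by apply: lt_le_trans p2; rewrite ltr1n.
have p0 : 0 < p := lt_trans ltr01 p1.
have e10 : 0 < 1 + eta by rewrite addr_gt0.
have e1i : 0 <= (1 + eta)^-1 by rewrite invr_ge0 ltW.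
have [a aE] : exists a, a = expR (y / 2) by eexists.
have [b bE] : exists b, b = expR (- (y / 2)) by eexists.
rewrite -aE -bE.
have a0 : 0 < a by rewrite aE expR_gt0.
have b0 : 0 < b by rewrite bE expR_gt0.
have ab : a * b = 1 by rewrite aE bE expRxMexpNx_1.
have ch : a ^+ 2 + b ^+ 2 = 2 * cosh y.
  rewrite aE bE -!expRM_natl coshE -[in RHS](_ : 2 * (y / 2) = y); last by field.
  by rewrite mulrN; field.
have [K HK] := test_lower p1 s0 a0 b0 eta0.
have c1 : 0 < cosh y := cosh_gt0 y.
have [X XE] : exists X, X = 2 * (cosh y - k) by eexists.
have X0 : 0 < X by rewrite XE mulr_gt0// subr_gt0.
rewrite -XE.
(* As a^2 + b^2 = 2 cosh y, the first smallness condition gives the factor 1 + eta in the upper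
   estimate of the modulus; the second gives 1 / (1 + eta) <= 1 - 4 dl in the lower one. *)
have [dl [dl0 dl1 dl2]] : exists dl, [/\ 0 < dl, 12 * cosh y * dl <= eta * X & dl * (4 * (1 + eta)) <= eta].
  have c12 : 0 < 12 * cosh y by rewrite mulr_gt0 ?ltr0n.
  have e14 : 0 < 4 * (1 + eta) by rewrite mulr_gt0 ?ltr0n.
  have q1 : 0 < eta * X / (12 * cosh y) by apply: divr_gt0 => //; exact: mulr_gt0.
  have q2 : 0 < eta / (4 * (1 + eta)) by rewrite divr_gt0.
  exists (Num.min (eta * X / (12 * cosh y)) (eta / (4 * (1 + eta)))); split.
  - by rewrite lt_min q1 q2.
  - by rewrite mulrC -ler_pdivlMr// ge_min lexx.
  - by rewrite -ler_pdivlMr// ge_min lexx orbT.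
have dl4 : 4 * dl <= 1.
  have : dl * 4 * (1 + eta) <= 1 * (1 + eta) by rewrite -mulrA mul1r (le_trans dl2)// lerDr.
  by rewrite ler_pM2r// mulrC.
have dlr : (1 + eta)^-1 <= 1 - 4 * dl.
  rewrite -[leLHS]mul1r ler_pdivrMr//.
  by have := dl2; move: dl4 dl0; clear; lra.
have dlX : a ^+ 2 + b ^+ 2 - 2 * k + 6 * dl * (a ^+ 2 + b ^+ 2) <= (1 + eta) * X.
  rewrite ch [(1 + eta) * X]mulrDl mul1r; apply: lerD; first by rewrite XE mulrBr.
  by move: dl1; move: (cosh y) => c; clear; lra.
have [rho rr J1] := mean_unbounded (`|K| / eta + 1).
have al1 : 0 < p^-1 <= 1 by rewrite invr_gt0 p0 invf_le1// ltW.
have [n Hn] := extremal_poly al1 rr dl0.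
(* The coefficients are cut off beyond n, as the test function requires; the sums up to n are
   unchanged. *)
have [d dE] : exists d : nat -> R, d = fun i => if (i < n.+1)%N then extremal_coef p^-1 rho i else 0 by eexists.
have ds i : (n < i)%N -> d i = 0 by rewrite dE ltnS [(i <= n)%N]leqNgt => ->.
have d0 : d 0%N = 1 by rewrite dE /= /extremal_coef expr0 mulr1.
have cE t : cos_sum d n t = cos_sum (extremal_coef p^-1 rho) n t.
  by apply: eq_big_nat => i /andP[_ ni]; rewrite dE ni.
have sE t : sin_sum d n t = sin_sum (extremal_coef p^-1 rho) n t.
  by apply: eq_big_nat => i /andP[_ ni]; rewrite dE ni.
have key := HK C d n C0 ds d0 hC.
have rr01 : 0 <= rho < 1 by case/andP: rr => /ltW -> ->.
(* The modulus of (1 + rho e^(it))^(-1/p), the size of h; its p-th power is the function whose mean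
   is unbounded. *)
have [M MdE] : exists M : R -> R, M = fun t => sqn t rho `^ (- (p^-1 / 2)) by eexists.
have M0 t : 0 < M t by rewrite MdE powR_gt0// sqn_gt0.
have Mp t : M t `^ p = sqn t rho `^ (- 2^-1).
  rewrite MdE -powRrM; congr (_ `^ _); field; exact: lt0r_neq0.
have iM : integ (fun t => M t `^ p) by under eq_fun do rewrite Mp; exact: sqn_integ.
have JE : mean (fun t => M t `^ p) = mean (fun t => sqn t rho `^ (- 2^-1)) by congr mean; apply/funext.
have lowH t : (1 + eta)^-1 * M t <= cabs (cos_sum d n t +i* sin_sum d n t).
  have [psi [e1 [e2 [_ b1 b2 c2 s2]]]] := Hn t.
  have ME : sqn t rho `^ (- (p^-1 / 2)) = M t by rewrite MdE.
  rewrite cE sE c2 s2 ME; apply: le_trans (perturbed_modulus_ge psi (M0 t) dl4 b1 b2).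
  by rewrite ler_pM2r.
have upF t : cabs (test_function a b d n (expi t)) <= Num.sqrt ((1 + eta) * X) * M t.
  have [psi [e1 [e2 [bpsi b1 b2 c2 s2]]]] := Hn t.
  have ME : sqn t rho `^ (- (p^-1 / 2)) = M t by rewrite MdE.
  rewrite test_functionE cE sE c2 s2 ME.
  have kl := cos_double_ge p2 bpsi; rewrite -kE in kl.
  exact: (perturbed_modulus_le (M0 t) dl4 b1 b2 ab kl dlX).
have iH : integ (fun t => cabs (cos_sum d n t +i* sin_sum d n t) `^ p).
  have := circle_abs_integ p1 (test_function_Lp 1 0 d n p1); congr integ; apply/funext => t.
  by rewrite /circle_abs test_functionE subr0 addr0 !mul1r.
have iF := circle_abs_integ p1 (test_function_Lp a b d n p1).
have D0 : 0 <= (a `^ s + b `^ s) `^ (p / s) by exact: powR_ge0.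
have L1 : ((1 + eta)^-1) `^ p * mean (fun t => M t `^ p) <= mean (fun t => cabs (cos_sum d n t +i* sin_sum d n t) `^ p).
  rewrite -(mean_scale (((1 + eta)^-1) `^ p) iM); apply: (mean_le (integ_scale _ iM) iH) => t.
  rewrite -(powRM _ e1i (ltW (M0 t))).
  apply: (ge0_ler_powR (ltW p0) _ _ (lowH t)); rewrite nnegrE; last exact: cabs_ge0.
  by apply: mulr_ge0 => //; exact: ltW.
have U1 : mean (fun t => circle_abs (test_function a b d n) t `^ p) <= ((1 + eta) * X) `^ (p / 2) * mean (fun t => M t `^ p).
  rewrite -(mean_scale (((1 + eta) * X) `^ (p / 2)) iM); apply: (mean_le iF (integ_scale _ iM)) => t.
  have -> : ((1 + eta) * X) `^ (p / 2) = Num.sqrt ((1 + eta) * X) `^ p.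
    by rewrite -powR12_sqrt ?(mulr_ge0 (ltW e10) (ltW X0))// -powRrM (mulrC 2^-1).
  rewrite -(powRM _ (sqrtr_ge0 _) (ltW (M0 t))).
  apply: (ge0_ler_powR (ltW p0) _ _ (upF t)); rewrite nnegrE; first exact: cabs_ge0.
  by apply: mulr_ge0; [exact: sqrtr_ge0|exact: ltW].
rewrite -JE in J1; move: J1 L1 U1; move: (mean (fun t => M t `^ p)) => J J1 L1 U1.
have J0 : 0 < J by apply: lt_le_trans J1; rewrite ltr_wpDl// divr_ge0// ltW.
have KJ : K <= eta * J.
  apply: (le_trans (ler_norm _)); rewrite mulrC -ler_pdivrMr//.
  by apply: le_trans J1; rewrite lerDl.
rewrite -(ler_pM2r J0) -mulrA mulrDl -!mulrA.
apply: (le_trans (ler_wpM2l D0 L1)); apply: (le_trans key); apply: lerD => //.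
apply: ler_wpM2l; first exact: ltW.
by apply: ler_wpM2l U1; exact: powR_ge0.
Qed.

Lemma test_limit p s C y : 2 <= p -> 0 < s -> 0 <= C -> 0 <= y -> bounded_by p s C ->
  (2 * cosh (s * y / 2)) `^ s^-1 <= C * Num.sqrt (2 * (cosh y - cos (pi / p))).
Proof.
move=> p2 s0 C0 y0 hC.
have p1 : 1 < p by apply: lt_le_trans p2; rewrite ltr1n.
have p0 : 0 < p := lt_trans ltr01 p1.
have k1 : cos (pi / p) < 1.
  rewrite -[ltRHS]cos0 ltr_cos ?in_itv/= ?lexx ?divr_ge0 ?pi_ge0 ?(ltW p0)//.
    by rewrite divr_gt0 ?pi_gt0.
  by rewrite ler_piMr ?pi_ge0// invf_le1// ltW.
have ky : cos (pi / p) < cosh y by apply: (lt_le_trans k1); exact: cosh_ge1.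
have X0 : 0 < 2 * (cosh y - cos (pi / p)) by rewrite mulr_gt0// subr_gt0.
have key eta : 0 < eta -> _ := fun e0 => mean_pow_ratio p2 s0 C0 hC erefl ky e0.
have DE : expR (y / 2) `^ s + expR (- (y / 2)) `^ s = 2 * cosh (s * y / 2).
  rewrite coshE -!expRM; rewrite (_ : y / 2 * s = s * y / 2); last by ring.
  rewrite (_ : - (y / 2) * s = - (s * y / 2)); last by ring.
  by field.
have c0 : 0 <= 2 * cosh (s * y / 2) by rewrite mulr_ge0// ltW// cosh_gt0.
apply: (powR_le_inv p0); rewrite ?mulr_ge0 ?sqrtr_ge0 ?powR_ge0//.
rewrite -powRrM (mulrC s^-1) (powRM _ C0 (sqrtr_ge0 _)).
have -> : Num.sqrt (2 * (cosh y - cos (pi / p))) `^ p = (2 * (cosh y - cos (pi / p))) `^ (p / 2).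
  by rewrite -powR12_sqrt ?(ltW X0)// -powRrM (mulrC 2^-1).
rewrite DE in key; move: key; move: ((2 * cosh _) `^ (p / s)) (2 * (cosh y - cos (pi / p))) X0 => D X X0 key.
have [B BE] : exists B, B = C `^ p * X `^ (p / 2) by eexists.
have B0 : 0 <= B by rewrite BE mulr_ge0 ?powR_ge0.
rewrite -BE.
(* Total power of 1 + eta in [mean_pow_ratio]: p from the lower estimate, p / 2 from the upper one,
   and 1 from the splitting. *)
pose e := p + (1 + p / 2).
have e0 : 0 < e by rewrite /e addr_gt0// addr_gt0// divr_gt0.
have step eps : 0 < eps -> D <= (1 + eps) * (B + eps).
  move=> eps0; have ep1 : 0 <= 1 + eps by rewrite addr_ge0// ltW.
  have [eta [eta0 eta1 eta2]] : exists eta, [/\ 0 < eta, eta <= eps & (1 + eta) `^ e <= 1 + eps].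
    have r1 : 1 < (1 + eps) `^ e^-1.
      rewrite -[ltLHS](_ : 1 `^ e^-1 = 1); last by rewrite powR1.
      by apply: gt0_ltr_powR; rewrite ?invr_gt0 ?nnegrE// ltrDl.
    exists (Num.min ((1 + eps) `^ e^-1 - 1) eps); split.
    - by rewrite lt_min subr_gt0 r1.
    - by rewrite ge_min lexx orbT.
    rewrite -[leRHS](powR_invK e0 ep1); apply: ge0_ler_powR; rewrite ?nnegrE ?powR_ge0 ?(ltW e0)//.
      by rewrite addr_ge0// le_min subr_ge0 (ltW r1) ltW.
    by rewrite -lerBrDl ge_min lexx.
  have e1 : 0 < 1 + eta by rewrite addr_gt0.
  have := key eta eta0.
  have -> : (1 + eta)^-1 `^ p = ((1 + eta) `^ p)^-1 by rewrite -[(1 + eta)^-1]powR_inv1 ?(ltW e1)// -powRrM mulN1r powRN.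
  rewrite ler_pdivrMr ?powR_gt0// => h; apply: (le_trans h).
  rewrite powRM ?(ltW e1) ?(ltW X0)//.
  have -> : (1 + eta) * (C `^ p * ((1 + eta) `^ (p / 2) * X `^ (p / 2))) = (1 + eta) * (1 + eta) `^ (p / 2) * B by rewrite BE; ring.
  rewrite powR_mul1// [leLHS]mulrC.
  have m1 : 1 <= (1 + eta) `^ (1 + p / 2).
    rewrite -[leLHS](_ : (1 + eta) `^ 0 = 1); last by rewrite powRr0.
    by rewrite ler_powR ?lerDl ?(ltW eta0)// addr_ge0// divr_ge0// ltW.
  apply: (@le_trans _ _ ((1 + eta) `^ p * ((1 + eta) `^ (1 + p / 2) * (B + eps)))).
    rewrite ler_wpM2l ?powR_ge0// mulrDr lerD2l.
    apply: (le_trans eta1); rewrite ler_peMl// ltW//.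
  rewrite mulrA -powRD; last by rewrite (gt_eqF e1) implybT.
  by rewrite ler_wpM2r// addr_ge0// ltW.
apply/ler_addgt0Pr => eps eps0.
have d0 : 0 < Num.min 1 (eps / (B + 2 + 1)).
  by rewrite lt_min ltr01 divr_gt0// ltr_wpDl// addr_ge0.
apply: (le_trans (step _ d0)).
have m1 : Num.min 1 (eps / (B + 2 + 1)) <= 1 by rewrite ge_min lexx.
have m2 : Num.min 1 (eps / (B + 2 + 1)) * (B + 2 + 1) <= eps.
  by rewrite -ler_pdivlMr ?ge_min ?lexx ?orbT// ltr_wpDl// addr_ge0.
move: (Num.min _ _) d0 m1 m2 => u u0 u1 u2.
have uu : u * u <= u by rewrite ler_piMl// ltW.
rewrite mulrDl mul1r mulrDr.
have E3 : u * (B + 2 + 1) = u * B + 3 * u by ring.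
by rewrite E3 in u2; move: uu u2 u0; move: (u * u) (u * B) => v w; clear; lra.
Qed.

End LowerBound.

(** * The constants *)

Section Main.
Variable R : realType.
Implicit Types (p s C : R).

Lemma cos_pi_lt1 p : 2 <= p -> 0 <= cos (pi / p) < 1.
Proof.
move=> p2; have p0 : 0 < p by apply: lt_le_trans p2.
apply/andP; split.
  apply: cos_ge0_pihalf; apply/andP; split.
    by rewrite (@le_trans _ _ 0)// ?oppr_le0 divr_ge0 ?pi_ge0// ltW.
  by rewrite ler_wpM2l ?pi_ge0// lef_pV2 ?posrE.
rewrite -[ltRHS]cos0 ltr_cos ?in_itv/= ?lexx ?divr_ge0 ?pi_ge0 ?(ltW p0)//.
  by rewrite divr_gt0 ?pi_gt0.
by rewrite ler_piMr ?pi_ge0// invf_le1// (le_trans _ p2)// ler1n.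
Qed.

Lemma pi_2p p : 0 < p -> pi / (2 * (p / 2)) = pi / p.
Proof. by move=> p0; congr (_ / _); field. Qed.

Lemma obtuse_upper p s B : 2 <= p -> 0 < s -> 0 < B ->
  (s / 2 <= (1 - cos (pi / p))^-1 /\ B = (1 - cos (pi / p))^-1) \/
  (forall y, 0 <= y -> cosh (s / 2 * y) `^ (s / 2)^-1 / (cosh y - cos (pi / p)) <= B) ->
  bounded_by p s (2 `^ (s^-1 - 2^-1) * Num.sqrt B).
Proof.
move=> p2 s0 B0 HB f fLp.
have p0 : 0 < p by apply: lt_le_trans p2.
have p1 : 1 < p by apply: lt_le_trans p2; rewrite ltr1n.
have q1 : 1 <= p / 2 by rewrite ler_pdivlMr// mul1r.
have q0 : 0 < p / 2 by rewrite divr_gt0.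
have s2 : 0 < s / 2 by rewrite divr_gt0.
have maj : pointwise_majorant (p / 2) (s / 2) B (phi_obtuse (p / 2)).
  by apply: majorant_obtuse; rewrite // pi_2p.
have t1p : 0 <= pi - pi / p <= pi.
  rewrite subr_ge0 ler_piMr ?pi_ge0 ?invf_le1 ?(ltW p1)//=.
  by rewrite gerBl divr_ge0 ?pi_ge0// ltW.
have phi0 : phi_obtuse (p / 2) (pi - pi / p) = 0.
  rewrite /phi_obtuse opprB addrCA subrr addr0 minElt.
  rewrite ifT; last by rewrite ltr_pM2l ?pi_gt0// ltf_pV2 ?posrE// ltr_pdivrMr// ltr_pMr// ltr1n.
  by rewrite (_ : p / 2 * (pi / p) = pi / 2) ?cos_pihalf ?oppr0//; move: (pi : R) => P; field; exact: lt0r_neq0.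
have [C C0 H] := majorant_complex p0 s0 B0 t1p phi0 maj.
apply: (projection_upper_bound p1 s0 _ C0 (trig_convex_obtuse q1) (@phi_obtuse_cont R (p / 2)) H fLp).
by rewrite mulr_ge0 ?powR_ge0 ?sqrtr_ge0.
Qed.

Lemma acute_upper p s : 1 < p -> p <= 4 / 3 -> 0 < s -> s / 2 <= (1 + cos (pi / p))^-1 ->
  bounded_by p s (2 `^ (s^-1 - 2^-1) * Num.sqrt (1 + cos (pi / p))^-1).
Proof.
move=> p1 p43 s0 sS f fLp; have p0 : 0 < p := lt_trans ltr01 p1.
have q12 : 1 / 2 < p / 2 by rewrite ltr_pM2r// invr_gt0.
have q23 : p / 2 <= 2 / 3 by move: p43; clear; lra.
have q0 : 0 < p / 2 by rewrite divr_gt0.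
have q1 : p / 2 <= 1 by apply: (le_trans q23); clear; lra.
have pip : 0 < pi / p < pi.
  by rewrite divr_gt0 ?pi_gt0//= gtr_pMr ?pi_gt0// invf_lt1.
have B0 : 0 < (1 + cos (pi / p))^-1 by rewrite invr_gt0; exact: cos_gtN1.
have maj : pointwise_majorant (p / 2) (s / 2) (1 + cos (pi / p))^-1 (fun t => cos (p / 2 * t)).
  by rewrite -(pi_2p p0); apply: majorant_acute; rewrite ?divr_gt0// pi_2p.
have t1p : 0 <= pi / p <= pi by case/andP: pip => /ltW -> /ltW ->.
have phi0 : cos (p / 2 * (pi / p)) = 0.
  by rewrite (_ : p / 2 * (pi / p) = pi / 2) ?cos_pihalf//; move: (pi : R) => P; field; exact: lt0r_neq0.
have [C C0 H] := majorant_complex p0 s0 B0 t1p phi0 maj.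
have pc : continuous (fun t : R => cos (p / 2 * t)) by move=> t; apply: isd_cont; deriv.
apply: (projection_upper_bound p1 s0 _ C0 (trig_convex_acute q0 q1) pc H fLp).
by rewrite mulr_ge0 ?powR_ge0 ?sqrtr_ge0.
Qed.

Lemma pow2_split s : 2 `^ (s^-1 - 2^-1) = 2 `^ s^-1 / Num.sqrt 2 :> R.
Proof. by rewrite powRD ?powRN ?powR12_sqrt// pnatr_eq0 implybT. Qed.

(** With x the sine or the cosine of pi / (2 p), the half-angle formulas give 1 - cos (pi / p) or 1
    + cos (pi / p) as 2 x^2; this turns the general form of the constant into the explicit ones. *)
Lemma const_half s (x : R) : 0 < x -> 2 `^ (s^-1 - 2^-1) * Num.sqrt (2 * x ^+ 2)^-1 = 2 `^ s^-1 / (2 * x).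
Proof.
move=> x0; have h : 0 <= 2 * x ^+ 2 by rewrite mulr_ge0 ?sqr_ge0.
have -> : Num.sqrt (2 * x ^+ 2)^-1 = (Num.sqrt 2 * x)^-1.
  by rewrite sqrtrV// sqrtrM ?ler0n// sqrtr_sqr gtr0_norm.
rewrite pow2_split.
have r2 : 0 < Num.sqrt (2 : R) by rewrite sqrtr_gt0.
have -> : 2 * x = Num.sqrt 2 * (Num.sqrt 2 * x) by rewrite mulrA -expr2 sqr_sqrtr.
by move: (_ `^ _) (Num.sqrt 2) r2 => A r r2; field; rewrite !gt_eqF.
Qed.

Let ratio p s (y : R) := cosh (s * y / 2) `^ s^-1 / Num.sqrt (cosh y - cos (pi / p)).
Let ratios p s := [set ratio p s y | y in [set y : R | 0 <= y]].

Lemma ratio_gt0 p s y : 2 <= p -> 0 < ratio p s y.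
Proof.
move=> p2; have /andP[_ k1] := cos_pi_lt1 p2.
rewrite divr_gt0 ?powR_gt0 ?cosh_gt0// sqrtr_gt0 subr_gt0 (lt_le_trans k1)//; exact: cosh_ge1.
Qed.

(** Ensures that the [sup] in [best_const] is a genuine supremum. The numerator is at most e^(y/2),
    and cosh y - cos (pi / p) is at least e^y times (1 - cos (pi / p)) / 2. *)
Lemma ratios_bounded p s : 2 <= p -> 0 < s -> has_sup (ratios p s).
Proof.
move=> p2 s0; have /andP[k0 k1] := cos_pi_lt1 p2.
split; first by exists (ratio p s 0), 0; rewrite //= lexx.
have r0 : 0 < Num.sqrt ((1 - cos (pi / p)) / 2) by rewrite sqrtr_gt0 divr_gt0// subr_gt0.
exists (Num.sqrt ((1 - cos (pi / p)) / 2))^-1 => _ [y /= y0 <-].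
have c1 : cosh (s * y / 2) `^ s^-1 <= expR (y / 2).
  have E : cosh (s * y / 2) <= expR (s * y / 2).
    have : expR (- (s * y / 2)) <= expR (s * y / 2).
      have h0 : 0 <= s * y / 2 by rewrite !mulr_ge0// ltW.
      by rewrite ler_expR; move: h0; move: (s * y / 2); clear; move=> u; lra.
    by rewrite coshE; lra.
  apply: (@le_trans _ _ (expR (s * y / 2) `^ s^-1)).
    by apply: ge0_ler_powR; rewrite ?nnegrE ?invr_ge0 ?expR_ge0 ?(ltW s0) ?(ltW (cosh_gt0 _)).
  by rewrite -expRM ler_expR le_eqVlt; apply/orP; left; apply/eqP; field; exact: lt0r_neq0.
have c2 : (1 - cos (pi / p)) / 2 * expR y <= cosh y - cos (pi / p).
  have h1 : cos (pi / p) <= cos (pi / p) * cosh y by rewrite ler_peMr// cosh_ge1.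
  have h2 : expR y / 2 <= cosh y by rewrite coshE; have := expR_ge0 (- y); lra.
  have h3 : (1 - cos (pi / p)) * (expR y / 2) <= (1 - cos (pi / p)) * cosh y.
    by rewrite ler_wpM2l// subr_ge0 ltW.
  rewrite mulrAC -mulrA; apply: (le_trans h3).
  by rewrite mulrBl mul1r lerB.
have c3 : Num.sqrt ((1 - cos (pi / p)) / 2) * expR (y / 2) <= Num.sqrt (cosh y - cos (pi / p)).
  have -> : expR (y / 2) = Num.sqrt (expR y).
    by rewrite [in RHS](splitr y) expRD -expr2 sqrtr_sqr ger0_norm ?expR_ge0.
  rewrite -sqrtrM ?divr_ge0 ?subr_ge0 ?(ltW k1)//.
  by rewrite ler_sqrt// subr_ge0 (le_trans (ltW k1))// cosh_ge1.
have d0 : 0 < Num.sqrt (cosh y - cos (pi / p)).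
  by apply: lt_le_trans c3; rewrite mulr_gt0 ?expR_gt0.
rewrite /ratio ler_pdivrMr//; apply: (le_trans c1).
by rewrite ler_pdivlMl.
Qed.

Lemma ratio_le_sup p s y : 2 <= p -> 0 < s -> 0 <= y -> ratio p s y <= sup (ratios p s).
Proof. by move=> p2 s0 y0; apply: (ub_le_sup (ratios_bounded p2 s0).2); exists y. Qed.

Lemma sup_ratios_gt0 p s : 2 <= p -> 0 < s -> 0 < sup (ratios p s).
Proof. by move=> p2 s0; apply: (lt_le_trans (@ratio_gt0 p s 0 p2)); exact: ratio_le_sup. Qed.

Lemma best_upper p s : 2 <= p -> 0 < s -> bounded_by p s (best_const p s).
Proof.
move=> p2 s0; have S0 := sup_ratios_gt0 p2 s0.
rewrite /best_const -/(ratios p s).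
have -> : sup (ratios p s) = Num.sqrt (sup (ratios p s) ^+ 2) by rewrite sqrtr_sqr gtr0_norm.
apply: obtuse_upper => //; first by rewrite exprn_gt0.
right => y y0.
have le := ratio_le_sup p2 s0 y0.
have -> : cosh (s / 2 * y) `^ (s / 2)^-1 / (cosh y - cos (pi / p)) = ratio p s y ^+ 2.
  have /andP[_ k1] := cos_pi_lt1 p2.
  rewrite /ratio exprMn exprVn sqr_sqrtr; last by rewrite subr_ge0 (le_trans (ltW k1))// cosh_ge1.
  rewrite -(powR_mulrn 2 (powR_ge0 _ _)) -powRrM (_ : s / 2 * y = s * y / 2); last by ring.
  by congr (_ `^ _ / _); field; exact: lt0r_neq0.
by rewrite ler_pXn2r ?nnegrE ?(ltW S0)// ltW// ratio_gt0.
Qed.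

Lemma best_lower p s C : 2 <= p -> 0 < s -> bounded_by p s C -> best_const p s <= C.
Proof.
move=> p2 s0 hC; have S0 := sup_ratios_gt0 p2 s0.
have w0 : 0 < 2 `^ (s^-1 - 2^-1) :> R by rewrite powR_gt0.
have main C' : 0 <= C' -> bounded_by p s C' -> best_const p s <= C'.
  move=> C0 h; rewrite /best_const mulrC -ler_pdivlMr//.
  apply: ge_sup; first by have [] := ratios_bounded p2 s0.
  move=> _ [y /= y0 <-].
  have /andP[_ k1] := cos_pi_lt1 p2.
  have d0 : 0 < cosh y - cos (pi / p) by rewrite subr_gt0 (lt_le_trans k1)// cosh_ge1.
  have := test_limit p2 s0 C0 y0 h.
  rewrite powRM ?(ltW (cosh_gt0 _))// sqrtrM// => le.
  have q0 : 0 < Num.sqrt (cosh y - cos (pi / p)) by rewrite sqrtr_gt0.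
  have r2 : 0 < Num.sqrt (2 : R) by rewrite sqrtr_gt0.
  have W0 : 0 < 2 `^ s^-1 :> R by rewrite powR_gt0.
  rewrite pow2_split ler_pdivrMr//.
  move: le q0 r2 W0; move: (Num.sqrt (_ - _)) (Num.sqrt 2) (2 `^ s^-1) (cosh _ `^ _) => q r W A le q0 r0 W0.
  have -> : C' / (W / r) * q = C' * (r * q) / W by field; rewrite !gt_eqF.
  by rewrite ler_pdivlMr// mulrC.
have [C0|C0] := leP 0 C; first exact: main.
(* A negative constant would make the constant 0 admissible, which contradicts the positivity of
   [best_const]. *)
have h0 : bounded_by p s 0.
  move=> f fLp; apply: (le_trans (hC f fLp)); apply: lee_wpmul2r; last by rewrite lee_fin ltW.
  exact: Lnorm_ge0.
have := main 0 (lexx _) h0; rewrite leNgt => /negP[].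
by rewrite /best_const mulr_gt0.
Qed.

End Main.

Local Close Scope complex_scope.
Local Close Scope classical_set_scope.

Theorem theorem1 (R : realType) :
  [/\ (forall p s : R, 2 <= p -> 0 < s ->
         (forall f : circle R -> R[i], in_Lp p f ->
            (circle_norm p (proj_mean p s f)
               <= (best_const p s)%:E * Lp_norm p f)%E) /\
         (forall C : R,
            (forall f : circle R -> R[i], in_Lp p f ->
               (circle_norm p (proj_mean p s f) <= C%:E * Lp_norm p f)%E) ->
            best_const p s <= C)),
      (forall p s : R, 2 <= p -> 0 < s ->
         s <= (sin (pi / (2 * p)))^-1 ^+ 2 ->
         forall f : circle R -> R[i], in_Lp p f ->
           (circle_norm p (proj_mean p s f)
              <= (2 `^ s^-1 / (2 * sin (pi / (2 * p))))%:E * Lp_norm p f)%E) &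
      (forall p s : R, 1 < p -> p <= 4 / 3 -> 0 < s ->
         s <= (cos (pi / (2 * p)))^-1 ^+ 2 ->
         forall f : circle R -> R[i], in_Lp p f ->
           (circle_norm p (proj_mean p s f)
              <= (2 `^ s^-1 / (2 * cos (pi / (2 * p))))%:E * Lp_norm p f)%E)].
Proof.
have hp p : 0 < p -> pi / p = pi / (2 * p) + pi / (2 * p) :> R.
  by move=> p0; move: (pi : R) => P; field; exact: lt0r_neq0.
split.
- by move=> p s p2 s0; split; [exact: best_upper|move=> C; exact: best_lower].
- move=> p s p2 s0 sS.
  have p0 : 0 < p by apply: lt_le_trans p2.
  have x0 : 0 < sin (pi / (2 * p)).
    rewrite sin_gt0_pi// divr_gt0 ?pi_gt0 ?mulr_gt0//= gtr_pMr ?pi_gt0// invf_lt1 ?mulr_gt0//.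
    by apply: lt_le_trans (ler_wpM2l _ p2) => //; rewrite -natrM ltr1n.
  have E : 1 - cos (pi / p) = 2 * sin (pi / (2 * p)) ^+ 2 by rewrite (hp p p0) cosDD; ring.
  rewrite -const_half// -E; apply: obtuse_upper => //.
    by rewrite E invr_gt0 mulr_gt0// exprn_gt0.
  left; split => //; rewrite E invfM mulrC ler_wpM2l ?invr_ge0//.
  by rewrite -exprVn.
move=> p s p1 p43 s0 sS.
have p0 : 0 < p := lt_trans ltr01 p1.
have x0 : 0 < cos (pi / (2 * p)).
  apply: cos_gt0_pihalf; apply/andP; split.
    by apply: (@lt_le_trans _ _ 0); rewrite ?oppr_lt0 ?divr_gt0 ?divr_ge0 ?pi_gt0 ?pi_ge0 ?mulr_ge0 ?(ltW p0).
  by rewrite ltr_pM2l ?pi_gt0// ltf_pV2 ?posrE ?mulr_gt0// ltr_pMr.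
have E : 1 + cos (pi / p) = 2 * cos (pi / (2 * p)) ^+ 2 by rewrite (hp p p0) cosDD'.
rewrite -const_half// -E; apply: acute_upper => //.
by rewrite E invfM mulrC ler_wpM2l ?invr_ge0// -exprVn.
Qed.
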